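(* For every $k,m\in\mathbb{N}$ and $\delta>0$ there exists $C>0$ such that the following holds. Let $Z$ be a finite abelian $m$-torsion group, and let $f:Z\to\mathbb{C}$ be a 1-bounded function with $\|f\|_{U^{k+1}}\ge\delta$. Then there are a finite $k$-step $m$-torsion nilspace $X$ of cardinality $|X|\le C$, a morphism $\phi:\mathcal{D}_1(Z)\to X$, and a 1-bounded function $F:X\to\mathbb{C}$, such that $\langle f,F\circ\phi\rangle\ge\tfrac12\delta^{2^{k+1}}$. Moreover, for any fixed function $D:\mathbb{R}_{>0}\to\mathbb{R}_{>0}$ we can further assume (with $C$ then allowed to depend also on $D$) that there exists $M=M(D,\delta)>0$ (for the given $k,m$) such that, for some $r\le M$, $X$ has complexity at most $r$ and $\phi$ is $D(r)$-balanced.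
   Context: An abelian group $Z$ is $m$-torsion if $mx=0$ for all $x\in Z$. A function is 1-bounded if its modulus is at most 1. $\mathbb{E}$ denotes the average; $\langle f,g\rangle=\mathbb{E}_{x\in Z}f(x)\overline{g(x)}$. $\|f\|_{U^{k+1}}^{2^{k+1}}=\mathbb{E}_{x,h_1,\dots,h_{k+1}\in Z}\prod_{v\in\{0,1\}^{k+1}}\mathcal{C}^{|v|}f(x+\sum_iv_ih_i)$, with $\mathcal{C}$ complex conjugation and $|v|=\sum_iv_i$. Nilspaces. A morphism $\{0,1\}^m\to\{0,1\}^n$ of discrete cubes is the restriction of an affine homomorphism $\mathbb{Z}^m\to\mathbb{Z}^n$. A nilspace is a non-empty set $X$ with sets $C^n(X)\subset X^{\{0,1\}^n}$ ($n\ge 0$) of $n$-cubes such that: (composition) $c\circ\theta\in C^m(X)$ for $c\in C^n(X)$ and $\theta:\{0,1\}^m\to\{0,1\}^n$ a morphism; (ergodicity) $C^0(X)=X$, $C^1(X)=X^{\{0,1\}}$; (corner completion) if $c':\{0,1\}^n\setminus\{1^n\}\to X$ restricts to an $(n-1)$-cube on each $(n-1)$-face containing $0^n$, then $c'$ extends to some $c\in C^n(X)$. $X$ is $k$-step if this extension is always unique for $n=k+1$. A morphism of nilspaces is a map taking cubes to cubes. For an abelian group $A$ and $\ell\ge1$, $\mathcal{D}_\ell(A)$ is the nilspace on $A$ where $c:\{0,1\}^n\to A$ is a cube iff $\sum_{v\in\{0,1\}^{\ell+1}}(-1)^{|v|}c(\theta(v))=0$ for every morphism $\theta:\{0,1\}^{\ell+1}\to\{0,1\}^n$.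 For a $k$-step nilspace $X$, write $x\sim_i y$ if there are $c,c'\in C^{i+1}(X)$ with $c(0^{i+1})=x$, $c'(0^{i+1})=y$ and $c(v)=c'(v)$ for $v\ne 0^{i+1}$; then $X_i:=X/\sim_i$, with the images of cubes, is an $i$-step nilspace ($X_0$ is a point, $X_k=X$). The $i$-th structure group $Z_i(X)$ ($1\le i\le k$) is the abelian group acting on $X_i$, simply transitively on each fibre of $X_i\to X_{i-1}$, such that if $c\in C^n(X_i)$ and $c':\{0,1\}^n\to X_i$ have the same projection to $X_{i-1}$, then $c'\in C^n(X_i)$ iff $c'-c:\{0,1\}^n\to Z_i(X)$ is a cube on $\mathcal{D}_i(Z_i(X))$. An $m$-torsion nilspace is one whose structure groups are all $m$-torsion. A $k$-step compact nilspace carries a compact, Hausdorff, second-countable topology with each $C^n(X)$ closed; it has finite rank if every structure group is a compact abelian Lie group (finite nilspaces, with the discrete topology, are examples). There are countably many isomorphism classes of $k$-step compact finite-rank nilspaces; one fixes a numbering of them by the positive integers (complexity notion), and the complexity of $X$ is its number. Balance. For each finite nilspace $X$ and each $n$ fix a metric $d_n$ on the space of probability measures on $C^n(X)$, inducing the usual topology. A morphism $\phi:\mathcal{D}_1(Z)\to X$ ($Z$ a finite abelian group) is $b$-balanced ($b>0$) if for every $n\le 1/b$ the image, under $c\mapsto\phi\circ c$, of the uniform probability measure on $C^n(\mathcal{D}_1(Z))$ is at $d_n$-distance at most $b$ from the uniform probability measure on $C^n(X)$. *)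

(* Defs.v *)
From HB Require Import structures.
From mathcomp Require Import all_boot all_order all_algebra.
From mathcomp Require Export complex.
From mathcomp Require Import all_classical all_reals all_analysis.

Set Implicit Arguments.
Unset Strict Implicit.
Unset Printing Implicit Defensive.

Import Order.TTheory GRing.Theory Num.Theory.
Import numFieldNormedType.Exports.

Local Open Scope classical_set_scope.
Local Open Scope ring_scope.
Local Open Scope complex_scope.

Definition cube (n : nat) := {ffun 'I_n -> bool}.

Definition cube0 (n : nat) : cube n := [ffun => false].

Definition cube1 (n : nat) : cube n := [ffun => true].

Definition weight (n : nat) (v : cube n) : nat := (\sum_(i < n) v i)%N.

Definition torsion (m : nat) (Z : zmodType) : Prop := forall x : Z, x *+ m = 0.

Definition bounded1 (R : realType) (T : Type) (f : T -> R[i]) : Prop :=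
  forall x, `|f x| <= 1.

Definition average (R : realType) (T : finType) (g : T -> R[i]) : R[i] :=
  (\sum_(x : T) g x) / #|T|%:R.

Definition inner (R : realType) (Z : finType) (f g : Z -> R[i]) : R[i] :=
  average (fun x => f x * Num.conj (g x)).

(** The [2 ^ n]-th power of the [U^n] norm. *)
Definition gowers_pow (R : realType) (Z : finZmodType) (n : nat)
    (f : Z -> R[i]) : R[i] :=
  average (fun xh : Z * {ffun 'I_n -> Z} =>
    \prod_(v : cube n)
      iter (weight v) Num.conj (f (xh.1 + \sum_(i < n) xh.2 i *+ v i))).

(** [gowers_pow] is a nonnegative real for [0 < n], and [N.-root] of a
    nonnegative real is its nonnegative real [N]-th root. *)
Definition gowers_norm (R : realType) (Z : finZmodType) (n : nat)
    (f : Z -> R[i]) : R[i] :=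
  (2 ^ n)%N.-root (gowers_pow n f).

Definition cube_morphism (m n : nat) (theta : cube m -> cube n) : Prop :=
  exists (A : 'M[int]_(m, n)) (b : 'rV[int]_n), forall v : cube m,
    \row_j (theta v j)%:Z = (\row_i (v i)%:Z) *m A + b.

(** [C n] is the set of [n]-cubes of a cube structure [C] on [X]. *)
Definition cubes_on (X : Type) := forall n : nat, set (cube n -> X).

(** The inclusion of [{0,1}^n] in [{0,1}^(n+1)] as the face [v_i = 0]. *)
Definition face (n : nat) (i : 'I_n.+1) (v : cube n) : cube n.+1 :=
  [ffun j => if unlift i j is Some j' then v j' else false].

(** A corner is a map on the complement of [cube1]; it is represented by a
    total map whose value at [cube1] is ignored. *)
Definition corner (X : Type) (C : cubes_on X) (n : nat)
    (c' : cube n.+1 -> X) : Prop :=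
  forall i : 'I_n.+1, C n (c' \o @face n i).

Definition completion (X : Type) (C : cubes_on X) (n : nat)
    (c' c : cube n -> X) : Prop :=
  C n c /\ forall v, v != cube1 n -> c v = c' v.

Record nilspace (X : Type) (C : cubes_on X) : Prop := {
  nilspace_nonempty : inhabited X;
  nilspace_composition : forall (m n : nat) (theta : cube m -> cube n) c,
    cube_morphism theta -> C n c -> C m (c \o theta);
  nilspace_ergodic0 : C 0%N = setT;
  nilspace_ergodic1 : C 1%N = setT;
  nilspace_completion : forall (n : nat) (c' : cube n.+1 -> X),
    corner C c' -> exists c, completion C c' c
}.

Definition step (X : Type) (C : cubes_on X) (k : nat) : Prop :=
  forall c' : cube k.+1 -> X, corner C c' ->
    forall c1 c2, completion C c' c1 -> completion C c' c2 -> c1 = c2.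

Definition nil_morphism (X Y : Type) (C : cubes_on X) (C' : cubes_on Y)
    (phi : X -> Y) : Prop :=
  forall n c, C n c -> C' n (phi \o c).

(** The nilspace [D_l(A)]. *)
Definition degree_cubes (l : nat) (A : zmodType) : cubes_on A := fun n =>
  [set c | forall theta : cube l.+1 -> cube n, cube_morphism theta ->
     \sum_(v : cube l.+1) c (theta v) *~ (-1) ^+ weight v = 0].

Definition sim (X : Type) (C : cubes_on X) (i : nat) (x y : X) : Prop :=
  exists c c' : cube i.+1 -> X,
    [/\ C i.+1 c, C i.+1 c', c (cube0 i.+1) = x, c' (cube0 i.+1) = y &
        forall v, v != cube0 i.+1 -> c v = c' v].

(** [X_i], as the set of classes of [sim C i]. *)
Definition factor (X : Type) (C : cubes_on X) (i : nat) : Type :=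
  {A : set X | exists x, A = [set y | sim C i x y]}.

Definition factor_pi (X : Type) (C : cubes_on X) (i : nat) (x : X) :
    factor C i :=
  exist _ [set y | sim C i x y] (ex_intro _ x erefl).

Definition factor_cubes (X : Type) (C : cubes_on X) (i : nat) :
    cubes_on (factor C i) := fun n =>
  [set c | exists2 c0, C n c0 & c = factor_pi C i \o c0].

(** The map [X_i -> X_(i-1)] induced by the identity of [X]. *)
Definition factor_down (X : Type) (C : cubes_on X) (i : nat)
    (a : factor C i) : factor C i.-1 :=
  factor_pi C i.-1 (projT1 (cid (proj2_sig a))).

(** [Z], acting by [act], is the [i]-th structure group ([1 <= i]); in the last
    clause [d] is the difference [c' - c]. *)
Definition structure_group (X : Type) (C : cubes_on X) (i : nat)
    (Z : zmodType) (act : Z -> factor C i -> factor C i) : Prop :=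
  [/\ forall a, act 0 a = a,
      forall z z' a, act (z + z') a = act z (act z' a),
      forall z a, factor_down (act z a) = factor_down a,
      forall a b, factor_down a = factor_down b -> exists! z, act z a = b &
      forall n (c c' : cube n -> factor C i) (d : cube n -> Z),
        factor_cubes c ->
        (forall v, factor_down (c v) = factor_down (c' v)) ->
        (forall v, c' v = act (d v) (c v)) ->
        (factor_cubes c' <-> @degree_cubes i Z n d)].

Definition torsion_nilspace (X : Type) (C : cubes_on X) (k m : nat) : Prop :=
  forall i : nat, (1 <= i <= k)%N ->
    exists (Z : zmodType) (act : Z -> factor C i -> factor C i),
      structure_group act /\ torsion m Z.

(** [f] is of class [C^n] on the open set [A]. *)
Fixpoint Cn_on (R : realType) (V W : normedModType R) (n : nat) (A : set V)
    (f : V -> W) : Prop :=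
  match n with
  | 0 => forall x, A x -> {for x, continuous f}
  | n'.+1 => (forall x, A x -> differentiable f x) /\
             (forall v, Cn_on n' A (fun x => 'D_v f x))
  end.

Definition smooth_on (R : realType) (V W : normedModType R) (A : set V)
    (f : V -> W) : Prop :=
  forall n, Cn_on n A f.

(** The charts are [chart i : dom i -> R^d], with inverses [coch i]; all maps
    are total, with irrelevant values outside their domains. *)
Record lie_atlas (R : realType) (G : topologicalZmodType) (d : nat) (I : Type)
    (dom : I -> set G) (chart : I -> G -> 'rV[R]_d)
    (coch : I -> 'rV[R]_d -> G) : Prop := {
  lie_dom_open : forall i, open (dom i);
  lie_cover : forall g, exists i, dom i g;
  lie_image_open : forall i, open (chart i @` dom i);
  lie_chartK : forall i g, dom i g -> coch i (chart i g) = g;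
  lie_chart_continuous : forall i g, dom i g -> {for g, continuous (chart i)};
  lie_coch_continuous : forall i x, (chart i @` dom i) x ->
    {for x, continuous (coch i)};
  lie_transition : forall i j,
    smooth_on (chart i @` (dom i `&` dom j)) (chart j \o coch i);
  lie_add : forall i j l,
    smooth_on [set xy : 'rV[R]_d * 'rV[R]_d |
        [/\ (chart i @` dom i) xy.1, (chart j @` dom j) xy.2 &
            dom l (coch i xy.1 + coch j xy.2)]]
      (fun xy => chart l (coch i xy.1 + coch j xy.2));
  lie_opp : forall i j,
    smooth_on [set x | (chart i @` dom i) x /\ dom j (- coch i x)]
      (fun x => chart j (- coch i x))
}.

Definition compact_abelian_lie (R : realType) (G : topologicalZmodType) :
    Prop :=
  [/\ compact [set: G], hausdorff_space G &
      exists d (I : Type) dom chart coch, @lie_atlas R G d I dom chart coch].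

Definition tfactor (X : topologicalType) (C : cubes_on X) (i : nat) : Type :=
  factor C i.

Section QuotientTopology.
Variables (X : topologicalType) (C : cubes_on X) (i : nat).

HB.instance Definition _ := gen_eqMixin (tfactor C i).
HB.instance Definition _ := gen_choiceMixin (tfactor C i).

Definition tfactor_open (U : set (tfactor C i)) : Prop :=
  open (factor_pi C i @^-1` U).

Lemma tfactor_openT : tfactor_open setT.
Proof. exact: openT. Qed.

Lemma tfactor_openI : setI_closed tfactor_open.
Proof. by move=> U V; exact: openI. Qed.

Lemma tfactor_open_bigcup (I : Type) (f : I -> set (tfactor C i)) :
  (forall j, tfactor_open (f j)) -> tfactor_open (\bigcup_j f j).
Proof.
by move=> fo; rewrite /tfactor_open preimage_bigcup; by apply: bigcup_open => j _; exact: fo.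
Qed.

HB.instance Definition _ := isOpenTopological.Build (tfactor C i)
  tfactor_openT tfactor_openI tfactor_open_bigcup.

End QuotientTopology.

Record compact_nilspace (X : topologicalType) (C : cubes_on X) (k : nat) :
    Prop := {
  cn_nilspace : nilspace C;
  cn_step : step C k;
  cn_compact : compact [set: X];
  cn_hausdorff : hausdorff_space X;
  cn_second_countable : @second_countable X;
  cn_closed : forall n, closed (C n : set {ptws cube n -> X})
}.

(** The topology of the structure group is the one that makes it a compact
    Hausdorff group acting continuously on the factor; it is unique. *)
Definition finite_rank (R : realType) (X : topologicalType) (C : cubes_on X)
    (k : nat) : Prop :=
  forall i : nat, (1 <= i <= k)%N ->
    exists (Z : topologicalZmodType) (act : Z -> tfactor C i -> tfactor C i),
      [/\ structure_group act,
          continuous (fun za : Z * tfactor C i => act za.1 za.2) &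
          compact_abelian_lie R Z].

Definition cfr_nilspace (R : realType) (X : topologicalType) (C : cubes_on X)
    (k : nat) : Prop :=
  compact_nilspace C k /\ finite_rank R C k.

Definition compact_nilspace_iso (X Y : topologicalType) (C : cubes_on X)
    (C' : cubes_on Y) : Prop :=
  exists (f : X -> Y) (g : Y -> X),
    [/\ cancel f g, cancel g f, continuous f & continuous g] /\
    nil_morphism C C' f /\ nil_morphism C' C g.

(** A numbering of the isomorphism classes of [k]-step compact finite-rank
    nilspaces by positive integers. *)
Definition complexity_notion (R : realType) (k : nat)
    (cplx : forall X : topologicalType, cubes_on X -> nat) : Prop :=
  (forall (X : topologicalType) (C : cubes_on X),
     cfr_nilspace R C k -> (0 < cplx X C)%N) /\
  (forall (X Y : topologicalType) (C : cubes_on X) (C' : cubes_on Y),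
     cfr_nilspace R C k -> cfr_nilspace R C' k ->
     (cplx X C = cplx Y C' <-> compact_nilspace_iso C C')).

Definition cube_set (X : finType) (C : cubes_on X) (n : nat) : finType :=
  {c : {ffun cube n -> X} | `[< C n c >]}.

Definition cube_fun (X : finType) (C : cubes_on X) (n : nat)
    (c : cube_set C n) : {ffun cube n -> X} := sval c.

Definition is_prob (R : realType) (T : finType) (p : {ffun T -> R}) : Prop :=
  (forall t, 0 <= p t) /\ \sum_t p t = 1.

Definition uniform (R : realType) (T : finType) : {ffun T -> R} :=
  [ffun => (#|T|%:R)^-1].

(** [d] is a metric on the simplex of probability measures on [T], and its
    topology is the one induced by the product topology of [T -> R]. *)
Record prob_metric (R : realType) (T : finType)
    (d : {ffun T -> R} -> {ffun T -> R} -> R) : Prop := {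
  pm_ge0 : forall p q, is_prob p -> is_prob q -> 0 <= d p q;
  pm_eq0 : forall p q, is_prob p -> is_prob q -> (d p q = 0 <-> p = q);
  pm_sym : forall p q, is_prob p -> is_prob q -> d p q = d q p;
  pm_triangle : forall p q r, is_prob p -> is_prob q -> is_prob r ->
    d p r <= d p q + d q r;
  pm_coarser : forall p, is_prob p -> forall e, 0 < e ->
    exists2 eta, 0 < eta & forall q, is_prob q ->
      (forall t, `|p t - q t| < eta) -> d p q < e;
  pm_finer : forall p, is_prob p -> forall e, 0 < e ->
    exists2 eta, 0 < eta & forall q, is_prob q ->
      d p q < eta -> forall t, `|p t - q t| < e
}.

Definition cube_metrics (R : realType) :=
  forall (X : finType) (C : cubes_on X) (n : nat),
    {ffun cube_set C n -> R} -> {ffun cube_set C n -> R} -> R.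

(** The image under [c |-> phi \o c] of a measure on [C n]. *)
Definition cube_image (R : realType) (Y X : finType) (C : cubes_on Y)
    (C' : cubes_on X) (n : nat) (phi : Y -> X) (p : {ffun cube_set C n -> R}) :
    {ffun cube_set C' n -> R} :=
  [ffun c' : cube_set C' n =>
     \sum_(c : cube_set C n | [forall v, phi (cube_fun c v) == cube_fun c' v])
       p c].

Definition balanced (R : realType) (d : cube_metrics R) (Z : finZmodType)
    (X : finType) (C : cubes_on X) (phi : Z -> X) (b : R) : Prop :=
  forall n : nat, n%:R <= b^-1 ->
    d X C n (cube_image C phi (uniform R (cube_set (@degree_cubes 1 Z) n)))
            (uniform R (cube_set C n)) <= b.

Definition correlates (R : realType) (k m : nat) (delta B : R)
    (Z : finZmodType) (f : Z -> R[i]) (X : finType) (C : cubes_on X)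
    (phi : Z -> X) (F : X -> R[i]) : Prop :=
  [/\ [/\ nilspace C, step C k, torsion_nilspace C k m & #|X|%:R <= B],
      nil_morphism (@degree_cubes 1 Z) C phi,
      bounded1 F &
      (2^-1 * delta ^+ (2 ^ k.+1))%:C <= inner f (F \o phi)].

(* Main.v *)
Require Import Defs.
From HB Require Import structures.
From mathcomp Require Import all_boot all_order all_algebra complex.
From mathcomp Require Import all_classical all_reals all_analysis.
From mathcomp Require Import cyclic cyclotomic lra ring separable spectral zify.

Set Implicit Arguments.
Unset Strict Implicit.
Unset Printing Implicit Defensive.

Import Order.TTheory GRing.Theory Num.Theory.

Local Open Scope ring_scope.
Local Open Scope complex_scope.

Local Notation Re := (@complex.Re _).

(** Argue by contradiction along a nonprincipal ultrafilter on the indices of a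
    sequence of counterexamples (Z_n, f_n). Call a family of functions structured
    of degree d if it is an L^2-limit of boundedly many dual functions of the U^d norm.

    Spectral theory for kernels that are structured in one variable, together with
    the fact that an orthogonal projection whose structured coefficients are all
    scalar has rank one, shows that dual functions of U^(d+2) are combinations of
    functions g all of whose multiplicative derivatives g(x) conj(g(x+t)) are
    structured of degree d+1. Here m-torsion enters: over the cubes with first two
    directions (ja, a), j mod m, the products of g telescope to an m-th power times a
    positive factor, so g^m itself is structured of degree d+1. Hence g is, up to
    structured factors, a phase u with values in Z/m whose derivative over most
    (d+2)-cubes is a function of phases of lower degree; averaging over random cubes
    corrects u so that this holds over all cubes.

    By induction, dual functions of U^(k+1) are approximated by functions of finitely
    many Z/m-valued phases of degrees at most k, each exactly determined on cubes by
    the phases of lower degree, and equidistributed modulo their linear relations.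
    The joint values of these phases form the nilspace: equidistribution gives
    corner completion and balance, exactness gives the step and the structure
    groups, and the dual function of f correlates with f. *)

(** The nilspace is built once for the whole sequence, from what occurs for almost all [n]. Its
    cardinality and complexity are therefore fixed numbers, which the bounds [n + 1] allowed to the
    [n]-th counterexample eventually exceed; no explicit bound results. The obstacle is that phases
    must take values in [Z/m] and not in the circle. A function [g] with structured derivatives is
    merely bounded and may vanish on a large set. A residue is recovered by moving each point, by
    one of finitely many translations, to a place where [g] is not small, dividing by an [m]-th root
    of an approximation to [g^m], and rounding. Rounding replaces small errors on all cubes by
    errors on few cubes; these can be removed altogether, because cubes of a given type recur with
    positive density. Only exact phases give cube sets that are determined by finitely many
    relations. The factor 1/2 is the price of replacing the dual function of [f] by a function of
    the phases at [L^2] distance below half of [delta^(2^(k+1))]. *)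

HB.instance Definition _ (Z1 Z2 : finZmodType) := GRing.Zmodule.on (Z1 * Z2)%type.
HB.instance Definition _ (I : finType) (Z : finZmodType) :=
  GRing.Zmodule.on {ffun I -> Z}.

(** * Moduli and averages *)

Section Modulus.
Variable R : realType.
Local Notation C := R[i].
Implicit Types z w : C.

Definition ab z : R := ComplexField.Normc.normc z.

Lemma abE z : (ab z)%:C = `|z|.
Proof. by []. Qed.
Lemma ab_ge0 z : 0 <= ab z.
Proof. by rewrite -ler0c abE normr_ge0. Qed.
Lemma abM z w : ab (z * w) = ab z * ab w.
Proof. by apply: complexI; rewrite rmorphM /= !abE normrM. Qed.
Lemma abD z w : ab (z + w) <= ab z + ab w.
Proof. by rewrite -lecR rmorphD /= !abE ler_normD. Qed.
Lemma abN z : ab (- z) = ab z.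
Proof. by apply: complexI; rewrite !abE normrN. Qed.
Lemma abB z w : ab (z - w) <= ab z + ab w.
Proof. by rewrite -(abN w) abD. Qed.
Lemma ab_sym z w : ab (z - w) = ab (w - z).
Proof. by rewrite -abN opprB. Qed.
Lemma ab_tri z w x : ab (z - w) <= ab (z - x) + ab (x - w).
Proof. by rewrite -[z - w](subrKA x) abD. Qed.
Lemma ab0 : ab 0 = 0.
Proof. by apply: complexI; rewrite abE normr0. Qed.
Lemma ab1 : ab 1 = 1.
Proof. by apply: complexI; rewrite abE normr1. Qed.
Lemma ab_eq0 z : (ab z == 0) = (z == 0).
Proof. by rewrite -(inj_eq (@complexI _)) abE normr_eq0. Qed.
Lemma abX z n : ab (z ^+ n) = ab z ^+ n.
Proof. by apply: complexI; rewrite rmorphXn /= !abE normrX. Qed.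
Lemma abV z : ab z^-1 = (ab z)^-1.
Proof. by apply: complexI; rewrite fmorphV /= !abE normfV. Qed.
Lemma abR (r : R) : ab r%:C = `|r|.
Proof. by rewrite /ab /= expr0n addr0 sqrtr_sqr. Qed.
Lemma ab_nat n : ab n%:R = n%:R.
Proof. by rewrite -(rmorph_nat (real_complex R)) abR ger0_norm ?ler0n. Qed.
Lemma ab_conj z : ab (Num.conj z) = ab z.
Proof. by apply: complexI; rewrite !abE norm_conjC. Qed.
Lemma ab_sum (T : Type) (r : seq T) (P : pred T) (F : T -> C) :
  ab (\sum_(t <- r | P t) F t) <= \sum_(t <- r | P t) ab (F t).
Proof.
elim/big_ind2: _ => [|x a y b h1 h2|//]; first by rewrite ab0.
exact: le_trans (abD _ _) (lerD h1 h2).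
Qed.
Lemma ab_prod (T : Type) (r : seq T) (P : pred T) (F : T -> C) :
  ab (\prod_(t <- r | P t) F t) = \prod_(t <- r | P t) ab (F t).
Proof. by apply: big_morph; [exact: abM | exact: ab1]. Qed.
Lemma mulcJ z : z * Num.conj z = (ab z ^+ 2)%:C.
Proof. by rewrite rmorphXn /= abE normCK. Qed.
Lemma Re_le_ab z : `|Re z| <= ab z.
Proof.
case: z => a b; rewrite /ab /= -sqrtr_sqr ler_wsqrtr //.
by rewrite lerDl sqr_ge0.
Qed.
Lemma ReJ z : Re (Num.conj z) = Re z.
Proof. by case: z. Qed.
Lemma ReD z w : Re (z + w) = Re z + Re w.
Proof. by case: z w => ? ? []. Qed.
Lemma ReB z w : Re (z - w) = Re z - Re w.
Proof. by case: z w => ? ? []. Qed.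
Lemma ReZ (r : R) z : Re (r%:C * z) = r * Re z.
Proof. by case: z => a b /=; rewrite mul0r subr0. Qed.
Lemma Re_sum (T : Type) (r : seq T) (P : pred T) (F : T -> C) :
  Re (\sum_(t <- r | P t) F t) = \sum_(t <- r | P t) Re (F t).
Proof. by apply: big_morph => // -[? ?] []. Qed.
Lemma ab_sqrD z w :
  ab (z + w) ^+ 2 = ab z ^+ 2 + ab w ^+ 2 + 2 * Re (z * Num.conj w).
Proof.
have h : (ab (z + w) ^+ 2)%:C
  = (ab z ^+ 2)%:C + (ab w ^+ 2)%:C + (z * Num.conj w + Num.conj (z * Num.conj w)).
  by rewrite -!mulcJ !rmorphM rmorphD /= conjCK; ring.
have := congr1 (@complex.Re R) h; rewrite !ReD ReJ /= => ->; ring.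
Qed.
Lemma ab_sqrD_le z w : ab (z + w) ^+ 2 <= 2 * ab z ^+ 2 + 2 * ab w ^+ 2.
Proof.
have h := abD z w; have h0 := ab_ge0 (z + w).
have h1 : ab (z + w) ^+ 2 <= (ab z + ab w) ^+ 2 by rewrite ler_pXn2r ?nnegrE ?addr_ge0 ?ab_ge0.
apply: le_trans h1 _; have := sqr_ge0 (ab z - ab w); nra.
Qed.
End Modulus.

Section Avg.
Variable K : numFieldType.

Definition avg (T : finType) (f : T -> K) : K := (\sum_t f t) / #|T|%:R.

Section One.
Variable T : finType.
Implicit Types f g : T -> K.

Lemma eq_avg f g : f =1 g -> avg f = avg g.
Proof. by move=> h; rewrite /avg (eq_bigr g). Qed.
Lemma avgD f g : avg (fun t => f t + g t) = avg f + avg g.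
Proof. by rewrite /avg big_split mulrDl. Qed.
Lemma avgN f : avg (fun t => - f t) = - avg f.
Proof. by rewrite /avg sumrN mulNr. Qed.
Lemma avgB f g : avg (fun t => f t - g t) = avg f - avg g.
Proof. by rewrite avgD avgN. Qed.
Lemma avgZ c f : avg (fun t => c * f t) = c * avg f.
Proof. by rewrite /avg -mulr_sumr mulrA. Qed.
Lemma avgZr c f : avg (fun t => f t * c) = avg f * c.
Proof. by rewrite /avg -mulr_suml mulrAC. Qed.
Lemma avg_sum (S : Type) (r : seq S) (P : pred S) (F : S -> T -> K) :
  avg (fun t => \sum_(s <- r | P s) F s t) = \sum_(s <- r | P s) avg (F s).
Proof. by rewrite /avg exchange_big /= mulr_suml. Qed.
Lemma avg0 : avg (fun _ : T => 0) = 0.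
Proof. by rewrite /avg big1 // mul0r. Qed.
Lemma avg_const c : (0 < #|T|)%N -> avg (fun _ : T => c) = c.
Proof.
move=> h; have -> : avg (fun _ : T => c) = c * #|T|%:R / #|T|%:R.
  by rewrite mulr_natr -sumr_const.
by rewrite mulfK // pnatr_eq0 -lt0n.
Qed.
Lemma avg_ge0 f : (forall t, 0 <= f t) -> 0 <= avg f.
Proof. by move=> h; rewrite /avg divr_ge0 ?ler0n ?sumr_ge0. Qed.
Lemma ler_avg f g : (forall t, f t <= g t) -> avg f <= avg g.
Proof. by move=> h; rewrite /avg ler_wpM2r ?invr_ge0 ?ler0n ?ler_sum. Qed.
Lemma avg_le f c : 0 <= c -> (forall t, f t <= c) -> avg f <= c.
Proof.
move=> c0 h; case: (posnP #|T|) => [T0|T0]; last by rewrite -(avg_const c T0) ler_avg.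
by rewrite /avg T0 invr0 mulr0.
Qed.
End One.

Lemma avg_exch (T S : finType) (F : T -> S -> K) :
  avg (fun t => avg (F t)) = avg (fun s => avg (F^~ s)).
Proof.
rewrite /avg -!mulr_suml exchange_big /=; ring.
Qed.
Lemma avg_pair (T S : finType) (F : T * S -> K) :
  avg F = avg (fun t => avg (fun s => F (t, s))).
Proof.
rewrite /avg -mulr_suml card_prod natrM invfM pair_bigA /= mulrA mulrAC.
by congr (_ / _ / _); apply: eq_bigr => -[].
Qed.
Lemma avg_pairE (T S : finType) (F : T -> S -> K) :
  avg (fun ts : T * S => F ts.1 ts.2) = avg (fun t => avg (F t)).
Proof. by rewrite avg_pair. Qed.

(** Measure preserving: all fibres have the same size, so uniform averages over [S] pull back to
    [T]. *)
Definition mp (T S : finType) (p : T -> S) : Prop :=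
  exists2 c : nat, (0 < c)%N & forall s, #|[set t | p t == s]| = c.

Lemma mp_avg (T S : finType) (p : T -> S) (F : S -> K) :
  mp p -> avg (fun t => F (p t)) = avg F.
Proof.
case=> c c0 hc; rewrite /avg.
have -> : \sum_t F (p t) = (\sum_s F s) * c%:R.
  rewrite (partition_big p xpredT) //= mulr_suml; apply: eq_bigr => s _.
  rewrite (eq_bigr (fun _ => F s)) => [|t /eqP -> //].
  rewrite sumr_const mulr_natr -(hc s); congr (_ *+ _).
  by apply: eq_card => t; rewrite inE.
have -> : #|T| = (c * #|S|)%N.
  rewrite -sum1_card (partition_big p xpredT) //= mulnC -sum_nat_const.
  apply: eq_bigr => s _; rewrite sum1_card -(hc s).
  by apply: eq_card => t; rewrite inE.
by rewrite natrM invfM mulrA mulfK // pnatr_eq0 -lt0n.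
Qed.
End Avg.

Lemma bij_mp (T S : finType) (p : T -> S) : bijective p -> mp p.
Proof.
move=> bp; exists 1%N => // s; case: (bp) => q pq qp.
apply/eqP/cards1P; exists (q s); apply/setP => t; rewrite !inE.
by apply/eqP/eqP => [<-|->].
Qed.

Lemma comp_mp (T S U : finType) (p : T -> S) (q : S -> U) :
  mp p -> mp q -> mp (q \o p).
Proof.
case=> c c0 hc [d d0 hd]; exists (d * c)%N; first by rewrite muln_gt0 d0.
move=> u; rewrite -sum1_card (partition_big p (fun s => q s == u)) /=; last first.
  by move=> t; rewrite inE.
rewrite -(hd u) -sum_nat_const.
have -> : (\sum_(i in [set t | q t == u]) c = \sum_(i | q i == u) c)%N.
  by apply: eq_bigl => s; rewrite inE.
apply: eq_bigr => s /eqP qs; rewrite sum1_card -(hc s).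
apply: eq_card => t; rewrite !inE /=.
rewrite unfold_in /= inE; apply/andP/eqP => [[_ /eqP] //|h].
by rewrite h qs.
Qed.

Lemma affine_mp (T S : finZmodType) (b : S) (q : T -> S) :
  {morph q : x y / x + y} -> (forall s, exists t, q t = s) ->
  mp (fun t => b + q t).
Proof.
move=> qD qs; exists #|[set t | q t == 0]|.
  have q0 : q 0 = 0 by apply: (addrI (q 0)); rewrite -qD !addr0.
  by apply/card_gt0P; exists 0; rewrite inE q0.
move=> s; have [t0 ht0] := qs (s - b).
rewrite -(@card_imset _ _ (fun x => x + t0) [set t | q t == 0]); last exact: addIr.
apply: eq_card => t.
rewrite !inE; apply/eqP/imsetP => [h|[t' ]].
  exists (t - t0); last by rewrite subrK.
  have hh : q (t - t0) + q t0 = q t by rewrite -qD subrK.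
  by rewrite inE -(inj_eq (addIr (q t0))) hh add0r ht0 -h addrC addKr.
by rewrite inE => /eqP q0 ->; rewrite qD q0 add0r ht0 addrC subrK.
Qed.

Section RealAvg.
Variable R : realType.
Local Notation C := R[i].

Lemma avg_CS (T : finType) (a b : T -> R) :
  avg (fun t => a t * b t) ^+ 2 <= avg (fun t => a t ^+ 2) * avg (fun t => b t ^+ 2).
Proof.
set A := avg (fun t => a t ^+ 2); set B := avg (fun t => b t ^+ 2); set S := avg _.
have A0 : 0 <= A by apply: avg_ge0 => t; exact: sqr_ge0.
have key l : 0 <= B - 2 * l * S + l ^+ 2 * A.
  have <- : avg (fun t => (b t - l * a t) ^+ 2) = B - 2 * l * S + l ^+ 2 * A.
    by rewrite -!avgZ -avgB -avgD; apply: eq_avg => t; ring.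
  by apply: avg_ge0 => t; exact: sqr_ge0.
have [A00|A1] := eqVneq A 0.
  have [->|S0] := eqVneq S 0; first by rewrite expr0n /= mulr_ge0 // avg_ge0 // => t; exact: sqr_ge0.
  (* With [A = 0] the quadratic is affine in [l]; this [l] makes it [-1]. *)
  have := key ((B + 1) / (2 * S)); rewrite A00 mulr0 addr0.
  have -> : B - 2 * ((B + 1) / (2 * S)) * S = -1 by field.
  by rewrite ler0N1.
have A2 : 0 < A by rewrite lt_def A1.
have := key (S / A).
have -> : B - 2 * (S / A) * S + (S / A) ^+ 2 * A = (A * B - S ^+ 2) / A by field.
by rewrite pmulr_lge0 ?invr_gt0 // subr_ge0.
Qed.

Lemma avg_sqr (T : finType) (a : T -> R) : avg a ^+ 2 <= avg (fun t => a t ^+ 2).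
Proof.
have [T0|T0] := posnP #|T|.
  by rewrite /avg T0 invr0 !mulr0 expr0n.
have := avg_CS a (fun=> 1); rewrite expr1n avg_const // mulr1.
by rewrite (eq_avg (g := a)) // => t; rewrite mulr1.
Qed.

Lemma avg_exp2 (T : finType) (a : T -> R) j : (forall t, 0 <= a t) ->
  avg a ^+ (2 ^ j) <= avg (fun t => a t ^+ (2 ^ j)).
Proof.
move=> a0; elim: j => [|j IH]; first by rewrite expr1.
rewrite expnSr exprM; apply: le_trans (_ : avg (fun t => a t ^+ (2 ^ j)) ^+ 2 <= _).
  by rewrite ler_pXn2r ?nnegrE ?exprn_ge0 ?avg_ge0 // => t; rewrite exprn_ge0.
by apply: le_trans (avg_sqr _) _; apply: ler_avg => t; rewrite exprM.
Qed.

Lemma ab_avg (T : finType) (f : T -> C) : ab (avg f) <= avg (fun t => ab (f t)).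
Proof.
rewrite /avg abM abV ab_nat ler_wpM2r ?invr_ge0 ?ler0n //; exact: ab_sum.
Qed.
Lemma conj_avg (T : finType) (f : T -> C) :
  Num.conj (avg f) = avg (fun t => Num.conj (f t)).
Proof. by rewrite /avg rmorphM fmorphV rmorph_nat rmorph_sum. Qed.
Lemma avgC (T : finType) (f : T -> R) : (avg f)%:C = avg (fun t => (f t)%:C).
Proof. by rewrite /avg rmorphM fmorphV rmorph_nat rmorph_sum. Qed.
Lemma Re_avg (T : finType) (f : T -> C) : Re (avg f) = avg (fun t => Re (f t)).
Proof.
by rewrite /avg mulrC -(rmorph_nat (real_complex R)) -fmorphV ReZ Re_sum mulrC.
Qed.
Lemma ab_avg_CS (T : finType) (f g : T -> C) :
  ab (avg (fun t => f t * g t)) ^+ 2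
  <= avg (fun t => ab (f t) ^+ 2) * avg (fun t => ab (g t) ^+ 2).
Proof.
apply: le_trans (avg_CS _ _); rewrite ler_pXn2r ?nnegrE ?ab_ge0 //.
  by apply: le_trans (ab_avg _) _; apply: ler_avg => t; rewrite abM.
by apply: avg_ge0 => t; rewrite mulr_ge0 ?ab_ge0.
Qed.
Lemma exists_le_avg (T : finType) (f : T -> R) : (0 < #|T|)%N ->
  exists t, f t <= avg f.
Proof.
move=> T0; apply: contrapT => /forallNP h.
have : avg f < avg f; last by rewrite ltxx.
rewrite {1}(_ : avg f = avg (fun _ : T => avg f)); last by rewrite avg_const.
rewrite /avg ltr_pM2r ?invr_gt0 ?ltr0n // -/(avg f).
case/card_gt0P: T0 => t0 _; rewrite (bigD1 t0) //= [ltRHS](bigD1 t0) //=.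
rewrite ltr_leD //; first by rewrite ltNge; apply/negP/h.
by apply: ler_sum => t _; rewrite ltW // ltNge; apply/negP/h.
Qed.
Lemma exists_ge_avg (T : finType) (f : T -> R) : (0 < #|T|)%N ->
  exists t, avg f <= f t.
Proof.
move=> T0; have [t] := exists_le_avg (fun t => - f t) T0.
by rewrite avgN lerN2; exists t.
Qed.

Definition N2 (T : finType) (f : T -> C) : R := avg (fun t => ab (f t) ^+ 2).

Lemma N2_ge0 (T : finType) (f : T -> C) : 0 <= N2 f.
Proof. by apply: avg_ge0 => t; exact: sqr_ge0. Qed.
Lemma N2_le (T : finType) (f : T -> C) K : (forall t, ab (f t) <= K) -> N2 f <= K ^+ 2.
Proof.
move=> h; apply: avg_le; first exact: sqr_ge0.
by move=> t; rewrite ler_pXn2r ?nnegrE ?ab_ge0 // (le_trans (ab_ge0 (f t))).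
Qed.
Lemma N2D (T : finType) (f g : T -> C) :
  N2 (fun t => f t + g t) <= 2 * N2 f + 2 * N2 g.
Proof. by rewrite -!avgZ -avgD; apply: ler_avg => t; exact: ab_sqrD_le. Qed.
Lemma N2_tri (T : finType) (f g h : T -> C) :
  N2 (fun t => f t - g t) <= 2 * N2 (fun t => f t - h t) + 2 * N2 (fun t => h t - g t).
Proof.
by apply: le_trans (N2D _ _); apply: ler_avg => t; rewrite subrKA.
Qed.
Lemma N2Z (T : finType) c (f : T -> C) : N2 (fun t => c * f t) = ab c ^+ 2 * N2 f.
Proof. by rewrite -avgZ; apply: eq_avg => t; rewrite abM exprMn. Qed.
Lemma N2_mulr (T : finType) (f g : T -> C) K : (forall t, ab (g t) <= K) ->
  N2 (fun t => f t * g t) <= K ^+ 2 * N2 f.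
Proof.
move=> h; rewrite -avgZ; apply: ler_avg => t; rewrite abM exprMn mulrC.
rewrite ler_wpM2r ?sqr_ge0 // ler_pXn2r ?nnegrE ?ab_ge0 //.
exact: le_trans (ab_ge0 (g t)) _.
Qed.
Lemma N2_avg (T S : finType) (F : T * S -> C) :
  N2 (fun t => avg (fun s => F (t, s))) <= N2 F.
Proof.
rewrite /N2 avg_pair; apply: ler_avg => t.
apply: le_trans (avg_sqr _); rewrite ler_pXn2r ?nnegrE ?ab_ge0 ?ab_avg //.
by apply: avg_ge0 => s; exact: ab_ge0.
Qed.
Lemma ab_avg_N2 (T : finType) (f : T -> C) : ab (avg f) ^+ 2 <= N2 f.
Proof.
apply: le_trans (avg_sqr _); rewrite ler_pXn2r ?nnegrE ?ab_ge0 ?ab_avg //.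
by apply: avg_ge0 => s; exact: ab_ge0.
Qed.
Lemma N2_mp (T S : finType) (p : T -> S) (f : S -> C) : mp p ->
  N2 (fun t => f (p t)) = N2 f.
Proof. by move=> h; rewrite /N2 (mp_avg (fun s => ab (f s) ^+ 2) h). Qed.
Lemma eq_N2 (T : finType) (f g : T -> C) : f =1 g -> N2 f = N2 g.
Proof. by move=> h; apply: eq_avg => t; rewrite h. Qed.
Lemma N2C (T : finType) (f g : T -> C) : N2 (fun t => f t - g t) = N2 (fun t => g t - f t).
Proof. by apply: eq_avg => t; rewrite ab_sym. Qed.

(* The partial sums of [F s_j - E F] are built greedily so that the squared
   norm grows by at most 1 at each step. *)
Lemma sampling (T S : finType) (F : S -> T -> C) (L : nat) : (0 < #|S|)%N ->
  (forall s t, ab (F s t) <= 1) -> (0 < L)%N ->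
  exists s : 'I_L -> S,
    N2 (fun t => avg (fun s => F s t) - \sum_(j < L) L%:R^-1 * F (s j) t) <= L%:R^-1.
Proof.
move=> S0 F1 L0; set M := fun t => avg (fun s => F s t).
have step l : exists s : 'I_l -> S,
    N2 (fun t => \sum_(j < l) (F (s j) t - M t)) <= l%:R.
  elim: l => [|l [s hs]].
    case/card_gt0P: S0 => s0 _; exists (fun=> s0).
    by rewrite (le_trans (N2_le (K := 0) _)) ?expr0n // => t; rewrite big_ord0 ab0.
  set P := fun t => _ in hs.
  have [s1 hs1] := exists_le_avg (fun s => N2 (fun t => P t + (F s t - M t))) S0.
  exists (fun j => if unlift ord_max j is Some j' then s j' else s1).
  rewrite (@eq_N2 _ _ (fun t => P t + (F s1 t - M t))); last first.
    move=> t; rewrite big_ord_recr /= unlift_none; congr (_ + _).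
    apply: eq_bigr => j _.
    by rewrite (_ : widen_ord _ _ = lift ord_max j) ?liftK //; apply: val_inj; rewrite /= /bump leqNgt ltn_ord.
  apply: le_trans hs1 _.
  rewrite /N2 avg_exch -natr1.
  have -> : avg (fun t => avg (fun s2 => ab (P t + (F s2 t - M t)) ^+ 2))
     = avg (fun t => ab (P t) ^+ 2) + avg (fun t => avg (fun s2 => ab (F s2 t - M t) ^+ 2)).
    rewrite -avgD; apply: eq_avg => t.
    under eq_avg => s2 do rewrite ab_sqrD.
    rewrite 2!avgD avg_const // avgZ -Re_avg avgZ -conj_avg avgB.
    by rewrite avg_const // /M subrr conjC0 mulr0 /= mulr0 addr0.
  rewrite lerD //; apply: avg_le => // t.
  have -> : avg (fun s2 => ab (F s2 t - M t) ^+ 2)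
     = avg (fun s2 => ab (F s2 t) ^+ 2) - ab (M t) ^+ 2.
    under eq_avg => s2 do rewrite ab_sqrD abN rmorphN mulrN.
    rewrite !avgD avg_const // avgZ -Re_avg avgN avgZr -/(M t) mulcJ /=; ring.
  rewrite lerBlDr -[leLHS]addr0 lerD ?sqr_ge0 //.
  by apply: avg_le => // s2; rewrite expr_le1 ?ab_ge0.
have [s hs] := step L; exists s.
rewrite (@eq_N2 _ _ (fun t => - L%:R^-1 * \sum_(j < L) (F (s j) t - M t))); last first.
  move=> t; rewrite sumrB -mulr_sumr mulNr mulrBr opprB; congr (_ - _).
  by rewrite sumr_const card_ord -[X in _ = _ * X]mulr_natl mulKf // pnatr_eq0 -lt0n.
rewrite N2Z abN abV ab_nat expr2 -mulrA ler_piMr ?invr_ge0 ?ler0n //.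
by rewrite mulrC ler_pdivrMr ?ltr0n // mul1r.
Qed.
End RealAvg.

(** * Ultrafilters and structured families *)

Section Ev.
Context (W : set_system nat) {UW : UltraFilter W}.

Definition ev (P : nat -> Prop) : Prop := W P.

Lemma evS (P Q : nat -> Prop) : (forall n, P n -> Q n) -> ev P -> ev Q.
Proof. by move=> h; apply: filterS. Qed.
Lemma evT (P : nat -> Prop) : (forall n, P n) -> ev P.
Proof. by move=> h; apply: filterS (@filterT _ W _) => n _; exact: h. Qed.
Lemma evI (P Q : nat -> Prop) : ev P -> ev Q -> ev (fun n => P n /\ Q n).
Proof. exact: filterI. Qed.
Lemma ev2 (P Q S : nat -> Prop) :
  (forall n, P n -> Q n -> S n) -> ev P -> ev Q -> ev S.
Proof. by move=> h p q; apply: evS (evI p q) => n [? ?]; exact: h. Qed.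
Lemma ev3 (P1 P2 P3 S : nat -> Prop) :
  (forall n, P1 n -> P2 n -> P3 n -> S n) -> ev P1 -> ev P2 -> ev P3 -> ev S.
Proof. by move=> h p q r; apply: ev2 (evI p q) r => n [? ?]; exact: h. Qed.
Lemma ev_const (P : Prop) : ev (fun=> P) -> P.
Proof.
move=> h; have [n] : exists n : nat, P by apply: (@filter_ex _ W _ (fun=> P)).
by [].
Qed.
Lemma ev_ex (P : nat -> Prop) : ev P -> exists n, P n.
Proof. exact: filter_ex. Qed.
Lemma evNE (P : nat -> Prop) : ~ ev P -> ev (fun n => ~ P n).
Proof. by have [|//] := in_ultra_setVsetC P UW. Qed.
Lemma evN (P : nat -> Prop) : ev (fun n => ~ P n) -> ~ ev P.
Proof.
by move=> h1 h2; apply: ev_const; apply: ev2 h1 h2 => n.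
Qed.
Lemma evB (T : Type) (P : T -> nat -> Prop) (r : seq T) :
  (forall x, List.In x r -> ev (P x)) -> ev (fun n => forall x, List.In x r -> P x n).
Proof.
elim: r => [|x r IH] h; first exact: evT.
have h1 : ev (P x) by apply: h; left.
have h2 := IH (fun y hy => h y (or_intror hy)).
by apply: ev2 h1 h2 => n p q y [<-|/q].
Qed.
Lemma in_List (T : eqType) (x : T) (r : seq T) : x \in r -> List.In x r.
Proof.
by elim: r => // y r IH; rewrite inE => /orP[/eqP ->|/IH]; [left | right].
Qed.
Lemma ev_fin (I : finType) (P : I -> nat -> Prop) :
  (forall i, ev (P i)) -> ev (fun n => forall i, P i n).
Proof.
move=> h; have := @evB _ P (enum I) (fun x _ => h x).
by apply: evS => n hn i; apply: hn; apply: in_List; rewrite mem_enum.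
Qed.
(** This pigeonhole principle replaces the extraction of subsequences: a choice among finitely many
    values that depends on [n] is constant for almost all [n]. *)
Lemma ev_pick (I : finType) (P : I -> nat -> Prop) :
  ev (fun n => exists i, P i n) -> exists i, ev (P i).
Proof.
move=> h; apply: contrapT => /forallNP h1.
have h2 := ev_fin (fun i => evNE (h1 i)).
by apply: (ev_const (P := False)); apply: ev2 h h2 => n [i hi] /(_ i).
Qed.

Section Null.
Variable R : realType.
Implicit Types a b : nat -> R.

(** The bounds are one-sided; [null] is applied to nonnegative sequences, where it says that the
    limit along the ultrafilter is 0. By [null_or] there is no third possibility. *)
Definition null a := forall e, 0 < e -> ev (fun n => a n < e).
Definition nnull a := exists2 e, 0 < e & ev (fun n => e <= a n).

Lemma null_or a : null a \/ nnull a.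
Proof.
have [h|/asboolPn] := pselect (null a); first by left.
move/asboolP => h; right; apply: contrapT => h1; apply: h => e e0.
apply: contrapT => /evNE h2; apply: h1; exists e => //.
by apply: evS h2 => n /negP; rewrite -leNgt.
Qed.
Lemma nullN a : null a -> ~ nnull a.
Proof.
move=> h [e e0 h1]; apply: ev_const; apply: ev2 (h e e0) h1 => n.
by rewrite leNgt => ->.
Qed.
Lemma null_le a b : ev (fun n => a n <= b n) -> null b -> null a.
Proof. by move=> h hb e e0; apply: ev2 h (hb e e0) => n; exact: le_lt_trans. Qed.
Lemma nnull_le a b : ev (fun n => a n <= b n) -> nnull a -> nnull b.
Proof. by move=> h [e e0 hb]; exists e => //; apply: ev2 hb h => n; exact: le_trans. Qed.
Lemma nullD a b : null a -> null b -> null (fun n => a n + b n).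
Proof.
move=> ha hb e e0; have e2 : 0 < e / 2 by rewrite divr_gt0.
by apply: ev2 (ha _ e2) (hb _ e2) => n; lra.
Qed.
Lemma nullZ K a : ev (fun n => 0 <= a n) -> null a -> null (fun n => K * a n).
Proof.
move=> a0 ha e e0.
have e2 : 0 < e / (`|K| + 1) by rewrite divr_gt0 ?ltr_wpDl.
apply: ev2 a0 (ha _ e2) => n a0n; rewrite ltr_pdivlMr ?ltr_wpDl // => h.
apply: le_lt_trans h; rewrite mulrC ler_wpM2l //.
by apply: le_trans (ler_norm _) _; rewrite lerDl.
Qed.
Lemma null_sum (I : finType) (a : I -> nat -> R) :
  (forall i, null (a i)) -> null (fun n => \sum_i a i n).
Proof.
move=> h e e0; have c0 : 0 < e / (#|I|%:R + 1) by rewrite divr_gt0 ?ltr_wpDl.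
apply: evS (ev_fin (fun i => h i _ c0)) => n hn.
have [I0|I0] := posnP #|I|.
  by rewrite big_pred0 // => i; have := card0_eq I0 i.
apply: le_lt_trans (_ : \sum_(i : I) e / (#|I|%:R + 1) < _).
  by apply: ler_sum => i _; exact: ltW.
rewrite sumr_const -[ltLHS]mulr_natr mulrAC ltr_pdivrMr ?ltr_wpDl // ltr_pM2l //.
by rewrite ltrDl.
Qed.
Lemma null_pow a j : ev (fun n => 0 <= a n) -> null (fun n => a n ^+ j) -> null a.
Proof.
move=> a0 h e e0; have ej : 0 < e ^+ j by rewrite exprn_gt0.
apply: ev2 a0 (h _ ej) => n an hn; rewrite ltNge; apply/negP => hle.
move: hn; rewrite ltNge => /negP; apply.
by rewrite lerXn2r ?nnegrE // ltW.
Qed.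
End Null.
End Ev.

Lemma N2_sum (R : realType) (T J : finType) (f : J -> T -> R[i]) :
  N2 (fun t => \sum_j f j t) <= #|J|%:R * \sum_j N2 (f j).
Proof.
rewrite /N2 -avg_sum -avgZ; apply: ler_avg => t.
have [J0|J0] := posnP #|J|.
  rewrite big_pred0 ?ab0 ?expr0n ?J0 ?mul0r // => i; exact: card0_eq J0 i.
have J1 : 0 < #|J|%:R :> R by rewrite ltr0n.
have := avg_sqr (fun j => ab (f j t)); rewrite /avg expr_div_n.
rewrite ler_pdivrMr ?exprn_gt0 // => h.
have e : (\sum_j ab (f j t) ^+ 2) / #|J|%:R * #|J|%:R ^+ 2
  = #|J|%:R * \sum_j ab (f j t) ^+ 2 by field; rewrite gt_eqF.
apply: le_trans (_ : (\sum_j ab (f j t)) ^+ 2 <= _); last by rewrite -e.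
 rewrite ler_pXn2r ?nnegrE ?ab_ge0 ?ab_sum //.
by apply: sumr_ge0 => j _; exact: ab_ge0.
Qed.

Section Closure.
Variable R : realType.
Context (W : set_system nat) {UW : UltraFilter W}.
Local Notation C := R[i].
Local Notation ev := (ev W).

Definition fam (T : nat -> finType) := forall n, T n -> C.
Definition base (T : nat -> finType) := forall n, (T n -> C) -> Prop.
Definition bdd (T : nat -> finType) (f : fam T) :=
  exists K : R, ev (fun n => forall t, ab (f n t) <= K).

Definition good_base T (B : base T) := forall n b, B n b ->
  (forall t, ab (b t) <= 1) /\ (forall c, ab c <= 1 -> B n (fun t => c * b t)).

(* [f] is an L^2-limit of sums of elements of [B], the number of summands being
   bounded along [W]. *)
Definition Cl T (B : base T) (f : fam T) := forall e : R, 0 < e ->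
  exists J : finType, ev (fun n => exists b : J -> T n -> C,
    (forall j, B n (b j)) /\ N2 (fun t => f n t - \sum_j b j t) < e).

Section OneT.
Variable T : nat -> finType.
Implicit Types (B : base T) (f g : fam T).

Lemma bdd_pos f : bdd f -> exists2 K : R, 0 < K & ev (fun n => forall t, ab (f n t) <= K).
Proof.
case=> K h; exists (`|K| + 1); first by rewrite ltr_wpDl.
apply: evS h => n h t; apply: le_trans (h t) _; apply: le_trans (ler_norm K) _.
by rewrite lerDl.
Qed.
Lemma bdd1 f K : (forall n t, ab (f n t) <= K) -> bdd f.
Proof. by move=> h; exists K; apply: evT. Qed.
Lemma bddM f g : bdd f -> bdd g -> bdd (fun n t => f n t * g n t).
Proof.
move=> /bdd_pos[K K0 hK] /bdd_pos[L L0 hL]; exists (K * L).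
by apply: ev2 hK hL => n h1 h2 t; rewrite abM ler_pM ?ab_ge0.
Qed.
Lemma bddJ f : bdd f -> bdd (fun n t => Num.conj (f n t)).
Proof. by move=> [K hK]; exists K; apply: evS hK => n h t; rewrite ab_conj. Qed.
Lemma bdd_prod (V : Type) (r : seq V) (f : V -> fam T) :
  (forall v, bdd (f v)) -> bdd (fun n t => \prod_(v <- r) f v n t).
Proof.
move=> h; elim: r => [|v r IH].
  by apply: (@bdd1 _ 1) => n t; rewrite big_nil ab1.
have [K hK] := bddM (h v) IH; exists K; apply: evS hK => n hn t.
by rewrite big_cons.
Qed.
Lemma Cl_sub B B' f : (forall n b, B n b -> B' n b) -> Cl B f -> Cl B' f.
Proof.
move=> h cf e e0; have [J hJ] := cf e e0; exists J.
by apply: evS hJ => n [b [hb he]]; exists b; split=> // j; apply: h.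
Qed.
Lemma Cl_lim B f : (forall e : R, 0 < e -> exists f', Cl B f' /\
  ev (fun n => N2 (fun t => f n t - f' n t) < e)) -> Cl B f.
Proof.
move=> h e e0; have e4 : 0 < e / 4 by rewrite divr_gt0.
have [f' [cf' hf']] := h _ e4; have [J hJ] := cf' _ e4; exists J.
apply: ev2 hf' hJ => n h1 [b [hb h2]]; exists b; split=> //.
apply: le_lt_trans (N2_tri _ _ (f' n)) _; lra.
Qed.
Lemma Cl_eq B f g : ev (fun n => f n =1 g n) -> Cl B f -> Cl B g.
Proof.
move=> h cf; apply: Cl_lim => e e0; exists f; split=> //.
apply: evS h => n h; rewrite (le_lt_trans (N2_le (K := 0) _)) ?expr0n //.
by move=> t; rewrite h subrr ab0.
Qed.
Lemma Cl_base B f : ev (fun n => B n (f n)) -> Cl B f.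
Proof.
move=> h e e0; exists unit; apply: evS h => n h; exists (fun=> f n); split=> //.
rewrite (le_lt_trans (N2_le (K := 0) _)) ?expr0n //.
by move=> t; rewrite big_const card_unit /= addr0 subrr ab0.
Qed.
Lemma Cl_add B f g : Cl B f -> Cl B g -> Cl B (fun n t => f n t + g n t).
Proof.
move=> cf cg e e0; have e4 : 0 < e / 4 by rewrite divr_gt0.
have [J hJ] := cf _ e4; have [J' hJ'] := cg _ e4; exists (J + J')%type.
apply: ev2 hJ hJ' => n [b [hb h1]] [b' [hb' h2]].
exists (fun j => match j with inl j => b j | inr j => b' j end).
split=> [[]//|]; set F := fun t => _.
rewrite (@eq_N2 _ _ F (fun t => (f n t - \sum_j b j t) + (g n t - \sum_j b' j t))).
  by apply: le_lt_trans (N2D _ _) _; lra.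
by move=> t; rewrite /F big_sumType /= opprD addrACA.
Qed.
Lemma Cl_0 B : Cl B (fun _ _ => 0).
Proof.
move=> e e0; exists void; apply: evT => n; exists (fun v : void => match v with end).
split=> [[]|]; rewrite (le_lt_trans (N2_le (K := 0) _)) ?expr0n // => t.
by rewrite big_pred0 ?subrr ?ab0 // => -[].
Qed.
Lemma Cl_sum B (V : Type) (r : seq V) (f : V -> fam T) :
  (forall v, Cl B (f v)) -> Cl B (fun n t => \sum_(v <- r) f v n t).
Proof.
move=> h; elim: r => [|v r IH].
  by apply: Cl_eq (Cl_0 B); apply: evT => n t; rewrite big_nil.
by apply: Cl_eq (Cl_add (h v) IH); apply: evT => n t; rewrite big_cons.
Qed.
(** [B] is closed only under constants of modulus at most 1, so a coefficient bounded by [K] is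
    spread over [N > K] equal summands. *)
Lemma Cl_scale B f (c : nat -> C) (K : R) : good_base B ->
  ev (fun n => ab (c n) <= K) -> Cl B f -> Cl B (fun n t => c n * f n t).
Proof.
move=> gB hc cf e e0; pose N := (Num.truncn K).+1.
have KN : K < N%:R by exact: truncnS_gt.
have N0 : 0 < N%:R :> R by rewrite ltr0n.
have e1 : 0 < e / N%:R ^+ 2 by rewrite divr_gt0 ?exprn_gt0.
have [J hJ] := cf _ e1; exists (J * 'I_N)%type.
apply: ev2 hc hJ => n cn [b [hb h1]].
exists (fun ji t => c n / N%:R * b ji.1 t); split.
  move=> j; apply: (gB _ _ (hb j.1)).2.
  by rewrite abM abV ab_nat ler_pdivrMr // mul1r ltW // (le_lt_trans cn).
rewrite (@eq_N2 _ _ _ (fun t => c n * (f n t - \sum_j b j t))).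
  rewrite N2Z; apply: le_lt_trans (_ : N%:R ^+ 2 * N2 (fun t => f n t - \sum_j b j t) < _).
    rewrite ler_wpM2r ?N2_ge0 // ler_pXn2r ?nnegrE ?ab_ge0 ?ltW //.
    exact: le_lt_trans cn KN.
  by rewrite mulrC -ltr_pdivlMr ?exprn_gt0.
move=> t; rewrite mulrBr; congr (_ - _).
rewrite -(pair_bigA _ (fun j (i : 'I_N) => c n / N%:R * b j t)) /= mulr_sumr.
apply: eq_bigr => j _; rewrite sumr_const card_ord -[LHS]mulr_natl mulrA mulrCA divff ?mulr1 //.
by rewrite pnatr_eq0.
Qed.

Definition hull B B' := forall n b, B n b ->
  exists (S : finType) (F : S -> T n -> C),
    [/\ (0 < #|S|)%N, forall s, B' n (F s) & forall t, b t = avg (fun s => F s t)].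

(** Elements of [B] are averages over index sets of unbounded size; [sampling] replaces each by [L]
    elements of [B'] with [L] independent of [n], which keeps the number of summands bounded. *)
Lemma Cl_hull B B' f : good_base B' -> hull B B' -> Cl B f -> Cl B' f.
Proof.
move=> gB' hB cf; apply: Cl_lim => e e0.
have e4 : 0 < e / 4 by rewrite divr_gt0.
have [J hJ] := cf _ e4.
(* Each of the [#|J|] averages is sampled with squared error at most [1 / L], and [N2_sum]
   multiplies the sum of these errors by [#|J|]. *)
pose L := (Num.truncn (#|J|%:R ^+ 2 * (4 / e))).+1.
have hL : #|J|%:R ^+ 2 / L%:R < e / 4.
  have := truncnS_gt (#|J|%:R ^+ 2 * (4 / e)); rewrite -/L => h.
  rewrite ltr_pdivrMr ?ltr0n // mulrC -ltr_pdivrMr ?divr_gt0 // invf_div.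
  exact: h.
have main : ev (fun n => exists b : J * 'I_L -> T n -> C, (forall j, B' n (b j)) /\
   N2 (fun t => f n t - \sum_j b j t) < e).
  apply: evS hJ => n [b [hb h1]].
  have /choice[G hG] : forall j, exists G : 'I_L -> T n -> C,
      (forall l, B' n (G l)) /\ N2 (fun t => b j t - \sum_l G l t) <= L%:R^-1.
    move=> j; have [S [F [S0 hF bF]]] := hB _ _ (hb j).
    have [s hs] := sampling S0 (fun s t => (gB' _ _ (hF s)).1 t) (ltn0Sn _ : (0 < L)%N).
    exists (fun l t => L%:R^-1 * F (s l) t); split=> [l|].
      apply: (gB' _ _ (hF _)).2; rewrite abV ab_nat invf_le1 ?ltr0n //.
      by rewrite ler1n.
    apply: le_trans hs; rewrite le_eqVlt; apply/orP; left; apply/eqP.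
    by apply: eq_N2 => t; rewrite bF.
  exists (fun jl => G jl.1 jl.2); split=> [[j l]|]; first exact: (hG j).1.
  apply: le_lt_trans (N2_tri _ _ (fun t => \sum_j b j t)) _.
  have : N2 (fun t => \sum_j b j t - \sum_jl G jl.1 jl.2 t) <= #|J|%:R ^+ 2 / L%:R.
    rewrite (@eq_N2 _ _ _ (fun t => \sum_j (b j t - \sum_l G j l t))); last first.
      by move=> t; rewrite sumrB -(pair_bigA _ (fun j l => G j l t)).
    apply: le_trans (N2_sum _) _; rewrite expr2 -mulrA ler_wpM2l ?ler0n //.
    apply: le_trans (ler_sum _ (fun j _ => (hG j).2)) _.
    by rewrite sumr_const mulr_natl.
  lra.
(* The decompositions are fixed for all [n] at once, with the default 0 at the exceptional [n], so
   that their sum is a family to which [Cl_lim] applies. *)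
have [b0 hb0] : exists b0 : forall n, J * 'I_L -> T n -> C, forall n,
    (exists b : J * 'I_L -> T n -> C, (forall j, B' n (b j)) /\
      N2 (fun t => f n t - \sum_j b j t) < e) ->
    (forall j, B' n (b0 n j)) /\ N2 (fun t => f n t - \sum_j b0 n j t) < e.
  have h n : exists b0 : J * 'I_L -> T n -> C,
    (exists b : J * 'I_L -> T n -> C, (forall j, B' n (b j)) /\
      N2 (fun t => f n t - \sum_j b j t) < e) ->
    (forall j, B' n (b0 j)) /\ N2 (fun t => f n t - \sum_j b0 j t) < e.
    have [[b hb]|h] := pselect (exists b : J * 'I_L -> T n -> C, (forall j, B' n (b j)) /\
      N2 (fun t => f n t - \sum_j b j t) < e); first by exists b.
    by exists (fun _ _ => 0).
  by exists (fun n => projT1 (cid (h n))) => n; exact: (projT2 (cid (h n))).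
exists (fun n t => \sum_(j <- index_enum (J * 'I_L)%type) b0 n j t); split.
  move=> d d0; exists (J * 'I_L)%type; apply: evS main => n /hb0[h1 h2].
  exists (b0 n); split=> //; rewrite (le_lt_trans (N2_le (K := 0) _)) ?expr0n //.
  by move=> t; rewrite subrr ab0.
by apply: evS main => n /hb0[].
Qed.

Lemma ab_sum_le (J : finType) (n : nat) (b : J -> T n -> C) t :
  (forall j, ab (b j t) <= 1) -> ab (\sum_j b j t) <= #|J|%:R.
Proof.
move=> h; apply: le_trans (ab_sum _ _ _) _.
by apply: le_trans (ler_sum _ (fun j _ => h j)) _; rewrite sumr_const.
Qed.

(** [f g - b b' = (f - b) g + (g - b') b]: the first term needs a bound on [g], the second the bound
    [#|J|] on the sum [b], so the precision for [g] is chosen after [J]. *)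
Lemma Cl_mul B1 B2 B f g : good_base B1 ->
  (forall n b1 b2, B1 n b1 -> B2 n b2 -> B n (fun t => b1 t * b2 t)) ->
  bdd g -> Cl B1 f -> Cl B2 g -> Cl B (fun n t => f n t * g n t).
Proof.
move=> gB1 hB /bdd_pos[K K0 hK] cf cg e e0.
have e1 : 0 < e / (4 * K ^+ 2) by rewrite divr_gt0 ?mulr_gt0 ?exprn_gt0.
have [J hJ] := cf _ e1.
have D0 : 0 < 4 * (#|J|%:R ^+ 2 + 1) :> R by rewrite mulr_gt0 // ltr_wpDl ?sqr_ge0.
have e2 : 0 < e / (4 * (#|J|%:R ^+ 2 + 1)) by rewrite divr_gt0.
have [J' hJ'] := cg _ e2; exists (J * J')%type.
apply: ev3 hK hJ hJ' => n gK [b [hb h1]] [b' [hb' h2]].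
exists (fun jj t => b jj.1 t * b' jj.2 t); split=> [[j j']|]; first exact: hB.
rewrite (@eq_N2 _ _ _ (fun t => (f n t - \sum_j b j t) * g n t
   + (g n t - \sum_j b' j t) * (\sum_j b j t))); last first.
  move=> t; rewrite -(pair_bigA _ (fun j j' => b j t * b' j' t)) /=.
  under [X in _ - X = _]eq_bigr => j _ do rewrite -mulr_sumr.
  by rewrite -mulr_suml; ring.
apply: le_lt_trans (N2D _ _) _.
have h3 := N2_mulr (fun t => f n t - \sum_j b j t) gK.
have h4 := N2_mulr (fun t => g n t - \sum_j b' j t)
  (fun t => ab_sum_le (fun j => (gB1 _ _ (hb j)).1 t)).
rewrite ltr_pdivlMr ?mulr_gt0 ?exprn_gt0 // in h1.
rewrite ltr_pdivlMr // in h2.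
have := N2_ge0 (fun t => g n t - \sum_j b' j t); nra.
Qed.

(** Pigeonhole over the boundedly many summands of an approximation of [f]: one of them carries a
    fixed part of the correlation with [g]. *)
Lemma Cl_corr B f g : good_base B -> bdd g -> Cl B f ->
  nnull W (fun n => ab (avg (fun t => f n t * g n t))) ->
  exists2 c : R, 0 < c & ev (fun n => exists2 b, B n b & c <= ab (avg (fun t => b t * g n t))).
Proof.
move=> gB /bdd_pos[K K0 hK] cf [c c0 hc].
have e1 : 0 < (c / (2 * K)) ^+ 2 by rewrite exprn_gt0 // divr_gt0 // mulr_gt0.
have [J hJ] := cf _ e1.
have J1 : 0 < 2 * (#|J|%:R + 1) :> R by rewrite mulr_gt0 // ltr_wpDl.
exists (c / (2 * (#|J|%:R + 1))); first by rewrite divr_gt0.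
apply: ev3 hK hc hJ => n gK hn [b [hb h1]].
apply: contrapT => h2.
have h3 j : ab (avg (fun t => b j t * g n t)) <= c / (2 * (#|J|%:R + 1)).
  by rewrite leNgt; apply/negP => h; apply: h2; exists (b j) => //; exact: ltW.
have : ab (avg (fun t => f n t * g n t)) <= c / 2 + c / (2 * (#|J|%:R + 1)) * #|J|%:R.
  have -> : avg (fun t => f n t * g n t) =
      avg (fun t => (f n t - \sum_j b j t) * g n t) + \sum_j avg (fun t => b j t * g n t).
    rewrite -avg_sum -avgD; apply: eq_avg => t.
    by rewrite -mulr_suml; ring.
  apply: le_trans (abD _ _) _; apply: lerD.
    have h4 : ab (avg (fun t => (f n t - \sum_j b j t) * g n t)) ^+ 2 <= (c / 2) ^+ 2.
      apply: le_trans (ab_avg_N2 _) _; apply: le_trans (N2_mulr _ gK) _.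
      apply: le_trans (ler_wpM2l (sqr_ge0 K) (ltW h1)) _.
      by rewrite -exprMn (_ : K * (c / (2 * K)) = c / 2) //; field; rewrite gt_eqF.
    by rewrite -(ler_pXn2r (n := 2)) ?nnegrE ?ab_ge0 // divr_ge0 // ltW.
  apply: le_trans (ab_sum _ _ _) _; apply: le_trans (ler_sum _ (fun j _ => h3 j)) _.
  by rewrite sumr_const mulr_natr.
have : c / (2 * (#|J|%:R + 1)) * #|J|%:R < c / 2.
  rewrite invfM mulrA -[ltLHS]mulrA gtr_pMr ?divr_gt0 //.
  by rewrite mulrC ltr_pdivrMr ?ltr_wpDl // mul1r ltrDl.
move: hn; lra.
Qed.
End OneT.

Lemma Cl_pull (T S : nat -> finType) (p : forall n, T n -> S n) (B : base S) (B' : base T)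
    (f : fam S) : (forall n, mp (p n)) ->
  (forall n b, B n b -> B' n (fun t => b (p n t))) ->
  Cl B f -> Cl B' (fun n t => f n (p n t)).
Proof.
move=> hp hB cf e e0; have [J hJ] := cf _ e0; exists J.
apply: evS hJ => n [b [hb h1]]; exists (fun j t => b j (p n t)).
split=> [j|]; first exact: hB.
by rewrite (N2_mp (fun s => f n s - \sum_j b j s)).
Qed.

Lemma Cl_avg (T S : nat -> finType) (B' : base (fun n => T n * S n)%type) (B : base T)
    (F : fam (fun n => T n * S n)%type) : good_base B -> (forall n, 0 < #|S n|)%N ->
  (forall n b s, B' n b -> B n (fun t => b (t, s))) ->
  Cl B' F -> Cl B (fun n t => avg (fun s => F n (t, s))).
Proof.
move=> gB S0 hB cF.
pose BA : base T := fun n a => exists2 b, B' n b & a = fun t => avg (fun s => b (t, s)).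
apply: (@Cl_hull _ BA) => //.
  move=> n _ [b hb ->]; exists (S n), (fun s t => b (t, s)); split=> // s.
  exact: hB.
move=> e e0; have [J hJ] := cF _ e0; exists J.
apply: evS hJ => n [b [hb h1]]; exists (fun j t => avg (fun s => b j (t, s))).
split=> [j|]; first by exists (b j).
apply: le_lt_trans h1.
rewrite (@eq_N2 _ _ _ (fun t => avg (fun s => F n (t, s) - \sum_j b j (t, s)))).
  exact: (N2_avg (fun ts => F n ts - \sum_j b j ts)).
by move=> t; rewrite avgB avg_sum.
Qed.

Definition prod_base (T : nat -> finType) (V : eqType) (r : seq V) (Bv : V -> base T) :
    base T :=
  fun n b => exists2 bv : V -> T n -> C, (forall v, v \in r -> Bv v n (bv v)) &
    b = fun t => \prod_(v <- r) bv v t.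

Lemma Cl_prod (T : nat -> finType) (V : eqType) (r : seq V) (Bv : V -> base T)
    (f : V -> fam T) : uniq r ->
  (forall v, good_base (Bv v)) -> (forall v, bdd (f v)) ->
  (forall v, v \in r -> Cl (Bv v) (f v)) ->
  Cl (prod_base r Bv) (fun n t => \prod_(v <- r) f v n t).
Proof.
move=> ur gB bf; elim: r ur => [|v r IH] /= => [_ _|/andP[vr ur] cf].
  apply: Cl_base; apply: evT => n; exists (fun _ _ => 1) => //.
  by apply: funext => t; rewrite !big_nil.
have cf' w : w \in r -> Cl (Bv w) (f w) by move=> h; apply: cf; rewrite inE h orbT.
have h := @Cl_mul T (Bv v) (prod_base r Bv) (prod_base (v :: r) Bv) _ _ (gB v) _ 
  (bdd_prod r bf) (cf v (mem_head _ _)) (IH ur cf').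
apply: Cl_eq (h _); first by apply: evT => n t; rewrite big_cons.
move=> n b1 _ hb1 [bv hbv ->].
exists (fun w => if w == v then b1 else bv w) => [w|].
  by rewrite inE; case: eqP => [->|_] //= /hbv.
apply: funext => t; rewrite big_cons eqxx; congr (_ * _).
by apply: eq_big_seq => w wr; case: eqP => // e; rewrite -e wr in vr.
Qed.
End Closure.

Lemma avg_addr (K : numFieldType) (Z : finZmodType) (F : Z -> K) a :
  avg (fun x => F (x + a)) = avg F.
Proof.
rewrite (@mp_avg _ _ _ (fun x => x + a)) //; apply: bij_mp.
by exists (fun x => x - a) => x; rewrite ?addrK ?subrK.
Qed.
Lemma avg_addl (K : numFieldType) (Z : finZmodType) (F : Z -> K) a :
  avg (fun x => F (a + x)) = avg F.
Proof. by rewrite -(avg_addr F a); apply: eq_avg => x; rewrite addrC. Qed.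

Lemma zmod_gt0 (Z : finZmodType) : (0 < #|Z|)%N.
Proof. by apply/card_gt0P; exists 0. Qed.

(** * Gowers norms and dual functions *)

Section Dirs.
Variables (K : numFieldType) (Z : finZmodType).
Implicit Types (Phi : seq Z -> K).

Definition Eh d Phi : K := avg (fun hs : d.-tuple Z => Phi hs).

Lemma Eh0 Phi : Eh 0 Phi = Phi [::].
Proof.
rewrite /Eh (@eq_avg _ _ _ (fun=> Phi [::])) ?avg_const ?card_tuple //.
by move=> t; rewrite tuple0.
Qed.
Lemma EhS d Phi : Eh d.+1 Phi = avg (fun h => Eh d (fun hs => Phi (h :: hs))).
Proof.
rewrite /Eh -(avg_pairE (fun h (hs : d.-tuple Z) => Phi (h :: hs))).
have hb : bijective (fun hh : Z * d.-tuple Z => [tuple of hh.1 :: hh.2]).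
  exists (fun t => (thead t, [tuple of behead t])).
    by move=> [h t] /=; rewrite theadE; congr (_, _); apply: val_inj.
  by move=> t; rewrite /= -tuple_eta.
by rewrite -(mp_avg (fun t : d.+1.-tuple Z => Phi t) (bij_mp hb)).
Qed.
Lemma tuple_gt0 d : (0 < #|{: d.-tuple Z}|)%N.
Proof. by rewrite card_tuple expn_gt0 zmod_gt0. Qed.
Lemma eq_Eh d Phi Psi : (forall hs, size hs = d -> Phi hs = Psi hs) -> Eh d Phi = Eh d Psi.
Proof. by move=> h; apply: eq_avg => t; rewrite h ?size_tuple. Qed.

Fixpoint zadd (hs ts : seq Z) : seq Z :=
  match hs, ts with h :: hs', t :: ts' => (h + t) :: zadd hs' ts' | _, _ => [::] end.

Lemma Eh_shift d Phi hs : size hs = d -> Eh d (fun ts => Phi (zadd hs ts)) = Eh d Phi.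
Proof.
elim: d hs Phi => [|d IH] [|h hs] Phi //= => [_|[sz]]; first by rewrite !Eh0.
rewrite !EhS -[RHS](avg_addl _ h); apply: eq_avg => t /=.
exact: (IH hs (fun l => Phi (h + t :: l))).
Qed.
End Dirs.

Section Gowers.
Variables (R : realType) (Z : finZmodType).
Local Notation C := R[i].
Implicit Types (F G : seq bool -> Z -> C) (f g : Z -> C).

(** The product of [F s (x + dot s hs)] over the vertices [s] of a cube, see [cprodE]; the recursion
    treats one direction at a time. *)
Fixpoint cprod F (hs : seq Z) (x : Z) : C :=
  match hs with
  | [::] => F [::] x
  | h :: hs' => cprod (fun s => F (false :: s)) hs' x * cprod (fun s => F (true :: s)) hs' (x + h)
  end.

Definition le1 (T : Type) (f : T -> C) := forall x, ab (f x) <= 1.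
Definition le1F F := forall s, le1 (F s).

Lemma le1M (T : Type) (f g : T -> C) : le1 f -> le1 g -> le1 (fun x => f x * g x).
Proof. by move=> hf hg x; rewrite abM mulr_ile1 ?ab_ge0. Qed.
Lemma eq_cprod F G hs x : (forall s y, size s = size hs -> F s y = G s y) ->
  cprod F hs x = cprod G hs x.
Proof.
elim: hs F G x => [|h hs IH] F G x e /=; first exact: e.
by congr (_ * _); apply: IH => s y sz; apply: e; rewrite /= sz.
Qed.
Lemma cprodM F G hs x :
  cprod (fun s y => F s y * G s y) hs x = cprod F hs x * cprod G hs x.
Proof.
by elim: hs F G x => [|h hs IH] F G x //=; rewrite !IH mulrACA.
Qed.
Lemma cprod_shift F a hs x : cprod (fun s y => F s (y + a)) hs x = cprod F hs (x + a).
Proof.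
elim: hs F x => [|h hs IH] F x //=.
by rewrite (IH (fun s => F (false :: s))) (IH (fun s => F (true :: s))) addrAC.
Qed.
Lemma cprod_conj F hs x : cprod (fun s y => Num.conj (F s y)) hs x = Num.conj (cprod F hs x).
Proof. by elim: hs F x => [|h hs IH] F x //=; rewrite !IH rmorphM. Qed.
Lemma cprod_le1 F hs : le1F F -> le1 (cprod F hs).
Proof.
elim: hs F => [|h hs IH] F hF x /=; first exact: hF.
by rewrite abM mulr_ile1 ?ab_ge0 // IH.
Qed.
Definition upd F s0 f : seq bool -> Z -> C := fun s => if s == s0 then f else F s.
Lemma upd_le1 F s0 f : le1F F -> le1 f -> le1F (upd F s0 f).
Proof. by move=> h hf s; rewrite /upd; case: eqP. Qed.
Lemma cprod_upd0 F hs f x : cprod (upd F (nseq (size hs) false) f) hs x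
  = f x * cprod (upd F (nseq (size hs) false) (fun=> 1)) hs x.
Proof.
elim: hs F x => [|h hs IH] F x /=; first by rewrite /upd /= mulr1.
rewrite mulrA; congr (_ * _).
rewrite -[RHS]IH; apply: eq_cprod => s y sz; rewrite /upd eqseq_cons /=.
by [].
Qed.
Fixpoint dot (s : seq bool) (ts : seq Z) : Z :=
  match s, ts with b :: s', t :: ts' => (if b then t else 0) + dot s' ts' | _, _ => 0 end.
Lemma dot0 n ts : dot (nseq n false) ts = 0.
Proof. by elim: n ts => [|n IH] [|t ts] //=; rewrite add0r. Qed.
Lemma cprod_add F hs ts x : size hs = size ts ->
  cprod F (zadd hs ts) x = cprod (fun s y => F s (y + dot s ts)) hs x.
Proof.
elim: hs ts F x => [|h hs IH] [|t ts] F x //= => [_|[sz]]; first by rewrite addr0.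
rewrite !IH //; congr (_ * _).
  by apply: eq_cprod => s y _; rewrite add0r.
rewrite addrA -[LHS]cprod_shift; apply: eq_cprod => s y _.
by rewrite -addrA.
Qed.

(** The Gowers inner product of the functions [F s], with the conjugations included in [F]. *)
Definition GP d F : C := avg (fun x => Eh d (fun hs => cprod F hs x)).

Lemma GP_exch d F : GP d F = Eh d (fun hs => avg (fun x => cprod F hs x)).
Proof. exact: avg_exch. Qed.
Lemma GPh d F : GP d.+1 F =
  avg (fun h => GP d (fun s x => F (false :: s) x * F (true :: s) (x + h))).
Proof.
rewrite GP_exch EhS; under [RHS]eq_avg => h do rewrite GP_exch.
apply: eq_avg => h; apply: eq_Eh => hs _; apply: eq_avg => x /=.
by rewrite cprodM (cprod_shift (fun s => F (true :: s))).
Qed.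
(** For fixed [hs] the two opposite faces in the first direction are translated independently, so
    the average factors. *)
Lemma GPS d F : GP d.+1 F = Eh d (fun hs =>
  avg (cprod (fun s => F (false :: s)) hs) * avg (cprod (fun s => F (true :: s)) hs)).
Proof.
rewrite GP_exch EhS /Eh avg_exch; apply: eq_avg => hs.
rewrite avg_exch /=.
under eq_avg => x do rewrite avgZ avg_addl.
by rewrite avgZr.
Qed.
Lemma GP0 F : GP 0 F = avg (F [::]).
Proof. by rewrite GP_exch Eh0. Qed.

Definition cj (s : seq bool) (z : C) := if odd (count id s) then Num.conj z else z.
Lemma ab_cj s z : ab (cj s z) = ab z.
Proof. by rewrite /cj; case: odd => //; rewrite ab_conj. Qed.
Lemma cj_cons b s z : cj (b :: s) z = if b then Num.conj (cj s z) else cj s z.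
Proof. by rewrite /cj /=; case: b => //=; case: odd => //=; rewrite conjCK. Qed.
Lemma cjM s z w : cj s (z * w) = cj s z * cj s w.
Proof. by rewrite /cj; case: odd; rewrite ?rmorphM. Qed.
Lemma cj_conj s z : cj s (Num.conj z) = Num.conj (cj s z).
Proof. by rewrite /cj; case: odd; rewrite ?conjCK. Qed.

(** The [2^d]-th power of the [U^d] norm ([gowers_U]). It is real and nonnegative for [d > 0], while
    [U 0 f] is the mean of [f]. *)
Definition U d f : C := GP d (fun s x => cj s (f x)).
Definition u d f : R := ab (U d f).

Lemma u_ge0 d f : 0 <= u d f. Proof. exact: ab_ge0. Qed.
Lemma U_S d f : U d.+1 f =
  (Eh d (fun hs => ab (avg (cprod (fun s x => cj s (f x)) hs)) ^+ 2))%:C.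
Proof.
rewrite /U GPS /Eh avgC; apply: eq_avg => hs; rewrite -mulcJ conj_avg; congr (_ * _).
apply: eq_avg => x; rewrite -cprod_conj.
by apply: eq_cprod => s y _; rewrite cj_cons.
Qed.
Lemma uE d f : u d.+1 f = Eh d (fun hs => ab (avg (cprod (fun s x => cj s (f x)) hs)) ^+ 2).
Proof.
rewrite /u U_S abR ger0_norm //; apply: avg_ge0 => hs; exact: sqr_ge0.
Qed.
Lemma U_u d f : U d.+1 f = (u d.+1 f)%:C.
Proof. by rewrite U_S uE. Qed.
Lemma u0E f : u 0 f = ab (avg f).
Proof. by rewrite /u /U GP0. Qed.
Lemma u_le1 d f : le1 f -> u d f <= 1.
Proof.
move=> h; apply: le_trans (ab_avg _) _; apply: avg_le => // x.
apply: le_trans (ab_avg _) _; apply: avg_le => // hs.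
by apply: cprod_le1 => s y; rewrite ab_cj.
Qed.
Lemma u_mono d f : u d f ^+ 2 <= u d.+1 f.
Proof.
rewrite uE /u /U GP_exch; apply: le_trans (avg_sqr _).
by rewrite ler_pXn2r ?nnegrE ?ab_ge0 ?ab_avg // avg_ge0 // => hs; rewrite ab_ge0.
Qed.
Lemma u_mono_le j k f : (j <= k)%N -> u j f ^+ (2 ^ (k - j)) <= u k f.
Proof.
elim: k => [|k IH]; first by rewrite leqn0 => /eqP ->.
rewrite leq_eqVlt => /orP[/eqP ->|]; first by rewrite subnn.
rewrite ltnS => jk; rewrite subSn // expnSr exprM.
apply: le_trans (u_mono _ _); rewrite ler_pXn2r ?nnegrE ?exprn_ge0 ?u_ge0 //; exact: IH.
Qed.
Lemma u_scale d c f : u d (fun x => c * f x) = ab c ^+ (2 ^ d) * u d f.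
Proof.
have h hs x : cprod (fun s y => cj s (c * f y)) hs x
   = cprod (fun s _ => cj s c) hs x * cprod (fun s y => cj s (f y)) hs x.
  by rewrite -cprodM; apply: eq_cprod => s y _; rewrite cjM.
have hc hs x y : cprod (fun s _ => cj s c) hs x = cprod (fun s _ => cj s c) hs y.
  by rewrite -[in RHS](subrK x y) addrC -cprod_shift.
have habs hs x : ab (cprod (fun s _ => cj s c) hs x) = ab c ^+ (2 ^ size hs).
  have : forall k, (forall s, ab (k s) = ab c) ->
      ab (cprod (fun s _ => k s) hs x) = ab c ^+ (2 ^ size hs).
    elim: hs x => [|h' hs IH] x k hk /=; first by rewrite expr1.
    by rewrite abM !IH // expnS mulSn mul1n exprD.
  by apply=> s; rewrite ab_cj.
case: d => [|d].
  by rewrite !u0E avgZ abM expn0 expr1.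
rewrite !uE /Eh -avgZ; apply: eq_avg => hs.
under eq_avg => x do rewrite h (hc hs x 0).
by rewrite avgZ abM exprMn habs size_tuple -exprM expnSr.
Qed.
Lemma u_shift d a f : u d (fun x => f (x + a)) = u d f.
Proof.
rewrite /u /U !GP_exch; congr ab; apply: eq_avg => hs.
by under eq_avg => x do rewrite (cprod_shift (fun s y => cj s (f y))); rewrite avg_addr.
Qed.
Lemma u_conj d f : u d (fun x => Num.conj (f x)) = u d f.
Proof.
rewrite /u -[RHS]ab_conj /U !GP_exch /Eh conj_avg; congr ab; apply: eq_avg => hs.
rewrite conj_avg; apply: eq_avg => x; rewrite -cprod_conj; apply: eq_cprod => s y _.
by rewrite cj_conj.
Qed.

(** The average on the left is the Gowers product of order [j + 2] with [A] on one face and [B] on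
    the opposite one; [GPS] factors it and Cauchy-Schwarz separates the faces. *)
Lemma u_pair_CS j (A B : Z -> C) :
  avg (fun h => u j.+1 (fun x => A x * B (x + h))) ^+ 2 <= u j.+2 A * u j.+2 B.
Proof.
have -> : avg (fun h => u j.+1 (fun x => A x * B (x + h)))
   = Re (Eh j.+1 (fun hs => avg (cprod (fun s x => cj s (A x)) hs)
                          * avg (cprod (fun s x => cj s (B x)) hs))).
  have := GPS j.+1 (fun s x => if s is b :: s' then cj s' (if b then B x else A x) else 0).
  rewrite GPh /= => <-; rewrite Re_avg; apply: eq_avg => h.
  rewrite -[LHS]/(Re ((u j.+1 (fun x => A x * B (x + h)))%:C)) -U_u.
  congr (Re _); apply: eq_avg => x; apply: eq_avg => hs; apply: eq_cprod => s y _.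
  by rewrite cjM.
apply: le_trans (_ : ab (Eh j.+1 (fun hs => avg (cprod (fun s x => cj s (A x)) hs)
                          * avg (cprod (fun s x => cj s (B x)) hs))) ^+ 2 <= _).
  by rewrite -real_normK ?num_real // ler_pXn2r ?nnegrE ?ab_ge0 ?Re_le_ab.
by apply: le_trans (ab_avg_CS _ _) _; rewrite !uE.
Qed.

(** A pattern [p] freezes the coordinates marked [Some b] at [b] and leaves the others free:
    [cp p F hs] is the product over the matching face, with free edges [hs]. [nS] and [nN] count the
    two kinds. *)
Fixpoint cp (p : seq (option bool)) F (hs : seq Z) (x : Z) : C :=
  match p with
  | [::] => F [::] x
  | Some b :: p' => cp p' (fun s => F (b :: s)) hs x
  | None :: p' => if hs is h :: hs' then
      cp p' (fun s => F (false :: s)) hs' x * cp p' (fun s => F (true :: s)) hs' (x + h)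
    else 0
  end.
Definition nS (p : seq (option bool)) := count isSome p.
Definition nN (p : seq (option bool)) := count (negb \o isSome) p.

Arguments nS : simpl never.
Arguments nN : simpl never.
Lemma nS_Some b p : nS (Some b :: p) = (nS p).+1. Proof. by []. Qed.
Lemma nS_None p : nS (None :: p) = nS p. Proof. by []. Qed.
Lemma nN_Some b p : nN (Some b :: p) = nN p. Proof. by []. Qed.
Lemma nN_None p : nN (None :: p) = (nN p).+1. Proof. by []. Qed.

Lemma cp_le1 p F hs : le1F F -> le1 (cp p F hs).
Proof.
elim: p F hs => [|[b|] p IH] F hs hF x /=; first exact: hF.
  by apply: IH => s.
case: hs => [|h hs]; first by rewrite ab0.
by rewrite abM mulr_ile1 ?ab_ge0 // IH.
Qed.
Lemma cp_shiftM p F G h hs x :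
  cp p (fun s y => F s y * G s (y + h)) hs x = cp p F hs x * cp p G hs (x + h).
Proof.
elim: p F G hs x => [|[b|] p IH] F G hs x //=.
  by rewrite (IH (fun s => F (b :: s)) (fun s => G (b :: s))).
case: hs => [|h' hs]; first by rewrite mul0r.
rewrite (IH (fun s => F (false :: s)) (fun s => G (false :: s))).
rewrite (IH (fun s => F (true :: s)) (fun s => G (true :: s))).
by rewrite mulrACA (addrAC x h h').
Qed.

Lemma GVN0 p F : nS p = 0%N ->
  GP (size p) F = Eh (nN p) (fun hs => avg (cp p F hs)).
Proof.
elim: p F => [|[b|] p IH] F //= p0; first by rewrite GP0 Eh0.
rewrite GPh nN_None EhS; apply: eq_avg => h; rewrite IH //.
apply: eq_Eh => hs _; apply: eq_avg => x.
by rewrite (cp_shiftM p (fun s => F (false :: s)) (fun s => F (true :: s))).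
Qed.

(** Partial Gowers-Cauchy-Schwarz. A coordinate [Some b] costs one Cauchy-Schwarz, after which the
    face [b] is kept and the other is bounded by 1; a free coordinate costs only convexity. The
    order of the resulting norm is the number of frozen coordinates. *)
Lemma GVN p F : le1F F ->
  ab (GP (size p) F) ^+ (2 ^ nS p) <= Eh (nN p) (fun hs => u (nS p) (cp p F hs)).
Proof.
elim: p F => [|[b|] p IH] F hF /=.
- by rewrite GP0 expn0 expr1 Eh0 u0E.
- rewrite nN_Some nS_Some; case: (posnP (nS p)) => p0.
    rewrite p0 GPS expn1.
    have h0 := fun G => GVN0 G p0.
    have -> : Eh (size p) (fun hs => avg (cprod (fun s => F (false :: s)) hs)
         * avg (cprod (fun s => F (true :: s)) hs))
       = Eh (nN p) (fun hs => avg (cp p (fun s => F (false :: s)) hs)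
         * avg (cp p (fun s => F (true :: s)) hs)).
      rewrite -GPS GPh; under eq_avg => h do rewrite h0.
      rewrite /Eh avg_exch; apply: eq_avg => hs.
      under eq_avg => h do under eq_avg => x do
        rewrite (cp_shiftM p (fun s => F (false :: s)) (fun s => F (true :: s))).
      rewrite avg_exch; under eq_avg => x do rewrite avgZ avg_addl.
      by rewrite avgZr.
    apply: le_trans (ab_avg_N2 _) _; apply: ler_avg => hs.
    rewrite uE Eh0 abM exprMn /=.
    have -> : avg (fun x => cj [::] (cp p (fun s => F (b :: s)) hs x)) = avg (cp p (fun s => F (b :: s)) hs) by [].
    have hle b' : ab (avg (cp p (fun s => F (b' :: s)) hs)) ^+ 2 <= 1.
      rewrite expr_le1 ?ab_ge0 //; apply: le_trans (ab_avg _) _.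
      by apply: avg_le => // x; apply: cp_le1 => s.
    by case: b; [apply: ler_piMl | apply: ler_piMr]; rewrite ?sqr_ge0.
  case: (nS p) p0 IH => // j _ IH; rewrite expnSr exprM.
  set X := Eh (nN p) (fun hs => avg (fun h => u j.+1
    (fun x => cp p (fun s => F (false :: s)) hs x * cp p (fun s => F (true :: s)) hs (x + h)))).
  apply: le_trans (_ : X ^+ 2 <= _).
    rewrite ler_pXn2r ?nnegrE ?exprn_ge0 ?ab_ge0 //; last first.
      by apply: avg_ge0 => hs; apply: avg_ge0 => h; exact: u_ge0.
    rewrite GPh; apply: le_trans (_ : avg (fun h => ab (GP (size p)
       (fun s x => F (false :: s) x * F (true :: s) (x + h)))) ^+ (2 ^ j.+1) <= _).
      rewrite lerXn2r ?nnegrE ?ab_ge0 ?ab_avg //.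
      by apply: avg_ge0 => h; rewrite ab_ge0.
    apply: le_trans (avg_exp2 _ _) _ => [h|]; first exact: ab_ge0.
    rewrite /X /Eh avg_exch; apply: ler_avg => h.
    have := IH (fun s x => F (false :: s) x * F (true :: s) (x + h)).
    move=> /(_ _)/le_trans; apply; first by move=> s x; rewrite abM mulr_ile1 ?ab_ge0 ?hF.
    rewrite le_eqVlt; apply/orP; left; apply/eqP; apply: eq_avg => hs.
    by congr (ab _); congr (U _ _); apply: funext => x; rewrite (cp_shiftM p (fun s => F (false :: s)) (fun s => F (true :: s))).
  apply: le_trans (avg_sqr _) _; apply: ler_avg => hs.
  apply: le_trans (u_pair_CS _ _ _) _.
  have hle b' : u j.+2 (cp p (fun s => F (b' :: s)) hs) <= 1.
    by apply: u_le1; apply: cp_le1 => s.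
  by case: b; [apply: ler_piMl | apply: ler_piMr]; rewrite ?u_ge0.
- rewrite nN_None nS_None GPh EhS.
  apply: le_trans (_ : avg (fun h => ab (GP (size p)
       (fun s x => F (false :: s) x * F (true :: s) (x + h)))) ^+ (2 ^ nS p) <= _).
    rewrite lerXn2r ?nnegrE ?ab_ge0 ?ab_avg //.
    by apply: avg_ge0 => h; rewrite ab_ge0.
  apply: le_trans (avg_exp2 _ _) _ => [h|]; first exact: ab_ge0.
  apply: ler_avg => h.
  have := IH (fun s x => F (false :: s) x * F (true :: s) (x + h)).
  move=> /(_ _)/le_trans; apply; first by move=> s x; rewrite abM mulr_ile1 ?ab_ge0 ?hF.
  rewrite le_eqVlt; apply/orP; left; apply/eqP; apply: eq_avg => hs.
  by congr (ab _); congr (U _ _); apply: funext => x; rewrite (cp_shiftM p (fun s => F (false :: s)) (fun s => F (true :: s))).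
Qed.

Lemma cp_Some (s : seq bool) F hs x : cp (map Some s) F hs x = F s x.
Proof. by elim: s F => [|b s IH] F //=; rewrite IH. Qed.
(** The pattern with every coordinate frozen isolates the single factor [F s]. *)
Lemma GCS (s : seq bool) F : le1F F -> ab (GP (size s) F) ^+ (2 ^ size s) <= u (size s) (F s).
Proof.
move=> hF; have := GVN (map Some s) hF; rewrite size_map.
have -> : nS (map Some s) = size s by rewrite /nS count_map -(count_predT s); apply: eq_count.
have -> : nN (map Some s) = 0%N by rewrite /nN count_map -(count_pred0 s); apply: eq_count.
rewrite Eh0 => h; apply: le_trans h _; rewrite le_eqVlt; apply/orP; left; apply/eqP.
by congr (ab _); congr (U _ _); apply: funext => x; rewrite cp_Some.
Qed.

(* Dual functions of the [U^d] norm; the factor at the base vertex is trivial. *)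
Definition B d (b : Z -> C) := exists F, [/\ le1F F,
  exists c, forall x, F (nseq d false) x = c & b = fun x => Eh d (fun hs => cprod F hs x)].

Lemma B_le1 d b : B d b -> le1 b.
Proof.
case=> F [hF _ ->] x; apply: le_trans (ab_avg _) _; apply: avg_le => // hs.
exact: cprod_le1.
Qed.
(** Placing [f] at the base vertex, where the factor of [b] is constant, turns the pairing into a
    Gowers product to which [GCS] applies. *)
Lemma avg_dual d b f : B d b -> le1 f -> ab (avg (fun x => f x * b x)) ^+ (2 ^ d) <= u d f.
Proof.
case=> F [hF [c hc] ->] hf; have c1 : ab c <= 1 by rewrite -(hc 0); exact: hF.
have -> : avg (fun x => f x * Eh d (fun hs => cprod F hs x)) =
    GP d (upd F (nseq d false) (fun x => f x * c)).
  apply: eq_avg => x; rewrite /Eh -avgZ; apply: eq_avg => hs.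
  have := cprod_upd0 F hs (fun x => f x * c) x; rewrite size_tuple => ->.
  rewrite -mulrA; congr (_ * _).
  have := cprod_upd0 F hs (fun=> c) x; rewrite size_tuple => <-.
  apply: eq_cprod => s y _; rewrite /upd; case: eqP => // ->; exact: hc.
have := @GCS (nseq d false) (upd F (nseq d false) (fun x => f x * c)).
rewrite size_nseq => /(_ _)/le_trans; apply.
  apply: upd_le1 => // x; rewrite abM mulr_ile1 ?ab_ge0 //; exact: hf.
rewrite /upd eqxx (_ : (fun x => f x * c) = (fun x => c * f x)); last first.
  by apply: funext => x; rewrite mulrC.
by rewrite u_scale ler_piMl ?u_ge0 // exprn_ile1 ?ab_ge0.
Qed.
Lemma dual_exists d f : le1 f -> exists2 b, B d b & U d f = avg (fun x => f x * b x).
Proof.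
move=> hf; exists (fun x => Eh d (fun hs =>
    cprod (upd (fun s x => cj s (f x)) (nseq d false) (fun=> 1)) hs x)).
  eexists; split; [|exists 1|reflexivity]; last by move=> x; rewrite /upd eqxx.
  by apply: upd_le1 => [s x|x]; rewrite ?ab_cj ?ab1.
apply: eq_avg => x; rewrite /Eh -avgZ; apply: eq_avg => hs.
have := cprod_upd0 (fun s x => cj s (f x)) hs f x; rewrite size_tuple => <-.
apply: eq_cprod => s y _; rewrite /upd; case: eqP => // ->.
by rewrite /cj count_nseq mul0n.
Qed.
Lemma B_scale d b c : B d b -> ab c <= 1 -> B d (fun t => c * b t).
Proof.
case=> F [hF [c0 hc] ->] c1.
exists (upd F (nseq d false) (fun=> c * c0)); split.
- apply: upd_le1 => // x; rewrite abM mulr_ile1 ?ab_ge0 // -(hc 0); exact: hF.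
- by exists (c * c0) => x; rewrite /upd eqxx.
- apply: funext => x; rewrite /Eh -avgZ; apply: eq_avg => hs.
  have := cprod_upd0 F hs (fun=> c * c0) x; rewrite size_tuple => ->.
  have := cprod_upd0 F hs (fun=> c0) x; rewrite size_tuple => h.
  rewrite -mulrA -h; congr (_ * _); apply: eq_cprod => s y _.
  by rewrite /upd; case: eqP => // ->.
Qed.
Lemma B_shift d b a : B d b -> B d (fun x => b (x + a)).
Proof.
case=> F [hF [c hc] ->]; exists (fun s y => F s (y + a)); split.
- by move=> s x; exact: hF.
- by exists c => x; exact: hc.
- by apply: funext => x; apply: eq_avg => hs; rewrite cprod_shift.
Qed.
Lemma B_conj d b : B d b -> B d (fun x => Num.conj (b x)).
Proof.
case=> F [hF [c hc] ->]; exists (fun s y => Num.conj (F s y)); split.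
- by move=> s x; rewrite ab_conj; exact: hF.
- by exists (Num.conj c) => x; rewrite hc.
- by apply: funext => x; rewrite /Eh conj_avg; apply: eq_avg => hs; rewrite cprod_conj.
Qed.
Lemma B_const d c : ab c <= 1 -> B d (fun=> c).
Proof.
move=> c1; exists (fun s _ => if s == nseq d false then c else 1); split.
- by move=> s x; case: eqP => // _; rewrite ab1.
- by exists c => x; rewrite eqxx.
- apply: funext => x; rewrite /Eh (@eq_avg _ _ _ (fun=> c)) ?avg_const ?tuple_gt0 //.
  move=> hs; have := cprod_upd0 (fun _ _ => 1) hs (fun=> c) x.
  rewrite size_tuple => e; rewrite -[RHS]mulr1.
  transitivity (c * cprod (upd (fun _ _ => 1) (nseq d false) (fun=> 1)) hs x).
    rewrite -e; apply: eq_cprod => s y _; by rewrite /upd; case: eqP.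
  congr (_ * _); have : forall F : seq bool -> Z -> C, (forall s y, F s y = 1) -> cprod F hs x = 1.
    elim: (tval hs) x {e} => [|h hs' IH] x F hF /=; first exact: hF.
    by rewrite !IH ?mulr1.
  by apply=> s y; rewrite /upd; case: eqP.
Qed.
Lemma B_S d b : B d b -> B d.+1 b.
Proof.
case=> F [hF [c hc] ->].
exists (fun s y => if s is true :: _ then 1 else F (behead s) y); split.
- by move=> [|[] s] x; rewrite ?ab1 //; exact: hF.
- by exists c => x /=; exact: hc.
- apply: funext => x; rewrite EhS.
  have e h : Eh d (fun hs => cprod (fun s y => if s is true :: _ then 1 else F (behead s) y) (h :: hs) x)
     = Eh d (fun hs => cprod F hs x).
    apply: eq_avg => hs /=; rewrite -[RHS]mulr1; congr (_ * _).
    have : forall y, cprod (fun _ _ => 1) hs y = 1 :> C.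
      elim: (tval hs) => [|h' hs' IH] y //=.
      by rewrite !IH mulr1.
    exact.
  by under eq_avg => h do rewrite e; rewrite avg_const ?zmod_gt0.
Qed.
(** The edges of the second cube are written [hs + ts] with [hs] the edges of the first. For fixed
    [ts] both cubes merge into one dual function with factors [F s y * F' s (y + dot s ts)], and the
    factor at the base vertex stays constant. *)
Lemma B_mul d b b' : B d b -> B d b' ->
  exists F : d.-tuple Z -> Z -> C, (forall s, B d (F s)) /\
   forall x, b x * b' x = avg (fun s => F s x).
Proof.
case=> F [hF [c hc] ->] [F' [hF' [c' hc'] ->]].
exists (fun ts x => Eh d (fun hs => cprod (fun s y => F s y * F' s (y + dot s ts)) hs x)).
split=> [ts|x].
  eexists; split; [| |reflexivity].
    by move=> s x; rewrite abM mulr_ile1 ?ab_ge0 ?hF ?hF'.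
  by exists (c * c') => x; rewrite dot0 addr0 hc hc'.
rewrite {1}/Eh -avgZr [RHS]avg_exch; apply: eq_avg => hs.
rewrite -(Eh_shift (fun l => cprod F' l x) (size_tuple hs)) /Eh -avgZ; apply: eq_avg => ts.
by rewrite cprod_add ?size_tuple // cprodM.
Qed.
End Gowers.

Lemma mp_twist (Z : finZmodType) (P Q : finType) (al : P -> Z) (be : P -> Q) :
  mp be -> mp (fun xp : Z * P => (xp.1 + al xp.2, be xp.2)).
Proof.
case=> c c0 hc; exists c => // -[y s]; rewrite -(hc s).
rewrite -(@card_imset _ _ (fun p => (y - al p, p)) [set p | be p == s]); last first.
  by move=> p q [].
apply: eq_card => -[x p]; rewrite !inE; apply/eqP/imsetP => [[<- <-]|[q]].
  by exists p; rewrite ?inE ?eqxx // addrK.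
by rewrite inE => /eqP <- [-> ->]; rewrite subrK.
Qed.
Lemma mp_id (T : finType) : mp (fun x : T => x).
Proof. by apply: bij_mp; exists id. Qed.
Lemma mp_fst (T S : finType) : (0 < #|S|)%N -> mp (fun p : T * S => p.1).
Proof.
move=> S0; exists #|S| => // t; rewrite -[RHS]cardsT.
rewrite -(@card_imset _ _ (fun s => (t, s)) [set: S]); last by move=> ? ? [].
apply: eq_card => -[t' s]; rewrite !inE /=; apply/eqP/imsetP => [->|[s' _ [->]] //].
by exists s; rewrite ?inE.
Qed.
Lemma mp_snd (T S : finType) : (0 < #|T|)%N -> mp (fun p : T * S => p.2).
Proof.
move=> T0; exists #|T| => // s; rewrite -[RHS]cardsT.
rewrite -(@card_imset _ _ (fun t => (t, s)) [set: T]); last by move=> ? ? [].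
apply: eq_card => -[t' s']; rewrite !inE /=; apply/eqP/imsetP => [->|[t _ [_ ->]] //].
by exists t'; rewrite ?inE.
Qed.

(** * Structured kernels *)

Section Kernels.
Variable R : realType.
Context (W : set_system nat) {UW : UltraFilter W}.
Variable Z : nat -> finZmodType.
Local Notation C := R[i].
Local Notation ev := (ev W).

Definition Zf : nat -> finType := fun n => Z n.
Definition ZP (P : nat -> finType) : nat -> finType := fun n => (Z n * P n)%type.

Definition Bf d : base R Zf := fun n b => B d b.
(** Structured in [x] for each value of the parameter, with no condition on the dependence on the
    parameter. *)
Definition BP d P : base R (ZP P) := fun n b => forall p, B d (fun x => b (x, p)).
Definition BK d := @BP d Zf.

Lemma good_Bf d : good_base (Bf d).
Proof. by move=> n b hb; split=> [|c c1]; [exact: B_le1 hb | exact: B_scale]. Qed.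
Lemma good_BP d P : good_base (@BP d P).
Proof.
move=> n b hb; split=> [[x p]|c c1 p]; first exact: (B_le1 (hb p) x).
exact: (B_scale (hb p)).
Qed.

Definition mulB (T : nat -> finType) (B1 B2 : base R T) : base R T := fun n b =>
  exists b1 b2, [/\ B1 n b1, B2 n b2 & b = fun t => b1 t * b2 t].

Lemma hull_Bf d : hull (mulB (Bf d) (Bf d)) (Bf d).
Proof.
move=> n _ [b1 [b2 [h1 h2 ->]]]; have [F [hF eF]] := B_mul h1 h2.
by exists (d.-tuple (Z n) : finType), F; split=> //; exact: tuple_gt0.
Qed.
Lemma hull_BP d P : hull (mulB (@BP d P) (@BP d P)) (@BP d P).
Proof.
move=> n _ [b1 [b2 [h1 h2 ->]]].
have /choice[F hF] := fun p => B_mul (h1 p) (h2 p).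
exists (d.-tuple (Z n) : finType), (fun s xp => F xp.2 s xp.1); split.
- exact: tuple_gt0.
- by move=> s p; exact: (hF p).1.
- by move=> [x p]; rewrite (hF p).2.
Qed.

Lemma S_mul d (f g : fam R Zf) : bdd W g -> Cl W (Bf d) f -> Cl W (Bf d) g ->
  Cl W (Bf d) (fun n x => f n x * g n x).
Proof.
move=> bg cf cg; apply: Cl_hull (@good_Bf d) (@hull_Bf d) _.
apply: Cl_mul (@good_Bf d) _ bg cf cg => n b1 b2 h1 h2.
by exists b1, b2.
Qed.
Lemma P_mul d P (f g : fam R (ZP P)) : bdd W g -> Cl W (@BP d P) f -> Cl W (@BP d P) g ->
  Cl W (@BP d P) (fun n x => f n x * g n x).
Proof.
move=> bg cf cg; apply: Cl_hull (@good_BP d P) (@hull_BP d P) _.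
apply: Cl_mul (@good_BP d P) _ bg cf cg => n b1 b2 h1 h2.
by exists b1, b2.
Qed.
Lemma P_prod d P (V : Type) (r : seq V) (f : V -> fam R (ZP P)) :
  (forall v, bdd W (f v)) -> (forall v, Cl W (@BP d P) (f v)) ->
  Cl W (@BP d P) (fun n x => \prod_(v <- r) f v n x).
Proof.
move=> bf cf; elim: r => [|v r IH].
  apply: Cl_base; apply: evT => n p; under eq_fun do rewrite big_nil.
  by apply: B_const; rewrite ab1.
apply: Cl_eq (P_mul _ (cf v) IH); first by apply: evT => n x; rewrite big_cons.
exact: bdd_prod.
Qed.
Lemma S_prod d (V : Type) (r : seq V) (f : V -> fam R Zf) :
  (forall v, bdd W (f v)) -> (forall v, Cl W (Bf d) (f v)) ->
  Cl W (Bf d) (fun n x => \prod_(v <- r) f v n x).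
Proof.
move=> bf cf; elim: r => [|v r IH].
  apply: Cl_base; apply: evT => n; under eq_fun do rewrite big_nil.
  by apply: B_const; rewrite ab1.
apply: Cl_eq (S_mul _ (cf v) IH); first by apply: evT => n x; rewrite big_cons.
exact: bdd_prod.
Qed.
Lemma conj_Cl (T : nat -> finType) (B : base R T) (f : fam R T) :
  (forall n b, B n b -> B n (fun t => Num.conj (b t))) ->
  Cl W B f -> Cl W B (fun n t => Num.conj (f n t)).
Proof.
move=> hB cf e e0; have [J hJ] := cf e e0; exists J.
apply: evS hJ => n [b [hb h]]; exists (fun j t => Num.conj (b j t)).
split=> [j|]; first exact: hB.
rewrite (@eq_N2 _ _ _ (fun t => Num.conj (f n t - \sum_j b j t))).
  by rewrite /N2; under eq_avg => t do rewrite ab_conj.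
by move=> t; rewrite rmorphB rmorph_sum.
Qed.
Lemma S_conj d (f : fam R Zf) : Cl W (Bf d) f -> Cl W (Bf d) (fun n x => Num.conj (f n x)).
Proof. by apply: conj_Cl => n b; exact: B_conj. Qed.
Lemma P_conj d P (f : fam R (ZP P)) : Cl W (@BP d P) f ->
  Cl W (@BP d P) (fun n x => Num.conj (f n x)).
Proof. by apply: conj_Cl => n b hb p; exact: (B_conj (hb p)). Qed.
Lemma S_shift d (f : fam R Zf) (a : forall n, Z n) :
  Cl W (Bf d) f -> Cl W (Bf d) (fun n x => f n (x + a n)).
Proof.
apply: (@Cl_pull R W _ Zf Zf (fun n x => x + a n)) => [n|n b]; last exact: B_shift.
by apply: bij_mp; exists (fun x => x - a n) => x; rewrite ?addrK ?subrK.
Qed.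

Lemma P_pull d (P Q : nat -> finType) (al : forall n, P n -> Z n) (be : forall n, P n -> Q n)
    (f : fam R (ZP Q)) : (forall n, mp (be n)) ->
  Cl W (@BP d Q) f -> Cl W (@BP d P) (fun n xp => f n (xp.1 + al n xp.2, be n xp.2)).
Proof.
move=> hb; apply: (@Cl_pull R W _ (ZP P) (ZP Q)) => [n|n b h p]; first exact: mp_twist.
by have /= := B_shift (al n p) (h (be n p)).
Qed.
Lemma P_pullS d (P : nat -> finType) (al : forall n, P n -> Z n) (f : fam R Zf) : (forall n, 0 < #|P n|)%N ->
  Cl W (Bf d) f -> Cl W (@BP d P) (fun n xp => f n (xp.1 + al n xp.2)).
Proof.
move=> P0; apply: (@Cl_pull R W _ (ZP P) Zf (fun n (xp : Z n * P n) => xp.1 + al n xp.2)) => [n|n b h p].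
  pose t := fun xp : Z n * P n => (xp.1 + al n xp.2, xp.2).
  have := @comp_mp _ _ _ t (fun xp : Z n * P n => xp.1).
  apply; [exact: (mp_twist (al n) (mp_id _)) | exact: mp_fst].
exact: (B_shift (al n p) h).
Qed.
Lemma P_avg d (P Q : nat -> finType) (f : fam R (ZP (fun n => (P n * Q n)%type))) :
  (forall n, 0 < #|Q n|)%N -> Cl W (@BP d (fun n => (P n * Q n)%type)) f ->
  Cl W (@BP d P) (fun n xp => avg (fun q => f n (xp.1, (xp.2, q)))).
Proof.
move=> Q0 cf.
pose B' : base R (fun n => ZP P n * Q n)%type :=
  fun n b => forall p q, B d (fun x => b ((x, p), q)).
have c' : Cl W B' (fun n (t : ZP P n * Q n) => f n (t.1.1, (t.1.2, t.2))).
  apply: Cl_pull cf => [n|n b h p q]; last exact: (h (p, q)).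
  apply: bij_mp; exists (fun xpq : Z n * (P n * Q n) => ((xpq.1, xpq.2.1), xpq.2.2)).
    by move=> [[x p] q].
  by move=> [x [p q]].
apply: Cl_eq (Cl_avg (@good_BP d P) Q0 _ c'); first by apply: evT => n [x p].
by move=> n b q h p; exact: h.
Qed.
Lemma S_avg d (P : nat -> finType) (f : fam R (ZP P)) : (forall n, 0 < #|P n|)%N ->
  Cl W (@BP d P) f -> Cl W (Bf d) (fun n x => avg (fun p => f n (x, p))).
Proof. by move=> P0 cf; apply: Cl_avg (@good_Bf d) P0 _ cf => n b s h; exact: h. Qed.

Lemma Z_gt0 n : (0 < #|Zf n|)%N. Proof. exact: zmod_gt0. Qed.

Lemma bdd_pull (T S : nat -> finType) (p : forall n, T n -> S n) (f : fam R S) :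
  bdd W f -> bdd W (fun n t => f n (p n t)).
Proof. by move=> [K hK]; exists K; apply: evS hK => n h t. Qed.

(** Composition of kernels: when [(x, t)] stands for the pair of points [x], [x + t], the
    intermediate point is [x + t] and the end point [x + r]. *)
Lemma K_comp d (f g : fam R (ZP Zf)) : bdd W g -> Cl W (@BK d) f -> Cl W (@BK d) g ->
  Cl W (@BK d) (fun n xr => avg (fun t => f n (xr.1, t) * g n (xr.1 + t, xr.2 - t))).
Proof.
move=> bg cf cg; pose P n : finType := (Z n * Z n)%type.
have c1 := @P_pull d P Zf (fun n _ => 0) (fun n p => p.2) f (fun n => mp_snd _ (Z_gt0 n)) cf.
have m2 n : mp (fun p : P n => p.1 - p.2).
  have := @affine_mp (Z n * Z n)%type (Z n) 0 (fun p => p.1 - p.2).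
  under [X in mp X]eq_fun do rewrite add0r.
  apply=> [[a b] [a' b'] /=|s]; first by rewrite opprD addrACA.
  by exists (s, 0); rewrite /= subr0.
have c2 := @P_pull d P Zf (fun n p => p.2) (fun n p => p.1 - p.2) g m2 cg.
have := P_avg Z_gt0 (P_mul (bdd_pull _ bg) c1 c2).
apply: Cl_eq; apply: evT => n [x r] /=; apply: eq_avg => t.
by rewrite addr0.
Qed.
Lemma K_adj d (f : fam R (ZP Zf)) : Cl W (@BK d) f ->
  Cl W (@BK d) (fun n xt => Num.conj (f n (xt.1 + xt.2, - xt.2))).
Proof.
move=> cf; apply: P_conj; apply: (@P_pull d Zf Zf (fun n t => t) (fun n t => - t)) => // n.
by apply: bij_mp; exists (fun t => - t) => t; rewrite opprK.
Qed.

(* Kernels on [Z n] are written in the coordinates [(x, y - x)]. *)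
Definition hat (g : fam R Zf) : fam R (ZP Zf) := fun n xt => g n xt.1 * Num.conj (g n (xt.1 + xt.2)).
Arguments hat g n xt : clear implicits.
Definition fle1 T (f : fam R T) := forall n, le1 (f n).

Lemma fle1_bdd T (f : fam R T) : fle1 f -> bdd W f.
Proof. by move=> h; apply: (@bdd1 R W _ T f 1) => n t; exact: h. Qed.
Lemma hat_le1 g : fle1 g -> fle1 (hat g).
Proof. by move=> h n [x t]; rewrite /hat /= abM ab_conj mulr_ile1 ?ab_ge0 ?h. Qed.

(* Multiplying psi(x) by the constant conj (E psi b) turns it into an average
   over t of the structured functions psi(x) conj(psi(x+t)) conj(b(x+t)). *)
Lemma corr_struct d (psi b : fam R Zf) : bdd W b ->
  Cl W (@BK d) (hat psi) -> Cl W (Bf d) b ->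
  nnull W (fun n => ab (avg (fun x => psi n x * b n x))) -> Cl W (Bf d) psi.
Proof.
move=> bb ch cb [c c0 hc].
have h1 : Cl W (@BK d) (fun n xt => hat psi n xt * Num.conj (b n (xt.1 + xt.2))).
  apply: P_mul => //; first by apply: bddJ; exact: bdd_pull.
  by apply: P_conj; exact: (@P_pullS d Zf (fun n t => t)  b Z_gt0).
have h2 := Cl_scale (@good_Bf d) (c := fun n => (Num.conj (avg (fun x => psi n x * b n x)))^-1)
  (K := c^-1) _ (S_avg Z_gt0 h1).
apply: (Cl_eq _ (h2 UW _)); last first.
  by apply: evS hc => n h; rewrite abV ab_conj lef_pV2 // posrE; exact: lt_le_trans h.
apply: evS hc => n h x /=.
have -> : avg (fun p => hat psi n (x, p) * Num.conj (b n (x + p)))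
   = psi n x * Num.conj (avg (fun x => psi n x * b n x)).
  rewrite -[in RHS](avg_addl _ x) conj_avg -avgZ; apply: eq_avg => p.
  by rewrite /hat /= rmorphM mulrA.
rewrite mulrCA mulVf ?mulr1 // conjC_eq0 -ab_eq0 gt_eqF //; exact: lt_le_trans h.
Qed.

(** Together with [dual_u]: a non-null [U^d] norm amounts to correlation with a structured function
    of degree [d]. *)
Lemma u_dual d (f : fam R Zf) : fle1 f -> nnull W (fun n => u d (f n)) ->
  exists b : fam R Zf, (forall n, B d (b n)) /\
    nnull W (fun n => ab (avg (fun x => f n x * b n x))).
Proof.
move=> hf [c c0 hc]; have h n := cid2 (dual_exists d (hf n)).
exists (fun n => s2val (h n)); split=> [n|]; first exact: (s2valP (h n)).
by exists c => //; apply: evS hc => n; rewrite /u -(s2valP' (h n)).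
Qed.
Lemma dual_u d (f b : fam R Zf) : fle1 f -> Cl W (Bf d) b -> 
  nnull W (fun n => ab (avg (fun x => f n x * b n x))) -> nnull W (fun n => u d (f n)).
Proof.
move=> hf cb h; have bf := fle1_bdd hf.
have [] := Cl_corr (@good_Bf d) bf cb.
  by apply: nnull_le h; apply: evT => n; under eq_avg do rewrite mulrC.
move=> c c0 hc; exists (c ^+ (2 ^ d)); first by rewrite exprn_gt0.
apply: evS hc => n [b' hb' h']; apply: le_trans (avg_dual hb' (hf n)).
rewrite lerXn2r ?nnegrE ?ab_ge0 ?(ltW c0) //.
by under eq_avg do rewrite mulrC.
Qed.
(** A function with structured derivatives is either structured or null in the [U^d] norm, because
    correlation with one dual function is all that [corr_struct] asks for. *)
Lemma struct_or d (psi : fam R Zf) : fle1 psi -> Cl W (@BK d) (hat psi) ->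
  nnull W (fun n => u d (psi n)) -> Cl W (Bf d) psi.
Proof.
move=> h1 ch hu; have [b [hb hc]] := u_dual h1 hu.
apply: corr_struct ch _ hc; last by apply: Cl_base; exact: evT.
by apply: (@bdd1 R W _ _ b 1) => n; exact: B_le1.
Qed.

(** For each [t] the pairing in [x] is controlled by the [U^(d+1)] norm of [phi x * g (x + t)];
    averaging over [t] raises the order by one through [u_pair_CS]. *)
Lemma kernel_u d n (b : Z n * Z n -> C) (g phi : Z n -> C) :
  (forall t, B d.+1 (fun x => b (x, t))) -> le1 g -> le1 phi ->
  ab (avg (fun xt => b xt * (g (xt.1 + xt.2) * phi xt.1))) ^+ (2 ^ d.+2) <= u d.+2 phi.
Proof.
move=> hb hg hp; rewrite avg_pair avg_exch expnSr exprM.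
apply: le_trans (_ : avg (fun t => u d.+1 (fun x => phi x * g (x + t))) ^+ 2 <= _).
  rewrite ler_pXn2r ?nnegrE ?exprn_ge0 ?ab_ge0 //; last by apply: avg_ge0 => t; exact: u_ge0.
  apply: le_trans (_ : avg (fun t => ab (avg (fun x => b (x, t) * (g (x + t) * phi x)))) ^+ (2 ^ d.+1) <= _).
    rewrite lerXn2r ?nnegrE ?ab_ge0 ?ab_avg //.
    by apply: avg_ge0 => h; rewrite ab_ge0.
  apply: le_trans (avg_exp2 _ _) _ => [h|]; first exact: ab_ge0.
  apply: ler_avg => t.
  have hle : le1 (fun x => phi x * g (x + t)) by move=> x; rewrite abM mulr_ile1 ?ab_ge0.
  apply: le_trans (avg_dual (hb t) hle).
  rewrite le_eqVlt; apply/orP; left; apply/eqP; congr (ab _ ^+ _).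
  by apply: eq_avg => x; rewrite mulrC [g _ * _]mulrC.
apply: le_trans (u_pair_CS _ _ _) _.
by rewrite ler_piMr ?u_ge0 // u_le1.
Qed.
Lemma K_corr_u d (k : fam R (ZP Zf)) (g phi : fam R Zf) : fle1 g -> fle1 phi ->
  Cl W (@BK d.+1) k ->
  nnull W (fun n => ab (avg (fun xt => k n xt * (g n (xt.1 + xt.2) * phi n xt.1)))) ->
  nnull W (fun n => u d.+2 (phi n)).
Proof.
move=> hg hp ck h.
have bg : bdd W (fun n (xt : Z n * Z n) => g n (xt.1 + xt.2) * phi n xt.1).
  by apply: (@bdd1 R W _ _ _ 1) => n xt; rewrite abM mulr_ile1 ?ab_ge0 ?hg ?hp.
have [c c0 hc] := Cl_corr (@good_BP d.+1 Zf) bg ck h.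
exists (c ^+ (2 ^ d.+2)); first by rewrite exprn_gt0.
apply: evS hc => n [b hb h'].
apply: le_trans (kernel_u hb (hg n) (hp n)).
by rewrite lerXn2r ?nnegrE ?ab_ge0 ?(ltW c0).
Qed.

(** The factor at the vertex with only the first coordinate equal to 1 depends on [x + t] alone,
    where [t] is the first edge. What remains is, for fixed [t], a dual function of order [d]. *)
Lemma B_split d n (b : Z n -> C) : B d.+1 b ->
  exists k : Z n * Z n -> C, exists2 phi : Z n -> C, le1 phi & 
    (forall t, B d (fun x => k (x, t))) /\
    forall x, b x = avg (fun t => k (x, t) * phi (x + t)).
Proof.
case=> F [hF [c hc] ->].
pose z := nseq d false.
pose G t := fun s x => F (false :: s) x * upd (fun s => F (true :: s)) z (fun=> 1) s (x + t).
exists (fun xt => Eh d (fun hs => cprod (G xt.2) hs xt.1)), (F (true :: z)); first exact: hF.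
split=> [t|x].
  exists (G t); split=> //; last first.
    by exists c => x; rewrite /G /upd eqxx mulr1; exact: hc.
  move=> s x; rewrite abM mulr_ile1 ?ab_ge0 ?hF //.
  by apply: upd_le1 => [s'|y]; [exact: hF | rewrite ab1].
rewrite EhS; apply: eq_avg => t; rewrite /Eh -avgZr; apply: eq_avg => hs.
rewrite /G cprodM -mulrA; congr (_ * _).
rewrite (cprod_shift (upd (fun s => F (true :: s)) z (fun=> 1))) mulrC.
have := cprod_upd0 (fun s => F (true :: s)) hs (F (true :: z)) (x + t).
rewrite size_tuple -/z => <-; apply: eq_cprod => s y _.
by rewrite /upd; case: eqP => // ->.
Qed.
End Kernels.

(** * Spectral theory of finite kernels *)

Section Spectral.
Variable R : realType.
Local Notation C := R[i].

Definition ip (T : finType) (f g : T -> C) : C := avg (fun x => f x * Num.conj (g x)).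
Definition orthon (T I : finType) (e : I -> T -> C) :=
  forall i j, ip (e i) (e j) = (i == j)%:R.

Lemma conjR (r : R) : Num.conj (r%:C) = r%:C :> C.
Proof. exact: conjc_real. Qed.
Lemma N2_ip (T : finType) (f : T -> C) : (N2 f)%:C = ip f f.
Proof. by rewrite /N2 avgC; apply: eq_avg => t; rewrite mulcJ. Qed.
Lemma ipD (T : finType) (f g h : T -> C) : ip (fun x => f x + g x) h = ip f h + ip g h.
Proof. by rewrite /ip -avgD; apply: eq_avg => x; rewrite mulrDl. Qed.
Lemma ipZ (T : finType) c (f h : T -> C) : ip (fun x => c * f x) h = c * ip f h.
Proof. by rewrite /ip -avgZ; apply: eq_avg => x; rewrite mulrA. Qed.
Lemma ip_sum (T : finType) (J : Type) (r : seq J) (P : pred J) (f : J -> T -> C) h :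
  ip (fun x => \sum_(j <- r | P j) f j x) h = \sum_(j <- r | P j) ip (f j) h.
Proof. by rewrite /ip -avg_sum; apply: eq_avg => x; rewrite mulr_suml. Qed.
Lemma ipC (T : finType) (f g : T -> C) : ip g f = Num.conj (ip f g).
Proof. by rewrite /ip conj_avg; apply: eq_avg => x; rewrite rmorphM /= conjCK mulrC. Qed.
Lemma ip_CS (T : finType) (f g : T -> C) : ab (ip f g) ^+ 2 <= N2 f * N2 g.
Proof.
apply: le_trans (ab_avg_CS _ _) _; rewrite /N2 le_eqVlt; apply/orP; left; apply/eqP.
by congr (_ * _); apply: eq_avg => x; rewrite ab_conj.
Qed.

Section ON.
Variables (T I : finType) (e : I -> T -> C).
Hypothesis He : orthon e.
Lemma ip_ON (c : I -> C) j : ip (fun x => \sum_i c i * e i x) (e j) = c j.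
Proof.
rewrite ip_sum (bigD1 j) //= ipZ He eqxx mulr1 big1 ?addr0 // => i /negbTE ij.
by rewrite ipZ He ij mulr0.
Qed.
Lemma N2_ON (c : I -> C) : N2 (fun x => \sum_i c i * e i x) = \sum_i ab (c i) ^+ 2.
Proof.
apply: complexI; rewrite N2_ip /= ipC ip_sum rmorph_sum [RHS]rmorph_sum.
by apply: eq_bigr => i _; rewrite ipZ ipC ip_ON rmorphM /= conjCK /= mulrC mulcJ.
Qed.
Lemma bessel (f : T -> C) : \sum_i ab (ip f (e i)) ^+ 2 <= N2 f.
Proof.
set g := fun x => \sum_i ip f (e i) * e i x.
have h0 : ip f g = (\sum_i ab (ip f (e i)) ^+ 2)%:C.
  rewrite ipC /g ip_sum !rmorph_sum; apply: eq_bigr => i _.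
  by rewrite ipZ (ipC f (e i)) rmorphM /= conjCK mulrC mulcJ.
have h1 := N2_ON (fun i => ip f (e i)); rewrite -/g in h1.
have : 0 <= N2 (fun x => f x + -1 * g x) by exact: N2_ge0.
rewrite -ler0c N2_ip ipD ipZ.
rewrite (ipC (fun x => f x + _) f) ipD ipZ (ipC (fun x => f x + _) g) ipD ipZ.
rewrite -N2_ip -[ip g g]N2_ip (ipC f g) h0 h1 !mulN1r !(rmorphD, rmorphN) /= ?conjR.
by rewrite subrr subr0 -rmorphB ler0c subr_ge0.
Qed.
End ON.

(** The spectral theorem normalised for averages: the matrix of [M] is divided by [#|T|], and the
    unit eigenvectors are multiplied by the square root of [#|T|], which makes them orthonormal for
    [ip]. *)
Lemma spectral (T : finType) (M : T -> T -> C) : (0 < #|T|)%N ->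
  (forall x y, M y x = Num.conj (M x y)) ->
  exists (e : 'I_#|T| -> T -> C) (lam : 'I_#|T| -> R),
  [/\ orthon e, forall x y, M x y = \sum_i (lam i)%:C * e i x * Num.conj (e i y) &
      forall x y, \sum_i e i x * Num.conj (e i y) = #|T|%:R * (x == y)%:R].
Proof.
move=> T0 hM; set N := #|T|.
have N0 : (N%:R : C) != 0 by rewrite pnatr_eq0 -lt0n.
pose A : 'M[C]_N := \matrix_(i, j) (M (enum_val i) (enum_val j) / N%:R).
have Aherm : map_mx Num.conj A^T = A.
  apply/matrixP => i j; rewrite !mxE rmorphM fmorphV rmorph_nat /=.
  by rewrite -hM.
have An : A \is normalmx by apply/normalmxP; rewrite Aherm.
have /orthomx_spectralP := An.
set S := spectralmx A; set d := spectral_diag A.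
have SU : S \is unitarymx := spectral_unitarymx A.
have S1 := unitarymxP SU.
have S2 : map_mx Num.conj S^T *m S = 1%:M by apply: mulmx1C.
rewrite invmx_unitary // => eA.
pose s : C := (Num.sqrt N%:R)%:C.
have s2 : s * Num.conj s = N%:R.
  by rewrite mulcJ abR ger0_norm ?sqrtr_ge0 // sqr_sqrtr ?ler0n // rmorph_nat.
pose e (k : 'I_N) x := s * Num.conj (S k (enum_rank x)).
have reidx (F : 'I_N -> C) : \sum_(x : T) F (enum_rank x) = \sum_(i < N) F i.
  by rewrite [RHS](reindex (fun x : T => enum_rank x)) //; apply: onW_bij; exact: enum_rank_bij.
have ON : orthon e.
  move=> i j; rewrite /ip /avg -/N.
  have -> : \sum_x e i x * Num.conj (e j x) = N%:R * \sum_(k < N) Num.conj (S i k) * S j k.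
    rewrite mulr_sumr -reidx; apply: eq_bigr => x _.
    by rewrite /e !rmorphM /= conjCK -s2; ring.
  have /matrixP/(_ j i) := S1; rewrite !mxE => h.
  rewrite mulrAC mulfV // mul1r -[RHS]/((i == j)%:R) eq_sym -h.
  by apply: eq_bigr => k _; rewrite !mxE mulrC.
have eM x y : M x y = \sum_i d 0 i * e i x * Num.conj (e i y).
  have /matrixP/(_ (enum_rank x) (enum_rank y)) := eA; rewrite !mxE !enum_rankK => h.
  rewrite -[LHS](divfK N0) h mulr_suml; apply: eq_bigr => k _.
  rewrite mul_mx_diag !mxE /e !rmorphM /= conjCK -s2 /=; ring.
have dr i : d 0 i = (Re (d 0 i))%:C.
  have q : forall x y, M x y = \sum_k (d 0 k * Num.conj (e k y)) * e k x.
    by move=> x y; rewrite eM; apply: eq_bigr => k _; rewrite mulrAC.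
  have h : avg (fun y => ip (M^~ y) (e i) * e i y) = d 0 i.
    have hip y : ip (M^~ y) (e i) = d 0 i * Num.conj (e i y).
      rewrite (_ : M^~ y = fun x => \sum_k (d 0 k * Num.conj (e k y)) * e k x) ?ip_ON //.
      by apply: funext => x; rewrite q.
    under eq_avg => y do rewrite hip -mulrA [_ * e i y]mulrC.
    by rewrite avgZ -/(ip _ _) ON eqxx mulr1.
  have h' : Num.conj (d 0 i) = d 0 i.
    rewrite -[in LHS]h -[RHS]h conj_avg.
    under eq_avg => y do rewrite /ip -avgZr conj_avg.
    under [RHS]eq_avg => y do rewrite /ip -avgZr.
    rewrite avg_exch; apply: eq_avg => x; apply: eq_avg => y.
    by rewrite /e !rmorphM /= !conjCK -hM; ring.
  have := RRe_real (x := d 0 i); move=> -> //; exact/CrealP.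
exists e, (fun i => Re (d 0 i)); split=> // [x y|x y].
  by rewrite eM; apply: eq_bigr => i _; rewrite -dr.
have /matrixP/(_ (enum_rank x) (enum_rank y)) := S2; rewrite !mxE => h.
rewrite (inj_eq enum_rank_inj) in h; rewrite -h mulr_sumr; apply: eq_bigr => k _.
by rewrite !mxE /e !rmorphM /= conjCK -s2; ring.
Qed.

Definition kf (T I : finType) (e : I -> T -> C) (lam : I -> R) (f : R -> R) (x y : T) : C :=
  \sum_i (f (lam i))%:C * e i x * Num.conj (e i y).
Definition kcomp (T : finType) (A B : T -> T -> C) (x y : T) : C :=
  avg (fun z => A x z * B z y).

Lemma kf_comp (T I : finType) (e : I -> T -> C) lam f g : orthon e ->
  kcomp (kf e lam f) (kf e lam g) = kf e lam (fun r => f r * g r).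
Proof.
move=> He; apply: funext => x; apply: funext => y; rewrite /kcomp /kf.
under eq_avg => z do rewrite mulr_suml.
rewrite avg_sum; apply: eq_bigr => i _.
have -> : (fun z => (f (lam i))%:C * e i x * Num.conj (e i z) *
    (\sum_j (g (lam j))%:C * e j z * Num.conj (e j y)))
  = (fun z => (f (lam i))%:C * e i x * ((\sum_j ((g (lam j))%:C * Num.conj (e j y)) * e j z)
      * Num.conj (e i z))).
  apply: funext => z; rewrite -!mulrA; congr (_ * (_ * _)).
  by rewrite mulrC; congr (_ * _); apply: eq_bigr => j _; ring.
rewrite avgZ -[X in _ * X]/(ip _ _) ip_ON // rmorphM /=; ring.
Qed.

(** The functions [e i x * conj (e i y)] are orthonormal on the square; this computes a
    Hilbert-Schmidt norm. *)
Lemma kf_pair (T I : finType) (e : I -> T -> C) (c : I -> C) : orthon e ->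
  N2 (fun xy : T * T => \sum_i c i * e i xy.1 * Num.conj (e i xy.2)) = \sum_i ab (c i) ^+ 2.
Proof.
move=> He; rewrite -(@N2_ON _ _ (fun i (xy : T * T) => e i xy.1 * Num.conj (e i xy.2))).
  by apply: eq_N2 => xy; apply: eq_bigr => i _; rewrite mulrA.
move=> i j; rewrite /ip avg_pair /=.
transitivity (avg (fun x => (e i x * Num.conj (e j x)) * Num.conj (ip (e i) (e j)))).
  apply: eq_avg => x; rewrite /ip conj_avg -avgZ; apply: eq_avg => y.
  by rewrite !rmorphM /= conjCK; ring.
rewrite avgZr -/(ip _ _) He; case: (i == j); by rewrite ?conjC1 ?conjC0 ?mulr1 ?mulr0.
Qed.

(* [kk*] for a kernel [k] bounded by 1. *)
Lemma spectral_gram (T : finType) (k : T -> T -> C) : (0 < #|T|)%N ->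
  (forall x y, ab (k x y) <= 1) ->
  exists (e : 'I_#|T| -> T -> C) (lam : 'I_#|T| -> R),
  [/\ orthon e,
      kcomp k (fun z y => Num.conj (k y z)) = kf e lam id,
      forall i, 0 <= lam i <= 1 /\ (forall x, lam i * ab (e i x) <= 1),
      \sum_i lam i ^+ 2 <= 1 &
      forall (phi : T -> C) (a : R) (P : pred 'I_#|T|), (forall t, ab (phi t) <= 1) -> 0 <= a ->
        (forall i, ~~ P i -> lam i <= a) ->
        let f x := avg (fun y => k x y * phi y) in
        N2 (fun x => f x - \sum_(i | P i) ip f (e i) * e i x) <= a].
Proof.
move=> T0 hk; set M := kcomp _ _.
have hM x y : M y x = Num.conj (M x y).
  by rewrite /M /kcomp conj_avg; apply: eq_avg => z; rewrite rmorphM /= conjCK mulrC.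
have [e [lam [ON eM comp]]] := spectral T0 hM; exists e, lam.
have M1 x y : ab (M x y) <= 1.
  apply: le_trans (ab_avg _) _; apply: avg_le => // z.
  by rewrite abM ab_conj mulr_ile1 ?ab_ge0.
(* Up to conjugation, the adjoint of [k] maps the eigenvectors to orthogonal functions of squared
   norms [lam i]. *)
have key i j : avg (fun z => (avg (fun x => k x z * Num.conj (e i x)))
    * Num.conj (avg (fun x => k x z * Num.conj (e j x)))) = (lam i)%:C * (i == j)%:R.
  transitivity (avg (fun y => ip (M^~ y) (e i) * e j y)).
    under eq_avg => z do rewrite conj_avg -avgZ.
    rewrite avg_exch; apply: eq_avg => y; rewrite /ip /M /kcomp -avgZr.
    under [RHS]eq_avg => x do rewrite -avgZr -avgZr.
    rewrite [RHS]avg_exch; apply: eq_avg => z; rewrite -avgZr; apply: eq_avg => x.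
    by rewrite !rmorphM /= conjCK; ring.
  transitivity (avg (fun y => (lam i)%:C * (e j y * Num.conj (e i y)))).
    apply: eq_avg => y; rewrite (_ : M^~ y = fun x => \sum_l ((lam l)%:C * Num.conj (e l y)) * e l x).
      by rewrite ip_ON // -mulrA [Num.conj _ * _]mulrC.
    by apply: funext => x; rewrite eM; apply: eq_bigr => l _; rewrite mulrAC.
  by rewrite avgZ -/(ip _ _) ON eq_sym.
have lam0 i : 0 <= lam i.
  have := key i i; rewrite eqxx mulr1; under eq_avg => z do rewrite mulcJ.
  rewrite -avgC => /complexI <-; apply: avg_ge0 => z; exact: sqr_ge0.
have lam2 : \sum_i lam i ^+ 2 <= 1.
  have := kf_pair (fun i => (lam i)%:C) ON.
  under [RHS]eq_bigr => i _ do rewrite abR ger0_norm //.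
  move=> <-; rewrite -(expr1n _ 2); apply: N2_le => -[x y] /=; rewrite -eM; exact: M1.
have lam1 i : lam i <= 1.
  rewrite -(ler_pXn2r (n := 2)) ?nnegrE // expr1n; apply: le_trans lam2.
  rewrite (bigD1 i) //= lerDl; apply: sumr_ge0 => j _; exact: sqr_ge0.
split=> //; first by apply: funext => x; apply: funext => y; exact: eM.
  move=> i; split; first by rewrite lam0 lam1.
  (* [lam i * e i] is the image of [e i] under [M], whose entries are bounded by 1. Hence
     eigenfunctions with [lam i] bounded below are uniformly bounded. *)
  move=> x; have -> : lam i * ab (e i x) = ab (ip (M x) (fun y => Num.conj (e i y))).
    rewrite -[lam i]ger0_norm // -abR -abM; congr ab.
    rewrite /ip; under eq_avg => y do rewrite conjCK eM mulr_suml.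
    rewrite avg_sum (bigD1 i) //= big1 ?addr0 => [|l li].
      under eq_avg => y do rewrite -mulrA [Num.conj _ * _]mulrC.
      by rewrite avgZ -/(ip _ _) ON eqxx mulr1.
    under eq_avg => y do rewrite -mulrA [Num.conj _ * _]mulrC.
    by rewrite avgZ -/(ip _ _) ON eq_sym (negbTE li) mulr0.
  rewrite -(ler_pXn2r (n := 2)) ?nnegrE ?ab_ge0 // expr1n; apply: le_trans (ip_CS _ _) _.
  apply: mulr_ile1; rewrite ?N2_ge0 //.
    by rewrite -(expr1n _ 2); apply: N2_le => y; exact: M1.
  rewrite /N2; under eq_avg => y do rewrite ab_conj.
  by rewrite -[avg _]/(Re ((N2 (e i))%:C)) N2_ip ON eqxx.
move=> phi a P hphi a0 hP; pose f x := avg (fun y => k x y * phi y).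
rewrite -[X in is_true X]/(N2 (fun x => f x - \sum_(i | P i) ip f (e i) * e i x) <= a).
have parseval x : f x = \sum_i ip f (e i) * e i x.
  transitivity (avg (fun y => f y * (\sum_i e i x * Num.conj (e i y)))).
    under eq_avg => y do rewrite comp.
    rewrite /avg (bigD1 x) //= eqxx mulr1 big1 ?addr0.
      by rewrite mulfK // pnatr_eq0 -lt0n.
    by move=> y yx; rewrite eq_sym (negbTE yx) !mulr0.
  under eq_avg => y do rewrite mulr_sumr.
  rewrite avg_sum; apply: eq_bigr => i _; rewrite /ip -avgZr.
  by apply: eq_avg => y; ring.
have -> : N2 (fun x => f x - \sum_(i | P i) ip f (e i) * e i x)
   = \sum_(i | ~~ P i) ab (ip f (e i)) ^+ 2.
  transitivity (N2 (fun x => \sum_i (if P i then 0 else ip f (e i)) * e i x)).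
    apply: eq_N2 => x; rewrite {1}parseval (bigID P) /= addrAC subrr add0r.
    rewrite [RHS](bigID P) /= [X in _ = X + _]big1 ?add0r.
      by apply: eq_bigr => i /negbTE ->.
    by move=> i ->; rewrite mul0r.
  rewrite N2_ON // (bigID P) /= big1 ?add0r.
    by apply: eq_bigr => i /negbTE ->.
  by move=> i ->; rewrite ab0 expr0n.
(* The normalised images of the eigenvectors under the adjoint. Bessel's inequality for [phi] in
   this system bounds the discarded part of [f] by the largest discarded eigenvalue. *)
pose q (i : 'I_#|T|) z : C := if lam i == 0 then 0 else
   ((Num.sqrt (lam i))^-1)%:C * Num.conj (avg (fun x => k x z * Num.conj (e i x))).
have ipq i : lam i != 0 -> ab (ip f (e i)) ^+ 2 = lam i * ab (ip phi (q i)) ^+ 2.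
  move=> l0; have e1 : ip f (e i) = (Num.sqrt (lam i))%:C * ip phi (q i).
    rewrite /ip /f; under eq_avg => x do rewrite -avgZr.
    rewrite avg_exch -avgZ; apply: eq_avg => z; rewrite /q (negbTE l0) rmorphM /= conjCK conjR.
    rewrite mulrCA [_ * (_ * avg _)]mulrA -rmorphM /= mulfV ?sqrtr_eq0 -?ltNge ?lt_def ?l0 ?lam0 //.
    rewrite mul1r -avgZ; apply: eq_avg => x; ring.
  by rewrite e1 abM exprMn abR ger0_norm ?sqrtr_ge0 // sqr_sqrtr.
have l0 i : lam i = 0 -> ip f (e i) = 0.
  move=> li; have := key i i; rewrite li mul0r; under eq_avg => z do rewrite mulcJ.
  rewrite -avgC => /complexI h0.
  have : ab (ip f (e i)) ^+ 2 <= 0.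
    have -> : ip f (e i) = avg (fun z => phi z * avg (fun x => k x z * Num.conj (e i x))).
      rewrite /ip /f; under eq_avg => x do rewrite -avgZr.
      rewrite avg_exch; apply: eq_avg => z; rewrite -avgZ; apply: eq_avg => x; ring.
    by apply: le_trans (ab_avg_CS _ _) _; rewrite h0 mulr0.
  move=> h; apply/eqP; rewrite -ab_eq0 -sqrf_eq0 eq_le h sqr_ge0 //.
pose I' := {i : 'I_#|T| | ~~ P i && (lam i != 0)}.
have ONq : orthon (fun i : I' => q (val i)).
  move=> i j; have /andP[_ /= i0] := valP i; have /andP[_ /= j0] := valP j.
  rewrite /q (negbTE i0) (negbTE j0) /ip.
  have pos l : lam l != 0 -> Num.sqrt (lam l) != 0.
    by move=> h; rewrite sqrtr_eq0 -ltNge lt_def h lam0.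
  transitivity (((Num.sqrt (lam (val i)))^-1)%:C * ((Num.sqrt (lam (val j)))^-1)%:C *
     Num.conj ((lam (val i))%:C * (val i == val j)%:R)).
    rewrite -key conj_avg -avgZ; apply: eq_avg => z.
    by rewrite !rmorphM /= !conjCK conjR; ring.
  rewrite (inj_eq val_inj); have [->|_] := eqVneq i j; last by rewrite mulr0 rmorph0 mulr0.
  rewrite mulr1 conjR -!rmorphM /= -invfM -expr2 sqr_sqrtr // mulVf ?rmorph1 //.
have := bessel ONq phi.
have N1 : N2 phi <= 1 by rewrite -(expr1n _ 2); apply: N2_le.
move=> /le_trans/(_ N1) hb.
apply: le_trans (_ : a * \sum_(i : I') ab (ip phi (q (val i))) ^+ 2 <= _); last first.
  by rewrite ler_piMr.
rewrite mulr_sumr (bigID (fun i => lam i == 0)) /= big1 ?add0r => [|i /andP[_ /eqP /l0 ->]]; last first.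
  by rewrite ab0 expr0n.
rewrite (eq_bigr (fun i => lam i * ab (ip phi (q i)) ^+ 2)) => [|i /andP[_ /ipq //]].
apply: le_trans (_ : \sum_(i < #|T| | ~~ P i && (lam i != 0)) a * ab (ip phi (q i)) ^+ 2 <= _).
  apply: ler_sum => i /andP[Pi _]; rewrite ler_wpM2r ?sqr_ge0 //; exact: hP.
rewrite le_eqVlt; apply/orP; left; apply/eqP.
rewrite (reindex_omap (val : I' -> 'I_#|T|) insub) /=; last first.
  by move=> i Pi; rewrite insubT.
by apply: eq_bigl => i; rewrite (valP i) valK eqxx.
Qed.
End Spectral.

(** * Limits along the ultrafilter *)

Section Ultralimit.
Variable R : realType.
Context (W : set_system nat) {UW : UltraFilter W}.
Local Notation ev := (ev W).

Lemma ultralimR (a : nat -> R) K : ev (fun n => `|a n| <= K) ->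
  exists l, null W (fun n => `|a n - l|).
Proof.
move=> hK; pose S : set R := fun s : R => ev (fun n => s <= a n).
have S0 : nonempty S by exists (- K); apply: evS hK => n; rewrite ler_norml => /andP[].
have Sub : has_ubound S.
  exists K => s hs; apply: (@ev_const W _); apply: ev2 hs hK => n h.
  by rewrite ler_norml => /andP[_]; exact: le_trans.
exists (sup S) => e e0.
have h1 : ev (fun n => sup S - e < a n).
  have [s Ss hs] := sup_adherent e0 (conj S0 Sub).
  by apply: evS Ss => n; exact: lt_le_trans.
have h2 : ev (fun n => a n < sup S + e).
  have : ~ ev (fun n => sup S + e <= a n).
    move=> h; have := ub_le_sup Sub h.
    by rewrite gerDl leNgt e0.
  by move=> /evNE; apply: evS => n /negP; rewrite -ltNge.
apply: ev2 h1 h2 => n; rewrite ltr_norml; lra.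
Qed.

Lemma ab_le_ReIm (z : R[i]) : ab z <= `|Re z| + `|complex.Im z|.
Proof.
case: z => a b; rewrite /ab /= -(ler_pXn2r (n := 2)) ?nnegrE ?sqrtr_ge0 ?addr_ge0 //.
rewrite sqr_sqrtr ?addr_ge0 ?sqr_ge0 // -(real_normK (num_real a)) -(real_normK (num_real b)).
have := normr_ge0 a; have := normr_ge0 b; nra.
Qed.
Lemma Im_le_ab (z : R[i]) : `|complex.Im z| <= ab z.
Proof.
case: z => a b; rewrite /ab /= -sqrtr_sqr ler_wsqrtr //.
by rewrite lerDr sqr_ge0.
Qed.

Lemma ultralim (a : nat -> R[i]) K : ev (fun n => ab (a n) <= K) ->
  exists l, null W (fun n => ab (a n - l)).
Proof.
move=> hK.
have [r hr] : exists r, null W (fun n => `|Re (a n) - r|).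
  by apply: (ultralimR (K := K)); apply: evS hK => n; exact: le_trans (Re_le_ab _).
have [s hs] : exists s, null W (fun n => `|complex.Im (a n) - s|).
  by apply: (ultralimR (K := K)); apply: evS hK => n; exact: le_trans (Im_le_ab _).
exists (r +i* s); apply: null_le (nullD hr hs); apply: evT => n.
apply: le_trans (ab_le_ReIm _) _.
by case: (a n) => x y /=.
Qed.
End Ultralimit.

Lemma cprod_updB (R : realType) (Z : finZmodType) (F : seq bool -> Z -> R[i]) s0 f g hs x :
  cprod (upd F s0 f) hs x - cprod (upd F s0 g) hs x =
  if size s0 == size hs then cprod (upd F s0 (fun y => f y - g y)) hs x else 0.
Proof.
elim: hs s0 F x => [|h hs IH] [|b s0] F x /=.
- by rewrite /upd eqxx.
- by rewrite /upd /= subrr.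
- have E (f' : Z -> R[i]) (c : bool) y : cprod (fun s => upd F [::] f' (c :: s)) hs y =
    cprod (fun s => F (c :: s)) hs y by apply: eq_cprod.
  by rewrite !E subrr.
have E (f' : Z -> R[i]) (c : bool) y :
   cprod (fun s => upd F (b :: s0) f' (c :: s)) hs y =
   if c == b then cprod (upd (fun s => F (c :: s)) s0 f') hs y else cprod (fun s => F (c :: s)) hs y.
  case: eqP => [->|cb].
    by apply: eq_cprod => s z _; rewrite /upd eqseq_cons eqxx.
  by apply: eq_cprod => s z _; rewrite /upd eqseq_cons (introF eqP cb).
rewrite !E eqSS; case: b E => E /=.
  by rewrite -mulrBr IH; case: eqP; rewrite ?mulr0.
by rewrite -mulrBl IH; case: eqP; rewrite ?mul0r.
Qed.

(** * Rank one *)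

Section RankOne.
Variable R : realType.
Context (W : set_system nat) {UW : UltraFilter W}.
Variable Z : nat -> finZmodType.
Local Notation C := R[i].
Local Notation ev := (ev W).
Local Notation Zf := (Zf Z).
Variable d : nat.
Local Notation BK := (@BK R Z d.+1).

(* Kernels in [x, y] coordinates. *)
Definition ker := forall n, Z n -> Z n -> C.
Definition KA (A : ker) := Cl W BK (fun n xt => A n xt.1 (xt.1 + xt.2)).
Definition kbdd (A : ker) := exists K : R, ev (fun n => forall x y, ab (A n x y) <= K).

Lemma good_BK : good_base BK. Proof. exact: good_BP. Qed.
Lemma mp_hat n : mp (fun xt : Z n * Z n => (xt.1, xt.1 + xt.2)).
Proof.
apply: bij_mp; exists (fun xy : Z n * Z n => (xy.1, xy.2 - xy.1)).
  by move=> [x t] /=; rewrite addrAC subrr add0r.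
by move=> [x y] /=; rewrite addrCA subrr addr0.
Qed.
Lemma N2_hat n (A : Z n -> Z n -> C) :
  N2 (fun xt : Z n * Z n => A xt.1 (xt.1 + xt.2)) = N2 (fun xy : Z n * Z n => A xy.1 xy.2).
Proof. exact: (N2_mp (fun xy : Z n * Z n => A xy.1 xy.2) (mp_hat n)). Qed.

Lemma kbdd_hat A : kbdd A -> bdd W (fun n (xt : ZP Z Zf n) => A n xt.1 (xt.1 + xt.2)).
Proof. by move=> [K hK]; exists K; apply: evS hK => n h xt. Qed.
Lemma KA_comp A B : kbdd B -> KA A -> KA B -> KA (fun n => kcomp (A n) (B n)).
Proof.
move=> bB cA cB; apply: Cl_eq (K_comp (kbdd_hat bB) cA cB).
apply: evT => n [x r] /=; rewrite /kcomp -[RHS](avg_addl _ x); apply: eq_avg => t.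
by rewrite addrACA subrr addr0.
Qed.
Lemma kbdd_comp A B : kbdd A -> kbdd B -> kbdd (fun n => kcomp (A n) (B n)).
Proof.
move=> [K hK] [L hL]; exists (K * L); apply: ev2 hK hL => n h1 h2 x y.
have KL : 0 <= K * L.
  by rewrite mulr_ge0 // (le_trans (ab_ge0 _) (h1 0 0), le_trans (ab_ge0 _) (h2 0 0)).
apply: le_trans (ab_avg _) _; apply: avg_le => // z.
by rewrite abM ler_pM ?ab_ge0.
Qed.
Lemma KA_lin A B (a b : C) : KA A -> KA B -> KA (fun n x y => a * A n x y + b * B n x y).
Proof.
by move=> cA cB; apply: Cl_add; apply: (Cl_scale (K := ab _) good_BK _ _) => //; apply: evT.
Qed.
Lemma KA_adj A : KA A -> KA (fun n x y => Num.conj (A n y x)).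
Proof.
move=> cA; apply: Cl_eq (K_adj cA); apply: evT => n [x t] /=.
by rewrite addrK.
Qed.
Lemma KA_null A B : null W (fun n => N2 (fun xy : Z n * Z n => A n xy.1 xy.2 - B n xy.1 xy.2)) ->
  KA B -> KA A.
Proof.
move=> h cB; apply: Cl_lim => e e0; exists (fun n xt => B n xt.1 (xt.1 + xt.2)); split=> //.
apply: evS (h e e0) => n.
by rewrite -(N2_hat (fun x y => A n x y - B n x y)).
Qed.
Section Finite.
Variables (J : finType) (g : J -> fam R Zf) (K : R).
Arguments g : clear implicits.
Hypothesis ONg : ev (fun n => orthon (fun j => g j n)).
Hypothesis K1 : 1 <= K.
Hypothesis gK : forall j n x, ab (g j n x) <= K.

(** Kernels on the span of the [g j]. The matrices [t] for which [kt t] is structured form an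
    algebra closed under adjoints ([KV_mul], [KV_lin], [KV_adj]); its unit [delta] is the projection
    onto the span. *)
Definition kt (t : J -> J -> C) : ker :=
  fun n x y => \sum_i \sum_j t i j * (g i n x * Num.conj (g j n y)).
Arguments kt t n x y : clear implicits.
Definition KV t := KA (kt t).
Definition delta : J -> J -> C := fun i j => (i == j)%:R.
Hypothesis PK : KV delta.

Lemma kt_bdd t : kbdd (kt t).
Proof.
exists (\sum_i \sum_j ab (t i j) * (K * K)); apply: evT => n x y.
apply: le_trans (ab_sum _ _ _) _; apply: ler_sum => i _.
apply: le_trans (ab_sum _ _ _) _; apply: ler_sum => j _.
by rewrite !abM ab_conj ler_wpM2l ?ab_ge0 // ler_pM ?ab_ge0.
Qed.
Lemma kt_comp (s t : J -> J -> C) n : orthon (fun j => g j n) ->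
  kcomp (kt s n) (kt t n) = kt (fun i j => \sum_l s i l * t l j) n.
Proof.
move=> ON; apply: funext => x; apply: funext => y; rewrite /kcomp /kt.
transitivity (\sum_i \sum_l \sum_j (s i l * t l j) * (g i n x * Num.conj (g j n y))); last first.
  apply: eq_bigr => i _; rewrite exchange_big /=; apply: eq_bigr => j _.
  by rewrite mulr_suml.
under eq_avg => z do rewrite mulr_suml.
rewrite avg_sum; apply: eq_bigr => i _.
under eq_avg => z do rewrite mulr_suml.
rewrite avg_sum; apply: eq_bigr => l _.
transitivity (\sum_l' \sum_j s i l * t l' j * (g i n x * Num.conj (g j n y)) * ip (g l' n) (g l n)).
  under eq_avg => z do rewrite mulr_sumr.
  rewrite avg_sum; apply: eq_bigr => l' _.
  under eq_avg => z do rewrite mulr_sumr.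
  rewrite avg_sum; apply: eq_bigr => j _; rewrite /ip -avgZ; apply: eq_avg => z; ring.
rewrite (bigD1 l) //= [X in _ + X]big1 ?addr0 => [|l' h].
  by apply: eq_bigr => j _; rewrite ON eqxx mulr1.
by apply: big1 => j _; rewrite ON (negbTE h) mulr0.
Qed.
Lemma KV_mul s t : KV s -> KV t -> KV (fun i j => \sum_l s i l * t l j).
Proof.
move=> cs ct; apply: Cl_eq (KA_comp (kt_bdd t) cs ct).
by apply: evS ONg => n ON [x y] /=; rewrite kt_comp.
Qed.
Lemma KV_lin s t a b : KV s -> KV t -> KV (fun i j => a * s i j + b * t i j).
Proof.
move=> cs ct; apply: Cl_eq (KA_lin a b cs ct); apply: evT => n [x y] /=.
rewrite !mulr_sumr -big_split; apply: eq_bigr => i _ /=.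
by rewrite !mulr_sumr -big_split; apply: eq_bigr => j _ /=; ring.
Qed.
Lemma KV_adj t : KV t -> KV (fun i j => Num.conj (t j i)).
Proof.
move=> ct; apply: Cl_eq (KA_adj ct); apply: evT => n [x y] /=.
rewrite rmorph_sum; under eq_bigr => i _ do rewrite rmorph_sum.
rewrite exchange_big /=; apply: eq_bigr => i _; apply: eq_bigr => j _.
by rewrite !rmorphM /= conjCK [Num.conj _ * g _ _ _]mulrC.
Qed.
Lemma null_sq (a : nat -> R) : ev (fun n => 0 <= a n) -> null W a -> null W (fun n => a n ^+ 2).
Proof.
move=> a0 h e e0; have e1 : 0 < Num.min e 1 by rewrite lt_min e0 ltr01.
apply: ev2 a0 (h _ e1) => n an; rewrite lt_min => /andP[ae a1].
by apply: le_lt_trans ae; rewrite expr2 ler_piMr // ltW.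
Qed.

Definition coef (b : ker) i j n : C :=
  avg (fun z => avg (fun w => b n z w * (Num.conj (g i n z) * g j n w))).
Arguments coef b i j n : clear implicits.

(** Compressing a structured kernel [b] to the span gives the kernel with matrix [coef b]. The limit
    of this matrix along the ultrafilter again belongs to a structured kernel, hence is scalar. *)
Lemma coef_scal (b : ker) : KA b -> kbdd b ->
  (forall t, KV t -> forall i j, i != j -> t i j = 0 /\ t i i = t j j) ->
  forall i j, i != j -> null W (fun n => ab (coef b i j n)) /\
    null W (fun n => ab (coef b i i n - coef b j j n)).
Proof.
move=> cb [K' hb] scal.
have ca i j : exists l, null W (fun n => ab (coef b i j n - l)).
  apply: (ultralim (K := `|K'| * (K * K))); apply: evS hb => n hb.
  have K'0 : 0 <= `|K'| * (K * K) by rewrite !mulr_ge0 // (le_trans ler01).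
  apply: le_trans (ab_avg _) _; apply: avg_le => // z.
  apply: le_trans (ab_avg _) _; apply: avg_le => // w.
  rewrite !abM ab_conj ler_pM ?ab_ge0 ?mulr_ge0 ?ab_ge0 //.
    by apply: le_trans (hb _ _) _; exact: ler_norm.
  by rewrite ler_pM ?ab_ge0.
have /choice[t' ht'] : forall ij, exists l, null W (fun n => ab (coef b ij.1 ij.2 n - l)).
  by move=> [i j]; exact: ca.
pose t i j := t' (i, j).
have ht i j : null W (fun n => ab (coef b i j n - t i j)) := ht' (i, j).
have KVt : KV t.
  have cP := KA_comp (kbdd_comp (ex_intro _ K' hb) (kt_bdd delta)) PK
    (KA_comp (kt_bdd delta) cb PK).
  apply: KA_null cP.
  have hs : null W (fun n => (\sum_i \sum_j ab (coef b i j n - t i j) * (K * K)) ^+ 2).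
    apply: null_sq.
      by apply: evT => n; apply: sumr_ge0 => i _; apply: sumr_ge0 => j _; rewrite !mulr_ge0 ?ab_ge0 // (le_trans ler01).
    apply: null_sum => i; apply: null_sum => j.
    apply: null_le (nullZ (K * K) _ (ht i j)); last by apply: evT => n; exact: ab_ge0.
    by apply: evT => n; rewrite mulrC.
  apply: null_le hs; apply: evT => n; apply: N2_le => -[x y] /=.
  have -> : kcomp (kt delta n) (kcomp (b n) (kt delta n)) x y
     = \sum_i \sum_j coef b i j n * (g i n x * Num.conj (g j n y)).
    have ktd x' y' : kt delta n x' y' = \sum_i g i n x' * Num.conj (g i n y').
      apply: eq_bigr => i _; rewrite (bigD1 i) //= /delta eqxx mul1r big1 ?addr0 //.
      by move=> j /negbTE; rewrite eq_sym => ->; rewrite mul0r.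
    rewrite /kcomp; under eq_avg => z do rewrite ktd mulr_suml.
    rewrite avg_sum; apply: eq_bigr => i _.
    transitivity (\sum_j avg (fun z => avg (fun w => g i n x * Num.conj (g i n z) *
        (b n z w * (g j n w * Num.conj (g j n y)))))).
      rewrite -avg_sum; apply: eq_avg => z; rewrite -avg_sum -avgZ; apply: eq_avg => w.
      by rewrite ktd !mulr_sumr.
    apply: eq_bigr => j _; rewrite /coef -avgZr; apply: eq_avg => z.
    by rewrite -avgZr; apply: eq_avg => w; ring.
  rewrite -sumrB; apply: le_trans (ab_sum _ _ _) _; apply: ler_sum => i _.
  rewrite -sumrB; apply: le_trans (ab_sum _ _ _) _; apply: ler_sum => j _.
  by rewrite -mulrBl !abM ab_conj ab_sym ler_wpM2l ?ab_ge0 // ler_pM ?ab_ge0.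
move=> i j ij; have [h1 h2] := scal _ KVt i j ij; split.
  by apply: null_le (ht i j); apply: evT => n; rewrite h1 subr0.
apply: null_le (nullD (ht i i) (ht j j)); apply: evT => n.
by rewrite h2 [ab (coef b j j n - _)]ab_sym; exact: ab_tri.
Qed.

(** The dual functions of the slices [x -> phi x (x + t)], one for each [t], form a structured
    kernel whose pairing with [phi] is the average on the last line. *)
Lemma kernel_null (phi : ker) : (forall n x y, ab (phi n x y) <= 1) ->
  (forall b : ker, (forall n t, B d.+1 (fun x => b n x (x + t))) ->
     null W (fun n => ab (avg (fun x => avg (fun y => phi n x y * b n x y))))) ->
  null W (fun n => avg (fun t => u d.+1 (fun x => phi n x (x + t)))).
Proof.
move=> p1 h.
have D n t := cid2 (dual_exists d.+1 (fun x => p1 n x (x + t))).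
pose b : ker := fun n x y => s2val (D n (y - x)) x.
have hb n t : B d.+1 (fun x => b n x (x + t)).
  rewrite (_ : (fun x => _) = s2val (D n t)); first exact: (s2valP (D n t)).
  by apply: funext => x; rewrite /b addrAC subrr add0r.
apply: null_le (h b hb); apply: evT => n.
have -> : avg (fun x => avg (fun y => phi n x y * b n x y)) =
    (avg (fun t => u d.+1 (fun x => phi n x (x + t))))%:C.
  rewrite avgC; under [RHS]eq_avg => t do rewrite -U_u (s2valP' (D n t)).
  rewrite [RHS]avg_exch; apply: eq_avg => x; rewrite -[LHS](avg_addl _ x).
  by apply: eq_avg => t; rewrite /b addrAC subrr add0r.
rewrite abR; exact: ler_norm.
Qed.

(** If [i1] and [i2] differed, the mixed kernel of [g i1] and [g i2] would have null norms, and so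
    would the difference of the two diagonal kernels. In the Gowers product of [g i1] with itself,
    put [g i2] at both ends of one edge. This changes the value by a null amount, since only the
    diagonal kernel along that edge changes; and it makes the product null, since a neighbouring
    edge now carries the mixed kernel. Hence the [U^(d+2)] norm of [g i1] is null, although the
    structured projection correlates with it. *)
Lemma rank_one : (forall t, KV t -> forall i j, i != j -> t i j = 0 /\ t i i = t j j) ->
  forall i j : J, i = j.
Proof.
move=> scal i1 i2; apply/eqP; apply: contrapT => /negP i12.
have K0 : 0 < K by exact: lt_le_trans K1.
(* This factor bounds the functions by [1/2], so that the difference [pd] of two products is bounded
   by 1. *)
pose c : C := ((2 * K)^-1)%:C.
have c2 : ab c = (2 * K)^-1 by rewrite abR ger0_norm // invr_ge0 mulr_ge0 // ltW.
pose ga (i : J) n x : C := c * Num.conj (g i n x).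
have gaK i n x : ab (ga i n x) <= 2^-1.
  rewrite abM ab_conj c2 invfM -mulrA ler_piMr ?invr_ge0 // mulrC ler_pdivrMr // mul1r.
  exact: gK.
pose ph i j : ker := fun n x y => ga i n x * Num.conj (ga j n y).
have ph1 i j n x y : ab (ph i j n x y) <= 4^-1.
  rewrite abM ab_conj (_ : 4^-1 = 2^-1 * 2^-1) ?ler_pM ?ab_ge0 //; by field.
have phE i j (b : ker) n : avg (fun x => avg (fun y => ph i j n x y * b n x y)) = c * c * coef b i j n.
  rewrite -avgZ; apply: eq_avg => x; rewrite -avgZ; apply: eq_avg => y.
  by rewrite /ph /ga rmorphM /= conjCK conjR; ring.
have bK (b : ker) : (forall n t, B d.+1 (fun x => b n x (x + t))) -> KA b /\ kbdd b.
  move=> hb; split; first by apply: Cl_base; apply: evT => n t; exact: hb.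
  exists 1; apply: evT => n x y; have := B_le1 (hb n (y - x)) x.
  by rewrite addrCA subrr addr0.
have null12 : null W (fun n => avg (fun t => u d.+1 (fun x => ph i1 i2 n x (x + t)))).
  apply: kernel_null => [n x y|b hb]; first by apply: le_trans (ph1 _ _ _ _ _) _; lra.
  have [cb bb] := bK b hb; have [h _] := coef_scal cb bb scal i12.
  apply: null_le (nullZ (ab (c * c)) _ h); last by apply: evT => n; exact: ab_ge0.
  by apply: evT => n; rewrite phE abM.
pose pd : ker := fun n x y => ph i2 i2 n x y - ph i1 i1 n x y.
have pd1 n x y : ab (pd n x y) <= 1.
  by apply: le_trans (abB _ _) _; have := ph1 i1 i1 n x y; have := ph1 i2 i2 n x y; lra.
have nulld : null W (fun n => avg (fun t => u d.+1 (fun x => pd n x (x + t)))).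
  apply: kernel_null => // b hb.
  have [cb bb] := bK b hb; rewrite eq_sym in i12; have [_ h] := coef_scal cb bb scal i12.
  apply: null_le (nullZ (ab (c * c)) _ h); last by apply: evT => n; exact: ab_ge0.
  apply: evT => n; rewrite -abM mulrBr -!phE -avgB le_eqVlt; apply/orP; left; apply/eqP.
  congr ab; apply: eq_avg => x; rewrite -avgB; apply: eq_avg => y.
  by rewrite /pd mulrBl.
pose z := nseq d false.
(* [i2] sits on the edge in the first direction with second coordinate 1 and all others 0. *)
pose I s := if (s == false :: true :: z) || (s == true :: true :: z) then i2 else i1.
pose F (I : seq bool -> J) n := fun s x => cj s (ga (I s) n x).
have F1 I' n : le1F (F I' n).
  by move=> s x; rewrite ab_cj; apply: le_trans (gaK _ _ _) _; lra.
have mixed : null W (fun n => ab (GP d.+2 (F I n))).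
  apply: (@null_pow _ _ _ _ (2 ^ d.+1)); first by apply: evT => n; exact: ab_ge0.
  apply: null_le null12; apply: evT => n.
  (* Exchanging the first two directions brings to the front an edge from an [i1] vertex to an [i2]
     vertex. *)
  pose sw (s : seq bool) := if s is a :: b :: s' then b :: a :: s' else s.
  have -> : GP d.+2 (F I n) = GP d.+2 (fun s => F I n (sw s)).
    rewrite !GP_exch !EhS; under eq_avg => h do rewrite EhS.
    rewrite avg_exch; apply: eq_avg => h; rewrite EhS; apply: eq_avg => h'.
    apply: eq_Eh => hs _; apply: eq_avg => x /=.
    by rewrite mulrACA (addrAC x h' h).
  rewrite GPh; apply: le_trans (_ : avg (fun h => ab (GP d.+1
    (fun s x => F I n (sw (false :: s)) x * F I n (sw (true :: s)) (x + h)))) ^+ (2 ^ d.+1) <= _).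
    rewrite lerXn2r ?nnegrE ?ab_ge0 ?ab_avg //.
    by apply: avg_ge0 => h; rewrite ab_ge0.
  apply: le_trans (avg_exp2 _ _) _ => [h|]; first exact: ab_ge0.
  apply: ler_avg => h.
  have := @GCS _ _ (false :: z) (fun s x => F I n (sw (false :: s)) x * F I n (sw (true :: s)) (x + h)).
  rewrite /= size_nseq => /(_ _)/le_trans; apply.
    by move=> s x; rewrite abM mulr_ile1 ?ab_ge0 ?F1.
  rewrite le_eqVlt; apply/orP; left; apply/eqP; congr (u _ _); apply: funext => x.
  rewrite /F /I /= !eqseq_cons !eqxx /= !cj_cons /cj count_nseq mul0n /=.
  by rewrite /ph; case: (z == _).
have const0 : null W (fun n => u d.+2 (ga i1 n)).
  have diff : null W (fun n => ab (GP d.+2 (F I n) - GP d.+2 (F (fun=> i1) n))).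
    apply: (@null_pow _ _ _ _ (2 ^ d.+1)); first by apply: evT => n; exact: ab_ge0.
    apply: null_le nulld; apply: evT => n.
    pose G0 h s x := F (fun=> i1) n (false :: s) x * F (fun=> i1) n (true :: s) (x + h).
    have -> : GP d.+2 (F I n) - GP d.+2 (F (fun=> i1) n) =
        avg (fun h => GP d.+1 (upd (G0 h) (true :: z) (fun x => Num.conj (pd n x (x + h))))).
      rewrite !GPh -avgB; apply: eq_avg => h; rewrite /GP -avgB; apply: eq_avg => x.
      rewrite /Eh -avgB; apply: eq_avg => hs.
      pose f1 := fun x => Num.conj (ph i2 i2 n x (x + h)).
      pose f2 := fun x => Num.conj (ph i1 i1 n x (x + h)).
      have := cprod_updB (G0 h) (true :: z) f1 f2 hs x.
      rewrite /= size_nseq size_tuple eqxx.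
      have cz w : cj z w = w by rewrite /cj count_nseq mul0n.
      have e1 : cprod (upd (G0 h) (true :: z) f1) hs x =
         cprod (fun s x => F I n (false :: s) x * F I n (true :: s) (x + h)) hs x.
        apply: eq_cprod => s y _; rewrite /upd /G0 /F /I !eqseq_cons /= !orbF.
        have [->|_] := eqVneq s (true :: z); last by [].
        by rewrite !cj_cons !cz /f1 /ph rmorphM.
      have e2 : cprod (upd (G0 h) (true :: z) f2) hs x = cprod (G0 h) hs x.
        apply: eq_cprod => s y _; rewrite /upd; have [->|_] := eqVneq s (true :: z); last by [].
        by rewrite /G0 /F !cj_cons !cz /f2 /ph rmorphM.
      rewrite e1 e2 => ->; apply: eq_cprod => s y _; rewrite /upd; case: eqP => // _.
      by rewrite /f1 /f2 /pd rmorphB.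
    apply: le_trans (_ : avg (fun h => ab (GP d.+1
       (upd (G0 h) (true :: z) (fun x => Num.conj (pd n x (x + h)))))) ^+ (2 ^ d.+1) <= _).
      rewrite lerXn2r ?nnegrE ?ab_ge0 ?ab_avg //.
      by apply: avg_ge0 => h; rewrite ab_ge0.
    apply: le_trans (avg_exp2 _ _) _ => [h|]; first exact: ab_ge0.
    apply: ler_avg => h.
    have := @GCS _ _ (true :: z) (upd (G0 h) (true :: z) (fun x => Num.conj (pd n x (x + h)))).
    rewrite /= size_nseq => /(_ _)/le_trans; apply.
      apply: upd_le1 => [s x|x]; last by rewrite ab_conj.
      by rewrite abM mulr_ile1 ?ab_ge0 ?F1.
    by rewrite /upd eqxx u_conj.
  apply: null_le (nullD diff mixed); apply: evT => n.
  rewrite /u /U -[X in ab X](subKr (GP d.+2 (F I n))).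
  by apply: le_trans (abB _ _) _; rewrite addrC.
apply: (nullN const0).
apply: (@K_corr_u _ _ _ _ d _ (fun n x => Num.conj (ga i1 n x)) _ _ _ PK).
- by move=> n x; rewrite ab_conj; apply: le_trans (gaK _ _ _) _; lra.
- by move=> n x; apply: le_trans (gaK _ _ _) _; lra.
exists ((2 * K)^-1 ^+ 2); first by rewrite exprn_gt0 // invr_gt0 mulr_gt0.
apply: evS ONg => n ON.
have -> : avg (fun xt : Z n * Z n => kt delta n xt.1 (xt.1 + xt.2) *
   (Num.conj (ga i1 n (xt.1 + xt.2)) * ga i1 n xt.1)) = c * c.
  rewrite (mp_avg (fun xy : Z n * Z n => kt delta n xy.1 xy.2 * (Num.conj (ga i1 n xy.2) * ga i1 n xy.1)) (mp_hat n)).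
  rewrite avg_pair /=.
  transitivity (c * c * \sum_j ip (g j n) (g i1 n) * ip (g i1 n) (g j n)); last first.
    rewrite (bigD1 i1) //= big1 ?addr0 ?ON ?eqxx ?mulr1 // => j ji.
    by rewrite ON (negbTE ji) mul0r.
  rewrite mulr_sumr.
  transitivity (\sum_j avg (fun x => avg (fun y => c * c * (g j n x * Num.conj (g i1 n x) * (g i1 n y * Num.conj (g j n y)))))).
    rewrite -avg_sum; apply: eq_avg => x; rewrite -avg_sum; apply: eq_avg => y.
    rewrite /kt mulr_suml; apply: eq_bigr => j _.
    rewrite (bigD1 j) //= big1 ?addr0 => [|l]; last first.
      by rewrite /delta eq_sym => /negbTE ->; rewrite mul0r.
    by rewrite /delta eqxx /ga rmorphM /= conjCK conjR; ring.
  apply: eq_bigr => j _; rewrite /ip -avgZr -avgZ; apply: eq_avg => x.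
  by rewrite -!avgZ.
by rewrite abM c2 expr2.
Qed.
End Finite.
Arguments kt {J} g t n x y.

End RankOne.
Arguments kt {R Z J} g t n x y.

(** * Splitting a structured projection into rank one pieces *)

Section Split.
Variable R : realType.
Context (W : set_system nat) {UW : UltraFilter W}.
Variable Z : nat -> finZmodType.
Local Notation C := R[i].
Local Notation ev := (ev W).
Local Notation Zf := (Zf Z).
Variable d : nat.
Local Notation BK := (@BK R Z d.+1).
Local Notation KA := (@KA R W Z d).
Local Notation KV := (@KV R W Z d _).
Lemma card_sig_lt (T : finType) (P : pred T) a : ~~ P a -> (#|{: {x | P x}}| < #|T|)%N.
Proof.
move=> Pa; rewrite card_sig -[ltnRHS](cardC P) -[ltnLHS]addn0 ltn_add2l.
by apply/card_gt0P; exists a.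
Qed.

Lemma sum_sig (V : nmodType) (T : finType) (S : pred T) (F : T -> V) :
  \sum_(l : {l | S l}) F (val l) = \sum_(l | S l) F l.
Proof.
rewrite [RHS](reindex_omap (val : {l | S l} -> T) insub) /=; last first.
  by move=> l Sl; rewrite insubT.
by apply: eq_big => [l|l _] //; rewrite (valP l) valK eqxx.
Qed.

Section Rotate.
Variables (J : finType) (g : J -> fam R Zf) (K : R) (e : 'I_#|J| -> J -> C).
Arguments g : clear implicits.
Hypothesis ONg : ev (fun n => orthon (fun j => g j n)).
Hypothesis K1 : 1 <= K.
Hypothesis gK : forall j n x, ab (g j n x) <= K.
Hypothesis ONe : orthon e.
Hypothesis J0 : (0 < #|J|)%N.
Variable S : pred 'I_#|J|.

(** The [e l] are orthonormal for the average over [J], not for the sum; hence this factor. *)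
Definition rotc : C := ((Num.sqrt #|J|%:R)^-1)%:C.
Definition rot (l : {l | S l}) : fam R Zf := fun n x =>
  rotc * \sum_i e (val l) i * g i n x.
Arguments rot l n x : clear implicits.

Lemma rotc2 : rotc * rotc = #|J|%:R^-1.
Proof.
rewrite /rotc -rmorphM -invfM -expr2 sqr_sqrtr ?ler0n //.
by rewrite fmorphV rmorph_nat.
Qed.
Lemma rot_ON : ev (fun n => orthon (fun l => rot l n)).
Proof.
apply: evS ONg => n ON l l'.
have -> : (l == l')%:R = (val l == val l')%:R :> C by rewrite (inj_eq val_inj).
rewrite -(ONe (val l) (val l')) /rot ipZ ip_sum.
have h i : ip (fun x => e (val l) i * g i n x) (fun x => rotc * \sum_i0 e (val l') i0 * g i0 n x)
    = rotc * (e (val l) i * Num.conj (e (val l') i)).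
  rewrite ipZ ipC ipZ ip_ON // rmorphM /= conjR; ring.
under eq_bigr => i _ do rewrite h.
rewrite -mulr_sumr mulrA rotc2 /ip /avg mulrC.
by [].
Qed.
Lemma rot_bdd : exists2 K' : R, 1 <= K' & forall l n x, ab (rot l n x) <= K'.
Proof.
exists (1 + \sum_l \sum_i ab (e l i) * K).
  by rewrite lerDl; apply: sumr_ge0 => l _; apply: sumr_ge0 => i _; rewrite mulr_ge0 ?ab_ge0 // (le_trans ler01).
move=> l n x; rewrite abM.
have c1 : ab rotc <= 1.
  rewrite -(ler_pXn2r (n := 2)) ?nnegrE ?ab_ge0 // expr1n expr2 -abM rotc2 abV ab_nat.
  by rewrite invf_le1 ?ltr0n // ler1n.
apply: le_trans (_ : \sum_i ab (e (val l) i) * K <= _).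
  rewrite -[leRHS]mul1r ler_pM ?ab_ge0 //; apply: le_trans (ab_sum _ _ _) _.
  by apply: ler_sum => i _; rewrite abM ler_wpM2l ?ab_ge0.
rewrite [in leRHS](bigD1 (val l)) //= addrCA lerDl addr_ge0 //.
by apply: sumr_ge0 => l' _; apply: sumr_ge0 => i _; rewrite mulr_ge0 ?ab_ge0 // (le_trans ler01).
Qed.
Lemma rot_sum n x y : \sum_l rot l n x * Num.conj (rot l n y) =
  kt g (fun i j => #|J|%:R^-1 * \sum_(l | S l) e l i * Num.conj (e l j)) n x y.
Proof.
rewrite /kt.
transitivity (\sum_(l : {l | S l}) \sum_i \sum_j #|J|%:R^-1 * (e (val l) i * Num.conj (e (val l) j) *
    (g i n x * Num.conj (g j n y)))).
  apply: eq_bigr => l _; rewrite /rot rmorphM rmorph_sum /= conjR mulrACA rotc2.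
  rewrite mulr_suml mulr_sumr; apply: eq_bigr => i _.
  rewrite mulr_sumr mulr_sumr; apply: eq_bigr => j _.
  by rewrite rmorphM; ring.
rewrite exchange_big /=; apply: eq_bigr => i _.
rewrite exchange_big /=; apply: eq_bigr => j _.
rewrite mulr_sumr mulr_suml.
rewrite (sum_sig S (fun l => #|J|%:R^-1 * (e l i * Num.conj (e l j) * (g i n x * Num.conj (g j n y))))).
under [LHS]eq_bigr => l _ do rewrite [#|J|%:R^-1 * _]mulrA.
reflexivity.
Qed.
End Rotate.
Arguments rot {J} g e {S} l n x.

Lemma KV_eq (J : finType) (g : J -> fam R Zf) (s t : J -> J -> C) :
  (forall i j, s i j = t i j) -> KV g s -> KV g t.
Proof. by move=> h; rewrite (_ : s = t) //; do 2! apply: funext => ?. Qed.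

(** Induction on the number of functions. If some structured matrix is not scalar, there is a
    Hermitian one with two distinct eigenvalues; its spectral projections are polynomials in it,
    hence structured, and cut the span into two smaller ones. Otherwise [rank_one] leaves at most
    one function. *)
Lemma split_chars (D : nat) (J : finType) (g : J -> fam R Zf) (K : R) : (#|J| <= D)%N ->
  ev (fun n => orthon (fun j => g j n)) -> 1 <= K -> (forall j n x, ab (g j n x) <= K) ->
  KV g (@delta R J) ->
  exists (J' : finType) (g' : J' -> fam R Zf) (K' : R),
  [/\ 1 <= K', forall j n x, ab (g' j n x) <= K',
      forall j, KA (fun n x y => g' j n x * Num.conj (g' j n y)) &
      ev (fun n => forall x y, \sum_j g j n x * Num.conj (g j n y) =
                               \sum_j g' j n x * Num.conj (g' j n y))].
Proof.
elim: D J g K => [|D IH] J g K JD ON K1 gK PK.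
  exists void, (of_void _), 1; split=> //; try by case.
  have J0 : #|J| = 0%N by apply/eqP; rewrite -leqn0.
  apply: evT => n x y; rewrite big1 => [|j _]; last by have := card0_eq J0 j.
  by rewrite big1 // => -[].
have ktd n x y : kt g (@delta R J) n x y = \sum_i g i n x * Num.conj (g i n y).
  apply: eq_bigr => i _; rewrite (bigD1 i) //= /delta eqxx mul1r big1 ?addr0 //.
  by move=> j /negbTE; rewrite eq_sym => ->; rewrite mul0r.
pose nonscal (t : J -> J -> C) := exists i j : J, i != j /\ ~ (t i j = 0 /\ t i i = t j j).
have [[t KVt nt]|scal] := pselect (exists2 t, KV g t & nonscal t); last first.
  have h : forall i j : J, i = j.
    apply: (rank_one ON K1 gK PK) => t KVt i j ij; apply: contrapT => h.
    by apply: scal; exists t => //; exists i, j.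
  exists J, g, K; split=> //; last exact: evT.
  move=> j; apply: Cl_eq PK; apply: evT => n [x t] /=.
  rewrite ktd (bigD1 j) //= big1 ?addr0 // => i; by rewrite (h i j) eqxx.
(* [h1] and [h2] are Hermitian and [2 t = h1 - i h2], so one of them is not scalar. *)
have [h [KVh hh nh]] : exists h : J -> J -> C, [/\ KV g h, forall i j, h j i = Num.conj (h i j) & nonscal h].
  pose h1 i j := 1 * t i j + 1 * Num.conj (t j i).
  pose I : C := 'i%C.
  have II : Num.conj I = - I by apply/eqP; rewrite eq_complex /= oppr0 !eqxx.
  have I2 : I * I = -1 by rewrite -expr2 sqr_i.
  pose h2 i j := I * t i j + (- I) * Num.conj (t j i).
  have K1' : KV g h1 by exact: (KV_lin _ _ KVt (KV_adj KVt)).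
  have K2' : KV g h2 by exact: (KV_lin _ _ KVt (KV_adj KVt)).
  case: nt => i [j [ij nt]].
  have [n1|n1] := pselect (h1 i j = 0 /\ h1 i i = h1 j j); last first.
    exists h1; split=> //; last by exists i, j.
    by move=> a b; rewrite /h1 !mul1r rmorphD /= conjCK addrC.
  exists h2; split=> //.
    move=> a b; rewrite /h2 rmorphD !rmorphM rmorphN /= conjCK II opprK addrC.
    by [].
  exists i, j; split=> // n2; apply: nt.
  have e a b : 2 * t a b = h1 a b - I * h2 a b.
    rewrite /h1 /h2 mulrDr !mulrA I2 mulrN mulNr I2; ring.
  case: n1 n2 => a1 a2 [b1 b2]; have two : (2 : C) != 0 by rewrite pnatr_eq0.
  by split; apply: (mulfI two); rewrite !e ?a1 ?b1 ?mulr0 ?subrr // a2 b2.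
case: nh => i0 [j0 [ij0 nh]].
have J0 : (0 < #|J|)%N by apply/card_gt0P; exists i0.
have JN : (#|J|%:R : C) != 0 by rewrite pnatr_eq0 -lt0n.
have [e [lam [ONe eh comp]]] := spectral J0 hh.
pose KVf f := KV g (kf e lam f).
have kf1 i j : kf e lam (fun=> 1) i j = #|J|%:R * (i == j)%:R.
  by rewrite -comp; apply: eq_bigr => l _; rewrite mul1r.
have KVf1 : KVf (fun=> 1).
  apply: KV_eq (KV_lin #|J|%:R 0 PK PK) => i j.
  by rewrite kf1 mul0r addr0.
have KVfi : KVf id by apply: KV_eq KVh => i j; rewrite eh.
have KVfM f1 f2 : KVf f1 -> KVf f2 -> KVf (fun r => f1 r * f2 r).
  move=> k1 k2; apply: KV_eq (KV_lin #|J|%:R^-1 0 (KV_mul ON gK k1 k2) PK) => i j.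
  rewrite mul0r addr0 -(kf_comp _ _ _ ONe) /kcomp /avg mulrC.
  by [].
have KVfL f1 f2 a b : KVf f1 -> KVf f2 -> KVf (fun r => a * f1 r + b * f2 r).
  move=> k1 k2; apply: KV_eq (KV_lin a%:C b%:C k1 k2) => i j.
  rewrite /kf !mulr_sumr -big_split; apply: eq_bigr => l _ /=.
  by rewrite rmorphD !rmorphM /=; ring.
have [[a b] /= lab] : exists ab : 'I_#|J| * 'I_#|J|, lam ab.1 != lam ab.2.
  apply: contrapT => hn; apply: nh.
  pose l0 := enum_rank i0.
  have hl l : lam l = lam l0.
    by apply/eqP; apply: contrapT => /negP ll; apply: hn; exists (l, l0).
  have hE i j : h i j = (lam l0)%:C * (#|J|%:R * (i == j)%:R).
    rewrite -comp eh mulr_sumr; apply: eq_bigr => l _; by rewrite hl mulrA.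
  by rewrite !hE !eqxx (negbTE ij0) !mulr0.
(* The Lagrange polynomial that is 1 at [lam a] and 0 at the other eigenvalues. *)
pose f0 r := \prod_(l | lam l != lam a) ((r - lam l) / (lam a - lam l)).
have f0E l : f0 (lam l) = (lam l == lam a)%:R.
  rewrite /f0; have [->|ne] := eqVneq (lam l) (lam a).
    by rewrite big1 // => l' l'a; rewrite divff // subr_eq0 eq_sym.
  by rewrite (bigD1 l) //= subrr !mul0r.
have KVf0 : KVf f0.
  rewrite /f0; elim: (index_enum _) => [|l r IHr].
    by rewrite (_ : (fun=> _) = fun=> 1) //; apply: funext => r; rewrite big_nil.
  have [la|la] := boolP (lam l != lam a); last first.
    rewrite (_ : (fun=> _) = fun r' => \prod_(l <- r | lam l != lam a) ((r' - lam l) / (lam a - lam l))) //.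
    by apply: funext => r'; rewrite big_cons (negbTE la).
  rewrite (_ : (fun=> _) = fun r' => ((lam a - lam l)^-1 * r' + (- lam l / (lam a - lam l)) * 1)
     * \prod_(l <- r | lam l != lam a) ((r' - lam l) / (lam a - lam l))).
    exact: (KVfM _ _ (KVfL _ _ _ _ KVfi KVf1) IHr).
  apply: funext => r'; rewrite big_cons la; congr (_ * _).
  by rewrite mulr1 mulrBl mulNr mulrC.
pose part (S : pred 'I_#|J|) f := (forall l, f (lam l) = (S l)%:R) /\ KVf f.
have main (S : pred 'I_#|J|) f l0 : ~~ S l0 -> part S f ->
  exists (J' : finType) (g' : J' -> fam R Zf) (K' : R),
  [/\ 1 <= K', forall j n x, ab (g' j n x) <= K',
      forall j, KA (fun n x y => g' j n x * Num.conj (g' j n y)) &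
      ev (fun n => forall x y, kt g (fun i j => #|J|%:R^-1 * kf e lam f i j) n x y =
                               \sum_j g' j n x * Num.conj (g' j n y))].
  move=> Sl [fS KVff].
  have [K' K'1 hK'] := rot_bdd e K1 gK J0 S.
  have sumE n x y : \sum_(l : {l | S l}) rot g e l n x * Num.conj (rot g e l n y) =
      kt g (fun i j => #|J|%:R^-1 * kf e lam f i j) n x y.
    rewrite rot_sum; congr (kt g _ n x y); apply: funext => i; apply: funext => j.
    congr (_ * _); rewrite /kf [LHS]big_mkcond; apply: eq_bigr => l _; rewrite fS.
    by case: (S l); rewrite ?mul1r ?mul0r.
  have [||J' [g' [K'' [h1 h2 h3 h4]]]] := IH _ (rot g e (S := S)) K' _ (rot_ON ON ONe S) K'1 hK'.
  - have := card_sig_lt Sl; rewrite card_ord => h'.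
    by rewrite -ltnS; exact: leq_trans h' JD.
  - apply: (Cl_eq _ (KV_lin #|J|%:R^-1 0 KVff PK)); apply: evT => n [x y] /=.
    rewrite [RHS](_ : _ = \sum_(l : {l | S l}) rot g e l n x * Num.conj (rot g e l n (x + y))); last first.
      apply: eq_bigr => i _; rewrite (bigD1 i) //= /delta eqxx mul1r big1 ?addr0 //.
      by move=> j /negbTE; rewrite eq_sym => ->; rewrite mul0r.
    rewrite sumE; congr (kt g _ n x (x + y)); apply: funext => i; apply: funext => j.
    by rewrite mul0r addr0.
  exists J', g', K''; split=> //; apply: evS h4 => n h4 x y.
  by rewrite -sumE h4.
have pa : part (fun l => lam l == lam a) f0 by split.
have pb : part (fun l => lam l != lam a) (fun r => 1 * 1 + -1 * f0 r).
  split; last exact: KVfL.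
  by move=> l; rewrite f0E; case: eqP => _ /=; ring.
have [|J1 [g1 [K1' [a1 a2 a3 a4]]]] := main _ f0 b _ pa.
  by rewrite eq_sym.
have [|J2 [g2 [K2' [b1 b2 b3 b4]]]] := main _ _ a _ pb.
  by rewrite negbK.
exists (J1 + J2)%type, (fun j => match j with inl j => g1 j | inr j => g2 j end), (K1' + K2').
have K1'0 : 0 <= K1' by exact: le_trans a1.
have K2'0 : 0 <= K2' by exact: le_trans b1.
split.
- by rewrite -[1]addr0 lerD.
- move=> [j|j] n x; first by apply: le_trans (a2 _ _ _) _; rewrite lerDl.
  by apply: le_trans (b2 _ _ _) _; rewrite lerDr.
- by case.
apply: ev2 a4 b4 => n h1 h2 x y; rewrite big_sumType /= -h1 -h2 -ktd /kt -big_split.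
apply: eq_bigr => i _; rewrite -big_split; apply: eq_bigr => j _ /=.
rewrite -mulrDl -mulrDr; congr (_ * _).
have -> : kf e lam f0 i j + kf e lam (fun r => 1 * 1 + -1 * f0 r) i j = kf e lam (fun=> 1) i j.
  rewrite /kf -big_split; apply: eq_bigr => l _ /=.
  by rewrite rmorphD !rmorphM rmorphN !rmorph1 /=; ring.
by rewrite kf1 mulKf.
Qed.
End Split.

(** * Approximating a step function by polynomials *)

Section Gap.
Variable R : realType.
Lemma bern_le (y : R) J : 0 <= y <= 1 -> (1 - y) ^+ J * (1 + J%:R * y) <= 1.
Proof.
move=> /andP[y0 y1]; elim: J => [|J IH]; first by rewrite expr0 mul0r addr0 mulr1.
apply: le_trans IH; rewrite exprSr -mulrA ler_wpM2l ?exprn_ge0 ?subr_ge0 //.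
have : 0 <= (J%:R + 1) * (y * y) by rewrite mulr_ge0 ?addr_ge0 ?ler0n ?mulr_ge0.
rewrite -natr1; nra.
Qed.
Lemma bern_ge (y : R) J : 0 <= y <= 1 -> 0 <= 1 - (1 - y) ^+ J <= J%:R * y.
Proof.
move=> /andP[y0 y1]; apply/andP; split.
  by rewrite subr_ge0 exprn_ile1 ?subr_ge0 // gerBl.
elim: J => [|J IH]; first by rewrite expr0 mul0r subrr.
have h : (1 - y) ^+ J <= 1 by rewrite exprn_ile1 ?subr_ge0 // gerBl.
rewrite exprS -natr1; nra.
Qed.
Lemma pow_small (q eta : R) : 0 <= q < 1 -> 0 < eta -> exists L, q ^+ L < eta.
Proof.
move=> /andP[q0 q1] e0; have q1' : 0 < 1 - q by rewrite subr_gt0.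
have e1 : 0 < eta * (1 - q) by rewrite mulr_gt0.
exists (Num.bound (eta * (1 - q))^-1).
set L := Num.bound _.
have hL : (eta * (1 - q))^-1 < L%:R by apply: archi_boundP; rewrite invr_ge0 ltW.
have := @bern_le (1 - q) L; rewrite subKr => /(_ _)/[!ltW q1']/[!gerBl]/[!q0]/(_ isT) h.
have h2 : 1 < L%:R * (1 - q) * eta.
  have : (eta * (1 - q))^-1 * (eta * (1 - q)) < L%:R * (eta * (1 - q)) by rewrite ltr_pM2r.
  by rewrite mulVf ?gt_eqF // [eta * _]mulrC mulrA.
rewrite ltNge; apply/negP => h3.
have : eta * (1 + L%:R * (1 - q)) <= q ^+ L * (1 + L%:R * (1 - q)).
  by rewrite ler_wpM2r // addr_ge0 // mulr_ge0 ?ler0n // ltW.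
nra.
Qed.
(** The polynomial [1 - (1 - r^(L+1))^J] approximates the indicator of [r >= hi] outside the gap
    [[lo, hi)]. The error is relative to [r], hence square-summable over the eigenvalues. Taking [J]
    of the order of [hi^-(L+1)] makes the error above the gap small, and below the gap it is of the
    order of [(lo / hi)^L]. *)
Lemma poly_gap (lo hi eps : R) : 0 < lo -> lo < hi -> hi <= 1 -> 0 < eps ->
  exists J L, forall r, 0 <= r <= 1 ->
    (r < lo -> `|1 - (1 - r ^+ L.+1) ^+ J| <= eps * r) /\
    (hi <= r -> `|(1 - r ^+ L.+1) ^+ J| <= eps * r).
Proof.
move=> l0 lh h1 e0; have h0 : 0 < hi by exact: lt_trans lh.
pose K := (eps * hi)^-1.
have K0 : 0 < K by rewrite invr_gt0 mulr_gt0.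
have [L hL] : exists L, (lo / hi) ^+ L < eps / ((K + 1) / hi).
  apply: pow_small; last by rewrite !divr_gt0 // addr_gt0.
  by rewrite divr_ge0 ?(ltW l0) ?(ltW h0) //= ltr_pdivrMr // mul1r.
pose J := Num.bound (K * (hi ^+ L.+1)^-1).
have hp : 0 < hi ^+ L.+1 by rewrite exprn_gt0.
have J1 : K * (hi ^+ L.+1)^-1 < J%:R.
  by rewrite /J; apply: archi_boundP; rewrite mulr_ge0 ?(ltW K0) // invr_ge0 ltW.
(* The least such [J']: one less falls below [K], so the excess is at most [hi^(L+1) <= 1]. *)
have [J' J'1 J'2] : exists2 J', K <= J'%:R * hi ^+ L.+1 & J'%:R * hi ^+ L.+1 <= K + 1.
  have hh : hi ^+ L.+1 <= 1 by rewrite exprn_ile1 // ltW.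
  have ex : exists j, K <= j%:R * hi ^+ L.+1.
    by exists J; rewrite -ler_pdivrMr // ltW.
  case: (ex_minnP ex) => -[|j] hj hmin.
    by rewrite mul0r in hj; have := lt_le_trans K0 hj; rewrite ltxx.
  exists j.+1 => //; have := contra_not (hmin j); rewrite ltnn => /(_ notF)/negP; rewrite -ltNge => /ltW h.
  by rewrite -natr1 mulrDl mul1r lerD.
exists J', L => r /andP[r0 r1].
have rL : 0 <= r ^+ L.+1 <= 1 by rewrite exprn_ge0 //= exprn_ile1.
split=> hr.
  have /andP[g0 g1] := bern_ge J' rL; rewrite ger0_norm //; apply: le_trans g1 _.
  rewrite exprSr mulrA ler_wpM2r //.
  apply: le_trans (_ : J'%:R * lo ^+ L <= _).
    by rewrite ler_wpM2l ?ler0n // lerXn2r ?nnegrE ?(ltW l0) // ltW.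
  have -> : lo ^+ L = (lo / hi) ^+ L * hi ^+ L by rewrite -exprMn divfK // gt_eqF.
  rewrite mulrCA; apply: le_trans (_ : (eps / ((K + 1) / hi)) * (J'%:R * hi ^+ L) <= _).
    by rewrite ler_wpM2r ?(ltW hL) // mulr_ge0 ?ler0n ?exprn_ge0 // ltW.
  rewrite mulrAC ler_pdivrMr ?divr_gt0 ?addr_gt0 // ler_wpM2l ?(ltW e0) //.
  by rewrite ler_pdivlMr // -mulrA -exprSr.
have /andP[g0 g1] := bern_ge J' rL; have g2 := bern_le J' rL.
rewrite ger0_norm; last by rewrite exprn_ge0 // subr_ge0; case/andP: rL.
have h3 : K <= J'%:R * r ^+ L.+1.
  by apply: le_trans J'1 _; rewrite ler_wpM2l ?ler0n // lerXn2r ?nnegrE ?(ltW h0).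
apply: le_trans (_ : eps * hi <= _); last by rewrite ler_wpM2l // ltW.
have X0 : 0 <= (1 - r ^+ L.+1) ^+ J' by rewrite exprn_ge0 // subr_ge0; case/andP: rL.
have : (1 - r ^+ L.+1) ^+ J' * K <= 1 by apply: le_trans g2; rewrite ler_wpM2l // (le_trans h3) // lerDr.
by rewrite /K ler_pdivrMr ?mulr_gt0 // mul1r.
Qed.
End Gap.

Lemma dep_choice (I : Type) (T : I -> Type) (P : forall i, T i -> Prop) :
  (forall i, exists x, P i x) -> {f : forall i, T i | forall i, P i (f i)}.
Proof. by move=> h; exists (fun i => sval (cid (h i))) => i; case: (cid (h i)). Qed.

(** * Dual functions as combinations of functions with structured derivatives *)

Section Span.
Variable R : realType.
Context (W : set_system nat) {UW : UltraFilter W}.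
Variable Z : nat -> finZmodType.
Local Notation C := R[i].
Local Notation ev := (ev W).
Local Notation Zf := (Zf Z).

Definition Char d (g : fam R Zf) := fle1 g /\ Cl W (@BK R Z d) (hat g).

Variable d : nat.
Local Notation BK := (@BK R Z d.+1).
Local Notation KA := (@KA R W Z d).

Lemma kf_eigen_count n (lam : 'I_n -> R) (th : R) : 0 < th ->
  (forall i, 0 <= lam i) -> \sum_i lam i ^+ 2 <= 1 ->
  (#|[pred i : 'I_n | (th <= lam i)%R]| <= Num.bound (th ^+ 2)^-1)%N.
Proof.
move=> t0 l0 ls; rewrite -(ler_nat R).
have h : th ^+ 2 * #|[pred i : 'I_n | (th <= lam i)%R]|%:R <= 1.
  apply: le_trans ls; rewrite -sum1_card natr_sum mulr_sumr [leRHS](bigID (fun i => th <= lam i)) /=.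
  rewrite -[leLHS]addr0 lerD ?sumr_ge0 // => [|i _]; last exact: sqr_ge0.
  by apply: ler_sum => i hi; rewrite mulr1 lerXn2r ?nnegrE // ltW.
have t2 : 0 < th ^+ 2 by rewrite exprn_gt0.
apply: le_trans (_ : (th ^+ 2)^-1 <= _); first by rewrite -[leRHS]mulr1 -ler_pdivrMl ?invr_gt0 // invrK.
by apply: ltW; apply: archi_boundP; rewrite invr_ge0 ltW.
Qed.

(** There are [N + 1] disjoint intervals of length [w] and at most [N] eigenvalues above [a], so one
    interval contains none. *)
Lemma gap_pick n (lam : 'I_n -> R) (a w : R) (N : nat) : 0 < w ->
  (#|[pred i : 'I_n | (a <= lam i)%R]| <= N)%N ->
  exists j : 'I_N.+1, forall i, ~~ (a + w * j%:R <= lam i < a + w * j.+1%:R).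
Proof.
move=> w0 hN; apply: contrapT => /forallNP h.
have /choice [f hf] : forall j : 'I_N.+1, exists i, a + w * j%:R <= lam i < a + w * j.+1%:R.
  move=> j; apply: contrapT => /forallNP h'; apply: (h j) => i; apply/negP; exact: h'.
have inj : injective f.
  move=> j j' e; apply: val_inj => /=; apply/eqP; rewrite eqn_leq.
  have hh (x y : 'I_N.+1) : f x = f y -> (x <= y)%N.
    move=> exy; have /andP[h1 _] := hf x; have /andP[_ h2] := hf y.
    rewrite exy in h1; have := le_lt_trans h1 h2.
    by rewrite ltrD2l ltr_pM2l // ltr_nat ltnS.
  by rewrite !hh.
have := max_card (mem (codom f)); have : (#|codom f| <= N)%N.
  apply: leq_trans hN; apply: subset_leq_card; apply/fintype.subsetP => _ /codomP[j ->].
  rewrite inE; have /andP[h1 _] := hf j; apply: le_trans h1.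
  by rewrite lerDl mulr_ge0 ?ler0n // ltW.
by rewrite card_codom // card_ord ltnn.
Qed.

(** The polynomial has no constant term, so it is reached from the kernel by compositions and linear
    combinations alone. *)
Lemma KA_fun (e : forall n, 'I_#|Zf n| -> Zf n -> C) (lam : forall n, 'I_#|Zf n| -> R) J L :
  (forall n, orthon (e n)) ->
  KA (fun n => kf (e n) (lam n) id) -> kbdd W (fun n => kf (e n) (lam n) id) ->
  KA (fun n => kf (e n) (lam n) (fun r => 1 - (1 - r ^+ L.+1) ^+ J)).
Proof.
move=> ON cA bA; pose Q f := KA (fun n => kf (e n) (lam n) f) /\ kbdd W (fun n => kf (e n) (lam n) f).
have Qeq f g : (forall r, f r = g r) -> Q f -> Q g by move=> h; rewrite (funext h).
have QM f g : Q f -> Q g -> Q (fun r => f r * g r).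
  move=> [a1 a2] [b1 b2]; split.
    by apply: (Cl_eq _ (KA_comp b2 a1 b1)); apply: evT => n xt; rewrite /= (kf_comp _ _ _ (ON n)).
  have [K hK] := kbdd_comp a2 b2; exists K; apply: evS hK => n h x y.
  by have := h x y; rewrite (kf_comp _ _ _ (ON n)).
have kfD n f g (a b : R) x y : kf (e n) (lam n) (fun r => a * f r + b * g r) x y =
    a%:C * kf (e n) (lam n) f x y + b%:C * kf (e n) (lam n) g x y.
  rewrite /kf !mulr_sumr -big_split; apply: eq_bigr => l _ /=.
  by rewrite rmorphD !rmorphM /=; ring.
have QD f g a b : Q f -> Q g -> Q (fun r => a * f r + b * g r).
  move=> [a1 [K1 a2]] [b1 [K2 b2]]; split.
    by apply: (Cl_eq _ (KA_lin a%:C b%:C a1 b1)); apply: evT => n xt; rewrite kfD.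
  exists (`|a| * K1 + `|b| * K2); apply: ev2 a2 b2 => n h1 h2 x y.
  by rewrite kfD; apply: le_trans (abD _ _) _; rewrite !abM !abR lerD // ler_wpM2l.
have Qid : Q id by [].
have QL : Q (fun r => r ^+ L.+1).
  elim: L => [|l IH]; first by apply: (Qeq _ _ _ Qid) => r; rewrite expr1.
  by apply: (Qeq _ _ _ (QM _ _ Qid IH)) => r; rewrite [RHS]exprS.
suff : Q (fun r => 1 - (1 - r ^+ L.+1) ^+ J) by case.
elim: J => [|j IH].
  by apply: (Qeq _ _ _ (QD _ _ 0 0 Qid Qid)) => r; rewrite expr0; ring.
apply: (Qeq _ _ _ (QD _ _ 1 1 IH (QD _ _ 1 (-1) QL (QM _ _ IH QL)))) => r.
rewrite [(1 - r ^+ L.+1) ^+ j.+1]exprS; ring.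
Qed.

(** [B_split] writes [b] as [k] applied to [phi]. The eigenvectors of the Gram kernel of [k] with
    eigenvalue at least [hi] capture [b] up to [th]; their number is bounded. As no eigenvalue lies
    in [[lo, hi)], the projection onto them is a limit of polynomials in the Gram kernel, hence
    structured, and [split_chars] applies. *)
Theorem span (b : fam R Zf) (eps : R) : (forall n, B d.+2 (b n)) -> 0 < eps ->
  exists (J : finType) (g : J -> fam R Zf) (c : J -> nat -> C) (K : R),
  [/\ forall j, Char d.+1 (g j), forall j n, ab (c j n) <= K &
      ev (fun n => N2 (fun x => b n x - \sum_j c j n * g j n x) < eps)].
Proof.
move=> hb e0; pose th := Num.min (eps / 2) 1.
have t0 : 0 < th by rewrite lt_min ltr01 divr_gt0.
have t1 : th <= 1 by rewrite ge_min lexx orbT.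
have te : th < eps by apply: le_lt_trans (_ : eps / 2 < eps); rewrite ?ge_min ?lexx //; lra.
have dk n : exists kp : (Z n * Z n -> C) * (Z n -> C),
   [/\ le1 kp.2, forall t, B d.+1 (fun x => kp.1 (x, t)) &
       forall x, b n x = avg (fun t => kp.1 (x, t) * kp.2 (x + t))].
  by have [k [p h1 [h2 h3]]] := B_split (hb n); exists (k, p).
have [kp hkp] := dep_choice dk.
pose k : ker R Z := fun n x y => (kp n).1 (x, y - x).
pose phi n := (kp n).2.
have phi1 n : le1 (phi n) by case: (hkp n).
have k1 n x y : ab (k n x y) <= 1 by case: (hkp n) => _ h _; exact: (B_le1 (h _)).
have bE n x : b n x = avg (fun y => k n x y * phi n y).
  case: (hkp n) => _ _ ->; rewrite -[RHS](avg_addl _ x); apply: eq_avg => t.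
  by rewrite /k [x + t]addrC addrK [t + x]addrC.
have kA : KA k.
  apply: Cl_base; apply: evT => n t; case: (hkp n) => _ h _.
  have := h t; congr (B _ _); apply: funext => x; by rewrite /k /= addrAC subrr add0r.
have [e he] := dep_choice (fun n => spectral_gram (Z_gt0 Z n) (k1 n)).
have [lam hl] := dep_choice he.
have ON n : orthon (e n) by case: (hl n).
have lam0 n i : 0 <= lam n i by case: (hl n) => _ _ /(_ i)[/andP[]].
have lam1 n i : lam n i <= 1 by case: (hl n) => _ _ /(_ i)[/andP[]].
have lame n i x : lam n i * ab (e n i x) <= 1 by case: (hl n) => _ _ /(_ i)[_].
have lam2 n : \sum_i lam n i ^+ 2 <= 1 by case: (hl n).
have kM : KA (fun n => kf (e n) (lam n) id).
  have kb : kbdd W (fun n x y => Num.conj (k n y x)) by exists 1; apply: evT => n x y; rewrite ab_conj.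
  by apply: (Cl_eq _ (KA_comp kb kA (KA_adj kA))); apply: evT => n xt; case: (hl n) => _ ->.
have bM : kbdd W (fun n => kf (e n) (lam n) id).
  have kb : kbdd W k by exists 1; apply: evT.
  have kb' : kbdd W (fun n x y => Num.conj (k n y x)) by exists 1; apply: evT => n x y; rewrite ab_conj.
  by have [K hK] := kbdd_comp kb kb'; exists K; apply: evS hK => n h x y; case: (hl n) => _ <-.
pose N := Num.bound ((th / 2) ^+ 2)^-1; have t2 : 0 < th / 2 by rewrite divr_gt0.
pose w := th / 2 / N.+1%:R; have w0 : 0 < w by rewrite divr_gt0 ?ltr0n.
(* The gap is located by an index from a finite set, so the same gap works for almost all [n]. *)
have [j hj] : exists j : 'I_N.+1, ev (fun n => forall i,
    ~~ (th / 2 + w * j%:R <= lam n i < th / 2 + w * j.+1%:R)).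
  apply: ev_pick; apply: evT => n; apply: gap_pick => //.
  exact: kf_eigen_count.
pose lo := th / 2 + w * j%:R; pose hi := th / 2 + w * j.+1%:R.
have lo0 : 0 < lo by rewrite ltr_wpDr // mulr_ge0 ?ler0n // ltW.
have lohi : lo < hi by rewrite ltrD2l ltr_pM2l // ltr_nat.
have hith : hi <= th.
  have : w * j.+1%:R <= w * N.+1%:R by rewrite ler_pM2l // ler_nat.
  by rewrite {2}/w divfK ?pnatr_eq0 // /hi; lra.
pose P n i := hi <= lam n i.
have gap : ev (fun n => forall i, ~~ P n i -> lam n i < lo).
  apply: evS hj => n h i; rewrite /P -ltNge => h2.
  by have := h i; rewrite -/lo -/hi h2 andbT -ltNge.
have [D hD] : exists D : 'I_N.+1, ev (fun n => #|[pred i | P n i]| == D :> nat).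
  apply: ev_pick; apply: evT => n.
  have h : (#|[pred i | P n i]| < N.+1)%N.
    rewrite ltnS; apply: leq_trans (kf_eigen_count t2 (lam0 n) (lam2 n)).
    apply: subset_leq_card; apply/fintype.subsetP => i; rewrite !inE /P; apply: le_trans.
    by rewrite /hi lerDl mulr_ge0 ?ler0n // ltW.
  by exists (Ordinal h) => /=.
have [g hg] : exists g : 'I_D -> fam R Zf, [/\ ev (fun n => orthon (fun i => g i n)),
    (forall i n x, ab (g i n x) <= 1 + hi^-1) &
    ev (fun n => forall F : (Zf n -> C) -> C, \sum_(i | P n i) F (e n i) = \sum_i F (g i n))].
  have hi0 : 0 < hi by exact: lt_trans lohi.
  (* An enumeration of the selected eigenvectors; zero at the exceptional [n] where their number is
     not [D]. *)
  pose ge n : 'I_D -> Zf n -> C := match @eqP _ #|[pred i | P n i]| (D : nat) with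
     | ReflectT E => fun i => e n (enum_val (cast_ord (esym E) i))
     | ReflectF _ => fun _ _ => 0 end.
  exists (fun i n => ge n i); split.
  - apply: evS hD => n /eqP h i i'; rewrite /ge; case: eqP => // E.
    by rewrite ON (inj_eq enum_val_inj) (inj_eq (@cast_ord_inj _ _ _)).
  - move=> i n x; rewrite /ge; case: eqP => E; last by rewrite ab0 addr_ge0 // invr_ge0 ltW.
    set l := enum_val _; have Pl : P n l by have := enum_valP (cast_ord (esym E) i); rewrite inE.
    apply: le_trans (_ : hi^-1 <= _); last by rewrite lerDr.
    rewrite -[leRHS]mul1r ler_pdivlMr // mulrC; apply: le_trans (lame n l x).
    by rewrite ler_wpM2r ?ab_ge0.
  - apply: evS hD => n /eqP h F; rewrite /ge; case: eqP => // E.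
    rewrite [LHS](eq_bigl (mem [pred i | P n i])) //.
    rewrite big_enum_val /= (reindex (cast_ord (esym E))) //=.
    by exists (cast_ord E) => i _; rewrite ?cast_ordK ?cast_ordKV.
case: hg => ONg gK gE.
have PKV : KV W d g (@delta R _).
  have kP : KA (fun n x y => \sum_(i | P n i) e n i x * Num.conj (e n i y)).
    apply: Cl_lim => eta eta0.
    pose ep := Num.min (eta / 2) 1.
    have ep0 : 0 < ep by rewrite lt_min ltr01 divr_gt0.
    have epe : ep < eta by apply: le_lt_trans (_ : eta / 2 < eta); rewrite ?ge_min ?lexx //; lra.
    have ep1 : ep <= 1 by rewrite ge_min lexx orbT.
    have [J [L hJL]] := poly_gap lo0 lohi (le_trans hith t1) ep0.
    exists (fun n xt => kf (e n) (lam n) (fun r => 1 - (1 - r ^+ L.+1) ^+ J) xt.1 (xt.1 + xt.2)).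
    split; first exact: (@KA_fun e lam J L ON kM bM).
    apply: evS gap => n gp.
    pose co i : C := ((P n i)%:R - (1 - (1 - lam n i ^+ L.+1) ^+ J))%:C.
    rewrite (@eq_N2 _ _ _ (fun xt : Z n * Z n => (fun x y => \sum_i co i * e n i x * Num.conj (e n i y)) xt.1 (xt.1 + xt.2))).
      rewrite (N2_hat (fun x y => \sum_i co i * e n i x * Num.conj (e n i y))) (kf_pair _ (ON n)).
      apply: le_lt_trans epe; apply: le_trans (_ : ep ^+ 2 <= _); last by rewrite expr2 ler_piMr // ltW.
      rewrite -[leRHS]mulr1; apply: le_trans (ler_wpM2l (sqr_ge0 ep) (lam2 n)).
      rewrite mulr_sumr; apply: ler_sum => i _; rewrite -exprMn abR.
      rewrite lerXn2r ?nnegrE ?normr_ge0 ?mulr_ge0 ?(ltW ep0) //.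
      have [|h1 h2] := hJL (lam n i); first by rewrite lam0 lam1.
      case: (boolP (P n i)) => hP.
        by rewrite opprB addrCA subrr addr0; apply: h2.
      by rewrite sub0r normrN; apply: h1; exact: gp.
    move=> xt /=; rewrite /kf big_mkcond -sumrB; apply: eq_bigr => i _; rewrite /co (rmorphB (real_complex R)) /=.
    by case: (P n i); rewrite ?rmorph1 ?rmorph0; ring.
  apply: (Cl_eq _ kP); apply: evS gE => n h [x t] /=.
  rewrite (h (fun f => f x * Num.conj (f (x + t)))) /kt; apply: eq_bigr => i _.
  rewrite (bigD1 i) //= /delta eqxx mul1r big1 ?addr0 //.
  by move=> i' /negbTE; rewrite eq_sym => ->; rewrite mul0r.
have K1 : 1 <= 1 + hi^-1 by rewrite lerDl invr_ge0 ltW // (lt_trans lo0).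
have [J' [g' [K' [K'1 g'K g'A g'E]]]] := split_chars (leqnn _) ONg K1 gK PKV.
have K'0 : 0 < K' by exact: lt_le_trans K'1.
have KN : (K'%:C : C) != 0 by rewrite -ab_eq0 abR normr_eq0 gt_eqF.
(* Rescaled to be bounded by 1; the coefficients absorb the factor [K' ^+ 2]. *)
pose g2 l n x := (K'^-1)%:C * g' l n x.
exists J', g2, (fun l n => (K' ^+ 2)%:C * ip (b n) (g2 l n)), (K' ^+ 2).
have g21 l : fle1 (g2 l).
  move=> n x; rewrite abM abR ger0_norm ?invr_ge0 ?(ltW K'0) // mulrC ler_pdivrMr // mul1r.
  exact: g'K.
split.
- move=> l; split=> //.
  have iK1 : ab ((K'^-1)%:C ^+ 2 : C) <= 1.
    by rewrite abX abR ger0_norm ?invr_ge0 ?(ltW K'0) // exprn_ile1 ?invr_ge0 ?(ltW K'0) // invf_le1.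
  apply: (Cl_eq _ (Cl_scale (@good_BK R Z d) (evT (W:=W) (fun n => iK1)) (g'A l))); apply: evT => n [x t]; rewrite /hat /g2 /= rmorphM /= conjR; ring.
- move=> l n; rewrite abM abR ger0_norm ?exprn_ge0 ?(ltW K'0) // ler_piMr ?exprn_ge0 ?(ltW K'0) //.
  apply: le_trans (ab_avg _) _; apply: avg_le => // x.
  by rewrite abM ab_conj mulr_ile1 ?ab_ge0 ?(B_le1 (hb n)) ?g21.
apply: ev3 gap gE g'E => n gp hE h'E.
case: (hl n) => _ _ _ _ /(_ (phi n) th (P n) (phi1 n) (ltW t0)) => /(_ _)/le_lt_trans h.
rewrite (@eq_N2 _ _ _ (fun x => avg (fun y => k n x y * phi n y) -
   \sum_(i | P n i) ip (fun x => avg (fun y => k n x y * phi n y)) (e n i) * e n i x)).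
  by apply: h te => i /gp hlo; apply/ltW/(lt_le_trans hlo)/ltW/(lt_le_trans lohi).
move=> x; rewrite -bE; congr (_ - _).
rewrite -(funext (bE n)).
rewrite (hE (fun f => ip (b n) f * f x)).
have E (I : finType) (G : I -> fam R Zf) : \sum_i ip (b n) (G i n) * G i n x =
   avg (fun y => b n y * \sum_i G i n x * Num.conj (G i n y)).
  under [RHS]eq_avg => y do rewrite mulr_sumr.
  rewrite avg_sum; apply: eq_bigr => i _; rewrite /ip -avgZr; apply: eq_avg => y; ring.
rewrite (E _ g); under [RHS]eq_avg => y do rewrite h'E.
rewrite -(E _ g'); apply: eq_bigr => i _.
have -> : ip (b n) (g2 i n) = (K'^-1)%:C * ip (b n) (g' i n).
  by rewrite ipC ipZ rmorphM /= conjR -ipC.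
rewrite /g2 fmorphV rmorphXn /=; field; by [].
Qed.
End Span.

Definition leb (s0 s : seq bool) := all2 implb s0 s.
Lemma leb_size s0 s : leb s0 s -> size s0 = size s.
Proof. by rewrite /leb all2E => /andP[/eqP]. Qed.
Lemma leb_refl s : leb s s.
Proof. by elim: s => //= -[] s ->. Qed.
Lemma leb_count s0 s : leb s0 s -> (count id s0 <= count id s)%N.
Proof. by elim: s0 s => [|[] s0 IH] [|[] s] //= /IH h; rewrite ?add1n ?add0n // (leq_trans h) // leq_addl. Qed.
Lemma leb_count_eq s0 s : leb s0 s -> (count id s <= count id s0)%N -> s = s0.
Proof.
elim: s0 s => [|a s0 IH] [|b s] //=; case: a; case: b => //= h.
- by rewrite leq_add2l => /(IH _ h) ->.
- by rewrite add1n add0n ltnNge leb_count.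
- by rewrite !add0n => /(IH _ h) ->.
Qed.

(** * Equidistribution of cubes *)

Section PinnedLaw.
Variables (R : realType) (Z : finZmodType).
Local Notation C := R[i].
Implicit Types (F G : seq bool -> Z -> C).
(** The face of the vertices above [s]: ones are frozen, zeros are free. *)
Definition pat (s : seq bool) := [seq if b then Some true else None | b <- s].
Arguments pat : simpl never.
Lemma pat_true s : pat (true :: s) = Some true :: pat s. Proof. by []. Qed.
Lemma pat_false s : pat (false :: s) = None :: pat s. Proof. by []. Qed.
Lemma nS_pat s : nS (pat s) = count id s.
Proof. by rewrite /nS count_map; apply: eq_count; case. Qed.

Lemma cp_one s0 F hs x : size hs = nN (pat s0) -> (forall s y, leb s0 s -> F s y = 1) -> cp (pat s0) F hs x = 1.
Proof.
elim: s0 F hs x => [|[] s0 IH] F hs x; first by move=> _ h; exact: h.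
  by rewrite pat_true nN_Some => sz h; apply: IH => // s y hs'; apply: h.
case: hs => [|h hs]; rewrite pat_false nN_None // => -[sz] hF.
rewrite [LHS]/= !IH ?mulr1 // => s y hs'; exact: hF.
Qed.
Lemma cp_above s0 F hs x : size hs = nN (pat s0) -> (forall s y, leb s0 s -> s != s0 -> F s y = 1) ->
  cp (pat s0) F hs x = F s0 x.
Proof.
elim: s0 F hs x => [|[] s0 IH] F hs x //.
  rewrite pat_true nN_Some => sz h; apply: (IH (fun s => F (true :: s))) => // s y hs' ne.
  by apply: h => //; rewrite eqseq_cons.
case: hs => [|h hs]; rewrite pat_false nN_None // => -[sz] hF.
rewrite [LHS]/= IH // => [|s y hs' ne]; last by apply: hF => //; rewrite eqseq_cons.
by rewrite cp_one ?mulr1 // => s y hs'; apply: hF.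
Qed.
(** On the face above [s0] only the factor at [s0] is left, and [GVN] freezes one coordinate for
    each 1 of [s0]. *)
Lemma GP_law s0 F : le1F F -> (forall s y, leb s0 s -> s != s0 -> F s y = 1) ->
  ab (GP (size s0) F) ^+ (2 ^ count id s0) <= u (count id s0) (F s0).
Proof.
move=> hF h; have := GVN (pat s0) hF; rewrite size_map nS_pat => /le_trans; apply.
rewrite (@eq_Eh _ _ _ _ (fun=> u (count id s0) (F s0))) => [|hs sz]; last first.
  by congr (u _ _); apply: funext => x; exact: cp_above.
by rewrite /Eh avg_const ?tuple_gt0.
Qed.
(** [GP_law] with a fixed base point. At the first coordinate of [s0] equal to 1 the upper face has
    a free base point, since [x + h] is equidistributed; one more Cauchy-Schwarz removes the pinned
    face. This is why [s0] must have a nonzero coordinate. *)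
Lemma pin_law s0 F x : le1F F -> has id s0 -> (forall s y, leb s0 s -> s != s0 -> F s y = 1) ->
  ab (Eh (size s0) (fun hs => cprod F hs x)) ^+ (2 ^ (count id s0).+1) <= u (count id s0) (F s0).
Proof.
elim: s0 F x => [|[] s0 IH] F x //= hF hs0 h; rewrite EhS; last first.
  pose G h s y := F (false :: s) y * F (true :: s) (y + h).
  have -> : avg (fun h => Eh (size s0) (fun hs => cprod (fun s => F (false :: s)) hs x *
     cprod (fun s => F (true :: s)) hs (x + h))) = avg (fun h => Eh (size s0) (fun hs => cprod (G h) hs x)).
    apply: eq_avg => t; apply: eq_Eh => hs _.
    by rewrite cprodM (cprod_shift (fun s => F (true :: s))).
  rewrite add0n; apply: le_trans (_ : avg (fun h => ab (Eh (size s0) (fun hs => cprod (G h) hs x))) ^+ (2 ^ (count id s0).+1) <= _).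
    rewrite lerXn2r ?nnegrE ?ab_ge0 ?ab_avg //.
    by apply: avg_ge0 => t; rewrite ab_ge0.
  apply: le_trans (avg_exp2 _ _) _ => [t|]; first exact: ab_ge0.
  apply: avg_le => [|t]; first exact: u_ge0.
  apply: le_trans (IH (G t) x _ hs0 _) _.
  - by move=> s y; rewrite abM mulr_ile1 ?ab_ge0 ?hF.
  - by move=> s y ls ne; rewrite /G !h ?mulr1 // eqseq_cons.
  rewrite le_eqVlt; apply/orP; left; apply/eqP; congr (u _ _); apply: funext => y.
  by rewrite /G [F (true :: _) _]h ?mulr1 //= leb_refl.
pose F1 s := F (true :: s).
have -> : avg (fun h => Eh (size s0) (fun hs => cprod (fun s => F (false :: s)) hs x * cprod F1 hs (x + h)))
   = Eh (size s0) (fun hs => cprod (fun s => F (false :: s)) hs x * avg (cprod F1 hs)).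
  rewrite /Eh avg_exch; apply: eq_avg => hs; rewrite avgZ; congr (_ * _).
  exact: avg_addl.
(* The upper face and its conjugate on opposite faces: the average of its squared modulus becomes a
   Gowers product. *)
pose F' s y := if s is b :: s' then (if b then Num.conj (F1 s' y) else F1 s' y) else 1.
have F'1 : le1F F'.
  move=> [|[] s] y; rewrite /F'; first by rewrite ab1.
    by rewrite ab_conj; exact: (hF (true :: s)).
  exact: (hF (true :: s)).
have e1 : ab (GP (size s0).+1 F') = Eh (size s0) (fun hs => ab (avg (cprod F1 hs)) ^+ 2).
  rewrite GPS -[RHS]ger0_norm; last by apply: avg_ge0 => hs; rewrite sqr_ge0.
  rewrite -abR /Eh avgC; congr (ab _); apply: eq_avg => hs.
  have -> : avg (cprod (fun s => F' (true :: s)) hs) = Num.conj (avg (cprod F1 hs)).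
    by rewrite conj_avg; apply: eq_avg => y; rewrite -cprod_conj.
  exact: mulcJ.
rewrite expnS exprM.
apply: le_trans (_ : ab (GP (size s0).+1 F') ^+ (2 ^ (1 + count id s0)) <= _).
  rewrite lerXn2r ?nnegrE ?exprn_ge0 ?ab_ge0 // e1.
  apply: le_trans (_ : Eh (size s0) (fun hs => ab (avg (cprod F1 hs))) ^+ 2 <= _); last exact: avg_sqr.
  rewrite ler_pXn2r ?nnegrE ?ab_ge0 //; last by apply: avg_ge0 => hs; exact: ab_ge0.
  apply: le_trans (ab_avg _) _; apply: ler_avg => hs; rewrite abM ler_piMl ?ab_ge0 //.
  by apply: cprod_le1 => s.
have := GVN (Some false :: pat s0) F'1; rewrite nS_Some nN_Some nS_pat [size _]/= size_map add1n => /le_trans; apply.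
rewrite (@eq_Eh _ _ _ _ (fun=> u (count id s0).+1 (F (true :: s0)))) => [|hs sz]; last first.
  congr (u _ _); apply: funext => y; apply: (@cp_above s0 F1) => // s z ls ne.
  by apply: h => //; rewrite eqseq_cons.
by rewrite /Eh avg_const ?tuple_gt0.
Qed.
End PinnedLaw.

Section AltSum.
Variable A : zmodType.
Implicit Types (f g : seq bool -> A).
Fixpoint alt d f : A := if d is d'.+1 then
  alt d' (fun s => f (false :: s)) - alt d' (fun s => f (true :: s)) else f [::].
Lemma eq_alt d f g : (forall s, size s = d -> f s = g s) -> alt d f = alt d g.
Proof.
elim: d f g => [|d IH] f g h /=; first exact: h.
by congr (_ - _); apply: IH => s sz; apply: h; rewrite /= sz.
Qed.
Lemma altB d f g : alt d (fun s => f s - g s) = alt d f - alt d g.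
Proof.
elim: d f g => [|d IH] f g //=.
by rewrite (IH (fun s => f (false :: s))) (IH (fun s => f (true :: s))) !opprD !opprK addrACA.
Qed.
Lemma alt_top d f g : alt d f = alt d g -> (forall s, size s = d -> s != nseq d true -> f s = g s) ->
  f (nseq d true) = g (nseq d true).
Proof.
elim: d f g => [|d IH] f g //= e h; apply: (IH (fun s => f (true :: s)) (fun s => g (true :: s))).
  apply: oppr_inj; move: e; rewrite (@eq_alt d (fun s => f (false :: s)) (fun s => g (false :: s))).
    by move/addrI.
  by move=> s sz; apply: h; rewrite /= ?sz.
by move=> s sz ne; apply: h; rewrite /= ?sz // eqseq_cons.
Qed.
Lemma alt_zero d : alt d (fun=> 0) = 0.
Proof. by elim: d => //= d ->; rewrite subr0. Qed.
Lemma alt_single d f : (forall s, size s = d -> s != nseq d false -> f s = 0) -> alt d f = f (nseq d false).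
Proof.
elim: d f => [|d IH] f h //=.
rewrite (@eq_alt d (fun s => f (true :: s)) (fun=> 0)) => [|s sz]; last by apply: h; rewrite /= ?sz.
by rewrite alt_zero subr0 IH // => s sz ne; apply: h; rewrite /= ?sz // eqseq_cons.
Qed.
End AltSum.

Section Cubes.
Variable Z : finZmodType.
Implicit Types (hs : seq Z) (x : Z) (s v w : seq bool).

Lemma dot_cat s s' hs hs' : size s = size hs -> dot (s ++ s') (hs ++ hs') = dot s hs + dot s' hs'.
Proof.
elim: s hs => [|b s IH] [|h hs] //= => [_|[sz]]; first by rewrite add0r.
by rewrite IH // addrA.
Qed.
(** Negated edges in the coordinates of [v]. The cube at [x + dot v hs] with edges
    [zadd (nvm v hs) hs'] has its vertices among the points [x + dot s hs + dot w hs'], with [s]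
    given by [mixv] ([dot_mix]). *)
Fixpoint nvm v hs := if v is b :: v' then if hs is h :: hs' then (if b then - h else 0) :: nvm v' hs' else [::] else [::].
Lemma size_nvm v hs : size v = size hs -> size (nvm v hs) = size hs.
Proof. by elim: v hs => [|b v IH] [|h hs] //= [/IH ->]. Qed.
Lemma size_zadd hs hs' : size hs = size hs' -> size (zadd hs hs') = size hs.
Proof. by elim: hs hs' => [|h hs IH] [|h' hs'] //= [/IH ->]. Qed.
Fixpoint mixv v w := if v is b :: v' then if w is c :: w' then (b && ~~ c) :: mixv v' w' else [::] else [::].
Lemma size_mixv v w : size v = size w -> size (mixv v w) = size v.
Proof. by elim: v w => [|b v IH] [|c w] //= [/IH ->]. Qed.
Lemma dot_mix v w hs hs' : size v = size w -> size v = size hs -> size hs' = size hs ->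
  dot v hs + dot w (zadd (nvm v hs) hs') = dot (mixv v w) hs + dot w hs'.
Proof.
elim: v w hs hs' => [|b v IH] [|c w] [|h hs] [|h' hs'] //= [s1] [s2] [s3].
rewrite addrACA IH //; case: b c => [] [] /=; rewrite ?add0r ?addr0.
- by rewrite [h + (_ + _)]addrA subrr add0r addrCA.
- by rewrite addrA.
- by rewrite addrCA.
- by [].
Qed.

Variable A : zmodType.
Implicit Type u : Z -> A.
Definition du u hs x := alt (size hs) (fun s => u (x + dot s hs)).
Lemma du_cons u h hs x : du u (h :: hs) x = du u hs x - du u hs (x + h).
Proof.
rewrite /du /=; congr (_ - _); apply: eq_alt => s _; first by rewrite add0r.
by rewrite addrA.
Qed.
Lemma duB u u' hs x : du (fun y => u y - u' y) hs x = du u hs x - du u' hs x.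
Proof. exact: altB. Qed.
(* The cubes on the right-hand side have independent random edges as soon as [hs'] has. *)
Lemma du_split u hs hs' x : size hs' = size hs ->
  du u hs x = alt (size hs) (fun v => du u (zadd (nvm v hs) hs') (x + dot v hs)).
Proof.
elim: hs hs' x => [|h hs IH] [|h' hs'] x //= => [_|[sz]]; first by rewrite addr0.
rewrite du_cons (IH hs' x sz) (IH hs' (x + h) sz) -!altB; apply: eq_alt => v _.
rewrite !du_cons !add0r [x + (h + _)]addrA.
have -> : x + h + dot v hs + (- h + h') = x + dot v hs + h'.
  by rewrite addrAC -!addrA; congr (_ + _); rewrite !addrA subrr add0r addrC.
by rewrite opprB addrA subrK.
Qed.

(** Inserts the bits of [t] at the positions where [s] is 1; this parametrises the vertices below
    [s]. *)
Fixpoint emb s (t : seq bool) : seq bool :=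
  match s with
  | [::] => [::]
  | true :: s' => head false t :: emb s' (behead t)
  | false :: s' => false :: emb s' t
  end.
Lemma size_emb s t : size (emb s t) = size s.
Proof. by elim: s t => [|[] s IH] t //=; rewrite IH. Qed.
Lemma leb_emb s t : leb (emb s t) s.
Proof. by elim: s t => [|[] s IH] t //=; rewrite IH ?implybT. Qed.
Lemma count_emb s t : size t = count id s -> count id (emb s t) = count id t.
Proof.
elim: s t => [|[] s IH] t /=; first by case: t.
  by case: t => [|b t] //=; rewrite add1n => -[h]; rewrite IH.
by rewrite !add0n; exact: IH.
Qed.
Lemma emb_true s : emb s (nseq (count id s) true) = s.
Proof. by elim: s => [|[] s IH] //=; rewrite IH. Qed.
Lemma dot_emb s t hs : size s = size hs -> size t = count id s -> dot (emb s t) hs = dot t (mask s hs).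
Proof.
elim: s t hs => [|[] s IH] t [|h hs] //=; first by case: t.
  by case: t => [|b t] //= [sz] [st]; rewrite IH.
by move=> [sz] st; rewrite add0r IH.
Qed.

(* The derivative of [u] over a [K]-cube depends only on the [eqv]-classes of its vertices. *)
Definition exact K (eqv : Z -> Z -> Prop) u := forall x hs x' hs', size hs = K -> size hs' = K ->
  (forall s, size s = K -> eqv (x + dot s hs) (x' + dot s hs')) -> du u hs x = du u hs' x'.

Section System.
Variables (I : finType) (dg : I -> nat) (g : I -> Z -> A).
Definition low D x x' := forall j, (dg j < D)%N -> g j x = g j x'.
Hypothesis ex : forall i, exact (dg i).+1 (low (dg i)) (g i).

(** In an exact system the values at vertices of weight at most the degree determine all others. At
    a vertex [s] of larger weight, exactness on a face of dimension [dg i + 1] with top vertex [s]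
    expresses the value by vertices of smaller weight and phases of lower degree. *)
Lemma det N (S : pred (seq bool)) x hs x' hs' : (forall s s', leb s s' -> S s' -> S s) ->
  size hs = N -> size hs' = N ->
  (forall s i, size s = N -> S s -> (count id s <= dg i)%N -> g i (x + dot s hs) = g i (x' + dot s hs')) ->
  forall s i, size s = N -> S s -> g i (x + dot s hs) = g i (x' + dot s hs').
Proof.
move=> Sd sz sz' h s i; move: {2}(dg i).+1 (ltnSn (dg i)) => D.
elim: D i s => // D IHD i s dD.
have [c] := ubnP (count id s); elim: c s => // c IHc s hc ss Ss.
case: (leqP (count id s) (dg i)) => cs; first exact: h.
(* The first [a] ones of [s] stay fixed; the face is spanned by the last [dg i + 1] of them. *)
pose a := (count id s - (dg i).+1)%N.
have ca : (a + (dg i).+1 = count id s)%N by rewrite subnK.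
pose p := nseq a true.
have szm (l : seq Z) : size l = N -> size (mask s l) = count id s by move=> e; rewrite size_mask // ss e.
have E (y : Z) (l : seq Z) t : size l = N -> size t = (dg i).+1 ->
    y + dot p (take a (mask s l)) + dot t (drop a (mask s l)) = y + dot (emb s (p ++ t)) l.
  move=> e et; rewrite dot_emb ?ss ?e //; last by rewrite size_cat size_nseq et.
  rewrite -addrA; congr (_ + _); rewrite -{3}(cat_take_drop a (mask s l)) dot_cat //.
  by rewrite size_nseq size_take szm // -ca; case: ltnP => //; lia.
have szd (l : seq Z) : size l = N -> size (drop a (mask s l)) = (dg i).+1.
  by move=> e; rewrite size_drop szm // -ca addKn.
have Semb t : S (emb s t) by apply: Sd Ss; exact: leb_emb.
have := ex (x := x + dot p (take a (mask s hs))) (szd _ sz) (szd _ sz')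
  (x' := x' + dot p (take a (mask s hs'))).
rewrite /du !szd // => /(_ _)/alt_top.
rewrite !E ?size_nseq // -nseqD ca emb_true; apply.
  move=> t st j dj; rewrite !E //; apply: IHD; rewrite ?size_emb //.
  by apply: leq_trans dj _; rewrite -ltnS.
move=> t st ne; rewrite !E //; apply: IHc; rewrite ?size_emb //.
rewrite count_emb ?size_cat ?size_nseq ?st // count_cat count_nseq mul1n.
rewrite -ltnS; apply: leq_trans hc; rewrite ltnS -ca ltn_add2l ltnNge.
apply: contra ne => hle; apply/eqP; rewrite -st.
apply/all_pred1P; have := hle; rewrite -st => h1.
have : count id t == size t by rewrite eqn_leq count_size.
by rewrite -all_count; apply: sub_all => -[].
Qed.
End System.
End Cubes.

(** * Fourier analysis over Z/m *)

Section Char.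
Variables (R : realType) (m' : nat).
Local Notation C := R[i].
Local Notation A := 'I_m'.+1.

Lemma prim_ex : exists z : C, m'.+1.-primitive_root z.
Proof.
pose p : {poly C} := 'X^(m'.+1) - 1; have [r Dp] := closed_field_poly_normal p.
rewrite (monicP _) ?monicXnsubC // scale1r in Dp.
have rn1: all m'.+1.-unity_root r by apply/allP=> z; rewrite -root_prod_XsubC -Dp.
have sz_r: (m'.+1 < (size r).+1)%N.
  by rewrite -(size_prod_XsubC r id) -Dp size_XnsubC.
have [|z] := hasP (has_prim_root (ltn0Sn m') rn1 _ sz_r); last by exists z.
by rewrite -separable_prod_XsubC -Dp separable_Xn_sub_1 // pnatr_eq0.
Qed.
Definition om : C := projT1 (cid prim_ex).
Lemma om_prim : m'.+1.-primitive_root om. Proof. exact: projT2 (cid prim_ex). Qed.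
Definition E (a : A) : C := om ^+ a.

Lemma E0 : E 0 = 1. Proof. by []. Qed.
Lemma ED a b : E (a + b) = E a * E b.
Proof. by rewrite /E /= (prim_expr_mod om_prim) exprD. Qed.
Lemma ab_E a : ab (E a) = 1.
Proof.
have h : ab om ^+ m'.+1 = 1 by rewrite -abX (prim_expr_order om_prim) ab1.
by rewrite /E abX; move/eqP: h; rewrite pexpr_eq1 ?ab_ge0 // => /eqP ->; rewrite expr1n.
Qed.
Lemma EJ a : E a * Num.conj (E a) = 1.
Proof. by rewrite mulcJ ab_E expr1n. Qed.
Lemma EN a : E (- a) = Num.conj (E a).
Proof.
have h : E (- a) * E a = 1 by rewrite -ED addrC subrr E0.
by rewrite -[LHS]mulr1 -(EJ a) mulrA h mul1r.
Qed.
Lemma EB a b : E (a - b) = E a * Num.conj (E b). Proof. by rewrite ED EN. Qed.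
Lemma E_sum (T : Type) (r : seq T) (P : pred T) (f : T -> A) :
  E (\sum_(i <- r | P i) f i) = \prod_(i <- r | P i) E (f i).
Proof. exact: (big_morph E ED E0). Qed.
Lemma E_inj a b : E a = E b -> a = b.
Proof.
move/eqP; rewrite /E (eq_prim_root_expr om_prim) !modn_small ?ltn_ord //.
by move/eqP/val_inj.
Qed.
Lemma Emul (a : A) k : E (a *+ k) = E a ^+ k.
Proof. by elim: k => [|k IH]; rewrite ?mulr0n ?expr0 // mulrS ED IH exprS. Qed.
Lemma A_torsion (a : A) : a *+ m'.+1 = 0.
Proof. by apply: E_inj; rewrite Emul E0 /E -exprM mulnC exprM (prim_expr_order om_prim) expr1n. Qed.

Lemma char_avg (G : finZmodType) (chi : G -> C) g0 :
  (forall x, chi (x + g0) = chi x * chi g0) -> chi g0 != 1 -> avg chi = 0.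
Proof.
move=> h ne; have := avg_addr chi g0; under eq_avg => x do rewrite h.
rewrite avgZr => /eqP; rewrite -subr_eq0 -[X in _ - X]mulr1 -mulrBr mulf_eq0 subr_eq0 (negbTE ne) orbF.
by move/eqP.
Qed.

Section Fourier.
Variable V : finType.
Local Notation G := {ffun V -> A}.
(** The pairing of [(Z/m)^V] with itself; the residue [e v] acts as a natural number, and
    [mulrn_mod] makes this additive in [e]. *)
Definition pair (e z : G) : A := \sum_v z v *+ e v.
Lemma mulrn_mod (a : A) k : a *+ (k %% m'.+1) = a *+ k.
Proof. by rewrite [in RHS](divn_eq k m'.+1) mulrnDr mulrnA mulrnAC A_torsion mul0rn add0r. Qed.
Lemma pairD e e' z : pair (e + e') z = pair e z + pair e' z.
Proof.
rewrite /pair -big_split; apply: eq_bigr => v _.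
by rewrite ffunE /= mulrn_mod mulrnDr.
Qed.
Lemma pairB e z z' : pair e (z - z') = pair e z - pair e z'.
Proof.
rewrite /pair -sumrB; apply: eq_bigr => v _.
by rewrite !ffunE mulrnBl.
Qed.
Lemma pair_orth (z : G) : avg (fun e => E (pair e z)) = (z == 0)%:R.
Proof.
have [->|/eqP nz] := eqVneq z 0.
  have p0 e : pair e 0 = 0 by rewrite /pair big1 // => v _; rewrite ffunE mul0rn.
  under eq_avg => e do rewrite p0 E0.
  by rewrite avg_const ?eqxx // zmod_gt0.
have [v hv] : exists v, z v != 0.
  apply: contrapT => /forallNP h; apply: nz; apply/ffunP => v; rewrite ffunE.
  by apply/eqP; apply: contrapT => /negP; exact: h.
have -> : (false%:R : C) = 0 by [].
pose g0 : G := [ffun w => if w == v then inord 1 else 0 : A].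
apply: (@char_avg G (fun e => E (pair e z)) g0).
  by move=> e; rewrite pairD ED.
rewrite /g0 /pair (bigD1 v) //= big1 ?addr0 => [|w wv]; last by rewrite ffunE (negbTE wv) mulr0n.
rewrite ffunE eqxx -E0; apply: contra hv => /eqP/E_inj.
have [e|m1] := posnP m'.
  by move=> _; apply/eqP; apply: E_inj; rewrite /E; case: (z v) => -[|k] //= hk; exfalso; move: hk; rewrite e.
by rewrite inordK ?ltnS // mulr1n => ->.
Qed.
Lemma fourier (Phi : G -> C) : (forall z, ab (Phi z) <= 1) ->
  exists2 c : G -> C, (forall e, ab (c e) <= 1) & forall z, Phi z = \sum_e c e * E (pair e z).
Proof.
move=> h; exists (fun e => avg (fun w => Phi w * Num.conj (E (pair e w)))).
  move=> e; apply: le_trans (ab_avg _) _; apply: avg_le => // w.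
  by rewrite abM ab_conj ab_E mulr1.
move=> z; transitivity (avg (fun w => Phi w * \sum_e E (pair e (z - w)))); last first.
  transitivity (avg (fun w => \sum_e Phi w * Num.conj (E (pair e w)) * E (pair e z))).
    apply: eq_avg => w; rewrite mulr_sumr; apply: eq_bigr => e _.
    by rewrite pairB EB; ring.
  by rewrite avg_sum; apply: eq_bigr => e _; rewrite avgZr.
have G0 : (#|G|%:R : C) != 0 by rewrite pnatr_eq0 -lt0n zmod_gt0.
have S w : \sum_e E (pair e (z - w)) = #|G|%:R * (z == w)%:R.
  by rewrite -subr_eq0 -pair_orth /avg mulrC divfK.
rewrite /avg (bigD1 z) //= S eqxx mulr1 big1 ?addr0 ?mulfK // => w wz.
by rewrite S eq_sym (negbTE wz) !mulr0.
Qed.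
End Fourier.

Section DuChar.
Variable Z : finZmodType.
Lemma E_du (w : Z -> A) hs x : cprod (fun s y => cj s (E (w y))) hs x = E (du w hs x).
Proof.
elim: hs x => [|h hs IH] x; first by rewrite /= /du /= addr0.
rewrite du_cons EB -!IH /= -cprod_conj; congr (_ * _); apply: eq_cprod => s y _; by rewrite cj_cons.
Qed.
Lemma big_tupleS (T : Type) (idx : T) (op : Monoid.com_law idx) d (f : seq bool -> T) :
  \big[op/idx]_(s : d.+1.-tuple bool) f s =
  op (\big[op/idx]_(s : d.-tuple bool) f (false :: s)) (\big[op/idx]_(s : d.-tuple bool) f (true :: s)).
Proof.
pose c (bs : bool * d.-tuple bool) : d.+1.-tuple bool := [tuple of bs.1 :: bs.2].
rewrite (reindex c) /=; last first.
  exists (fun t => (thead t, [tuple of behead t])) => [[b s] _|t _].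
    by rewrite /c /= theadE; congr (_, _); apply: val_inj.
  by rewrite /c /= -tuple_eta.
rewrite -(pair_bigA _ (fun b (s : d.-tuple bool) => f (b :: s))) /= big_bool Monoid.mulmC.
by [].
Qed.
Lemma cprodE (F : seq bool -> Z -> C) hs x :
  cprod F hs x = \prod_(s : (size hs).-tuple bool) F s (x + dot s hs).
Proof.
elim: hs F x => [|h hs IH] F x.
  rewrite /= (eq_bigr (fun=> F [::] x)) => [|s _]; last by rewrite tuple0 /= addr0.
  by rewrite prodr_const card_tuple expn0.
rewrite /= !IH (big_tupleS _ (size hs) (fun s => F s (x + dot s (h :: hs)))).
by congr (_ * _); apply: eq_bigr => s _ /=; rewrite ?add0r ?addrA.
Qed.
End DuChar.
End Char.

(** * Derivatives of exact phases are structured *)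

Section Phase.
Variable R : realType.
Context (W : set_system nat) {UW : UltraFilter W}.
Variable Z : nat -> finZmodType.
Local Notation C := R[i].
Local Notation ev := (ev W).
Local Notation Zf := (Zf Z).
Variable m' : nat.
Local Notation A := 'I_m'.+1.
Local Notation E := (@E R m').

Definition ind (T : eqType) (p : forall n, Z n -> T) (t : T) : fam R Zf := fun n x => (p n x == t)%:R.
Arguments ind {T} p t n x.
Lemma ab_bool (b : bool) : ab (b%:R : C) <= 1.
Proof. by case: b; rewrite ?ab1 ?ab0. Qed.

(** By exactness the derivative at [x] with step [t] is determined by the type of any cube with
    first edge [t] and by the phases at its other vertices. Summing over the finitely many types
    [tau] and averaging over the other edges leaves, for each [tau], indicators at [x] and [x + t]
    times a dual function whose factor at the base vertex is 1. *)
Lemma diff_phase k (T : finType) (p : forall n, Z n -> T) (v : forall n, Z n -> A)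
    (P : nat -> finType) (al : forall n, P n -> Z n) : (forall n, 0 < #|P n|)%N ->
  (forall t, Cl W (@Bf R Z k) (ind p t)) ->
  ev (fun n => exact k.+1 (fun x y => p n x = p n y) (v n)) ->
  Cl W (@BP R Z k P) (fun n xq => E (v n xq.1) * Num.conj (E (v n (xq.1 + al n xq.2)))).
Proof.
move=> P0 hp hex; pose TT := {ffun k.+1.-tuple bool -> T}.
pose ty n x hs : TT := [ffun s : k.+1.-tuple bool => p n (x + dot s hs)].
(* The derivative as a function of the type, well defined by exactness; types that do not occur get
   0. *)
pose rho n (tau : TT) : A := if pselect (exists xh : Z n * seq (Z n), size xh.2 = k.+1 /\ ty n xh.1 xh.2 = tau)
  is left h then (fun xh => du (v n) xh.2 xh.1) (projT1 (cid h)) else 0.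
have hrho : ev (fun n => forall x hs, size hs = k.+1 -> du (v n) hs x = rho n (ty n x hs)).
  apply: evS hex => n ex x hs sz; rewrite /rho; case: pselect => [h|[]]; last by exists (x, hs).
  case: (cid h) => -[x' hs'] /= [sz' e]; apply: ex => // s ss.
  have := congr1 (fun f : TT => f (tcast ss (in_tuple s))) e.
  by rewrite !ffunE val_tcast.
pose z := nseq k false.
pose w n t y := v n y - v n (y + t).
pose I n (tau : TT) t (s : seq bool) y : C :=
  if insub s is Some s' then ((p n y == tau [tuple of false :: (s' : k.-tuple bool)]) && (p n (y + t) == tau [tuple of true :: s']))%:R else 1.
pose G n tau t s y := upd (fun s y => I n tau t s y * Num.conj (cj s (E (w n t y)))) z (fun=> 1) s y.
have I1 n tau t s y : ab (I n tau t s y) <= 1.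
  by rewrite /I; case: insubP => [s' _ _|_]; rewrite ?ab1 // ab_bool.
have G1 n tau t : le1F (G n tau t).
  by apply: upd_le1 => [s y|y]; rewrite ?ab1 // abM ab_conj ab_cj ab_E mulr1.
pose bb tau : fam R (ZP Z P) := fun n xt => Eh k (fun hs => cprod (G n tau (al n xt.2)) hs xt.1).
have Bbb tau n t : B k (fun x => bb tau n (x, t)).
  exists (G n tau (al n t)); split=> //; exists 1 => x.
  by rewrite /G /upd eqxx.
pose f tau : fam R (ZP Z P) := fun n xt => E (rho n tau) *
  (ind p (tau [tuple of false :: nseq k false]) n xt.1 * ind p (tau [tuple of true :: nseq k false]) n (xt.1 + al n xt.2) * bb tau n xt).
have cf tau : Cl W (@BP R Z k P) (f tau).
  have bi t : bdd W (ind p t) by apply: (@bdd1 R W _ _ _ 1) => n x; exact: ab_bool.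
  apply: (@Cl_scale R W _ (ZP Z P) (@BP R Z k P) _ (fun n => E (rho n tau)) 1); first exact: good_BP.
    by apply: evT => n; rewrite ab_E.
  apply: P_mul; last by apply: Cl_base; apply: evT => n t; exact: Bbb.
    by apply: (@bdd1 R W _ _ _ 1) => n [x t]; exact: (B_le1 (Bbb tau n t)).
  apply: P_mul.
  - exact: (@bdd_pull R W _ (ZP Z P) Zf (fun n xt => xt.1 + al n xt.2)).
  - apply: (Cl_eq _ (@P_pullS R W _ Z k P (fun n t => 0) (ind p (tau [tuple of false :: nseq k false])) P0 (hp _))).
    by apply: evT => n xt; rewrite addr0.
  - exact: (@P_pullS R W _ Z k P al _ P0 (hp _)).
apply: (Cl_eq _ (Cl_sum (index_enum TT) (fun tau => cf tau))).
apply: evS hrho => n h [x q] /=; set t := al n q; rewrite -EB -/(w n t x).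
have key hs : size hs = k -> E (w n t x) = \sum_(tau : TT) E (rho n tau) *
  (ind p (tau [tuple of false :: nseq k false]) n x * ind p (tau [tuple of true :: nseq k false]) n (x + t) *
   cprod (G n tau t) hs x).
  move=> sz; have e1 : E (w n t x) = E (rho n (ty n x (t :: hs))) *
      Num.conj (cprod (upd (fun s y => cj s (E (w n t y))) z (fun=> 1)) hs x).
    have h0 : cprod (upd (fun s y => cj s (E (w n t y))) z (fun y => E (w n t y))) hs x = E (rho n (ty n x (t :: hs))).
      rewrite -h ?[size _]/= ?sz // du_cons.
      have -> : du (v n) hs x - du (v n) hs (x + t) = du (w n t) hs x.
        rewrite /w (duB (v n) (fun y => v n (y + t))); congr (_ - _); rewrite /du.
        by apply: eq_alt => s _; rewrite addrAC.
      rewrite -E_du; apply: eq_cprod => s y _; rewrite /upd; case: eqP => // ->.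
      by rewrite /cj count_nseq mul0n.
    rewrite -h0 /z -sz cprod_upd0 -mulrA mulcJ.
    have -> : ab (cprod (upd (fun s y => cj s (E (w n t y))) (nseq (size hs) false) (fun=> 1)) hs x) = 1.
      rewrite cprodE ab_prod big1 // => s _; rewrite /upd; case: eqP => _; first exact: ab1.
      by rewrite ab_cj ab_E.
    by rewrite expr1n mulr1.
  have e2 (tau : TT) : ind p (tau [tuple of false :: nseq k false]) n x * ind p (tau [tuple of true :: nseq k false]) n (x + t) *
     cprod (G n tau t) hs x = (ty n x (t :: hs) == tau)%:R *
       Num.conj (cprod (upd (fun s y => cj s (E (w n t y))) z (fun=> 1)) hs x).
    have e3 : cprod (G n tau t) hs x = cprod (upd (I n tau t) z (fun=> 1)) hs x *
        Num.conj (cprod (upd (fun s y => cj s (E (w n t y))) z (fun=> 1)) hs x).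
      rewrite -cprod_conj -cprodM; apply: eq_cprod => s y _; rewrite /G /upd.
      by case: eqP => // _; rewrite conjC1 mulr1.
    rewrite e3 mulrA; congr (_ * _).
    have -> : ind p (tau [tuple of false :: nseq k false]) n x * ind p (tau [tuple of true :: nseq k false]) n (x + t) = I n tau t z x.
      rewrite /I insubT ?size_nseq // => h'; rewrite /ind -natrM mulnb.
      by congr ((_ && _)%:R); congr (_ == tau _); apply: val_inj.
    have := cprod_upd0 (I n tau t) hs (I n tau t z) x; rewrite sz -/z => <-.
    have -> : cprod (upd (I n tau t) z (I n tau t z)) hs x = cprod (I n tau t) hs x.
      by apply: eq_cprod => s y _; rewrite /upd; case: eqP => // ->.
    rewrite cprodE; case: eqP => [<-|ne] /=.
      rewrite big1 // => s _; rewrite /I; case: insubP => // s' _ es'.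
      by rewrite !ffunE /= es' add0r addrA addrAC !eqxx.
    apply/eqP/negPn/negP; rewrite prodf_seq_neq0 => /allP hall; apply: ne; apply/ffunP => s.
    rewrite ffunE; case/tupleP: s => b s.
    have := hall (tcast (esym sz) s) (mem_index_enum _).
    rewrite /= /I val_tcast valK pnatr_eq0 eqb0 negbK => /andP[/eqP a1 /eqP a2].
    by case: b => /=; [rewrite -a2 | rewrite -a1]; congr (p n _); rewrite ?add0r // addrA addrAC.
  rewrite (bigD1 (ty n x (t :: hs))) //= e2 eqxx mul1r -e1 big1 ?addr0 // => tau ne.
  by rewrite e2 eq_sym (negbTE ne) mul0r mulr0.
symmetry; transitivity (@Eh _ (Z n) k (fun hs => E (w n t x))); first by rewrite /Eh avg_const ?tuple_gt0.
rewrite (eq_Eh key) /Eh avg_sum; apply: eq_bigr => tau _.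
by rewrite /f /bb !avgZ.
Qed.
Lemma hat_phase k (T : finType) (p : forall n, Z n -> T) (v : forall n, Z n -> A) :
  (forall t, Cl W (@Bf R Z k) (ind p t)) ->
  ev (fun n => exact k.+1 (fun x y => p n x = p n y) (v n)) ->
  Cl W (@BK R Z k) (hat (fun n x => E (v n x))).
Proof. by move=> hp hex; apply: (diff_phase (P := Zf) (fun n t => t) (Z_gt0 Z) hp hex). Qed.
End Phase.

(** * Doubling directions *)

Section Lists.
Variables (R : realType) (Z : finZmodType).
Local Notation C := R[i].
Lemma cprod_cat (F : seq bool -> Z -> C) hs hs' x :
  cprod F (hs ++ hs') x = cprod (fun s y => cprod (fun s' => F (s ++ s')) hs' y) hs x.
Proof. by elim: hs F x => [|h hs IH] F x //=; rewrite !IH. Qed.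
Lemma Eh_cat (K : numFieldType) N M (Phi : seq Z -> K) :
  Eh (N + M) Phi = Eh N (fun hs => Eh M (fun hs' => Phi (hs ++ hs'))).
Proof.
elim: N Phi => [|N IH] Phi; first by rewrite add0n Eh0.
by rewrite addSn !EhS; apply: eq_avg => h; rewrite IH.
Qed.
Lemma size_ind_has (s : seq bool) : ~~ has id s -> s = nseq (size s) false.
Proof. by elim: s => //= -[] s IH //= /IH {1}->. Qed.
Lemma has_nseqF n : has id (nseq n false) = false.
Proof. by elim: n. Qed.
Lemma leb_cat s1 s2 t1 t2 : size s1 = size t1 -> leb (s1 ++ s2) (t1 ++ t2) = leb s1 t1 && leb s2 t2.
Proof. by elim: s1 t1 => [|a s1 IH] [|b t1] //= [sz]; rewrite IH // andbA. Qed.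
Lemma leb_has s t : leb s t -> has id s -> has id t.
Proof. by elim: s t => [|a s IH] [|b t] //= /andP[ab /IH h] /orP[ha|/h ->]; rewrite ?orbT //; move: ab; rewrite ha /= => ->. Qed.

Variables (N M : nat) (Fm : seq bool -> Z -> C).
Hypothesis F1 : forall s y, ~~ has id (drop N s) -> Fm s y = 1.
(** The last [M] directions are replaced by two independent copies, the second carrying the
    conjugate; vertices that mix both copies carry 1. An average of squared moduli thus becomes a
    single average of a cube product ([dbl_avg]), as [pin_law] requires. *)
Definition dbl (s : seq bool) (y : Z) : C :=
  let b := take M (drop N s) in let c := drop M (drop N s) in
  if ~~ has id c then Fm (take N s ++ b) y else
  if ~~ has id b then Num.conj (Fm (take N s ++ c) y) else 1.
Lemma dblE a b c y : size a = N -> size b = M -> dbl (a ++ b ++ c) y =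
  if ~~ has id c then Fm (a ++ b) y else if ~~ has id b then Num.conj (Fm (a ++ c) y) else 1.
Proof. by move=> sa sb; rewrite /dbl take_size_cat // drop_size_cat // take_size_cat // drop_size_cat. Qed.
Lemma dbl_le1 : le1F Fm -> le1F dbl.
Proof. by move=> h s y; rewrite /dbl; case: ifP => _; [exact: h|case: ifP => _; [rewrite ab_conj; exact: h|by rewrite ab1]]. Qed.
Lemma cprod_dbl hs hs' hs'' x : size hs = N -> size hs' = M -> size hs'' = M ->
  cprod dbl (hs ++ hs' ++ hs'') x = cprod Fm (hs ++ hs') x * Num.conj (cprod Fm (hs ++ hs'') x).
Proof.
move=> s1 s2 s3; rewrite !cprod_cat -cprod_conj -cprodM; apply: eq_cprod => s y ss.
have ssN : size s = N by rewrite ss.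
rewrite cprod_cat.
pose g z := Num.conj (cprod (fun s'' => Fm (s ++ s'')) hs'' z).
have z0 : size (nseq M false) = M by rewrite size_nseq.
transitivity (cprod (upd (fun s' => Fm (s ++ s')) (nseq (size hs') false) g) hs' y).
  apply: eq_cprod => s' z sz'; have sM : size s' = M by rewrite sz'.
  rewrite /upd s2; case: eqP => [->|ne].
    rewrite /g -cprod_conj; apply: eq_cprod => s'' w _; rewrite dblE // has_nseqF /=.
    case: ifP => // h0; rewrite !F1 ?conjC1 //; rewrite drop_size_cat // ?has_nseqF //.
  have h' : has id s' by apply: contraT => /size_ind_has h; case: ne; rewrite h sM.
  rewrite (@eq_cprod _ _ _ (upd (fun _ _ => 1) (nseq (size hs'') false) (Fm (s ++ s')))); last first.
    move=> s'' w sz''; rewrite dblE // h' /= /upd; case: eqP => [->|ne']; first by rewrite has_nseqF.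
    by case: ifP => // /size_ind_has h; case: ne'; rewrite h sz''.
  rewrite cprod_upd0 cprodE big1 ?mulr1 // => i _; rewrite /upd; by case: eqP.
rewrite cprod_upd0 mulrC; congr (_ * _); apply: eq_cprod => s' z _; rewrite /upd s2.
by case: eqP => // ->; rewrite F1 // drop_size_cat // has_nseqF.
Qed.
Lemma dbl_avg x : Eh (N + (M + M)) (fun hs => cprod dbl hs x) =
  (Eh N (fun hs => ab (Eh M (fun hs' => cprod Fm (hs ++ hs') x)) ^+ 2))%:C.
Proof.
rewrite Eh_cat; transitivity (Eh N (fun hs => (ab (Eh M (fun hs' => cprod Fm (hs ++ hs') x)) ^+ 2)%:C : C)).
  2: by rewrite /Eh avgC.
apply: eq_Eh => hs s1; rewrite Eh_cat -mulcJ; rewrite [X in Num.conj X]/Eh conj_avg -avgZ.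
rewrite /Eh [LHS]avg_exch; apply: eq_avg => hs''; rewrite -avgZr; apply: eq_avg => hs'.
by rewrite cprod_dbl ?size_tuple.
Qed.
End Lists.

(** * Systems of phases *)

Section Sys.
Variable R : realType.
Context (W : set_system nat) {UW : UltraFilter W}.
Variable Z : nat -> finZmodType.
Local Notation C := R[i].
Local Notation ev := (ev W).
Local Notation Zf := (Zf Z).
Local Notation Bf := (@Bf R Z).
Variable m' : nat.
Local Notation A := 'I_m'.+1.
Local Notation E := (@E R m').

(* A finite set of phases; indices of degree 0 carry constant phases. *)
Record sys := Sys { sI : finType; sd : sI -> nat; sg : forall n, sI -> Z n -> A }.
Arguments sd : clear implicits.
Arguments sg : clear implicits.
Definition slow X n D x x' := low (sd X) (sg X n) D x x'.
Definition eqs X n x x' := forall i, sg X n i x = sg X n i x'.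
Definition ep X (e : {ffun sI X -> A}) n x : A := \sum_i sg X n i x *+ e i.
Arguments ep : clear implicits.
Definition exacts X n := forall i, exact (sd X i).+1 (slow X (n := n) (sd X i)) (sg X n i).
(* The last clause: a combination of phases of degree [D] either vanishes or has
   null [U^D] norm. *)
Definition good k X := [/\ forall i, (sd X i <= k)%N, ev (fun n => exacts X n) &
  forall D (e : {ffun sI X -> A}), (forall i, sd X i != D -> e i = 0) ->
    ev (fun n => forall x, ep X e n x = 0) \/ null W (fun n => u D (fun x => E (ep X e n x)))].
(** The index set and the degrees of the system do not depend on [n]; this is what later bounds the
    nilspace. *)
Definition dets k (T : nat -> Type) (f : forall n, Z n -> T n) :=
  exists2 X, good k X & ev (fun n => forall x x', eqs X (n := n) x x' -> f n x = f n x').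

Lemma B_mono d d' n (b : Z n -> C) : (d <= d')%N -> B d b -> B d' b.
Proof. by move=> /subnK <-; elim: (d' - d)%N => [|j IH] // /IH; exact: B_S. Qed.
Lemma Cl_mono d d' (f : fam R Zf) : (d <= d')%N -> Cl W (Bf d) f -> Cl W (Bf d') f.
Proof. by move=> h; apply: Cl_sub => n b; exact: B_mono. Qed.
Lemma BK_mono d d' (f : fam R (ZP Z Zf)) : (d <= d')%N -> Cl W (@BK R Z d) f -> Cl W (@BK R Z d') f.
Proof. by move=> h; apply: Cl_sub => n b hb t; apply: B_mono (hb t). Qed.

(** A dual function times a structured one is structured, so a correlation of [f c] would be a
    correlation of [f]. *)
Lemma unull_mul D (f c : fam R Zf) : fle1 f -> fle1 c -> Cl W (Bf D) c ->
  null W (fun n => u D (f n)) -> null W (fun n => u D (fun x => f n x * c n x)).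
Proof.
move=> f1 c1 cc h; have [//|h'] := null_or (UW := UW) (fun n => u D (fun x => f n x * c n x)).
have fc1 : fle1 (T := Zf) (fun n x => f n x * c n x) by move=> n; exact: le1M.
have [b [hb hc]] := u_dual fc1 h'.
exfalso; apply: (nullN h); apply: (@dual_u R W UW Z D f (fun n x => c n x * b n x)) => //.
  apply: S_mul => //; last by apply: Cl_base; apply: evT => n; exact: hb.
  by apply: (@bdd1 R W _ _ _ 1) => n; exact: B_le1.
by apply: nnull_le hc; apply: evT => n; under eq_avg => x do rewrite -mulrA.
Qed.
(** The kernel [hat] of a phase correlates perfectly with the product it is made of. So the
    [U^(d+2)] norm is not null, and [struct_or] applies. *)
Lemma phase_S d (v : forall n, Z n -> A) : Cl W (@BK R Z d.+1) (hat (fun n x => E (v n x))) ->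
  Cl W (Bf d.+2) (fun n x => E (v n x)).
Proof.
move=> h; have l1 : fle1 (T := Zf) (fun n x => E (v n x)) by move=> n x; rewrite ab_E.
apply: struct_or => //; first exact: BK_mono h.
have : nnull W (fun n => u d.+2 (fun x => Num.conj (E (v n x)))).
  apply: (K_corr_u (k := hat (fun n x => E (v n x))) (g := fun n x => E (v n x))) => //.
    by move=> n x; rewrite ab_conj ab_E.
  exists 1 => //; apply: evT => n; rewrite (@eq_avg _ _ _ (fun=> 1)) ?avg_const ?ab1 //.
    by rewrite card_prod muln_gt0 zmod_gt0.
  move=> [x t]; rewrite /hat /=; have := EJ R (v n x); have := EJ R (v n (x + t)).
  by move=> a1 a2; rewrite mulrACA [X in _ * X]mulrC -[RHS]mulr1 -{1}a2 -a1; ring.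
by apply: nnull_le; apply: evT => n; rewrite u_conj.
Qed.
Lemma du_mul (Zn : finZmodType) (v : Zn -> A) a hs x : du (fun y => v y *+ a) hs x = du v hs x *+ a.
Proof. by elim: hs x => [|h hs IH] x; rewrite ?du_cons ?IH ?mulrnBl // /du /=. Qed.
Lemma exact_mul (Zn : finZmodType) K eqv (v : Zn -> A) a : exact K eqv v -> exact K eqv (fun y => v y *+ a).
Proof. by move=> h x hs x' hs' s1 s2 e; rewrite !du_mul (h x hs x' hs'). Qed.
Lemma exact_sub (Zn : finZmodType) K (eqv eqv' : Zn -> Zn -> Prop) (v : Zn -> A) :
  (forall x y, eqv x y -> eqv' x y) -> exact K eqv' v -> exact K eqv v.
Proof. by move=> h ex x hs x' hs' s1 s2 e; apply: ex => // s /e/h. Qed.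

(** Fourier expansion reduces the claim to single phases of degree [d < D]. Those of degree 0 are
    constant. For the others the indicators of lower types are structured of degree [d] by
    induction, hence so are the derivatives by [hat_phase], and [phase_S] costs one degree more. *)
Lemma low_Cl k X D (F : fam R Zf) : good k X -> fle1 F ->
  ev (fun n => forall x x', slow X (n := n) D x x' -> F n x = F n x') -> Cl W (Bf D) F.
Proof.
move=> [_ ex _]; elim/ltn_ind: D F => D IH F F1 hF.
pose z n x : {ffun sI X -> A} := [ffun i => if (sd X i < D)%N then sg X n i x else 0].
pose Phi n (w : {ffun sI X -> A}) : C := if pselect (exists x, z n x = w) is left h then F n (projT1 (cid h)) else 0.
have Phi1 n w : ab (Phi n w) <= 1 by rewrite /Phi; case: pselect => h; rewrite ?ab0 // F1.
have [c hc] := dep_choice (fun n => let: ex_intro2 c a b := fourier (Phi1 n) in ex_intro _ c (conj a b)).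
apply: (@Cl_eq R W _ Zf (Bf D) (fun n x => \sum_e c n e * \prod_i E (z n x i *+ e i))).
  apply: evS hF => n hF x; rewrite (_ : F n x = Phi n (z n x)).
    by rewrite (hc n).2; apply: eq_bigr => e _; rewrite E_sum.
  rewrite /Phi; case: pselect => [h|[]]; last by exists x.
  case: (cid h) => y /= hy; apply: hF => i iD.
  by have := congr1 (fun f : {ffun sI X -> A} => f i) hy; rewrite !ffunE iD.
apply: Cl_sum => e.
apply: (@Cl_scale R W _ Zf (Bf D) _ (fun n => c n e) 1); first exact: good_Bf.
  by apply: evT => n; exact: (hc n).1.
apply: S_prod => i; first by apply: (@bdd1 R W _ _ _ 1) => n x; rewrite ab_E.
have [iD|iD] := boolP (sd X i < D)%N; last first.
  apply: Cl_base; apply: evT => n; rewrite /z; apply: (@eq_ind_r _ (fun=> 1) (B D)).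
    by apply: B_const; rewrite ab1.
  by apply: funext => x; rewrite ffunE (negbTE iD) mul0rn E0.
apply: (@Cl_eq R W _ Zf (Bf D) (fun n x => E (sg X n i x *+ e i))).
  by apply: evT => n x; rewrite ffunE iD.
apply: (Cl_mono iD).
case Ei : (sd X i) => [|d].
  apply: Cl_base; apply: evS ex => n /(_ i); rewrite Ei => ex.
  apply: (@eq_ind_r _ (fun=> E (sg X n i 0 *+ e i)) (B 1)); first by apply: B_const; rewrite ab_E.
  apply: funext => x; congr (E (_ *+ _)).
  have := ex 0 [:: x] 0 [:: 0] erefl erefl; rewrite !du_cons /du /= !addr0 subrr add0r => h.
  by symmetry; apply/eqP; rewrite -subr_eq0; apply/eqP; apply: h => s _ j.
apply: phase_S; pose zi n x : {ffun sI X -> A} := [ffun j => if (sd X j < d.+1)%N then sg X n j x else 0].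
apply: (@hat_phase R W UW Z m' d.+1 _ zi (fun n x => sg X n i x *+ e i)).
  move=> t; apply: IH; first by rewrite -Ei.
    by move=> n x; exact: ab_bool.
  apply: evT => n x x' h; rewrite /ind; congr ((_ == _)%:R); apply/ffunP => j; rewrite !ffunE.
  by case: ifP => // /h.
apply: evS ex => n /(_ i) ex; apply: exact_mul; move: ex; rewrite Ei; apply: exact_sub => x y h j jd.
by have := congr1 (fun f : {ffun sI X -> A} => f j) h; rewrite !ffunE jd.
Qed.
End Sys.

(** * The law of the phases on random cubes *)

Section Law.
Variable R : realType.
Context (W : set_system nat) {UW : UltraFilter W}.
Variable Z : nat -> finZmodType.
Local Notation C := R[i].
Local Notation ev := (ev W).
Local Notation Zf := (Zf Z).
Local Notation Bf := (@Bf R Z).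
Variable m' : nat.
Local Notation A := 'I_m'.+1.
Local Notation E := (@E R m').
Local Notation sys := (sys Z m').
Local Notation good := (@good R W Z m').
Local Notation eqs X n x x' := (@eqs Z m' X n x x').

Definition typed (X : sys) n (S : pred (seq bool)) N (T : Type) (r : Z n -> seq (Z n) -> T) :=
  forall x hs x' hs', size hs = N -> size hs' = N ->
  (forall s, size s = N -> S s -> eqs X n (x + dot s hs) (x' + dot s hs')) -> r x hs = r x' hs'.

Section Fixed.
Variables (k : nat) (X : sys) (S : pred (seq bool)).
Hypothesis gX : good k X.
Hypothesis Sd : forall s s', leb s s' -> S s' -> S s.
Local Notation I := (sI X).
Local Notation sd := (@sd Z m' X).
Local Notation sg n := (@sg Z m' X n).

(** The free positions: by [det], phases at vertices of weight at most their degree determine all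
    values on [S]. *)
Definition fr (v : seq bool) (i : I) := S v && (count id v <= sd i)%N.

Section Len.
Variable L : nat.
Local Notation V := (L.-tuple bool).
Local Notation G := {ffun V * I -> A}.
Implicit Types (e : G) (v : V).
Definition er e v D : {ffun I -> A} := [ffun i => if (sd i == D) && fr v i then e (v, i) else 0].
Definition ef e v n y : A := \sum_i (if fr v i then sg n i y else 0) *+ e (v, i).
Arguments ef : clear implicits.
Definition fd n x hs : G := [ffun vi : V * I => if fr vi.1 vi.2 then sg n vi.2 (x + dot vi.1 hs) else 0].
Arguments fd : clear implicits.

Lemma pair_fd e n x hs : pair e (fd n x hs) = \sum_v ef e v n (x + dot v hs).
Proof.
rewrite /pair /ef (pair_bigA _ (fun v i => (if fr v i then sg n i (x + dot v hs) else 0) *+ e (v, i))) /=.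
by apply: eq_bigr => -[v i] _; rewrite ffunE.
Qed.
Lemma ef_er e v n y : ef e v n y = \sum_(D < k.+1) ep (er e v D) y.
Proof.
rewrite exchange_big /=; apply: eq_bigr => i _.
have [h _ _] := gX; have ik : (sd i < k.+1)%N by rewrite ltnS.
rewrite (bigD1 (Ordinal ik)) //= ffunE eqxx big1 ?addr0 => [|D ne].
  by case: (fr v i); rewrite ?mul0rn.
by rewrite ffunE; case: eqP => [e1|]; [case/eqP: ne; apply: val_inj|].
Qed.
(** Among the vertices where the combination does not vanish take [vs] of largest weight, and there
    the highest degree [D] whose part does not vanish. The weight of [vs] is at most [D] because
    only free positions enter. In a good system that part has null [U^D] norm; the parts of lower
    degree are structured factors and keep it null. *)
Lemma max_bad e (Q : pred V) : (exists2 v, Q v & ~ ev (fun n => forall y, ef e v n y = 0)) ->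
  exists vs, [/\ Q vs, null W (fun n => u (count id vs) (fun y => E (ef e vs n y))) &
    forall v, Q v -> leb vs v -> v != vs -> ev (fun n => forall y, ef e v n y = 0)].
Proof.
move=> [v0 Q0 b0].
pose P v := Q v && `[< ~ ev (fun n => forall y, ef e v n y = 0) >].
have P0 : P v0 by rewrite /P Q0; apply/asboolP.
have [vs /andP[Qs /asboolP bs] hmax] := arg_maxnP (fun v => count id v) P0.
exists vs; split=> //; last first.
  move=> v Qv lv ne; apply: contrapT => bv.
  have : P v by rewrite /P Qv; apply/asboolP.
  move/hmax => h; case/eqP: ne; apply: val_inj; exact: (leb_count_eq lv h).
pose PD (D : 'I_k.+1) := `[< ~ ev (fun n => forall y, ep (er e vs D) (n := n) y = 0) >].
have [D0 hD0] : exists D, PD D.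
  apply: contrapT => /forallNP h; apply: bs.
  have : ev (fun n => forall D : 'I_k.+1, forall y, ep (er e vs D) (n := n) y = 0).
    apply: ev_fin => D; apply: contrapT => hD; apply: (h D); exact/asboolP.
  by apply: evS => n h' y; rewrite ef_er big1.
have [D /asboolP bD hmaxD] := arg_maxnP (fun D : 'I_k.+1 => D : nat) hD0.
have jD : (count id vs <= D)%N.
  rewrite leqNgt; apply/negP => h; apply: bD; apply: evT => n y; rewrite /ep big1 // => i _.
  rewrite ffunE; case: eqP => //= e1; rewrite /fr e1 leqNgt h andbF; exact: mulr0n.
case: (gX) => _ _ /(_ D (er e vs D)) [|//|nD].
  by move=> i ne; rewrite ffunE (negbTE ne).
pose c n y := E (\sum_(D' < k.+1 | (D' < D)%N) ep (er e vs D') (n := n) y).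
have cc : Cl W (Bf D) c.
  apply: (low_Cl gX); first by move=> n y; rewrite ab_E.
  apply: evT => n x x' h; congr E; apply: eq_bigr => D' lt; apply: eq_bigr => i _.
  by rewrite ffunE; case: eqP => //= e1; rewrite h // e1.
have eE : ev (fun n => forall y, E (ef e vs n y) = E (ep (er e vs D) y) * c n y).
  have : ev (fun n => forall D' : 'I_k.+1, (D < D')%N -> forall y, ep (er e vs D') (n := n) y = 0).
    apply: ev_fin => D'; case: (ltnP D D') => lt; last exact: evT.
    have : ev (fun n => forall y, ep (er e vs D') (n := n) y = 0).
      apply: contrapT => h; have hP : PD D' by apply/asboolP.
      have h2 : (D' <= D)%N := hmaxD _ hP.
      by have := leq_ltn_trans h2 lt; rewrite ltnn.
    by apply: evS.
  apply: evS => n h y; rewrite ef_er -ED; congr E.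
  rewrite (bigD1 D) //=; congr (_ + _).
  rewrite (bigID (fun D' : 'I_k.+1 => (D' < D)%N)) /= [X in _ + X]big1 ?addr0 => [|D'].
    apply: eq_bigl => D' /=; case: (ltnP D' D) => h'; rewrite ?andbF ?andbT //.
    by apply/eqP => e1; move: h'; rewrite e1 ltnn.
  by move=> /andP[ne ge]; apply: h; rewrite ltn_neqAle leqNgt ge andbT eq_sym.
have nf : null W (fun n => u D (fun y => E (ef e vs n y))).
  apply: null_le (unull_mul (f := fun n y => E (ep (er e vs D) y)) (c := c) _ _ cc nD).
  - by apply: evS eE => n h; rewrite (funext h).
  - by move=> n y; rewrite ab_E.
  - by move=> n y; rewrite ab_E.
have h0 : ev (fun n => 0 <= u (count id vs) (fun y => E (ef e vs n y))) by apply: evT => n; exact: u_ge0.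
refine (null_pow (j := (2 ^ (D - count id vs))%N) h0 _).
by apply: null_le nf; apply: evT => n; exact: u_mono_le.
Qed.
Lemma fd_typed n x hs x' hs' : exacts X n -> size hs = L -> size hs' = L ->
  fd n x hs = fd n x' hs' -> forall s, size s = L -> S s -> eqs X n (x + dot s hs) (x' + dot s hs').
Proof.
move=> ex s1 s2 h s sz Ss i.
apply: (@det _ _ _ sd (sg n) ex L S x hs x' hs' Sd s1 s2 _ s i sz Ss) => t j st St ct.
have := congr1 (fun f : G => f (tcast st (in_tuple t), j)) h.
by rewrite !ffunE /= val_tcast /= /fr St ct.
Qed.
End Len.
Arguments ef {L} e v n y.
Arguments fd L n x hs : clear implicits.

Section Split.
Variables N M : nat.
Local Notation V := ((N + M).-tuple bool).
Local Notation G := {ffun V * I -> A}.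
Definition p0 (e : G) n x hs : A := \sum_(v : V | ~~ has id (drop N v)) ef e v n (x + dot (take N v) hs).
Arguments p0 : clear implicits.

Lemma dot_low (v : V) n (hs hs' : seq (Z n)) : size hs = N -> ~~ has id (drop N v) ->
  dot v (hs ++ hs') = dot (take N v) hs.
Proof.
move=> sz /size_ind_has h; rewrite -{1}(cat_take_drop N v) dot_cat; last first.
  by rewrite size_takel // size_tuple leq_addr.
by rewrite h dot0 addr0.
Qed.
(** If the combination vanishes at all vertices that involve the last [M] directions, the character
    depends on the first [N] only. Otherwise [max_bad] provides a vertex with null norm, and after
    doubling the last [M] directions [pin_law] applies at every base point. *)
Lemma law_char (e : G) :
  ev (fun n => forall x hs hs', size hs = N -> pair e (fd (N + M) n x (hs ++ hs')) = p0 e n x hs) \/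
  forall x : forall n, Z n, null W (fun n => Eh N (fun hs => ab (Eh M (fun hs' => E (pair e (fd (N + M) n (x n) (hs ++ hs'))))))).
Proof.
pose Q (v : V) := has id (drop N v).
have split_pair n x hs hs' : size hs = N -> pair e (fd (N + M) n x (hs ++ hs')) =
    p0 e n x hs + \sum_(v | Q v) ef e v n (x + dot v (hs ++ hs')).
  move=> sz; rewrite pair_fd (bigID Q) /= addrC; congr (_ + _).
  by apply: eq_bigr => v hv; rewrite dot_low.
case: (pselect (exists2 v, Q v & ~ ev (fun n => forall y, ef e v n y = 0))) => [bad|nb]; [right=> x|left]; last first.
  have : ev (fun n => forall v, Q v -> forall y, ef e v n y = 0).
    apply: ev_fin => v; case: (boolP (Q v)) => Qv; last exact: evT.
    have : ev (fun n => forall y, ef e v n y = 0) by apply: contrapT => h; apply: nb; exists v.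
    by apply: evS.
  apply: evS => n h y hs hs' sz; rewrite split_pair // [X in _ + X]big1 ?addr0 // => v Qv.
  exact: h.
have [vs [Qs nu above]] := max_bad bad.
have ab1v : ev (fun n => forall v, Q v -> leb vs v -> v != vs -> forall y, ef e v n y = 0).
  apply: ev_fin => v; case: (boolP [&& Q v, leb vs v & v != vs]) => [/and3P[a1 a2 a3]|h].
    by have := above v a1 a2 a3; apply: evS.
  by apply: evT => n a1 a2 a3; move: h; rewrite a1 a2 a3.
pose Fm n s y : C := if has id (drop N s) then (if insub s is Some v then E (ef e v n y) else 1) else 1.
have Fm1 n s y : ~~ has id (drop N s) -> Fm n s y = 1 by rewrite /Fm => /negbTE ->.
have Fmle n : le1F (Fm n).
  move=> s y; rewrite /Fm; case: ifP => _; last by rewrite ab1.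
  by case: insubP => [v _ _|_]; rewrite ?ab_E ?ab1.
have FmV n (v : V) y : Q v -> Fm n v y = E (ef e v n y) by rewrite /Fm /Q => ->; rewrite valK.
have abE n hs : size hs = N -> ab (Eh M (fun hs' => E (pair e (fd (N + M) n (x n) (hs ++ hs'))))) =
    ab (Eh M (fun hs' => cprod (Fm n) (hs ++ hs') (x n))).
  move=> sz; rewrite -[RHS]mul1r -(ab_E R (p0 e n (x n) hs)) -abM /Eh -avgZ; congr ab.
  apply: eq_avg => hs'; rewrite split_pair // ED E_sum; congr (_ * _).
  rewrite cprodE.
  have sL : size (hs ++ hs') = (N + M)%N by rewrite size_cat sz size_tuple.
  rewrite sL [RHS](bigID Q) /= [X in _ * X]big1 ?mulr1 => [|v /Fm1 -> //].
  by apply: eq_bigr => v Qv; rewrite FmV.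
pose s0 := val vs ++ nseq M false.
have svs : size vs = (N + M)%N by rewrite size_tuple.
have sz0 : size s0 = (N + (M + M))%N by rewrite size_cat svs size_nseq addnA.
have szt : size (take N vs) = N by rewrite size_takel // svs leq_addr.
have szd : size (drop N vs) = M by rewrite size_drop svs addKn.
have s0E : s0 = take N vs ++ drop N vs ++ nseq M false by rewrite catA cat_take_drop.
have c0 : count id s0 = count id vs by rewrite count_cat count_nseq mul0n addn0.
refine (null_pow (j := (2 ^ (count id s0).+2)%N) _ _).
  by apply: evT => n; apply: avg_ge0 => hs; exact: ab_ge0.
apply: null_le nu; apply: evS ab1v => n h.
rewrite (@eq_Eh _ _ _ _ (fun hs => ab (Eh M (fun hs' => cprod (Fm n) (hs ++ hs') (x n))))); last by move=> hs /abE.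
rewrite expnS exprM.
apply: le_trans (_ : ab (Eh (size s0) (fun hs => cprod (dbl N M (Fm n)) hs (x n))) ^+ (2 ^ (count id s0).+1) <= _).
  have nn : 0 <= Eh N (fun hs => ab (Eh M (fun hs' => cprod (Fm n) (hs ++ hs') (x n))) ^+ 2).
    by apply: avg_ge0 => hs; exact: sqr_ge0.
  rewrite lerXn2r ?nnegrE ?sqr_ge0 ?ab_ge0 // sz0 (dbl_avg M (Fm1 n)) abR ger0_norm //.
  exact: avg_sqr.
have -> : (fun y => E (ef e vs n y)) = dbl N M (Fm n) s0.
  by apply: funext => y; rewrite s0E (dblE _ _ _ szt szd) has_nseqF /= cat_take_drop FmV.
rewrite -c0; apply: pin_law.
- exact: dbl_le1.
- by rewrite s0E !has_cat [has id (drop N vs)]Qs orbT.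
move=> s y ls ne; have ss := leb_size ls; rewrite sz0 in ss.
pose a := take N s; pose b := take M (drop N s); pose c := drop M (drop N s).
have sE : s = a ++ b ++ c by rewrite /a /b /c !cat_take_drop.
have sa : size a = N by rewrite size_takel // -ss leq_addr.
have sb : size b = M by rewrite size_takel // size_drop -ss addKn leq_addr.
have sc : size c = M by rewrite !size_drop -ss addKn addKn.
move: ls; rewrite s0E sE !leb_cat ?szt ?szd // => /and3P[la lb lc].
rewrite (dblE _ _ _ sa sb); case: ifP => [h0|_].
  have sab : size (a ++ b) == (N + M)%N by rewrite size_cat sa sb.
  have Qab : Q (Tuple sab) by rewrite /Q /= drop_size_cat //; apply: leb_has lb _.
  rewrite -[a ++ b]/(val (Tuple sab)) FmV // h //=.
    by rewrite -(cat_take_drop N vs) leb_cat ?szt // la lb.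
  apply: contra ne => /eqP e1; apply/eqP; rewrite sE /s0 -e1 /= -catA; do 2 congr (_ ++ _).
  by rewrite (size_ind_has h0) sc.
case: ifP => // /negbTE hb; case/negP: (negbT hb); apply: leb_has lb _; exact: Qs.
Qed.
Lemma p0_typed e n : typed X (fun s => S (s ++ nseq M false)) N (p0 e n).
Proof.
move=> x hs x' hs' s1 s2 h; apply: eq_bigr => v hv; apply: eq_bigr => i _.
rewrite /fr; case: (boolP (S v)) => //= Sv; case: ifP => // _; congr (_ *+ _).
apply: h; first by rewrite size_takel // size_tuple leq_addr.
suff -> : take N v ++ nseq M false = v by [].
rewrite -[RHS](cat_take_drop N v); congr (_ ++ _).
by rewrite [RHS](size_ind_has hv) size_drop size_tuple addKn.
Qed.

(** Conditional expectation: the average over the last [M] directions is, up to a null error, a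
    function of the type of the cube spanned by the first [N]. After Fourier expansion in the free
    data, the characters of the second kind in [law_char] average out. *)
Lemma CI (Phi : forall n, Z n -> seq (Z n) -> C) : (forall n x hs, ab (Phi n x hs) <= 1) ->
  ev (fun n => typed X S (N + M) (Phi n)) ->
  exists2 Psi : forall n, Z n -> seq (Z n) -> C,
    forall n, typed X (fun s => S (s ++ nseq M false)) N (Psi n) &
    forall x : forall n, Z n, null W (fun n =>
      Eh N (fun hs => ab (Eh M (fun hs' => Phi n (x n) (hs ++ hs')) - Psi n (x n) hs))).
Proof.
move=> P1 Pt; have [_ ex _] := gX.
pose Ph n (w : G) : C := if pselect (exists xh : Z n * seq (Z n), size xh.2 = (N + M)%N /\ fd (N + M) n xh.1 xh.2 = w)
  is left h then (fun xh => Phi n xh.1 xh.2) (projT1 (cid h)) else 0.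
have Ph1 n w : ab (Ph n w) <= 1 by rewrite /Ph; case: pselect => h; rewrite ?ab0.
have [c hc] := dep_choice (fun n => let: ex_intro2 c a b := fourier (Ph1 n) in ex_intro _ c (conj a b)).
have PhE : ev (fun n => forall x hs, size hs = (N + M)%N -> Phi n x hs = Ph n (fd (N + M) n x hs)).
  apply: ev2 Pt ex => n Pt ex x hs sz; rewrite /Ph; case: pselect => [h|[]]; last by exists (x, hs).
  case: (cid h) => -[y hy] /= [sy e]; apply: Pt => // s ss Ss; exact: (fd_typed ex _ _ (esym e)).
pose gd (e : G) := `[< ev (fun n => forall x hs hs', size hs = N -> pair e (fd (N + M) n x (hs ++ hs')) = p0 e n x hs) >].
exists (fun n x hs => \sum_(e | gd e) c n e * E (p0 e n x hs)).
  by move=> n x hs x' hs' s1 s2 h; apply: eq_bigr => e _; rewrite (p0_typed _ s1 s2 h).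
move=> x.
have hg : ev (fun n => forall e, gd e -> forall x hs hs', size hs = N -> pair e (fd (N + M) n x (hs ++ hs')) = p0 e n x hs).
  by apply: ev_fin => e; case: (boolP (gd e)) => [/asboolP|_]; [apply: evS|exact: evT].
have nb : null W (fun n => \sum_(e : G) if gd e then 0 else
    Eh N (fun hs => ab (Eh M (fun hs' => E (pair e (fd (N + M) n (x n) (hs ++ hs'))))))).
  apply: null_sum => e; case: (boolP (gd e)) => ge.
    by move=> ep ep0; exact: evT.
  by have [h|h] := law_char e; [move/asboolP: ge => []|exact: h].
apply: null_le nb; apply: ev2 PhE hg => n hE hg.
have -> : \sum_(e : G) (if gd e then 0 else Eh N (fun hs => ab (Eh M (fun hs' => E (pair e (fd (N + M) n (x n) (hs ++ hs')))))))
  = Eh N (fun hs => \sum_(e : G | ~~ gd e) ab (Eh M (fun hs' => E (pair e (fd (N + M) n (x n) (hs ++ hs')))))).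
  rewrite /Eh avg_sum [RHS]big_mkcond; apply: eq_bigr => e _; by case: (gd e).
apply: ler_avg => hs.
have -> : Eh M (fun hs' => Phi n (x n) (hs ++ hs')) =
    \sum_e c n e * Eh M (fun hs' => E (pair e (fd (N + M) n (x n) (hs ++ hs')))).
  under [RHS]eq_bigr => e _ do rewrite /Eh -avgZ.
  rewrite -avg_sum; apply: eq_avg => hs'; rewrite hE ?size_cat ?size_tuple //.
  exact: (hc n).2.
rewrite (bigID gd) /= addrAC -sumrB big1 ?add0r => [|e ge].
  apply: le_trans (ab_sum _ _ _) _; apply: ler_sum => e _; rewrite abM ler_piMl ?ab_ge0 //.
  exact: (hc n).1.
rewrite -mulrBr (_ : Eh M _ = E (p0 e n (x n) hs)) ?subrr ?mulr0 //.
rewrite (@eq_Eh _ _ _ _ (fun=> E (p0 e n (x n) hs))) ?/Eh ?avg_const ?tuple_gt0 // => hs' _.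
by rewrite hg // size_tuple.
Qed.
End Split.
End Fixed.
End Law.

(** * Reading a value off its approximate distribution *)

Section Decode.
Variables (R : realType) (m' : nat).
Local Notation C := R[i].
Local Notation A := 'I_m'.+1.

Definition dec (Psi : A -> C) : A := odflt 0 [pick b | 2^-1 < Re (Psi b)].
Section DecP.
Variables (Psi : A -> C) (p : A -> R) (b : A).
Hypotheses (p0 : forall b', 0 <= p b') (p1 : \sum_b' p b' = 1).
Let s := \sum_b' ab ((p b')%:C - Psi b').
Lemma dec_core : (1 - p b) + s < 4^-1 -> dec Psi = b.
Proof.
move=> h.
have hs b' : ab ((p b')%:C - Psi b') <= s.
  by rewrite /s (bigD1 b') //= lerDl sumr_ge0 // => i _; exact: ab_ge0.
have hr b' : `|p b' - Re (Psi b')| <= s.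
  by apply: le_trans (hs b'); have := Re_le_ab ((p b')%:C - Psi b'); rewrite ReB.
have hb b' : b' != b -> p b' <= 1 - p b.
  move=> ne; rewrite -p1 (bigD1 b) //= addrAC subrr add0r (bigD1 b') //= lerDl.
  by apply: sumr_ge0.
have Psib : 2^-1 < Re (Psi b) by have := hr b; rewrite ler_norml => /andP[_]; lra.
rewrite /dec; case: pickP => [b' hb'|/(_ b)]; last by rewrite Psib.
apply/eqP; apply: contraT => ne; have := hb _ ne; have := hr b'; rewrite ler_norml => /andP[h1 _] h2.
move: hb' => /=; lra.
Qed.
Lemma s_ge0 : 0 <= s. Proof. by apply: sumr_ge0 => i _; exact: ab_ge0. Qed.
Lemma pb_le1 : p b <= 1. Proof. by rewrite -p1 (bigD1 b) //= lerDl sumr_ge0. Qed.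
(** [p] is the true distribution and [Psi] an approximation with total error [s]. Decoding can fail
    only if [1 - p b + s >= 1/4]. When [p b] is already at least [7/8], as in [dec_le8], failure is
    charged to [s] alone. *)
Lemma dec_le : (dec Psi != b)%:R <= 4 * (1 - p b) + 4 * s.
Proof.
case: (ltP ((1 - p b) + s) 4^-1) => [/dec_core ->|h].
  by rewrite eqxx -[X in X <= _]/(0 : R); have := s_ge0; have := pb_le1; lra.
have : ((dec Psi != b)%:R : R) <= 1 by case: (_ != _).
lra.
Qed.
Lemma dec_le8 : 1 - p b <= 8^-1 -> (dec Psi != b)%:R <= 8 * s.
Proof.
move=> hb; case: (ltP s 8^-1) => [h|h].
  rewrite dec_core; first by rewrite eqxx -[X in X <= _]/(0 : R); have := s_ge0; lra.
  move: h; rewrite -/s; lra.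
have : ((dec Psi != b)%:R : R) <= 1 by case: (_ != _).
lra.
Qed.
End DecP.
End Decode.

(** * Majority values and recurrence of cube types *)

Section Tools.
Variable R : realType.
Context (W : set_system nat) {UW : UltraFilter W}.
Variable Z : nat -> finZmodType.
Local Notation C := R[i].
Local Notation ev := (ev W).
Variable m' : nat.
Local Notation A := 'I_m'.+1.
Local Notation E := (@E R m').
Local Notation sys := (sys Z m').
Local Notation good := (@good R W Z m').
Local Notation eqs X n x x' := (@eqs Z m' X n x x').
Implicit Types (X : sys).

(** If the statement failed for almost all [n], the bad points would form one sequence. Estimates
    along sequences of base points thus become uniform in the base point. *)
Lemma evall (T : nat -> Type) (P : forall n, T n -> Prop) : (forall n, T n) ->
  (forall x : forall n, T n, ev (fun n => P n (x n))) -> ev (fun n => forall x, P n x).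
Proof.
move=> d h; apply: contrapT => /(evNE (UW := UW)) hn.
pose x n : T n := if pselect (exists t, ~ P n t) is left e then projT1 (cid e) else d n.
apply: (@evN W _ _ _ (h x)); apply: evS hn => n hn; rewrite /x; case: pselect => [e|ne].
  exact: projT2 (cid e).
by case: hn => t; apply: contrapT => ht; apply: ne; exists t.
Qed.

Lemma Eh_const (K : numFieldType) (Zn : finZmodType) d (c : K) : @Eh K Zn d (fun=> c) = c.
Proof. by rewrite /Eh avg_const ?tuple_gt0. Qed.
Lemma ler_Eh (Zn : finZmodType) d (f g : seq Zn -> R) : (forall hs, size hs = d -> f hs <= g hs) -> Eh d f <= Eh d g.
Proof. by move=> h; apply: ler_avg => hs; apply: h; rewrite size_tuple. Qed.
Lemma Eh_ge0 (Zn : finZmodType) d (f : seq Zn -> R) : (forall hs, 0 <= f hs) -> 0 <= Eh d f.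
Proof. by move=> h; apply: avg_ge0. Qed.
Lemma EhD (Zn : finZmodType) d (f g : seq Zn -> R) : Eh d (fun hs => f hs + g hs) = Eh d f + Eh d g.
Proof. exact: avgD. Qed.
Lemma EhZ (Zn : finZmodType) d c (f : seq Zn -> R) : Eh d (fun hs => c * f hs) = c * Eh d f.
Proof. exact: avgZ. Qed.
Lemma Eh_sum (Zn : finZmodType) d (I : finType) (f : I -> seq Zn -> R) :
  Eh d (fun hs => \sum_i f i hs) = \sum_i Eh d (f i).
Proof. exact: avg_sum. Qed.
Lemma Eh_pick (Zn : finZmodType) d (f : seq Zn -> R) : exists2 hs, size hs = d & f hs <= Eh d f.
Proof.
have [hs h] := exists_le_avg (fun hs : d.-tuple Zn => f hs) (tuple_gt0 Zn d).
by exists hs => //; rewrite size_tuple.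
Qed.

(** [Gam] is the prevailing value of [Rr] over the last [M] directions, read off the distributions
    given by [CI]. The first bound multiplies the probability of failure by a constant. In the
    second, a clear majority for every [hs] leaves an arbitrarily small error; this stops the
    accumulation of errors. *)
Lemma decode k X (S : pred (seq bool)) N M (Rr : forall n, Z n -> seq (Z n) -> A) :
  good k X -> (forall s s', leb s s' -> S s' -> S s) -> ev (fun n => typed X S (N + M) (Rr n)) ->
  exists2 Gam : forall n, Z n -> seq (Z n) -> A,
    forall n, typed X (fun s => S (s ++ nseq M false)) N (Gam n) &
    forall e, 0 < e -> ev (fun n => forall x (val : seq (Z n) -> A),
      let q hs : R := Eh M (fun hs' => (Rr n x (hs ++ hs') != val hs)%:R) in
      Eh N (fun hs => (Gam n x hs != val hs)%:R) <= 4 * Eh N q + e /\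
      ((forall hs, size hs = N -> q hs <= 8^-1) -> Eh N (fun hs => (Gam n x hs != val hs)%:R) <= e)).
Proof.
move=> gX Sd tR.
have /choice [Psi hPsi] : forall b : A, exists Psi : forall n, Z n -> seq (Z n) -> C,
    (forall n, typed X (fun s => S (s ++ nseq M false)) N (Psi n)) /\
    forall x : forall n, Z n, null W (fun n =>
      Eh N (fun hs => ab (Eh M (fun hs' => (Rr n (x n) (hs ++ hs') == b)%:R) - Psi n (x n) hs))).
  move=> b; have [||Psi h1 h2] := @CI R W UW Z m' k X S gX Sd N M (fun n x hs => (Rr n x hs == b)%:R).
  - by move=> n x hs; exact: ab_bool.
  - by apply: evS tR => n t x hs x' hs' s1 s2 h; rewrite (t x hs x' hs').
  by exists Psi.
exists (fun n x hs => dec (fun b => Psi b n x hs)).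
  move=> n x hs x' hs' s1 s2 h; congr dec; apply: funext => b; exact: (proj1 (hPsi b)).
move=> e e0.
have hs0 (x : forall n, Z n) : null W (fun n => \sum_b Eh N (fun hs => ab (Eh M (fun hs' => (Rr n (x n) (hs ++ hs') == b)%:R) - Psi b n (x n) hs))).
  by apply: null_sum => b; exact: (hPsi b).2.
have e8 : 0 < e / 8 by rewrite divr_gt0.
have := @evall Z (fun n x => \sum_b Eh N (fun hs => ab (Eh M (fun hs' => (Rr n x (hs ++ hs') == b)%:R) - Psi b n x hs)) < e / 8) (fun n => 0) (fun x => hs0 x _ e8).
apply: evS => n hn x val q; have {hn} := hn x; rewrite -Eh_sum.
set sg := Eh N _ => hsg.
pose p hs b : R := Eh M (fun hs' => (Rr n x (hs ++ hs') == b)%:R).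
have p0 hs b : 0 <= p hs b by apply: Eh_ge0 => hs'; exact: ler0n.
have p1 hs : \sum_b p hs b = 1.
  rewrite -Eh_sum -[RHS](Eh_const (Z n) M); apply: eq_Eh => hs' _.
  rewrite (bigD1 (Rr n x (hs ++ hs'))) //= eqxx big1 ?addr0 // => b.
  by rewrite eq_sym => /negbTE ->.
have pC hs b : (p hs b)%:C = Eh M (fun hs' => (Rr n x (hs ++ hs') == b)%:R) :> C.
  by rewrite /p /Eh avgC; apply: eq_avg => hs'; case: (_ == _).
have qE hs : 1 - p hs (val hs) = q hs.
  rewrite -{1}(Eh_const (Z n) M (1 : R)) /q /p /Eh -avgB; apply: eq_avg => hs'.
  by case: (_ == _); rewrite ?subrr ?subr0.
have sgE : sg = Eh N (fun hs => \sum_b ab ((p hs b)%:C - Psi b n x hs)).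
  by apply: eq_Eh => hs _; apply: eq_bigr => b _; rewrite pC.
split.
  apply: le_trans (_ : Eh N (fun hs => 4 * q hs + 4 * \sum_b ab ((p hs b)%:C - Psi b n x hs)) <= _).
    by apply: ler_Eh => hs _; rewrite -qE; apply: dec_le.
  rewrite EhD !EhZ -sgE lerD2l; lra.
move=> hq; apply: le_trans (_ : Eh N (fun hs => 8 * \sum_b ab ((p hs b)%:C - Psi b n x hs)) <= _).
  by apply: ler_Eh => hs sz; apply: dec_le8 => //; rewrite qE hq.
rewrite EhZ -sgE; lra.
Qed.

(** [CI] with no direction kept: up to a small error, the statistics of the cubes at [x] depend only
    on the type of [x]. *)
Lemma transfer k X (S : pred (seq bool)) M (T : forall n, Z n -> seq (Z n) -> bool) :
  good k X -> (forall s s', leb s s' -> S s' -> S s) -> S (nseq M false) -> ev (fun n => typed X S M (T n)) ->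
  forall e, 0 < e -> ev (fun n => forall x x', eqs X n x x' ->
    Eh M (fun hs => (T n x hs)%:R) <= Eh M (fun hs => (T n x' hs)%:R) + e :> R).
Proof.
move=> gX Sd S0 tT e e0.
have [||Psi h1 h2] := @CI R W UW Z m' k X S gX Sd 0 M (fun n x hs => (T n x hs)%:R).
- by move=> n x hs; exact: ab_bool.
- by apply: evS tT => n t x hs x' hs' s1 s2 h; rewrite (t x hs x' hs').
have e2 : 0 < e / 2 by rewrite divr_gt0.
have := @evall Z (fun n x => Eh 0 (fun hs => ab (Eh M (fun hs' => (T n x (hs ++ hs'))%:R) - Psi n x hs)) < e / 2) (fun n => 0) (fun x => h2 x _ e2).
apply: evS => n hn x x' xx'; have := hn x; have := hn x'; rewrite !Eh0 /=.
have -> : Psi n x' [::] = Psi n x [::].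
  symmetry; apply: h1 => // s s0 _; rewrite (size0nil s0) /= !addr0; exact: xx'.
have EC y : Eh M (fun hs' => (T n y hs')%:R) = (Eh M (fun hs' => (T n y hs')%:R))%:C :> C.
  by rewrite /Eh avgC; apply: eq_avg => hs'; case: (T _ _ _).
rewrite !EC => a1 a2.
set a := Eh M _; set b := Eh M (fun hs => (T n x' hs)%:R).
have : ab (a%:C - b%:C) < e.
  by apply: le_lt_trans (ab_tri _ _ (Psi n x [::])) _; rewrite [ab (Psi _ _ _ - _)]ab_sym; rewrite -/a -/b in a1 a2 *; lra.
rewrite -rmorphB abR => h; have := ler_norm (a - b); lra.
Qed.

(** Expand in characters the event that a cube has the free data of the given one. Characters that
    are constant in the directions contribute 1 each, as both cubes have the same base point; the
    others are null. The trivial character alone gives [1 / #|G|], and half of it absorbs the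
    errors. *)
Lemma positivity k X M : good k X -> exists2 kap : R, 0 < kap &
  ev (fun n => forall xhs : Z n * M.-tuple (Z n), kap <= Eh M (fun h1 =>
    `[< forall s, size s = M -> eqs X n (xhs.1 + dot s h1) (xhs.1 + dot s xhs.2) >]%:R)).
Proof.
move=> gX; have [_ ex _] := gX.
pose S : pred (seq bool) := xpredT; pose FD := @fd Z m' X S; have Sd : forall s s', leb s s' -> S s' -> S s by [].
pose G : finZmodType := {ffun M.-tuple bool * sI X -> A}.
have G0 : 0 < #|G|%:R :> R by rewrite ltr0n zmod_gt0.
exists (2 * #|G|%:R)^-1; first by rewrite invr_gt0 mulr_gt0.
apply: (@evall (fun n => (Z n * M.-tuple (Z n))%type) (fun n xhs => (2 * #|G|%:R)^-1 <= Eh M (fun h1 =>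
    `[< forall s, size s = M -> eqs X n (xhs.1 + dot s h1) (xhs.1 + dot s xhs.2) >]%:R))).
  by move=> n; exact: (0, [tuple of nseq M 0]).
move=> xhs; pose x n := (xhs n).1; pose hs n := (xhs n).2.
pose gd (e : G) := `[< ev (fun n => forall x h0 hs', size h0 = 0%N -> pair e (FD (0 + M)%N n x (h0 ++ hs')) = @p0 Z m' X S 0 M e n x h0) >].
have hg : ev (fun n => forall e, gd e -> forall hs', pair e (FD M n (x n) hs') = @p0 Z m' X S 0 M e n (x n) [::]).
  by apply: ev_fin => e; case: (boolP (gd e)) => [/asboolP|_]; [apply: evS => n h _ hs'; exact: (h (x n) [::] hs')|exact: evT].
have nb : null W (fun n => \sum_(e : G) if gd e then 0 else ab (Eh M (fun hs' => E (pair e (FD M n (x n) hs'))))).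
  apply: null_sum => e; case: (boolP (gd e)) => ge.
    by move=> ep ep0; exact: evT.
  have [h|h] := @law_char R W UW Z m' k X S gX 0 M e; first by move/asboolP: ge => [].
  by apply: null_le (h x); apply: evT => n; rewrite Eh0.
have e1 : 0 < 2^-1 :> R by rewrite invr_gt0.
apply: ev3 hg (nb _ e1) ex => n hg nb' ex.
apply: le_trans (_ : Eh M (fun h1 => (FD M n (x n) h1 == FD M n (x n) (hs n))%:R) <= _); last first.
  apply: ler_Eh => h1 sz; case: eqP => [e|_]; last exact: ler0n.
  rewrite asboolT // => s ss; apply: (fd_typed Sd ex sz _ e) => //; exact: size_tuple.
set P := Eh M _.
have PE : P%:C = avg (fun e : G => Eh M (fun h1 => E (pair e (FD M n (x n) h1))) * Num.conj (E (pair e (FD M n (x n) (hs n))))).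
  rewrite /P /Eh avgC; under [RHS]eq_avg => e do rewrite -avgZr.
  rewrite avg_exch; apply: eq_avg => h1.
  transitivity (avg (fun e => E (pair e (FD M n (x n) h1 - FD M n (x n) (hs n))))).
    rewrite pair_orth subr_eq0; by case: (_ == _).
  by apply: eq_avg => e; rewrite pairB EB.
have Pge : 1 - 2^-1 <= #|G|%:R * P.
  have : ab (\sum_(e | gd e) 1 - (#|G|%:R * P)%:C : C) <= 2^-1.
    rewrite ltW //; apply: le_lt_trans nb'.
    have -> : (#|G|%:R * P)%:C = \sum_e Eh M (fun h1 => E (pair e (FD M n (x n) h1))) * Num.conj (E (pair e (FD M n (x n) (hs n)))) :> C.
      by rewrite rmorphM /= PE /avg rmorph_nat mulrC divfK // pnatr_eq0 -lt0n zmod_gt0.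
    rewrite [X in _ - X](bigID gd) /= opprD addrA -sumrB big1 ?add0r => [|e ge].
      rewrite abN; apply: le_trans (ab_sum _ _ _) _; rewrite [leRHS](bigID gd) /= [X in X + _]big1 ?add0r => [|e ->] //.
      by apply: ler_sum => e /negbTE ->; rewrite abM ab_conj ab_E mulr1.
    rewrite (@eq_Eh _ _ _ _ (fun=> E (@p0 Z m' X S 0 M e n (x n) [::]))) => [|h1 _]; last by rewrite hg.
    by rewrite Eh_const hg // EJ subrr.
  rewrite sumr_const -(rmorph_nat (real_complex R)) -rmorphB abR => h.
  have g0 : 1 <= #|gd|%:R :> R.
    rewrite ler1n; apply/card_gt0P; exists 0; apply/asboolP; apply: evT => n' y h0 hs' _.
    have pz (z : G) : pair 0 z = 0 by rewrite /pair big1 // => v _; rewrite ffunE.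
    rewrite pz /p0 big1 // => v _; rewrite /ef big1 // => i _; by rewrite ffunE.
  have := ler_norm (#|gd|%:R - #|G|%:R * P); lra.
rewrite invfM mulrC ler_pdivrMl // ; lra.
Qed.
End Tools.

(** * Union bounds over the vertices of a cube *)

Section Edges.
Variables (R : realType) (Z : finZmodType) (A : zmodType) (K : nat).
Lemma Eh_dot (v : seq bool) (phi : Z -> R) : has id v -> Eh (size v) (fun h => phi (dot v h)) = avg phi.
Proof.
elim: v phi => [|b v IH] phi //= hv; rewrite EhS; case: b hv => /= [_|hv].
  rewrite /Eh avg_exch -[RHS](Eh_const Z (size v)); apply: eq_avg => hs.
  exact: avg_addr.
rewrite -[RHS](@avg_const R Z) ?zmod_gt0 //; apply: eq_avg => h.
by rewrite -(IH phi hv); apply: eq_Eh => hs _; rewrite add0r.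
Qed.
Lemma alt_union d (f g : seq bool -> A) : (alt d f != alt d g)%:R <= \sum_(v : d.-tuple bool) (f v != g v)%:R :> R.
Proof.
case: (boolP [forall v : d.-tuple bool, f v == g v]) => [/forallP h|].
  rewrite (@eq_alt _ d f g) ?eqxx; first by apply: sumr_ge0.
  by move=> s sz; have /eqP := h (tcast sz (in_tuple s)); rewrite val_tcast.
rewrite negb_forall => /existsP[v hv]; rewrite (bigD1 v) //= hv.
by apply: le_trans (_ : 1 <= _); [case: (_ != _) | rewrite lerDl sumr_ge0].
Qed.
Lemma zadd_nvm0 (h h' : seq Z) : size h = size h' -> zadd (nvm (nseq (size h) false) h) h' = h'.
Proof. by elim: h h' => [|a h IH] [|a' h'] //= [sz]; rewrite add0r IH. Qed.
Lemma unif_dir (v : seq bool) h (Phi : seq Z -> R) : size h = K -> size v = K ->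
  Eh K (fun h' => Phi (zadd (nvm v h) h')) = Eh K Phi.
Proof. by move=> sh sv; apply: Eh_shift; rewrite size_nvm ?sv. Qed.
Lemma card_tb : \sum_(v : K.-tuple bool) (1 : R) = 2 ^+ K.
Proof. by rewrite sumr_const card_tuple card_bool natrX. Qed.
Lemma union_fix (a b : Z -> seq Z -> A) (del : R) x h : size h = K ->
  (forall y, Eh K (fun h' => (a y h' != b y h')%:R) <= del) ->
  Eh K (fun h' => (alt K (fun v => a (x + dot v h) (zadd (nvm v h) h')) !=
                   alt K (fun v => b (x + dot v h) (zadd (nvm v h) h')))%:R) <= 2 ^+ K * del.
Proof.
move=> sh hd; apply: le_trans (ler_Eh (fun h' _ => alt_union K _ _)) _.
rewrite Eh_sum -card_tb mulr_suml; apply: ler_sum => v _; rewrite mul1r.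
rewrite (unif_dir (fun l => (a (x + dot v h) l != b (x + dot v h) l)%:R)) ?size_tuple //.
Qed.
Lemma Eh_exch (f : seq Z -> seq Z -> R) : Eh K (fun h => Eh K (fun h' => f h h')) = Eh K (fun h' => Eh K (fun h => f h h')).
Proof. by rewrite /Eh avg_exch. Qed.
Lemma neq_le (T : eqType) (a b c : T) : (a != c)%:R <= (a != b)%:R + (b != c)%:R :> R.
Proof.
case: (eqVneq a b) => [->|_] /=; first by rewrite add0r.
by case: (a != c); case: (b != c); rewrite /=; lra.
Qed.
Lemma bool_le (b b1 b2 : bool) : (b -> b1 || b2) -> b%:R <= b1%:R + b2%:R :> R.
Proof. by case: b b1 b2 => [] [] [] //= h; try (by have := h isT); lra. Qed.
Lemma bool_pos (a b c : bool) : 0 < a%:R - (b%:R + c%:R) :> R -> [/\ a, ~~ b & ~~ c].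
Proof. by case: a b c => [] [] [] //= h; split=> //; exfalso; move: h; lra. Qed.
End Edges.

(** * Exact phases *)

Section Exactify.
Variable R : realType.
Context (W : set_system nat) {UW : UltraFilter W}.
Variable Z : nat -> finZmodType.
Local Notation ev := (ev W).
Variable m' : nat.
Local Notation A := 'I_m'.+1.
Local Notation sys := (sys Z m').
Local Notation good := (@good R W Z m').
Local Notation eqs X n x x' := (@eqs Z m' X n x x').
Variables (k : nat) (X : sys) (K : nat).
Hypothesis gX : good k X.

(** The right-hand side of [du_split] with each derivative replaced by its prediction [r], the
    vertices in [P] being left out. *)
Definition rsum n (r : Z n -> seq (Z n) -> A) (P : pred (seq bool)) x (h h' : seq (Z n)) : A :=
  alt K (fun v => if P v then 0 else r (x + dot v h) (zadd (nvm v h) h')).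
Lemma rsum_typed n (r : Z n -> seq (Z n) -> A) P x h h' y l l' : typed X xpredT K r ->
  size h = K -> size h' = K -> size l = K -> size l' = K ->
  (forall v w, size v = K -> size w = K ->
     eqs X n (x + (dot (mixv v w) h + dot w h')) (y + (dot (mixv v w) l + dot w l'))) ->
  rsum r P x h h' = rsum r P y l l'.
Proof.
move=> tr s1 s2 s3 s4 e; apply: eq_alt => v sv; case: (P v) => //; apply: tr.
- by rewrite size_zadd size_nvm ?sv ?s1 ?s2 ?s3 ?s4.
- by rewrite size_zadd size_nvm ?sv ?s1 ?s2 ?s3 ?s4.
by move=> w sw _; rewrite -!addrA !dot_mix ?sv ?sw ?s1 ?s2 ?s3 ?s4 //; exact: e.
Qed.

Variables (u : forall n, Z n -> A) (r0 : forall n, Z n -> seq (Z n) -> A) (eps : R).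
Hypotheses (eps0 : 0 < eps) (eps1 : 360 * (2 ^+ K * 2 ^+ K) * eps <= 1).
Hypothesis tr0 : ev (fun n => typed X xpredT K (r0 (n := n))).
Hypothesis hu : ev (fun n => avg (fun x => Eh K (fun h => (du (u (n := n)) h x != r0 x h)%:R)) <= eps).
Let N : R := 2 ^+ K.
Let N1 : 1 <= N. Proof. by rewrite exprn_ege1 // ler1n. Qed.
Let zK := nseq K false.

(** In [du_split] the cube at a vertex [v] has a uniformly distributed base point, except for
    [v = 0], where it is the cube [h'] at [x]. With that term moved to the left, the average
    hypothesis gives a prediction at every [x]. *)
Lemma step1 n x : avg (fun x => Eh K (fun h => (du (u (n := n)) h x != r0 x h)%:R)) <= eps ->
  Eh K (fun h => Eh K (fun h' => (du (u (n := n)) h x - du (u (n := n)) h' x != rsum (r0 (n := n)) (pred1 zK) x h h')%:R)) <= N * eps.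
Proof.
move=> hn; set un := u (n := n).
have dE h h' : size h = K -> size h' = K -> du un h x - du un h' x =
    alt K (fun v => if v == zK then 0 else du un (zadd (nvm v h) h') (x + dot v h)).
  move=> sh sh'; rewrite {1}(@du_split _ _ un h h') ?sh //.
  have -> : du un h' x = alt K (fun v => if v == zK then du un (zadd (nvm v h) h') (x + dot v h) else 0).
    rewrite alt_single => [|s _ /negbTE -> //]; rewrite eqxx /zK -{1}sh zadd_nvm0 ?sh //.
    by rewrite dot0 addr0.
  by rewrite -altB; apply: eq_alt => v _; case: (v == zK); rewrite ?subrr ?subr0.
apply: le_trans (_ : Eh K (fun h => Eh K (fun h' => \sum_(v : K.-tuple bool)
    ((v != zK :> seq bool) && (du un (zadd (nvm v h) h') (x + dot v h) != r0 (x + dot v h) (zadd (nvm v h) h')))%:R)) <= _).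
  apply: ler_Eh => h sh; apply: ler_Eh => h' sh'; rewrite dE //.
  apply: le_trans (alt_union _ _ _ _) _; apply: ler_sum => v _.
  by rewrite /=; case: (_ == zK); rewrite /= ?eqxx.
rewrite (@eq_Eh _ _ _ _ (fun h => \sum_(v : K.-tuple bool) Eh K (fun h' => ((v != zK :> seq bool) && (du un (zadd (nvm v h) h') (x + dot v h) != r0 (x + dot v h) (zadd (nvm v h) h')))%:R))); last first.
  by move=> h _; rewrite Eh_sum.
rewrite Eh_sum /N -(card_tb R K) mulr_suml; apply: ler_sum => v _; rewrite mul1r.
rewrite (@eq_Eh _ _ _ _ (fun h => (fun y => Eh K (fun h' => ((v != zK :> seq bool) && (du un h' y != r0 y h'))%:R)) (x + dot v h))); last first.
  by move=> h sh; rewrite (unif_dir (fun l => ((v != zK :> seq bool) && (du un l (x + dot v h) != r0 (x + dot v h) l))%:R)) ?size_tuple.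
case: (eqVneq (v : seq bool) zK) => [_|ne] /=.
  by rewrite (@eq_Eh _ _ _ _ (fun=> 0)) ?Eh_const ?ltW // => h _; rewrite Eh_const.
have hv : has id v.
  by apply: contraT => /size_ind_has e; case/eqP: ne; rewrite e size_tuple.
have := @Eh_dot R (Z n) v (fun y => Eh K (fun h' => (du un h' (x + y) != r0 (x + y) h')%:R)) hv.
rewrite size_tuple => ->.
by rewrite (avg_addl (fun y => Eh K (fun h' => (du un h' y != r0 y h')%:R)) x).
Qed.

(** Vertices that do not mix the first two blocks of directions: the two predictions compared in
    [step2] use the blocks [h] and [l] separately. *)
Let S (s : seq bool) := ~~ (has id (take K s) && has id (take K (drop K s))).
Let Sd : forall s s', leb s s' -> S s' -> S s.
Proof.
have lt a b j : leb a b -> leb (take j a) (take j b).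
  elim: j a b => [|j IH] [|x a] [|y b] //= /andP[xy /IH h]; by apply/andP.
have ld a b j : leb a b -> leb (drop j a) (drop j b).
  by elim: j a b => [|j IH] [|x a] [|y b] //= /andP[xy]; exact: IH.
move=> s s' l; apply: contra => /andP[h1 h2]; apply/andP; split.
  by apply: leb_has h1; exact: lt.
by apply: leb_has h2; apply/lt/ld.
Qed.
Lemma S3 (a b c : seq bool) : size a = K -> size b = K -> S (a ++ b ++ c) = ~~ (has id a && has id b).
Proof. by move=> sa sb; rewrite /S take_size_cat // drop_size_cat // take_size_cat. Qed.

(* For every [x], the difference of the derivatives along [h] and along [l] is
   a function of the two cube types. *)
Lemma step2 : exists2 Gam : forall n, Z n -> seq (Z n) -> A,
  forall n, typed X (fun s => S (s ++ nseq K false)) (K + K) (Gam n) &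
  ev (fun n => forall x, Eh K (fun h => Eh K (fun l =>
     (Gam n x (h ++ l) != du (u (n := n)) h x - du (u (n := n)) l x)%:R)) <= 9 * N * eps).
Proof.
(* Both predictions use the same third block [h'], and the derivative along it cancels. *)
pose Rs n x (hh : seq (Z n)) := rsum (r0 (n := n)) (pred1 zK) x (take K hh) (drop K (drop K hh)) -
   rsum (r0 (n := n)) (pred1 zK) x (take K (drop K hh)) (drop K (drop K hh)).
have tRs : ev (fun n => typed X S (K + K + K) (Rs n)).
  apply: evS tr0 => n tr x hh y ll s1 s2 e.
  have sz (T : Type) (l : seq T) : size l = (K + K + K)%N -> [/\ size (take K l) = K, size (take K (drop K l)) = K & size (drop K (drop K l)) = K].
    move=> sl; rewrite !size_takel ?size_drop ?sl -?addnA ?leq_addr ?addKn ?leq_addr //.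
  have [a1 a2 a3] := sz _ _ s1; have [b1 b2 b3] := sz _ _ s2.
  have cE (T : Type) (l : seq T) : l = take K l ++ take K (drop K l) ++ drop K (drop K l) by rewrite !cat_take_drop.
  rewrite /Rs; congr (_ - _); apply: rsum_typed => // v w sv sw.
    have := e (mixv v w ++ nseq K false ++ w).
    rewrite S3 ?size_mixv ?size_nseq ?sv ?sw // has_nseqF andbF => /(_ _ isT).
    rewrite (cE _ hh) (cE _ ll) !dot_cat ?size_nseq ?size_mixv ?sv ?sw ?a1 ?b1 ?a2 ?b2 // !dot0 !add0r.
    by rewrite -!cE; apply; rewrite !size_cat size_mixv ?size_nseq ?sv ?sw // addnA.
  have := e (nseq K false ++ mixv v w ++ w).
  rewrite S3 ?size_mixv ?size_nseq ?sv ?sw // has_nseqF => /(_ _ isT).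
  rewrite (cE _ hh) (cE _ ll) !dot_cat ?size_nseq ?size_mixv ?sv ?sw ?a1 ?b1 ?a2 ?b2 // !dot0 !add0r.
  by rewrite -!cE; apply; rewrite !size_cat size_mixv ?size_nseq ?sv ?sw // addnA.
have [Gam tG hG] := decode gX Sd tRs.
exists Gam => //; apply: ev2 hu (hG _ eps0) => n hn hG' x.
have [h1 _] := hG' x (fun hh => du (u (n := n)) (take K hh) x - du (u (n := n)) (drop K hh) x).
move: h1; rewrite !Eh_cat.
set q := Eh K (fun hs => Eh K (fun hs' => Eh K _)); set p := Eh K _ => h1.
have -> : Eh K (fun h => Eh K (fun l => (Gam n x (h ++ l) != du (u (n := n)) h x - du (u (n := n)) l x)%:R)) = p.
  by apply: eq_Eh => h sh; apply: eq_Eh => l sl; rewrite take_size_cat // drop_size_cat.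
have hq : q <= 2 * (N * eps).
  pose b h h' : R := (du (u (n := n)) h x - du (u (n := n)) h' x != rsum (r0 (n := n)) (pred1 zK) x h h')%:R.
  apply: le_trans (_ : Eh K (fun h => Eh K (fun l => Eh K (fun h' => b h h' + b l h'))) <= _).
    apply: ler_Eh => h sh; apply: ler_Eh => l sl; apply: ler_Eh => h' sh'.
    rewrite /Rs -catA !take_size_cat // !drop_size_cat // take_size_cat //.
    apply: bool_le; rewrite -negb_and; apply: contra => /andP[/eqP <- /eqP <-].
    by rewrite opprB addrA subrK.
  rewrite (@eq_Eh _ _ _ _ (fun h => Eh K (b h) + Eh K (fun l => Eh K (b l)))).
    by rewrite EhD Eh_const mulr2n mulrDl mul1r lerD // step1.
  move=> h sh; rewrite (@eq_Eh _ _ _ _ (fun l => Eh K (b h) + Eh K (b l))) => [|l sl]; last by rewrite EhD.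
  by rewrite EhD Eh_const.
apply: le_trans h1 _; have : eps <= N * eps by rewrite ler_peMl // ltW.
lra.
Qed.

(** Replacing [l] in [step2] by a fixed cube at a representative of the type of [x] defines [V]. At
    the representative [Gam] is mostly the difference of two values of [V], and [transfer] carries
    this to [x]. Then [du u h x - V x h] hardly depends on [h], and its prevailing value is
    [U x]. *)
Lemma step4 : exists2 V : forall n, Z n -> seq (Z n) -> A, forall n, typed X xpredT K (V n) &
  exists U : forall n, Z n -> A, ev (fun n => forall x,
    Eh K (fun h => (du (u (n := n)) h x - U n x != V n x h)%:R) <= 45 * N * eps).
Proof.
have [Gam tG hG] := step2; set e1 := 9 * N * eps in hG.
have e10 : 0 <= e1 by rewrite !mulr_ge0 ?(le_trans ler01 N1) // ltW.
pose D n x h := du (u (n := n)) h x.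
pose rep n (x : Z n) : Z n := xget 0 [set z | eqs X n x z].
have repP n x : eqs X n x (rep n x).
  by rewrite /rep; apply: (@xgetPex _ 0 [set z | eqs X n x z]); exists x.
have repE n x y : eqs X n x y -> rep n x = rep n y.
  move=> h; rewrite /rep; congr xget; apply/seteqP; split=> z hz i; first by rewrite -(h i).
  by rewrite (h i).
have repK n x : rep n (rep n x) = rep n x by rewrite -(repE _ _ _ (repP n x)).
have hst0 n z : exists hst : seq (Z n), size hst = K /\
   Eh K (fun h => (Gam n z (h ++ hst) != D n z h - D n z hst)%:R) <= 
   Eh K (fun h => Eh K (fun l => (Gam n z (h ++ l) != D n z h - D n z l)%:R)) :> R.
  rewrite Eh_exch; have [l sl hl] := Eh_pick K (fun l => Eh K (fun h => (Gam n z (h ++ l) != D n z h - D n z l)%:R) : R).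
  by exists l.
pose hst n z := projT1 (cid (hst0 n z)).
have shst n z : size (hst n z) = K by have := projT2 (cid (hst0 n z)) => -[].
have hhst n z := (projT2 (cid (hst0 n z))).2.
pose cond n x h (zhh : Z n * seq (Z n)) := [/\ size zhh.2 = (K + K)%N,
   forall s, size s = K -> eqs X n (zhh.1 + dot s (take K zhh.2)) (x + dot s h) &
   forall s, size s = K -> eqs X n (zhh.1 + dot s (drop K zhh.2)) (rep n x + dot s (hst n (rep n x)))].
pose V n x h := if pselect (exists zhh, cond n x h zhh) is left e then
   (fun zhh => Gam n zhh.1 zhh.2) (projT1 (cid e)) else 0.
have S0 (s : seq bool) : size s = (K + K)%N -> S (s ++ nseq K false) = ~~ (has id (take K s) && has id (drop K s)).
  move=> ss; rewrite -{1}(cat_take_drop K s) -catA S3 // ?size_takel ?size_drop ?ss ?leq_addr ?addKn //.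
have dsplit n (hh : seq (Z n)) (s : seq bool) : size hh = (K + K)%N -> size s = (K + K)%N ->
   dot s hh = dot (take K s) (take K hh) + dot (drop K s) (drop K hh).
  by move=> s1 s2; rewrite -dot_cat ?cat_take_drop // !size_takel ?s1 ?s2 ?leq_addr.
have nohas (s : seq bool) n (l : seq (Z n)) : ~~ has id s -> dot s l = 0.
  by move=> /size_ind_has ->; exact: dot0.
have VP n x h zhh : cond n x h zhh -> V n x h = Gam n zhh.1 zhh.2.
  move=> c; rewrite /V; case: pselect => [e|[]]; last by exists zhh.
  case: (cid e) => z [c1 c2 c3] /=; have [d1 d2 d3] := c; apply: tG => // s ss.
  have st : size (take K s) = K by rewrite size_takel // ss leq_addr.
  have sd : size (drop K s) = K by rewrite size_drop ss addKn.
  rewrite S0 // negb_and (dsplit n z.2 s) // (dsplit n zhh.2 s) // => /orP[] h0 i.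
    by rewrite !(nohas _ _ _ h0) !add0r c3 // d3.
  by rewrite !(nohas _ _ _ h0) !addr0 c2 // d2.
have tV n : typed X xpredT K (V n).
  move=> x h y l sh sl e.
  have exy : eqs X n x y by have := e (nseq K false); rewrite !dot0 !addr0 size_nseq; apply.
  have cE zhh : cond n x h zhh -> cond n y l zhh.
    move=> [c1 c2 c3]; split=> // s ss i; first by rewrite c2 // e.
    by rewrite c3 // (repE _ _ _ exy).
  have cE' zhh : cond n y l zhh -> cond n x h zhh.
    move=> [c1 c2 c3]; split=> // s ss i; first by rewrite c2 // e.
    by rewrite c3 // (repE _ _ _ exy).
  have [[zhh c]|nc] := pselect (exists zhh, cond n x h zhh).
    by rewrite (VP _ _ _ _ c) (VP _ _ _ _ (cE _ c)).
  rewrite /V; case: pselect => // _; case: pselect => // -[zhh c]; case: nc; exists zhh; exact: cE'.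
exists V => //.
have Vrep n y h : rep n y = y -> size h = K -> V n y h = Gam n y (h ++ hst n y).
  move=> ry sh; rewrite (@VP n y h (y, h ++ hst n y)) //; split=> /=.
  - by rewrite size_cat sh shst.
  - by rewrite take_size_cat.
  - by rewrite drop_size_cat // ry.
pose T n x hh := Gam n x hh != V n x (take K hh) - V n x (drop K hh).
have tT n : typed X (fun s => S (s ++ nseq K false)) (K + K) (T n).
  move=> x h y l sh sl e; rewrite /T (tG n x h y l) //.
  have sz (j : seq (Z n)) : size j = (K + K)%N -> size (take K j) = K /\ size (drop K j) = K.
    by move=> sj; rewrite size_takel ?size_drop ?sj ?leq_addr ?addKn.
  have [a1 a2] := sz _ sh; have [b1 b2] := sz _ sl.
  rewrite (tV n x (take K h) y (take K l)) // 1?(tV n x (drop K h) y (drop K l)) // => s ss _.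
    have := e (nseq K false ++ s); rewrite S0 ?size_cat ?size_nseq ?ss // take_size_cat ?size_nseq // has_nseqF.
    by rewrite (dsplit n h) ?(dsplit n l) ?size_cat ?size_nseq ?ss // take_size_cat ?size_nseq // drop_size_cat ?size_nseq // !dot0 !add0r; apply.
  have := e (s ++ nseq K false); rewrite S0 ?size_cat ?size_nseq ?ss // drop_size_cat // has_nseqF andbF.
  by rewrite (dsplit n h) ?(dsplit n l) ?size_cat ?size_nseq ?ss // take_size_cat // drop_size_cat // !dot0 !addr0; apply.
have Sd0 s s' : leb s s' -> S (s' ++ nseq K false) -> S (s ++ nseq K false).
  by move=> l; apply: Sd; rewrite leb_cat ?(leb_size l) // l leb_refl.
have S00 : S (nseq (K + K) false ++ nseq K false).
  by rewrite S0 ?size_nseq // nseqD take_size_cat ?size_nseq // has_nseqF.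
have htr := @transfer R W UW Z m' k X _ (K + K) T gX Sd0 S00 (evT (UW := UW) tT) _ eps0.
exists (fun n x => if pselect (exists a, Eh K (fun h => (D n x h - a != V n x h)%:R) <= 45 * N * eps) is left e then projT1 (cid e) else 0).
apply: ev2 hG htr => n hG' htr' x.
case: pselect => [e|[]]; first by have := projT2 (cid e).
pose y := rep n x.
have hy : Eh (K + K) (fun hh => (T n y hh)%:R) <= 3 * e1.
  rewrite Eh_cat.
  pose g h : R := (Gam n y (h ++ hst n y) != D n y h - D n y (hst n y))%:R.
  have hg : Eh K g <= e1 by apply: le_trans (hhst n y) _; exact: hG'.
  apply: le_trans (_ : Eh K (fun h => Eh K (fun l => (Gam n y (h ++ l) != D n y h - D n y l)%:R + (g h + g l))) <= _).
    apply: ler_Eh => h sh; apply: ler_Eh => l sl; rewrite /T take_size_cat // drop_size_cat //.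
    rewrite !Vrep ?repK // /g; apply: le_trans (neq_le _ _ (D n y h - D n y l) _) _; rewrite lerD2l.
    apply: bool_le; rewrite -negb_and; apply: contra => /andP[/eqP -> /eqP ->].
    by rewrite opprB addrA subrK.
  rewrite (@eq_Eh _ _ _ _ (fun h => Eh K (fun l => (Gam n y (h ++ l) != D n y h - D n y l)%:R) + (g h + Eh K g))); last first.
    move=> h _; rewrite EhD; congr (_ + _).
    by rewrite EhD Eh_const.
  rewrite !EhD Eh_const; have := hG' y; rewrite -/(D n y); lra.
have h2 : Eh (K + K) (fun hh => (T n x hh)%:R) <= 3 * e1 + eps.
  by apply: le_trans (htr' _ _ (repP n x)) _; rewrite lerD2r.
have [l sl hl] := Eh_pick K (fun l => Eh K (fun h => (D n x h - D n x l != V n x h - V n x l)%:R) : R).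
exists (D n x l - V n x l).
rewrite (@eq_Eh _ _ _ _ (fun h => (D n x h - D n x l != V n x h - V n x l)%:R)); last first.
  move=> h _; congr ((~~ _)%:R); rewrite -subr_eq0 -[RHS]subr_eq0; congr (_ == _).
  by rewrite !opprB !addrA (addrAC (D n x h) (V n x l)).
apply: le_trans hl _; rewrite Eh_exch.
apply: le_trans (_ : Eh K (fun h => Eh K (fun l => (Gam n x (h ++ l) != D n x h - D n x l)%:R + (T n x (h ++ l))%:R)) <= _).
  apply: ler_Eh => h sh; apply: ler_Eh => l' sl'; rewrite /T take_size_cat // drop_size_cat //.
  by apply: le_trans (neq_le _ _ (Gam n x (h ++ l')) _) _; rewrite lerD2r eq_sym.
rewrite (@eq_Eh _ _ _ _ (fun h => Eh K (fun l => (Gam n x (h ++ l) != D n x h - D n x l)%:R) + Eh K (fun l => (T n x (h ++ l))%:R))); last by move=> h _; rewrite EhD.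
rewrite EhD; rewrite Eh_cat in h2.
have h3 : Eh K (fun h => Eh K (fun l => (Gam n x (h ++ l) != D n x h - D n x l)%:R)) <= e1 := hG' x.
have h4 : eps <= N * eps by rewrite ler_peMl // ltW.
apply: le_trans (lerD h3 h2) _; rewrite /e1 -!mulrA; move: h4 eps0; set q := N * eps; lra.
Qed.

(** [u' = u - U]. By [du_split] and [step4] a clear majority predicts its derivative at every [x]
    and [h], so [decode] yields [rho] with arbitrarily small probability of failure. Once this is
    below the recurrence probability [kap], failures are excluded: some cube of the same type obeys
    the prediction. On average [U] agrees with [r0 - V], which is typed; this gives [w]. *)
Theorem exactify : exists2 u' : forall n, Z n -> A, ev (fun n => exact K (fun x y => eqs X n x y) (u' n)) &
  exists2 w : forall n, Z n -> A, forall n x y, eqs X n x y -> w n x = w n y &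
   ev (fun n => avg (fun x => (u' n x != u x - w n x)%:R) <= 200 * N * eps).
Proof.
have [V tV [U hU]] := step4; set d1 := 45 * N * eps in hU.
have d10 : 0 <= d1 by rewrite !mulr_ge0 ?(le_trans ler01 N1) // ltW.
pose u' n y := u y - U n y.
have duE n h x h' : size h = K -> size h' = K -> du (u' n) h x =
    alt K (fun v => du (u (n := n)) (zadd (nvm v h) h') (x + dot v h) - U n (x + dot v h)).
  by move=> sh sh'; rewrite altB (duB (u (n := n)) (U n)) (@du_split _ _ _ h h') ?sh // {2}/du sh.
pose rV n x hh := rsum (V n) pred0 x (take K hh) (drop K hh).
have sz n (j : seq (Z n)) : size j = (K + K)%N -> size (take K j) = K /\ size (drop K j) = K.
  by move=> sj; rewrite size_takel ?size_drop ?sj ?leq_addr ?addKn.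
have mixE n x (hh : seq (Z n)) v w : size hh = (K + K)%N -> size v = K -> size w = K ->
    x + (dot (mixv v w) (take K hh) + dot w (drop K hh)) = x + dot (mixv v w ++ w) hh.
  move=> sh sv sw; have [a1 a2] := sz _ _ sh.
  by rewrite -dot_cat ?cat_take_drop // size_mixv ?sv.
have smix v w : size v = K -> size w = K -> size (mixv v w ++ w) = (K + K)%N.
  by move=> sv sw; rewrite size_cat size_mixv ?sv ?sw.
have trV n : typed X xpredT (K + K) (rV n).
  move=> x h y l sh sl e; have [a1 a2] := sz _ _ sh; have [b1 b2] := sz _ _ sl.
  by apply: rsum_typed => // v w sv sw; rewrite !mixE //; apply: e => //; exact: smix.
(* [8 * 45 = 360] is the origin of the constant in [eps1]. *)
have Nd1 : N * d1 <= 8^-1.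
  by rewrite /d1; move: eps1; rewrite -/N => h; rewrite -(ler_pM2l (x := 8)) ?divff //; lra.
have [rho trho hrho] := decode (S := xpredT) gX (fun _ _ _ _ => isT) (evT (UW := UW) trV).
have hrho' (e : R) : 0 < e -> ev (fun n => forall x, Eh K (fun h => (du (u' n) h x != rho n x h)%:R) <= e).
  move=> e0; apply: ev2 (hrho e e0) hU => n hr hU' x.
  have [_ h2] := hr x (fun h => du (u' n) h x).
  rewrite (@eq_Eh _ _ _ _ (fun h => (rho n x h != du (u' n) h x)%:R)) => [|h _]; last by rewrite eq_sym.
  apply: h2 => h sh; apply: le_trans Nd1.
  have := @union_fix R (Z n) _ K (fun y l => du (u (n := n)) l y - U n y) (V n) d1 x h sh hU'.
  apply: le_trans; apply: ler_Eh => h' sh'; rewrite /rV take_size_cat // drop_size_cat //.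
  by rewrite (duE n h x h' sh sh') eq_sym.
exists u'.
  have [kap kap0 hpos] := positivity (K + K) gX.
  (* The failures of [rho] and of its alternating sum have probability at most [e] and [N e]. A
     total below [kap] leaves a good cube of the required type, and below 1 a good [h']. *)
  pose e := Num.min 1 kap / (2 * (N + 1)).
  have N10 : 0 < N + 1 by have := N1; lra.
  have m0 : 0 < Num.min 1 kap by rewrite lt_min ltr01.
  have e0 : 0 < e by rewrite divr_gt0 // mulr_gt0.
  have he : (N + 1) * e < Num.min 1 kap.
    have -> : (N + 1) * e = Num.min 1 kap / 2 by rewrite /e; field; rewrite gt_eqF.
    by rewrite ltr_pdivrMr // mulr_natr mulr2n ltrDl.
  have [he1 hek] : (N + 1) * e < 1 /\ (N + 1) * e < kap by move: he; rewrite lt_min => /andP[].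
  apply: ev2 (hrho' e e0) hpos => n hr hp.
  have key x h : size h = K -> du (u' n) h x = rho n x h.
    move=> sh.
    pose al x h h' := alt K (fun v => rho n (x + dot v h) (zadd (nvm v h) h')).
    have bad2 y l : size l = K -> Eh K (fun h' => (du (u' n) l y != al y l h')%:R) <= N * e.
      move=> sl; have := @union_fix R (Z n) _ K (fun y l => du (u' n) l y) (rho n) e y l sl hr.
      apply: le_trans; apply: ler_Eh => h' sh'; rewrite -/(al y l h').
      by rewrite [du (u' n) l y](@du_split _ _ _ l h') ?sl.
    have [h' sh' hh'] := Eh_pick K (fun h' => (du (u' n) h x != al x h h')%:R : R).
    have e1 : du (u' n) h x = al x h h'.
      apply/eqP; apply: contraT => ne; have := le_trans hh' (bad2 x h sh); rewrite ne /=.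
      by have := e0; lra.
    have shh : size (h ++ h') == (K + K)%N by rewrite size_cat sh sh'.
    pose ty (h1 : seq (Z n)) := `[< forall s, size s = (K + K)%N -> eqs X n (x + dot s h1) (x + dot s (h ++ h')) >].
    have hkap : kap <= Eh (K + K) (fun h1 => (ty h1)%:R) := hp (x, Tuple shh).
    pose f hh : R := (ty hh)%:R - ((du (u' n) (take K hh) x != rho n x (take K hh))%:R + (du (u' n) (take K hh) x != al x (take K hh) (drop K hh))%:R).
    have [hh shh' hf] : exists2 hh, size hh = (K + K)%N & 0 < f hh.
      have [hh sh2 h2] := Eh_pick (K + K) (fun hh => - f hh).
      exists hh => //; rewrite -oppr_lt0; apply: le_lt_trans h2 _.
      have -> : Eh (K + K) (fun hh => - f hh) = - Eh (K + K) f by rewrite /Eh avgN.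
      rewrite oppr_lt0 /f.
      have -> : Eh (K + K) (fun hh => (ty hh)%:R - ((du (u' n) (take K hh) x != rho n x (take K hh))%:R + (du (u' n) (take K hh) x != al x (take K hh) (drop K hh))%:R)) =
        Eh (K + K) (fun hh => (ty hh)%:R) - (Eh (K + K) (fun hh => (du (u' n) (take K hh) x != rho n x (take K hh))%:R) + Eh (K + K) (fun hh => (du (u' n) (take K hh) x != al x (take K hh) (drop K hh))%:R)) :> R.
        by rewrite -EhD /Eh avgB.
      have b1 : Eh (K + K) (fun hh => (du (u' n) (take K hh) x != rho n x (take K hh))%:R) <= e :> R.
        rewrite Eh_cat; apply: le_trans (hr x); apply: ler_Eh => l sl.
        rewrite (@eq_Eh _ _ _ _ (fun=> (du (u' n) l x != rho n x l)%:R)) ?Eh_const // => l' _.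
        by rewrite take_size_cat.
      have b2 : Eh (K + K) (fun hh => (du (u' n) (take K hh) x != al x (take K hh) (drop K hh))%:R) <= N * e :> R.
        rewrite Eh_cat -[leRHS](Eh_const (Z n) K); apply: ler_Eh => l sl; apply: le_trans (bad2 x l sl).
        by apply: ler_Eh => l' _; rewrite take_size_cat // drop_size_cat.
      lra.
    have [a1 a2] := sz _ _ shh'.
    have [/asboolP tyh /negPn/eqP g1 /negPn/eqP g2] := bool_pos hf.
    (* Both sides are typed, so the pair [h], [h'] may be exchanged for the good pair contained in
       [hh]. *)
    rewrite e1; transitivity (al x (take K hh) (drop K hh)).
      apply: (@rsum_typed n (rho n) pred0 x h h' x (take K hh) (drop K hh)) => // v w sv sw i; have := tyh _ (smix _ _ sv sw) i; rewrite -mixE // => ->.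
      by rewrite dot_cat // size_mixv ?sv.
    rewrite -g2 g1; apply: (trho n) => // s ss _ i.
    have := tyh (s ++ nseq K false); rewrite size_cat ss size_nseq => /(_ erefl i).
    rewrite -{1}(cat_take_drop K hh) !dot_cat ?ss ?a1 ?sh // !dot0 !addr0.
    by [].
  move=> x h y l sh sl e2; rewrite !key //; apply: (trho n) => // s ss _; exact: e2.
pose rw n x h := r0 (n := n) x h - V n x h.
have trw : ev (fun n => typed X xpredT (0 + K) (rw n)).
  by apply: evS tr0 => n t x h y l sh sl e; rewrite /rw (t x h y l) // (tV n x h y l).
have [w tw hw] := decode (S := xpredT) gX (fun _ _ _ _ => isT) trw.
exists (fun n x => w n x [::]).
  by move=> n x y e; apply: tw => // s s0 _; rewrite (size0nil s0) /= !addr0.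
apply: ev3 hu (hw eps eps0) hU => n hn hw' hU'.
apply: le_trans (_ : avg (fun x => 4 * (Eh K (fun h => (du (u (n := n)) h x != r0 x h)%:R) + d1) + eps) <= _).
  apply: ler_avg => x; have [h1 _] := hw' x (fun=> U n x); rewrite !Eh0 /= in h1.
  have -> : (u' n x != u x - w n x [::]) = (w n x [::] != U n x).
    by rewrite /u' (inj_eq (addrI _)) eqr_opp eq_sym.
  apply: le_trans h1 _; rewrite lerD2r ler_pM2l //.
  apply: le_trans (_ : Eh K (fun h => (du (u (n := n)) h x != r0 x h)%:R + (du (u (n := n)) h x - U n x != V n x h)%:R) <= _).
    apply: ler_Eh => h sh; apply: bool_le; rewrite -negb_and; apply: contra => /andP[/eqP h2 /eqP h3].
    by rewrite /rw -h2 -h3 opprB addrC subrK.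
  by rewrite EhD lerD2l.
rewrite avgD avgZ avgD !avg_const ?zmod_gt0 //.
have h5 : eps <= N * eps by rewrite ler_peMl // ltW.
rewrite /d1 -!mulrA; move: hn h5 eps0; set q := N * eps; set p := avg _; lra.
Qed.
End Exactify.

(** * Joining and extending systems *)

Section Join.
Variable R : realType.
Context (W : set_system nat) {UW : UltraFilter W}.
Variable Z : nat -> finZmodType.
Local Notation C := R[i].
Local Notation ev := (ev W).
Local Notation Zf := (Zf Z).
Local Notation Bf := (@Bf R Z).
Variable m' : nat.
Local Notation A := 'I_m'.+1.
Local Notation E := (@E R m').
Local Notation sys := (sys Z m').
Local Notation good := (@good R W Z m').
Local Notation dets := (@dets R W Z m').
Local Notation eqs X n x x' := (@eqs Z m' X n x x').

Lemma bool_le1 (b b1 : bool) : (b -> b1) -> b%:R <= b1%:R :> R.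
Proof. by case: b b1 => [] [] //= h; have := h isT. Qed.

Lemma round_ex : exists2 c : R, 0 < c & exists rd : C -> A, forall a z, ab (E a - z) < c -> rd z = a.
Proof.
pose P (ab : A * A) := ab.1 != ab.2.
have [c c0 hc] : exists2 c : R, 0 < c & forall a b : A, a != b -> c <= ab (E a - E b).
  pose d (p : A * A) := ab (E p.1 - E p.2).
  have d0 p : P p -> 0 < d p.
    move=> h; rewrite lt_neqAle ab_ge0 andbT eq_sym ab_eq0 subr_eq0.
    by apply: contra h => /eqP/E_inj/eqP.
  exists (\big[Num.min/1]_(p | P p) d p).
    by apply: (big_ind (fun x : R => 0 < x)) => // x y hx hy; rewrite lt_min hx.
  move=> a b ne; have hP : P (a, b) by [].
  by rewrite (bigD1 (a, b)) //= ge_min lexx.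
exists (c / 2); first by rewrite divr_gt0.
exists (fun z => odflt 0 [pick a | ab (E a - z) < c / 2]) => a z h.
case: pickP => [b hb|/(_ a)]; last by rewrite h.
apply/eqP; apply: contraT => ne; have := hc _ _ ne.
have := ab_tri (E b) (E a) z; rewrite [ab (z - E a)]ab_sym; lra.
Qed.

Lemma dets_sub k (T T' : nat -> Type) (f : forall n, Z n -> T n) (f' : forall n, Z n -> T' n) :
  ev (fun n => forall x x', f n x = f n x' -> f' n x = f' n x') -> dets k f -> dets k f'.
Proof. by move=> h [X gX hX]; exists X => //; apply: ev2 h hX => n h hX x x' /hX/h. Qed.
Definition void_sys : sys := @Sys Z m' void (fun _ => 0%N) (fun _ v _ => of_void _ v).
Lemma good_void k : good k void_sys.
Proof.
split=> [[]||D e _]; first by apply: evT => n [].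
by left; apply: evT => n x; rewrite /ep big1 // => -[].
Qed.
Lemma dets_const k (T : nat -> Type) (f : forall n, Z n -> T n) :
  ev (fun n => forall x x', f n x = f n x') -> dets k f.
Proof. by move=> h; exists void_sys; [exact: good_void | apply: evS h => n h x x' _]. Qed.
Lemma dets0_const (T : nat -> Type) (f : forall n, Z n -> T n) : dets 0 f ->
  ev (fun n => forall x x', f n x = f n x').
Proof.
move=> [X [d0 ex _] h]; apply: ev2 ex h => n ex h x x'; apply: h => i.
have di : sd i = 0%N by apply/eqP; rewrite -leqn0.
have := ex i; rewrite di => e1.
have := e1 x [:: x' - x] x [:: 0] erefl erefl; rewrite !du_cons /du /= !addr0 subrr [x + _]addrC subrK => h'.
by apply/eqP; rewrite -subr_eq0; apply/eqP; apply: h' => s _ j.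
Qed.

(** Two good systems cannot simply be united: a combination of phases from both may be neither zero
    nor null. Joint determination is therefore part of the induction, together with [regular]. *)
Definition joins k := forall (T T' : nat -> Type) (f : forall n, Z n -> T n) (f' : forall n, Z n -> T' n),
  dets k f -> dets k f' -> dets k (fun n x => (f n x, f' n x)).
Definition apx k (f : fam R Zf) := forall e, 0 < e -> exists F : fam R Zf, dets k F /\
  ev (fun n => N2 (fun x => f n x - F n x) < e).
Definition regular k := forall b : fam R Zf, (forall n, B k.+1 (b n)) -> apx k b.

Lemma joins_fin k (I : finType) (T : I -> nat -> Type) (f : forall i n, Z n -> T i n) : joins k ->
  (forall i, dets k (f i)) -> dets k (fun n x => fun i => f i n x).
Proof.
move=> J hf.
suff [X gX hX] : exists2 X, good k X & ev (fun n => forall x x', eqs X n x x' -> forall i, i \in enum I -> f i n x = f i n x').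
  exists X => //; apply: evS hX => n h x x' e; apply: functional_extensionality_dep => i.
  by apply: h e _ _; rewrite mem_enum.
elim: (enum I) => [|i r [X gX hX]]; first by exists void_sys; [exact: good_void | apply: evT].
have dX : dets k (fun n x (i : sI X) => sg (n := n) i x).
  by exists X => //; apply: evT => n x x' e; apply: functional_extensionality_dep => l; exact: e.
have [Y gY hY] := J _ _ _ _ dX (hf i).
exists Y => //; apply: ev2 hX hY => n h h' x x' e; have [a1 a2] := h' _ _ e.
move=> j; rewrite inE => /predU1P[->|jr]; first exact: a2.
by apply: h => // l; exact: (congr1 (fun F => F l) a1).
Qed.

Lemma Cl_apx k (f : fam R Zf) : joins k -> regular k -> Cl W (Bf k.+1) f -> apx k f.
Proof.
move=> J Rg cf e e0; have e2 : 0 < e / 4 by rewrite divr_gt0.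
have [I hI] := cf _ e2.
pose P n (b : I -> Z n -> C) := (forall j, B k.+1 (b j)) /\ N2 (fun t => f n t - \sum_j b j t) < e / 4.
have [b hb] : exists b : I -> fam R Zf, (forall j n, B k.+1 (b j n)) /\ ev (fun n => N2 (fun t => f n t - \sum_j b j n t) < e / 4).
  pose b0 n : I -> Z n -> C := if pselect (exists b, P n b) is left h then projT1 (cid h) else fun _ _ => 0.
  exists (fun j n => b0 n j); split=> [j n|].
    rewrite /b0; case: pselect => [h|_]; first by have [] := projT2 (cid h).
    by apply: B_const; rewrite ab0.
  by apply: evS hI => n h; rewrite /b0; case: pselect => [h'|[]//]; have [] := projT2 (cid h').
case: hb => hb1 hb2.
pose e3 := e / 4 / (#|I|%:R + 1) ^+ 2.
have I1 : 0 < #|I|%:R + 1 :> R by rewrite ltr_wpDl ?ler0n.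
have e30 : 0 < e3 by rewrite divr_gt0 // exprn_gt0.
have /choice [F hF] := fun j => Rg (b j) (hb1 j) e3 e30.
exists (fun n x => \sum_j F j n x); split.
  apply: dets_sub (joins_fin J (fun j => (hF j).1)); apply: evT => n x x' h.
  by apply: eq_bigr => j _; exact: (congr1 (fun G => G j) h).
have hF2 : ev (fun n => forall j, N2 (fun x => b j n x - F j n x) < e3) by apply: ev_fin => j; exact: (hF j).2.
apply: ev2 hb2 hF2 => n h1 h2.
apply: le_lt_trans (N2_tri _ _ (fun x => \sum_j b j n x)) _.
have h3 : N2 (fun x => \sum_j b j n x - \sum_j F j n x) <= e / 4.
  rewrite (@eq_N2 _ _ _ (fun x => \sum_j (b j n x - F j n x))) => [|x]; last by rewrite sumrB.
  apply: le_trans (N2_sum _) _.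
  apply: le_trans (_ : #|I|%:R * (\sum_(j : I) e3) <= _).
    by rewrite ler_wpM2l ?ler0n //; apply: ler_sum => j _; exact: ltW.
  have -> : \sum_(j : I) e3 = #|I|%:R * e3 by rewrite sumr_const mulr_natl.
  rewrite mulrA -expr2 /e3 mulrA ler_pdivrMr ?exprn_gt0 // mulrC ler_wpM2l ?(ltW e2) //.
  by rewrite lerXn2r ?nnegrE ?ler0n ?(ltW I1) // lerDl.
lra.
Qed.

Lemma du_sum (Zn : finZmodType) (I : Type) (r : seq I) (v : I -> Zn -> A) hs x :
  du (fun y => \sum_(i <- r) v i y) hs x = \sum_(i <- r) du (v i) hs x.
Proof.
elim: hs x => [|h hs IH] x; first by rewrite /du.
by rewrite du_cons !IH -sumrB; apply: eq_bigr => i _; rewrite du_cons.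
Qed.

(* [beta x] is the most frequent value of an expression in the types of random cubes at [x]. *)
Lemma exact_dets k (T : nat -> Type) (p : forall n, Z n -> T n) (beta : forall n, Z n -> A) :
  joins k -> regular k -> dets k p ->
  ev (fun n => exact k.+2 (fun x y => p n x = p n y) (beta n)) ->
  Cl W (Bf k.+1) (fun n x => E (beta n x)) -> dets k beta.
Proof.
move=> J Rg dp ex cb; have [c c0 [rd hrd]] := round_ex.
set K := k.+2; pose N : R := 2 ^+ K; have N0 : 0 < N by rewrite exprn_gt0.
(* With this precision [b0] differs from [beta] with probability at most [1 / (8 N)], so the
   vertices of a cube other than its base are all correct with probability at least [7/8], as the
   second part of [decode] requires. *)
have e0 : 0 < c ^+ 2 * (8 * N)^-1 by rewrite mulr_gt0 ?exprn_gt0 // invr_gt0 mulr_gt0.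
have [F [dF hF]] := Cl_apx J Rg cb e0.
have [X gX hX] := J _ _ _ _ dp dF.
pose b0 n x := rd (F n x).
pose Rr n x h := du (beta n) h x - alt K (fun v => if v == nseq K false then 0 else b0 n (x + dot v h)).
have tR : ev (fun n => typed X xpredT (0 + K) (Rr n)).
  apply: ev2 ex hX => n ex hX x h y l sh sl e; rewrite /Rr; congr (_ - _).
    by apply: ex => // s ss; have [] := hX _ _ (e s ss isT).
  apply: eq_alt => s ss; case: (_ == _) => //; congr rd.
  by have [] := hX _ _ (e s ss isT).
have [Gam tG hG] := decode (S := xpredT) gX (fun _ _ _ _ => isT) tR.
have h20 : 0 < 2^-1 :> R by rewrite invr_gt0.
exists X => //; apply: ev2 hF (hG _ h20) => n hF' hG'.
have bad : avg (fun x => (beta n x != b0 n x)%:R) <= (8 * N)^-1 :> R.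
  rewrite -(ler_pM2l (x := c ^+ 2)) ?exprn_gt0 //; apply: le_trans (ltW hF'); rewrite -avgZ; apply: ler_avg => x.
  case: eqP => [_|ne]; first by rewrite mulr0 sqr_ge0.
  rewrite mulr1 lerXn2r ?nnegrE ?ab_ge0 ?(ltW c0) // leNgt; apply/negP => h; apply: ne.
  by rewrite /b0 (hrd (beta n x)).
suff main x : beta n x = Gam n x [::].
  move=> x y e; rewrite !main; apply: tG => // s s0 _; rewrite (size0nil s0) /= !addr0; exact: e.
have [_ /(_ _)] := hG' x (fun=> beta n x); rewrite Eh0 /= => h.
suff h1 : (Gam n x [::] != beta n x)%:R <= 2^-1 :> R.
  apply/eqP; apply: contraT => ne; move: h1; rewrite eq_sym ne /=; lra.
apply: h => hs s0; rewrite (size0nil s0) /=.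
apply: le_trans (_ : Eh K (fun h => \sum_(v : K.-tuple bool) ((v != nseq K false :> seq bool) && (beta n (x + dot v h) != b0 n (x + dot v h)))%:R) <= _).
  apply: ler_Eh => h' sh'.
  apply: le_trans (_ : (alt K (fun v => if v == nseq K false then 0 else beta n (x + dot v h')) != alt K (fun v => if v == nseq K false then 0 else b0 n (x + dot v h')))%:R <= _).
    apply: bool_le1; apply: contra => /eqP e1; rewrite /Rr -e1.
    rewrite /du sh' -altB alt_single; last by move=> s _ /negbTE ->; rewrite subrr.
    by rewrite eqxx subr0 dot0 addr0.
  apply: le_trans (alt_union _ _ _ _) _; apply: ler_sum => v _.
  by case: (_ == nseq K false); rewrite /= ?eqxx.
rewrite Eh_sum; apply: le_trans (_ : \sum_(v : K.-tuple bool) (8 * N)^-1 <= _); last first.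
  have -> : \sum_(v : K.-tuple bool) (8 * N)^-1 = N * (8 * N)^-1.
    by rewrite /N -(card_tb R K) mulr_suml; apply: eq_bigr => v _; rewrite mul1r.
  by rewrite invfM mulrCA mulfV ?mulr1 // gt_eqF.
apply: ler_sum => v _; case: (eqVneq (v : seq bool) (nseq K false)) => [_|ne] /=.
  by rewrite Eh_const invr_ge0 mulr_ge0 // ltW.
have hv : has id v by apply: contraT => /size_ind_has e; case/eqP: ne; rewrite e size_tuple.
have := @Eh_dot R (Z n) v (fun y => (beta n (x + y) != b0 n (x + y))%:R) hv.
rewrite size_tuple => ->.
by rewrite (avg_addl (fun y => (beta n y != b0 n y)%:R) x).
Qed.

Definition rep (X : sys) n (x : Z n) : Z n := xget 0 [set z | eqs X n x z].
Lemma repP X n (x : Z n) : eqs X n x (rep X x).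
Proof. by apply: (@xgetPex _ 0 [set z | eqs X n x z]); exists x. Qed.
Arguments repP X {n} x i.
Lemma repE X n (x y : Z n) : eqs X n x y -> rep X x = rep X y.
Proof.
move=> h; rewrite /rep; congr xget; apply/seteqP; split=> z hz i; first by rewrite -(h i).
by rewrite (h i).
Qed.

Lemma phase_hat k (T : nat -> Type) (p : forall n, Z n -> T n) (v : forall n, Z n -> A) : dets k p ->
  ev (fun n => exact k.+2 (fun x y => p n x = p n y) (v n)) -> Cl W (@BK R Z k.+1) (hat (fun n x => E (v n x))).
Proof.
move=> [X gX hX] ex; pose z n (x : Z n) : {ffun sI X -> A} := [ffun i => sg (s := X) i x].
have zE n (x y : Z n) : z n x = z n y -> eqs X n x y.
  by move=> h i; have := congr1 (fun f : {ffun sI X -> A} => f i) h; rewrite !ffunE.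
apply: (@hat_phase R W UW Z m' k.+1 _ z v).
  move=> t; apply: (low_Cl gX); first by move=> n x; exact: ab_bool.
  apply: evT => n x x' h; rewrite /ind; congr ((_ == _)%:R); apply/ffunP => j; rewrite !ffunE.
  by apply: h; have [d _ _] := gX; rewrite ltnS.
by apply: ev2 ex hX => n ex hX; apply: exact_sub ex => x y /zE/hX.
Qed.

(** A combination of the new phases with non-null [U^(k+1)] norm is structured by [struct_or], hence
    by [exact_dets] a function of phases of degree at most [k]; all these are adjoined to [X].
    Subtracting from each [g j] its value at a representative of the type in [X] makes these
    combinations vanish, and multiplies the others by a structured factor, which keeps them null. *)
Lemma assemble k (T : nat -> Type) (p : forall n, Z n -> T n) (J : finType) (g : forall n, J -> Z n -> A) :
  joins k -> regular k -> dets k p ->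
  ev (fun n => forall j, exact k.+2 (fun x y => p n x = p n y) (g n j)) ->
  dets k.+1 (fun n x => (p n x, fun j => g n j x)).
Proof.
move=> Jn Rg dp ex.
pose eg (e : {ffun J -> A}) n x := \sum_j g n j x *+ e j.
pose q e n x : A := if pselect (nnull W (fun n => u k.+1 (fun x => E (eg e n x)))) then eg e n x else 0.
have exg e : ev (fun n => exact k.+2 (fun x y => p n x = p n y) (eg e n)).
  apply: evS ex => n ex x hs x' hs' s1 s2 h; rewrite !du_sum; apply: eq_bigr => j _.
  by rewrite !du_mul (ex j x hs x' hs').
have dq e : dets k (q e).
  rewrite /q; case: pselect => hn; last by apply: dets_const; exact: evT.
  have hh := phase_hat dp (exg e).
  apply: (exact_dets Jn Rg dp (exg e)).
  by apply: struct_or => //= n x; rewrite ab_E.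
have [X gX hX] := Jn _ _ _ _ dp (joins_fin Jn dq).
have [dX eX iX] := gX.
pose gt n j x := g n j x - g n j (rep X x).
pose Y := @Sys Z m' (sI X + J)%type (fun i => match i with inl i => sd i | inr _ => k.+1 end)
  (fun n i x => match i with inl i => sg i x | inr j => gt n j x end).
have YX n x y : eqs Y n x y -> eqs X n x y by move=> h i; exact: (h (inl i)).
exists Y; last first.
  apply: evS hX => n h x y e; have [e1 _] := h _ _ (YX _ _ _ e); congr (_, _); first exact: e1.
  apply: funext => j; have := e (inr j); rewrite /= /gt (repE (YX _ _ _ e)).
  by move/addIr.
split.
- by case=> [i|j] /=; [exact: leq_trans (dX i) _ | exact: leqnn].
- apply: ev3 eX hX ex => n eX' hX' ex'; case=> [i|j] /=.
    apply: exact_sub (eX' i) => x y h l dl; exact: (h (inl l)).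
  move=> x hs x' hs' s1 s2 h.
  have h' s : size s = k.+2 -> eqs X n (x + dot s hs) (x' + dot s hs').
    by move=> ss i; apply: (h s ss (inl i)); rewrite /= ltnS.
  rewrite /gt !(duB (g n j) (fun y => g n j (rep X y))); congr (_ - _).
    by apply: (ex' j x hs x' hs') => // s ss; have [] := hX' _ _ (h' s ss).
  by rewrite /du s1 s2; apply: eq_alt => s ss; rewrite (repE (h' s ss)).
move=> D e he.
have epE n x : ep e (n := n) x = ep (X := X) [ffun i => e (inl i)] x + \sum_j gt n j x *+ e (inr j).
  by rewrite /ep big_sumType /=; congr (_ + _); apply: eq_bigr => i _; rewrite ffunE.
have [Dk|Dk] := eqVneq D k.+1; last first.
  have [|h|h] := iX D [ffun i => e (inl i)].
  - by move=> i hi; rewrite ffunE; exact: (he (inl i)).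
  - left; apply: evS h => n h x; rewrite epE h add0r big1 // => j _.
    by rewrite (he (inr j)) ?mulr0n //= eq_sym.
  right; apply: null_le h; apply: evT => n; rewrite le_eqVlt; apply/orP; left; apply/eqP; congr (u _ _).
  apply: funext => x; rewrite epE [X in _ + X]big1 ?addr0 // => j _.
  by rewrite (he (inr j)) ?mulr0n //= eq_sym.
pose e' : {ffun J -> A} := [ffun j => e (inr j)].
have epE' n x : ep e (n := n) x = eg e' n x - eg e' n (rep X x).
  rewrite epE /ep big1 ?add0r => [|i _]; last first.
    rewrite ffunE (he (inl i)) ?mulr0n //= Dk neq_ltn ltnS; by rewrite dX.
  by rewrite /eg -sumrB; apply: eq_bigr => j _; rewrite ffunE mulrnBl.
have [hn|hn] := pselect (nnull W (fun n => u k.+1 (fun x => E (eg e' n x)))).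
  left; apply: evS hX => n h x; rewrite epE'.
  have [_ h2] := h _ _ (repP X x).
  have qe y : q e' n y = eg e' n y by rewrite /q; case: pselect.
  have h3 : q e' n x = q e' n (rep X x) := congr1 (fun F => F e') h2.
  by rewrite -!qe h3 subrr.
right; have nl : null W (fun n => u k.+1 (fun x => E (eg e' n x))).
  by have [//|] := null_or (UW := UW) (fun n => u k.+1 (fun x => E (eg e' n x))).
rewrite Dk.
have := @unull_mul R W UW Z k.+1 (fun n x => E (eg e' n x)) (fun n x => Num.conj (E (eg e' n (rep X x)))).
move=> /(_ _ _ _ nl) H; apply: null_le (H _ _ _).
- by apply: evT => n; rewrite le_eqVlt; apply/orP; left; apply/eqP; congr (u _ _); apply: funext => x; rewrite epE' EB.
- by move=> n x; rewrite ab_E.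
- by move=> n x; rewrite ab_conj ab_E.
apply: (low_Cl gX); first by move=> n x; rewrite ab_conj ab_E.
by apply: evT => n x y h; rewrite (@repE X n x y) // => i; apply: h; rewrite ltnS.
Qed.

Lemma joins0 : joins 0.
Proof.
move=> T T' f f' /dets0_const h /dets0_const h'; apply: dets_const.
by apply: ev2 h h' => n h h' x x'; rewrite (h x x') (h' x x').
Qed.
Lemma regular0 : regular 0.
Proof.
move=> b hb e e0; exists b; split.
  apply: dets_const; apply: evT => n x x'; have [F [_ [c hc] ->]] := hb n.
  by rewrite !EhS; under eq_avg => h do rewrite Eh0 /= hc; under [RHS]eq_avg => h do rewrite Eh0 /= hc; rewrite !avgZ !avg_addl.
apply: evT => n; rewrite (@eq_N2 _ _ _ (fun=> 0)) => [|x]; last by rewrite subrr.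
by rewrite /N2 (@eq_avg _ _ _ (fun=> 0)) ?avg0 // => x; rewrite ab0 expr0n.
Qed.

(** Phases of degree above [k] become zero phases of degree 0, so that the index set is
    unchanged. *)
Definition trunc k (X : sys) : sys := @Sys Z m' (sI X) (fun i => if (sd i <= k)%N then sd i else 0%N)
  (fun n i x => if (sd i <= k)%N then sg i x else 0).
Lemma good_trunc k X : good k.+1 X -> good k (trunc k X).
Proof.
move=> [d ex ind]; split.
- by move=> i /=; case: ifP.
- apply: evS ex => n ex i /=; case: ifP => ik; last first.
    by move=> x hs x' hs' s1 s2 _; rewrite /du s1 s2 !alt_zero.
  apply: exact_sub (ex i) => x y h j jd.
  have jk : (sd j <= k)%N by rewrite ltnW // (leq_trans jd).
  by have := h j; rewrite /= jk => /(_ jd).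
move=> D e he; pose e' : {ffun sI X -> A} := [ffun i => if (sd (s := X) i <= k)%N then e i else 0].
have epE n x : ep (X := trunc k X) e (n := n) x = ep e' x.
  have kk (b : bool) (a c : A) : (if b then a else 0) *+ c = a *+ (if b then c else 0 : A).
    by case: b => //; exact: mul0rn.
  by apply: eq_bigr => i _; rewrite ffunE; exact: (kk (sd (s := X) i <= k)%N (sg (s := X) (n := n) i x) (e i)).
have [|h|h] := ind D e'.
- by move=> i hi; rewrite ffunE; case: ifP => // ik; apply: he; rewrite /= ik.
- by left; apply: evS h => n h x; rewrite epE.
by right; apply: null_le h; apply: evT => n; rewrite le_eqVlt; apply/orP; left; apply/eqP; congr (u _ _); apply: funext => x; rewrite epE.
Qed.
(** The parts of degree at most [k] are joined by induction; the phases of degree [k + 1] of either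
    system are exact over the joined part, and [assemble] adds them. *)
Lemma joinsS k : joins k -> regular k -> joins k.+1.
Proof.
move=> Jk Rk T T' f f' [X gX hX] [Y gY hY].
pose tv (X : sys) n x (i : sI X) := sg (s := trunc k X) (n := n) i x.
have dt (X' : sys) : good k.+1 X' -> dets k (fun n x => @tv X' n x).
  move=> g; exists (trunc k X'); first exact: good_trunc.
  by apply: evT => n x x' h; apply: funext => i; exact: h.
have dp := Jk _ _ _ _ (dt X gX) (dt Y gY).
pose top (X : sys) n (i : sI X) (x : Z n) : A := if (sd i <= k)%N then 0 else sg i x.
pose g n (i : sI X + sI Y) x := match i with inl i => @top X n i x | inr i => @top Y n i x end.
have tE (X' : sys) n (x y : Z n) : @tv X' n x = @tv X' n y -> forall i : sI X', (sd (s := X') i <= k)%N -> sg (s := X') i x = sg (s := X') i y.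
  by move=> h i ik; have := congr1 (fun F => F i) h; rewrite /tv /= ik.
have hg : ev (fun n => forall j, exact k.+2 (fun x y => (@tv X n x, @tv Y n x) = (@tv X n y, @tv Y n y)) (g n j)).
  have [dX eX _] := gX; have [dY eY _] := gY; apply: ev2 eX eY => n eX' eY'.
  case=> i; rewrite /g /top; case: (leqP (sd i) k) => ik; try by move=> x hs x' hs' s1 s2 _; rewrite /du s1 s2 !alt_zero.
    have di : sd i = k.+1 by apply/eqP; rewrite eqn_leq dX.
    have := eX' i; rewrite di; apply: exact_sub => x y [h _] j jd; exact: (tE X).
  have di : sd i = k.+1 by apply/eqP; rewrite eqn_leq dY.
  have := eY' i; rewrite di; apply: exact_sub => x y [_ h] j jd; exact: (tE Y).
apply: dets_sub (assemble Jk Rk dp hg); apply: ev2 hX hY => n hX' hY' x x' [h1 h2 h3].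
congr (_, _); [apply: hX' | apply: hY'] => i; case: (leqP (sd i) k) => ik.
- exact: (tE X) h1 i ik.
- by have := congr1 (fun F => F (inl i)) h3; rewrite /= /top leqNgt ik.
- exact: (tE Y) h2 i ik.
- by have := congr1 (fun F => F (inr i)) h3; rewrite /= /top leqNgt ik.
Qed.
End Join.

(** * Absorbing structured factors of higher degree *)

Section Core.
Variable R : realType.
Context (W : set_system nat) {UW : UltraFilter W}.
Variable Z : nat -> finZmodType.
Local Notation C := R[i].
Local Notation ev := (ev W).
Local Notation Zf := (Zf Z).
Local Notation Bf := (@Bf R Z).
Variable m' : nat.
Local Notation A := 'I_m'.+1.
Local Notation E := (@E R m').
Local Notation sys := (sys Z m').
Local Notation good := (@good R W Z m').
Local Notation dets := (@dets R W Z m').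
Local Notation joins := (@joins R W Z m').
Local Notation regular := (@regular R W Z m').
Local Notation apx := (@apx R W Z m').
Local Notation eqs X n x x' := (@eqs Z m' X n x x').

Definition proj (z : C) : C := if ab z <= 1 then z else z / (ab z)%:C.
Lemma proj_le1 z : ab (proj z) <= 1.
Proof.
rewrite /proj; case: ifP => // /negbT; rewrite -ltNge => h.
by rewrite abM abV abR ger0_norm ?ab_ge0 // divff // gt_eqF // (lt_trans ltr01).
Qed.
Lemma proj_near c z : ab c <= 1 -> ab (c - proj z) <= 2 * ab (c - z).
Proof.
move=> hc; rewrite /proj; case: ifP => [_|/negbT]; first by rewrite ler_peMl ?ab_ge0 // ler1n.
rewrite -ltNge => h; have z0 : 0 < ab z by exact: lt_trans h.
apply: le_trans (ab_tri _ _ z) _; rewrite mulr2n mulrDl mul1r lerD2l.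
have -> : z - z / (ab z)%:C = z * (1 - (ab z)^-1)%:C.
  by rewrite rmorphB rmorph1 fmorphV mulrBr mulr1.
have iz : (ab z)^-1 <= 1 by rewrite invf_le1 // ltW.
rewrite abM abR ger0_norm ?subr_ge0 // mulrBr mulr1 divff ?gt_eqF //.
have := ab_tri z 0 c; rewrite !subr0 [ab (z - c)]ab_sym; lra.
Qed.
Lemma apx1 k (f : fam R Zf) : fle1 f -> apx k f -> forall e, 0 < e ->
  exists F : fam R Zf, [/\ fle1 F, dets k F & ev (fun n => N2 (fun x => f n x - F n x) < e)].
Proof.
move=> f1 hf e e0; have e4 : 0 < e / 4 by rewrite divr_gt0.
have [F [dF hF]] := hf _ e4; exists (fun n x => proj (F n x)); split.
- by move=> n x; exact: proj_le1.
- by apply: dets_sub dF; apply: evT => n x x' ->.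
apply: evS hF => n h; apply: le_lt_trans (_ : 4 * N2 (fun x => f n x - F n x) < e); last by lra.
rewrite /N2 -avgZ; apply: ler_avg => x.
have -> : 4 * ab (f n x - F n x) ^+ 2 = (2 * ab (f n x - F n x)) ^+ 2 by ring.
by rewrite ler_pXn2r ?nnegrE ?mulr_ge0 ?ab_ge0 //; apply: proj_near; exact: f1.
Qed.

(** A phase of degree below [k] is structured itself; for one of degree [k] only the derivative is,
    by [diff_phase] with a one-point parameter set. *)
Lemma char_shift k X (gX : good k X) (e : {ffun sI X -> A}) (t : forall n, Z n) :
  Cl W (Bf k) (fun n x => E (ep e x) * Num.conj (E (ep e (x + t n)))).
Proof.
have [d ex _] := gX.
apply: (@Cl_eq R W _ Zf (Bf k) (fun n x => \prod_i (E (sg i x *+ e i) * Num.conj (E (sg i (x + t n) *+ e i))))).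
  by apply: evT => n x; rewrite big_split /= /ep !E_sum rmorph_prod.
apply: S_prod => i; first by apply: (@bdd1 R W _ _ _ 1) => n x; rewrite abM ab_conj !ab_E mulr1.
have [ik|ik] := ltnP (sd i) k.
  have c1 : Cl W (Bf k) (fun n x => E (sg i x *+ e i)).
    apply: (low_Cl gX); first by move=> n x; rewrite ab_E.
    by apply: evT => n x x' h; rewrite h.
  apply: S_mul => //; last by apply: S_conj; exact: (S_shift t c1).
  by apply: (@bdd1 R W _ _ _ 1) => n x; rewrite ab_conj ab_E.
have di : sd i = k by apply/eqP; rewrite eqn_leq d.
pose z n (x : Z n) : {ffun sI X -> A} := [ffun j => if (sd (s := X) j < k)%N then sg j x else 0].
have h := @diff_phase R W UW Z m' k _ z (fun n x => sg i x *+ e i) (fun _ => unit) (fun n _ => t n).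
have {h} := h (fun n => eq_ind_r (fun c => (0 < c)%N) (ltn0Sn 0) card_unit).
move=> /(_ _ _)/Cl_pull-h.
refine (h Zf (fun n x => (x, tt)) (Bf k) _ _ _ _).
- by move=> n; apply: bij_mp; exists (fun x : Z n * unit => x.1) => // -[x []].
- by move=> n b hb; exact: (hb tt).
- move=> y; apply: (low_Cl gX); first by move=> n x; exact: ab_bool.
  apply: evT => n x x' h'; rewrite /ind; congr ((_ == _)%:R); apply/ffunP => j; rewrite !ffunE.
  by case: ifP => // /h'.
- apply: evS ex => n /(_ i) ex; apply: exact_mul; move: ex; rewrite di; apply: exact_sub => x y hxy j jd.
  by have := congr1 (fun f : {ffun sI X -> A} => f j) hxy; rewrite !ffunE jd.
Qed.

Lemma dets_fourier X (F : fam R Zf) : fle1 F -> ev (fun n => forall x x', eqs X n x x' -> F n x = F n x') ->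
  exists2 c : forall n, {ffun sI X -> A} -> C, forall n e, ab (c n e) <= 1 &
  ev (fun n => forall x, F n x = \sum_e c n e * E (ep e x)).
Proof.
move=> F1 hX.
pose z n (x : Z n) : {ffun sI X -> A} := [ffun i => sg i x].
pose Phi n (w : {ffun sI X -> A}) : C := if pselect (exists x, z n x = w) is left h then F n (projT1 (cid h)) else 0.
have Phi1 n w : ab (Phi n w) <= 1 by rewrite /Phi; case: pselect => h; rewrite ?ab0 // F1.
have [c hc] := dep_choice (fun n => let: ex_intro2 c a b := fourier (Phi1 n) in ex_intro _ c (conj a b)).
exists c; first by move=> n; exact: (hc n).1.
apply: evS hX => n hX x; rewrite (_ : F n x = Phi n (z n x)).
  rewrite (hc n).2; apply: eq_bigr => e _; congr (_ * E _).
  by apply: eq_bigr => i _; rewrite ffunE.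
rewrite /Phi; case: pselect => [h|[]]; last by exists x.
case: (cid h) => y /= hy; apply: hX => i.
by have := congr1 (fun f : {ffun sI X -> A} => f i) hy; rewrite !ffunE.
Qed.

Lemma nnull_sum (I : finType) (a : I -> nat -> R) : nnull W (fun n => \sum_i a i n) -> exists i, nnull W (a i).
Proof.
move=> h; apply: contrapT => /forallNP hn; apply: nullN h; apply: null_sum => i.
by have [//|/hn] := null_or (UW := UW) (a i).
Qed.
Lemma prod_diff (I : Type) (r : seq I) (a b : I -> C) : (forall i, ab (a i) <= 1) -> (forall i, ab (b i) <= 1) ->
  ab (\prod_(i <- r) a i - \prod_(i <- r) b i) <= \sum_(i <- r) ab (a i - b i).
Proof.
move=> ha hb; elim: r => [|i r IH]; first by rewrite !big_nil subrr ab0.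
rewrite !big_cons; have -> : a i * \prod_(j <- r) a j - b i * \prod_(j <- r) b j =
  (a i - b i) * \prod_(j <- r) a j + b i * (\prod_(j <- r) a j - \prod_(j <- r) b j) by ring.
apply: le_trans (abD _ _) _; rewrite !abM lerD //.
  rewrite ler_piMr ?ab_ge0 // ab_prod; elim: r {IH} => [|j r IH]; rewrite ?big_nil // big_cons.
  by rewrite mulr_ile1 ?ab_ge0 // prodr_ge0 // => l _; exact: ab_ge0.
by apply: le_trans IH; rewrite ler_piMl ?ab_ge0.
Qed.
Lemma prod_le1 (I : finType) (a : I -> C) : (forall i, ab (a i) <= 1) -> ab (\prod_i a i) <= 1.
Proof.
by move=> h; rewrite ab_prod; apply: prodr_ile1 => i _; rewrite ab_ge0 h.
Qed.
Lemma ab_le_N2 (T : finType) (f : T -> C) e : 0 <= e -> N2 f <= e ^+ 2 -> avg (fun t => ab (f t)) <= e.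
Proof.
move=> e0 h; rewrite -(ler_pXn2r (n := 2)) ?nnegrE //; last by apply: avg_ge0 => t; exact: ab_ge0.
by apply: le_trans (avg_sqr _) h.
Qed.

(* Replacing the [B^{k+2}] factors by exact phases turns their translates into
   multiples of a single exact phase of the base point. *)
Lemma core k (L : finType) (il : L -> nat) (c : L -> fam R Zf) (A1 A2 : fam R Zf) :
  joins k.+1 -> regular k.+1 -> fle1 A1 -> fle1 A2 -> (forall l, fle1 (c l)) -> (forall l, Cl W (Bf k.+2) (c l)) ->
  nnull W (fun n => avg (fun a => u k.+1 (fun y => A1 n y * A2 n (y + a) * \prod_l c l n (y + a *+ il l)))) ->
  nnull W (fun n => u k.+2 (A1 n)).
Proof.
move=> J Rg a1 a2 c1 cc [ep0 ep00 hE]; set D := (2 ^ k.+1)%N.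
have A12 n (a y : Z n) : ab (A1 n y * A2 n (y + a)) <= 1 by rewrite abM mulr_ile1 ?ab_ge0 ?a1 ?a2.
pose th := Num.min (ep0 / 4) 1; have th0 : 0 < th by rewrite lt_min ltr01 divr_gt0.
pose L1 : R := #|L|%:R + 1; have L10 : 0 < L1 by rewrite ltr_wpDl ?ler0n.
pose del := th / 2 / L1; have del0 : 0 < del by rewrite !divr_gt0.
have d20 : 0 < del ^+ 2 by rewrite exprn_gt0.
have hF0 : forall l, exists F : fam R Zf, [/\ fle1 F, dets k.+1 F & ev (fun n => N2 (fun x => c l n x - F n x) < del ^+ 2)].
  by move=> l; exact: (apx1 (c1 l) (Cl_apx J Rg (cc l)) d20).
have [F hF] := choice hF0.
have F1 l : fle1 (F l) by case: (hF l).
have [X gX hX] : dets k.+1 (fun n x => fun l => F l n x) by apply: joins_fin => // l; case: (hF l).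
have hco l : exists2 co : forall n, {ffun sI X -> A} -> C, forall n e, ab (co n e) <= 1 &
  ev (fun n => forall x, F l n x = \sum_e co n e * E (ep e x)).
  by apply: dets_fourier => //; apply: evS hX => n h x x' /h/(congr1 (fun q => q l)).
pose co l := projT1 (cid2 (hco l)).
have co1 l n e : ab (co l n e) <= 1 by rewrite /co; case: cid2.
have coE : ev (fun n => forall l x, F l n x = \sum_e co l n e * E (ep e x)).
  by apply: ev_fin => l; rewrite /co; case: cid2.
pose Xi := {ffun L -> {ffun sI X -> A}}.
pose chi (xi : Xi) n y : C := \prod_l E (ep (xi l) (n := n) y).
have chi1 xi : fle1 (chi xi) by move=> n y; apply: prod_le1 => l; rewrite ab_E.
(* The total of the norms in which the structured factors are replaced by a phase [chi] of the base
   point. *)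
pose sec n a := \sum_(xi : Xi) u k.+1 (fun y => (A1 n y * chi xi n y) * A2 n (y + a)).
have sec0 n a : 0 <= sec n a by apply: sumr_ge0 => xi _; exact: u_ge0.
(* If the average of [sec] is not null, [u_pair_CS] bounds it by the norm of [A1 * chi], where [chi]
   is a structured factor. Otherwise a shift with small [sec] contradicts the hypothesis. *)
have [nl|nn] := null_or (UW := UW) (fun n => avg (sec n)); last first.
  have [xi hxi] : exists xi : Xi, nnull W (fun n => avg (fun a => u k.+1 (fun y => (A1 n y * chi xi n y) * A2 n (y + a)))).
    by apply: nnull_sum; apply: nnull_le nn; apply: evT => n; rewrite /sec avg_sum.
  have h2 : nnull W (fun n => u k.+2 (fun y => A1 n y * chi xi n y)).
    case: hxi => c0 c00 hc; exists (c0 ^+ 2); first by rewrite exprn_gt0.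
    apply: evS hc => n h; apply: le_trans (_ : avg (fun a => u k.+1 (fun y => (A1 n y * chi xi n y) * A2 n (y + a))) ^+ 2 <= _).
      by rewrite ler_pXn2r ?nnegrE ?(ltW c00) //; exact: le_trans (ltW c00) h.
    apply: le_trans (u_pair_CS k _ _) _; rewrite ler_piMr ?u_ge0 //; exact: (u_le1 _ (a2 n)).
  have [nA|//] := null_or (UW := UW) (fun n => u k.+2 (A1 n)).
  exfalso; apply: nullN h2; apply: unull_mul => //.
  have cx l : Cl W (Bf k.+2) (fun n y => E (ep (xi l) y)).
    apply: (low_Cl gX); first by move=> n x; rewrite ab_E.
    have [d _ _] := gX; apply: evT => n x x' h; congr E; apply: eq_bigr => i _.
    by rewrite h // ltnS.
  by apply: S_prod => // l; apply: (@bdd1 R W _ _ _ 1) => n y; rewrite ab_E.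
pose f n a y := A1 n y * A2 n (y + a) * \prod_l c l n (y + a *+ il l).
have f1 n a : le1 (f n a).
  by move=> y; rewrite abM mulr_ile1 ?ab_ge0 //; apply: prod_le1 => l; exact: c1.
(* One shift at which the norm in the hypothesis is large and [sec] exceeds its mean by a bounded
   factor only; it maximises a suitable difference on average. *)
have pick n : exists a, ep0 <= avg (fun a => u k.+1 (f n a)) ->
   ep0 / 2 <= u k.+1 (f n a) /\ sec n a <= 2 / ep0 * avg (sec n).
  pose gg a := u k.+1 (f n a) - (ep0 / 2) * ((avg (sec n))^-1 * sec n a).
  have [a ha] := exists_ge_avg gg (zmod_gt0 (Z n)).
  exists a => h; have u1 : u k.+1 (f n a) <= 1 := u_le1 _ (f1 n a).
  have s0 : 0 <= avg (sec n) by apply: avg_ge0.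
  have hg : ep0 / 2 <= gg a.
    apply: le_trans ha; rewrite /gg avgB avgZ avgZ.
    have : (avg (sec n))^-1 * avg (sec n) <= 1.
      by have [->|ne] := eqVneq (avg (sec n)) 0; [rewrite mulr0 | rewrite mulVf].
    move=> h'; have : (ep0 / 2) * ((avg (sec n))^-1 * avg (sec n)) <= ep0 / 2 by rewrite ler_piMr // divr_ge0 // ltW.
    lra.
  have t0 : 0 <= (avg (sec n))^-1 * sec n a by rewrite mulr_ge0 ?invr_ge0.
  have e2 : 0 < ep0 / 2 by rewrite divr_gt0.
  split; first by apply: le_trans hg _; rewrite /gg gerBl mulr_ge0 // ltW.
  have [s00|sp] := eqVneq (avg (sec n)) 0.
    rewrite s00 mulr0; move: s00 => /eqP; rewrite /avg mulf_eq0 invr_eq0 pnatr_eq0 eqn0Ngt zmod_gt0 orbF psumr_eq0 //.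
    by move=> /allP /(_ a (mem_index_enum _)) /eqP ->.
  have sp' : 0 < avg (sec n) by rewrite lt_neqAle eq_sym sp.
  have : (ep0 / 2) * ((avg (sec n))^-1 * sec n a) <= 1 by move: hg; rewrite /gg; lra.
  rewrite -ler_pdivlMl // mulr1 => h3.
  have -> : 2 / ep0 = (ep0 / 2)^-1 by rewrite invf_div.
  by rewrite -ler_pdivrMr // mulrC.
pose a n := projT1 (cid (pick n)).
have [h1 h2] : nnull W (fun n => u k.+1 (f n (a n))) /\ null W (fun n => sec n (a n)).
  split.
    by exists (ep0 / 2); [rewrite divr_gt0|apply: evS hE => n h; have [] := projT2 (cid (pick n)) h].
  apply: null_le (nullZ (2 / ep0) _ nl); last by apply: evT => n; apply: avg_ge0.
  by apply: evS hE => n h; have [] := projT2 (cid (pick n)) h.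
exfalso.
have hu1 : ev (fun n => ep0 / 2 <= u k.+1 (f n (a n))).
  by apply: evS hE => n h; have [] := projT2 (cid (pick n)) h.
have [b hb] := dep_choice (fun n => let: ex_intro2 b h1 h2 := dual_exists k.+1 (f1 n (a n)) in ex_intro _ b (conj h1 h2)).
pose f' n y := A1 n y * A2 n (y + a n) * \prod_l F l n (y + a n *+ il l).
have close : ev (fun n => avg (fun y => ab (f n (a n) y - f' n y)) <= th / 2).
  have hF2 : ev (fun n => forall l, N2 (fun x => c l n x - F l n x) < del ^+ 2) by apply: ev_fin => l; case: (hF l).
  apply: evS hF2 => n h; apply: le_trans (_ : avg (fun y => \sum_l ab (c l n (y + a n *+ il l) - F l n (y + a n *+ il l))) <= _).
    apply: ler_avg => y; rewrite /f /f' -mulrBr abM; apply: le_trans (_ : ab (\prod_l c l n (y + a n *+ il l) - \prod_l F l n (y + a n *+ il l)) <= _).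
      by rewrite ler_piMl ?ab_ge0.
    by apply: prod_diff => l; [exact: c1 | exact: F1].
  rewrite avg_sum; apply: le_trans (_ : \sum_(l : L) del <= _).
    apply: ler_sum => l _; rewrite (avg_addr (fun y => ab (c l n y - F l n y))).
    by apply: ab_le_N2; [exact: ltW | exact: ltW].
  have -> : \sum_(l : L) del = #|L|%:R * del by rewrite sumr_const mulr_natl.
  have -> : #|L|%:R * del = th / 2 * (#|L|%:R / L1) by rewrite /del mulrCA.
  by rewrite ler_piMr ?divr_ge0 ?(ltW th0) // ler_pdivrMr // mul1r lerDl.
have hcorr : ev (fun n => th / 2 <= ab (avg (fun y => f' n y * b n y))).
  apply: ev2 hu1 close => n hu hc; have [bB bU] := hb n.
  have e1 : ep0 / 2 <= ab (avg (fun y => f n (a n) y * b n y)) by rewrite -bU.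
  have e2 : ab (avg (fun y => f n (a n) y * b n y) - avg (fun y => f' n y * b n y)) <= th / 2.
    rewrite -avgB; apply: le_trans (ab_avg _) _; apply: le_trans hc; apply: ler_avg => y.
    by rewrite -mulrBl abM ler_piMr ?ab_ge0 ?(B_le1 bB).
  have e3 : th <= ep0 / 4 by rewrite ge_min lexx.
  have := ab_tri (avg (fun y => f n (a n) y * b n y)) 0 (avg (fun y => f' n y * b n y)).
  by rewrite !subr0; lra.
(* Phases at [y] divided by their translates. By [char_shift] this is structured of degree [k + 1],
   one less than the phases themselves. *)
pose w (xi : Xi) n y : C := \prod_l (E (ep (xi l) (n := n) y) * Num.conj (E (ep (xi l) (y + a n *+ il l)))).
have cw xi : Cl W (Bf k.+1) (w xi).
  apply: S_prod => l; first by apply: (@bdd1 R W _ _ _ 1) => n y; rewrite abM ab_conj !ab_E mulr1.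
  exact: (char_shift gX (xi l) (fun n => a n *+ il l)).
have w1 xi : fle1 (w xi) by move=> n y; apply: prod_le1 => l; rewrite abM ab_conj !ab_E mulr1.
pose tm (xi : Xi) n := ab (avg (fun y => (A1 n y * chi xi n y * A2 n (y + a n)) * (Num.conj (w xi n y) * b n y))).
have [xi hxi] : exists xi, nnull W (tm xi).
  apply: nnull_sum; exists (th / 2); first by rewrite divr_gt0.
  apply: ev2 hcorr coE => n hc coE; apply: le_trans hc _.
  have -> : avg (fun y => f' n y * b n y) = \sum_(xi : Xi) (\prod_l co l n (xi l)) *
       avg (fun y => (A1 n y * chi xi n y * A2 n (y + a n)) * (Num.conj (w xi n y) * b n y)).
    under [RHS]eq_bigr => xi _ do rewrite -avgZ.
    rewrite -avg_sum; apply: eq_avg => y; rewrite /f'.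
    have -> : \prod_l F l n (y + a n *+ il l) = \sum_(xi : Xi) \prod_l (co l n (xi l) * E (ep (xi l) (y + a n *+ il l))).
      under eq_bigr => l _ do rewrite coE.
      by rewrite bigA_distr_bigA.
    rewrite mulr_sumr mulr_suml; apply: eq_bigr => xi _.
    rewrite big_split /=.
    have -> : \prod_l E (ep (xi l) (y + a n *+ il l)) = chi xi n y * Num.conj (w xi n y).
      rewrite /chi /w rmorph_prod -big_split; apply: eq_bigr => l _ /=.
      by rewrite rmorphM /= conjCK mulrA EJ mul1r.
    ring.
  apply: le_trans (ab_sum _ _ _) _; apply: ler_sum => xi _; rewrite abM ler_piMl ?ab_ge0 //.
  by apply: prod_le1 => l; exact: co1.
have : nnull W (fun n => u k.+1 (fun y => (A1 n y * chi xi n y) * A2 n (y + a n))).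
  apply: (@dual_u R W UW Z k.+1 (fun n y => (A1 n y * chi xi n y) * A2 n (y + a n)) (fun n y => Num.conj (w xi n y) * b n y)).
  - by move=> n y; rewrite !abM !mulr_ile1 ?mulr_ge0 ?ab_ge0 ?a1 ?a2 ?chi1.
  - apply: S_mul.
    + by apply: (@bdd1 R W _ _ _ 1) => n; exact: (B_le1 (hb n).1).
    + exact: S_conj.
    + by apply: Cl_base; apply: evT => n; exact: (hb n).1.
  exact: hxi.
apply: nullN; apply: null_le h2; apply: evT => n; rewrite /sec (bigD1 xi) //= lerDl.
by apply: sumr_ge0 => xi' _; exact: u_ge0.
Qed.
End Core.

(** * Products over shifted cubes *)

Lemma mp_two (Zn : finZmodType) (P L : finType) (al : P -> Zn) (be : L -> Zn) : (0 < #|P|)%N -> (0 < #|L|)%N ->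
  mp (fun q : (Zn * P) * (Zn * L) => (q.1.1 + al q.1.2, q.2.1 + be q.2.2)).
Proof.
move=> hP hL.
have m0 : mp (fun _ : L => tt) by exists #|L| => // -[]; rewrite -cardsT; apply: eq_card => l; rewrite !inE.
have m1 : mp (fun yl : Zn * L => yl.1 + be yl.2).
  exact: (comp_mp (mp_twist be m0) (@mp_fst Zn unit (eq_ind_r (fun c => (0 < c)%N) (ltn0Sn 0) card_unit))).
have m2 : mp (fun q : Zn * (P * (Zn * L)) => (q.1 + al q.2.1, q.2.2.1 + be q.2.2.2)).
  exact: (mp_twist (fun pl : P * (Zn * L) => al pl.1) (comp_mp (@mp_snd P (Zn * L)%type hP) m1)).
have m3 : mp (fun q : (Zn * P) * (Zn * L) => (q.1.1, (q.1.2, q.2))).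
  by apply: bij_mp; exists (fun q : Zn * (P * (Zn * L)) => ((q.1, q.2.1), q.2.2)); [case=> -[? ?] ?|case=> ? [? ?]].
exact: (comp_mp m3 m2).
Qed.

Lemma avg_ffun (K : numFieldType) (I T : finType) (F : I -> T -> K) :
  avg (fun s : {ffun I -> T} => \prod_i F i (s i)) = \prod_i avg (F i).
Proof.
by rewrite /avg [in RHS]big_split /= prodr_const bigA_distr_bigA card_ffun natrX exprVn.
Qed.

Section CprodMore.
Variables (R : realType) (Z : finZmodType).
Local Notation C := R[i].
Lemma cprodEt N (F : seq bool -> Z -> C) hs x : size hs = N ->
  cprod F hs x = \prod_(s : N.-tuple bool) F s (x + dot s hs).
Proof. by move=> <-; exact: cprodE. Qed.
Lemma cprod_prod (J : finType) (F : J -> seq bool -> Z -> C) hs x :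
  cprod (fun s y => \prod_j F j s y) hs x = \prod_j cprod (F j) hs x.
Proof. by rewrite cprodE exchange_big; apply: eq_bigr => j _; rewrite cprodE. Qed.
Lemma cj_nseq k (z : C) : cj (nseq k false) z = z.
Proof. by rewrite /cj; have -> : count id (nseq k false) = 0%N by elim: k. Qed.

(** The second argument is chosen so that the conjugated factors sit on a cube without the shifts
    [t], with independent base point and edges; averaging over it produces the constant
    [conj (U N g)]. *)
Lemma Q_formula N (g : Z -> C) hs (t : seq bool -> Z) x : size hs = N ->
  avg (fun yl : Z * N.-tuple Z => \prod_(v : N.-tuple bool)
    cj v (g (x + dot v hs + t v) * Num.conj (g (x + dot v hs + t v + (yl.1 + dot v yl.2 - t v))))) =
  cprod (fun s y => cj s (g (y + t s))) hs x * Num.conj (U N g).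
Proof.
move=> sh.
have e (yl : Z * N.-tuple Z) : \prod_(v : N.-tuple bool)
    cj v (g (x + dot v hs + t v) * Num.conj (g (x + dot v hs + t v + (yl.1 + dot v yl.2 - t v)))) =
    cprod (fun s y => cj s (g (y + t s))) hs x * Num.conj (cprod (fun s y => cj s (g y)) (zadd hs yl.2) (x + yl.1)).
  rewrite cprod_add ?sh ?size_tuple // !(cprodEt _ _ sh) rmorph_prod -big_split; apply: eq_bigr => v _ /=.
  rewrite cjM cj_conj; congr (_ * Num.conj (cj v (g _))).
  by rewrite -[LHS]addrA (addrC (t v)) subrK addrACA addrA.
rewrite (eq_avg e) avgZ -conj_avg; congr (_ * Num.conj _).
rewrite (avg_pairE (fun y (l : N.-tuple Z) => cprod (fun s y => cj s (g y)) (zadd hs l) (x + y))) /U /GP.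
rewrite -(avg_addl (fun y => Eh N (fun l => cprod (fun s y => cj s (g y)) l y)) x); apply: eq_avg => y.
exact: (Eh_shift (fun l => cprod (fun s y => cj s (g y)) l (x + y)) sh).
Qed.
End CprodMore.

(** * Torsion *)

Section Torsion.
Variable R : realType.
Context (W : set_system nat) {UW : UltraFilter W}.
Variable Z : nat -> finZmodType.
Local Notation C := R[i].
Local Notation ev := (ev W).
Local Notation Zf := (Zf Z).
Local Notation Bf := (@Bf R Z).
Local Notation BK := (@BK R Z).
Local Notation ZP := (ZP Z).

Section QCl.
Variables (d N : nat) (P : nat -> finType) (cf : forall n, P n -> seq (Z n)).
Definition QB : base R (ZP P) := fun n b => exists c (bv : seq bool -> Z n -> C),
  [/\ ab c <= 1, forall s, B d (bv s) & b = fun xp => c * cprod bv (cf xp.2) xp.1].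
Lemma good_QB : good_base QB.
Proof.
move=> n b [c [bv [hc hb ->]]]; split.
  by move=> t; rewrite abM mulr_ile1 ?ab_ge0 //; apply: cprod_le1 => s; exact: (B_le1 (hb s)).
move=> a ha; exists (a * c), bv; split => //; first by rewrite abM mulr_ile1 ?ab_ge0.
by apply/funext => xp; rewrite mulrA.
Qed.
(** Dividing [Q_formula] by its constant, which is bounded below, writes the cube product as an
    average of products of derivatives [hat g], each structured. The shifts [t] are arbitrary. *)
Lemma Q_Cl (g : fam R Zf) (t : forall n, seq bool -> Z n) : (forall n, 0 < #|P n|)%N ->
  (forall n p, size (cf (n := n) p) = N) -> fle1 g -> Cl W (BK d) (hat g) -> nnull W (fun n => u N (g n)) ->
  Cl W QB (fun n xp => cprod (fun s y => cj s (g n (y + t n s))) (cf xp.2) xp.1).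
Proof.
move=> P0 sz g1 gk [e0 e00 hU].
pose S n : finType := (Z n * N.-tuple (Z n))%type.
have S0 n : (0 < #|S n|)%N by rewrite card_prod muln_gt0 zmod_gt0 tuple_gt0.
pose F n (q : ZP P n * S n) : C := \prod_(v : N.-tuple bool)
   cj v (hat g (n := n) (q.1.1 + (dot v (cf q.1.2) + t n v), q.2.1 + (dot v q.2.2 - t n v))).
have h1 : Cl W QB (fun n xp => avg (fun s => F n (xp, s))).
  pose Bv (v : N.-tuple bool) : base R (fun n => (ZP P n * S n)%type) := fun n b =>
    exists2 ka : Z n * Z n -> C, (forall t, B d (fun x => ka (x, t))) &
      b = fun q => ka (q.1.1 + (dot v (cf q.1.2) + t n v), q.2.1 + (dot v q.2.2 - t n v)).
  have ghat1 v n x : ab (cj v (hat g (n := n) x)) <= 1 by rewrite ab_cj; exact: hat_le1.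
  apply: (@Cl_avg R W UW (ZP P) S (prod_base (index_enum (N.-tuple bool)) Bv) QB F) => //.
  - exact: good_QB.
  - move=> n b s [bv hv ->].
    have hb0 v : exists b0 : Z n -> C, B d b0 /\ forall xp, bv v (xp, s) = b0 (xp.1 + dot v (cf xp.2)).
      have [ka hk ->] := hv v (mem_index_enum _).
      exists (fun y => ka (y + t n v, s.1 + (dot v s.2 - t n v))); split; last by move=> xp /=; rewrite addrA.
      by have := B_shift (t n v) (hk (s.1 + (dot v s.2 - t n v))).
    have [b0 hb] := choice hb0.
    exists 1, (fun s => b0 (insubd (nseq_tuple N false) s)); split; first by rewrite ab1.
      by move=> s'; case: (hb (insubd (nseq_tuple N false) s')).
    apply/funext => xp; rewrite mul1r (cprodEt _ _ (sz n xp.2)); apply: eq_bigr => v _.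
    by rewrite valKd; case: (hb v) => _ ->.
  apply: Cl_prod.
  - exact: index_enum_uniq.
  - move=> v n b [ka hk ->]; split; first by move=> q; exact: (B_le1 (hk _)).
    by move=> c hc; exists (fun xt => c * ka xt) => // t'; exact: B_scale.
  - by move=> v; apply: (@bdd1 R W _ _ _ 1).
  move=> v _.
  have hcj : Cl W (BK d) (fun n xt => cj v (hat g (n := n) xt)).
    rewrite /cj; case: (odd _) => //; exact: P_conj.
  apply: (@Cl_pull R W UW (fun n => (ZP P n * S n)%type : finType) (ZP Zf)
    (fun n q => (q.1.1 + (dot v (cf q.1.2) + t n v), q.2.1 + (dot v q.2.2 - t n v))) (BK d) (Bv v) _ _ _ hcj).
    by move=> n; apply: (mp_two (fun p => dot v (cf p) + t n v) (fun l : N.-tuple (Z n) => dot v l - t n v)) => //; exact: tuple_gt0.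
  by move=> n b hb; exists b.
have hc : ev (fun n => ab (Num.conj (U N (g n)))^-1 <= e0^-1).
  by apply: evS hU => n h; rewrite abV ab_conj lef_pV2 ?posrE // (lt_le_trans e00).
apply: (Cl_eq _ (Cl_scale good_QB hc h1)); apply: evS hU => n h xp.
have U0 : Num.conj (U N (g n)) != 0.
  by rewrite -ab_eq0 ab_conj gt_eqF // (lt_le_trans e00).
have -> : avg (fun s => F n (xp, s)) = cprod (fun s y => cj s (g n (y + t n s))) (cf xp.2) xp.1 * Num.conj (U N (g n)).
  rewrite -(Q_formula (g n) (t n) xp.1 (sz n xp.2)); apply: eq_avg => yl; apply: eq_bigr => v _.
  by rewrite /hat /= !addrA.
by rewrite mulrC -mulrA mulfV // mulr1.
Qed.
End QCl.

Lemma hat_avg n (g : Z n -> C) : avg (fun xt : Z n * Z n => (ab (g xt.1) ^+ 2) * (ab (g (xt.1 + xt.2)) ^+ 2)) = N2 g ^+ 2.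
Proof.
rewrite (avg_pairE (fun x t => (ab (g x) ^+ 2) * (ab (g (x + t)) ^+ 2))) expr2 /N2 -avgZr; apply: eq_avg => x.
by rewrite avgZ (avg_addl (fun y => ab (g y) ^+ 2)).
Qed.
Lemma U_nnull d (g : fam R Zf) : fle1 g -> Cl W (BK d.+1) (hat g) -> nnull W (fun n => N2 (g n)) ->
  nnull W (fun n => u d.+2 (g n)).
Proof.
move=> g1 gk [e e0 hN].
apply: (@K_corr_u R W UW Z d (fun n xt => Num.conj (hat g (n := n) xt)) (fun n x => Num.conj (g n x)) g) => //.
- by move=> n x; rewrite ab_conj g1.
- exact: P_conj.
exists (e ^+ 2); first by rewrite exprn_gt0.
apply: evS hN => n h.
have -> : avg (fun xt : Z n * Z n => Num.conj (hat g xt) * (Num.conj (g n (xt.1 + xt.2)) * g n xt.1)) = (N2 (g n) ^+ 2)%:C.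
  rewrite -hat_avg avgC; apply: eq_avg => xt; rewrite /hat rmorphM /= conjCK rmorphM /= -!mulcJ; ring.
by rewrite abR ger0_norm ?exprn_ge0 ?N2_ge0 // ler_pXn2r ?nnegrE ?N2_ge0 // ltW.
Qed.
(** [hat g * conj (hat g)] is the kernel [hat] of [|g|^2], whose mean is bounded below, so
    [corr_struct] applies with the constant 1. *)
Lemma sq_Cl d (g : fam R Zf) : fle1 g -> Cl W (BK d) (hat g) -> nnull W (fun n => N2 (g n)) ->
  Cl W (Bf d) (fun n x => (ab (g n x) ^+ 2)%:C).
Proof.
move=> g1 gk [e e0 hN].
apply: (@corr_struct R W UW Z d _ (fun _ _ => 1)).
- by apply: (@bdd1 R W _ _ _ 1) => n x; rewrite ab1.
- apply: (Cl_eq _ (P_mul _ gk (P_conj gk))).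
    by apply: evT => n xt; rewrite mulcJ /hat abM ab_conj exprMn rmorphM /= conjR.
  by apply: bddJ; apply: fle1_bdd; exact: hat_le1.
- by apply: Cl_base; apply: evT => n; apply: B_const; rewrite ab1.
exists e => //; apply: evS hN => n h.
rewrite (eq_avg (g := fun x => (ab (g n x) ^+ 2)%:C)) => [|x]; last by rewrite mulr1.
by rewrite -avgC abR ger0_norm // N2_ge0.
Qed.
Lemma hat_pow d (g : fam R Zf) m : fle1 g -> Cl W (BK d) (hat g) -> Cl W (BK d) (hat (fun n x => g n x ^+ m)).
Proof.
move=> g1 gk; apply: (Cl_eq _ (P_prod (index_enum 'I_m) _ (fun _ => gk))).
  by apply: evT => n xt; rewrite prodr_const card_ord /hat exprMn rmorphXn.
by move=> _; apply: fle1_bdd; exact: hat_le1.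
Qed.
Lemma pow_fle1 (g : fam R Zf) m : fle1 g -> fle1 (fun n x => g n x ^+ m).
Proof. by move=> g1 n x; rewrite abX exprn_ile1 ?ab_ge0 ?g1. Qed.
Lemma pow_lower n (g : Z n -> C) e q : le1 g -> (q <= 2 ^ e)%N -> N2 g ^+ (2 ^ e) <= avg (fun x => (ab (g x) ^+ 2) ^+ q).
Proof.
move=> g1 hq; apply: le_trans (avg_exp2 _ _) _; first by move=> x; rewrite exprn_ge0 ?ab_ge0.
apply: ler_avg => x; apply: ler_wiXn2l => //; first by rewrite exprn_ge0 ?ab_ge0.
by rewrite exprn_ile1 ?ab_ge0 ?g1.
Qed.

Variable m' : nat.
Local Notation m := m'.+1.
Hypothesis tors : forall n (x : Z n), x *+ m = 0.
Local Notation joins := (@joins R W Z m').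
Local Notation regular := (@regular R W Z m').

Lemma B1_const n (b : Z n -> C) : B 1 b -> forall x y, b x = b y.
Proof.
move=> [F [_ [c hc] ->]] x y; rewrite /= !EhS; under eq_avg => h do rewrite Eh0 /= hc.
under [RHS]eq_avg => h do rewrite Eh0 /= hc.
by rewrite !avgZ (avg_addl (F [:: true])) (avg_addl (F [:: true])).
Qed.
(** Dual functions of degree 1 are constant, so a structured kernel of degree 1 hardly depends on
    its first variable. *)
Lemma drift (f : fam R (ZP Zf)) j : Cl W (BK 1) f ->
  null W (fun n => N2 (fun xa : Z n * Z n => f n (xa.1 + xa.2 *+ j, xa.2) - f n xa)).
Proof.
move=> h e e0; have e8 : 0 < e / 8 by rewrite divr_gt0.
have [J hJ] := h _ e8; apply: evS hJ => n [b [hb hN]].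
have mpj : mp (fun xa : Z n * Z n => (xa.1 + xa.2 *+ j, xa.2)) := mp_twist (fun a => a *+ j) (@mp_id _).
apply: le_lt_trans (N2_tri _ _ (fun xa : Z n * Z n => \sum_j b j xa)) _.
have -> : N2 (fun t : Z n * Z n => f n (t.1 + t.2 *+ j, t.2) - \sum_j b j t) = N2 (fun t => f n t - \sum_j b j t).
  rewrite -(N2_mp (fun t => f n t - \sum_j b j t) mpj); apply: eq_N2 => -[x a] /=; congr (_ - _); apply: eq_bigr => i _.
  exact: (B1_const (hb i a)).
rewrite [X in _ + 2 * X]N2C; lra.
Qed.
Lemma drift_prod (f : fam R (ZP Zf)) : fle1 f -> Cl W (BK 1) f ->
  null W (fun n => ab (avg (fun xa : Z n * Z n => \prod_(j < m) f n (xa.1 + xa.2 *+ j, xa.2)) - avg (fun xa => f n xa ^+ m))).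
Proof.
move=> f1 h; have hs : null W (fun n => \sum_(j < m) avg (fun xa : Z n * Z n => ab (f n (xa.1 + xa.2 *+ j, xa.2) - f n xa))).
  apply: null_sum => j e e0; have e20 : 0 < (e / 2) ^+ 2 by rewrite exprn_gt0 // divr_gt0.
  apply: evS (drift j h e20) => n hn; apply: le_lt_trans (ab_le_N2 (e := e / 2) _ (ltW hn)) _; lra.
apply: null_le hs; apply: evT => n; rewrite -avgB; apply: le_trans (ab_avg _) _; rewrite -avg_sum.
apply: ler_avg => xa; rewrite -[X in _ ^+ X](card_ord m) -prodr_const.
by apply: prod_diff => j; exact: f1.
Qed.
(** The telescoping in the lowest degree: over [j] modulo [m], the product of [hat g] at
    [(x + j a, a)] equals that of [|g|^2] at the same points, since [m a = 0]. By [drift_prod] the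
    first product averages to nearly [|E g^m|^2] and the second to nearly the mean of [|g|^(2m)],
    which is bounded below. *)
Lemma torsion0 (g : fam R Zf) : fle1 g -> Cl W (BK 1) (hat g) -> nnull W (fun n => N2 (g n)) ->
  Cl W (Bf 1) (fun n x => g n x ^+ m).
Proof.
move=> g1 gk hN; apply: struct_or; [exact: pow_fle1|exact: hat_pow|].
have n1 := drift_prod (hat_le1 g1) gk.
pose sq : fam R (ZP Zf) := fun n xt => (ab (g n xt.1) ^+ 2)%:C.
have sq1 : fle1 sq by move=> n x; rewrite abR ger0_norm ?exprn_ge0 ?ab_ge0 // exprn_ile1 ?ab_ge0 ?g1.
have sqK : Cl W (BK 1) sq.
  have := @P_pullS R W UW Z 1 Zf (fun n _ => 0) _ (@Z_gt0 Z) (sq_Cl g1 gk hN).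
  by apply: Cl_eq; apply: evT => n xt; rewrite addr0.
have n2 := drift_prod sq1 sqK.
have [c c0 hc] := hN; pose th := c ^+ (2 ^ m); have th0 : 0 < th by rewrite exprn_gt0.
exists (th / 2); first by rewrite divr_gt0.
have th4 : 0 < th / 4 by rewrite divr_gt0.
apply: ev3 hc (n1 _ th4) (n2 _ th4) => n hc' h1 h2.
set a1 := avg _ in h1; set a2 := avg _ in h1; set a3 := avg _ in h2; set a4 := avg _ in h2.
have e13 : a1 = a3.
  apply: eq_avg => -[x a] /=; rewrite /hat /sq /=.
  under eq_bigr => j _ do rewrite -addrA -mulrSr.
  rewrite big_split /=; under [RHS]eq_bigr => j _ do rewrite -mulcJ.
  rewrite big_split /=; congr (_ * _); rewrite big_ord_recr [RHS]big_ord_recl /= mulrC tors mulr0n; congr (_ * _).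
have e4 : th <= ab a4.
  have -> : a4 = (avg (fun x : Z n => (ab (g n x) ^+ 2) ^+ m))%:C.
    rewrite /a4 (avg_pairE (fun x _ => ((ab (g n x) ^+ 2)%:C) ^+ m)) avgC; apply: eq_avg => x.
    by rewrite (avg_const _ (zmod_gt0 (Z n))) [RHS]rmorphXn.
  rewrite abR ger0_norm; last by apply: avg_ge0 => x; rewrite !exprn_ge0 ?ab_ge0.
  apply: le_trans (pow_lower (e := m) (g1 n) _); last by rewrite ltnW // ltn_expl.
  by rewrite /th ler_pXn2r ?nnegrE ?N2_ge0 ?(ltW c0) ?expn_gt0.
have e2 : ab a2 <= u 1 (fun x => g n x ^+ m).
  rewrite uE Eh0 /= -/(ab (avg _)).
  have -> : a2 = avg (fun x => g n x ^+ m) * Num.conj (avg (fun x => g n x ^+ m)).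
    rewrite /a2 (avg_pairE (fun x t => (hat g (n := n) (x, t)) ^+ m)) -avgZr; apply: eq_avg => x.
    rewrite conj_avg -(avg_addl (fun y => Num.conj (g n y ^+ m)) x) -avgZ; apply: eq_avg => t.
    by rewrite /hat exprMn rmorphXn.
  by rewrite abM ab_conj -expr2 lexx.
have t1 := ab_tri a4 0 a3; have t2 := ab_tri a1 0 a2; rewrite !subr0 in t1 t2.
rewrite [ab (a4 - a3)]ab_sym in t1; rewrite e13 in h1 t2; lra.
Qed.

Section Pos.
Variables (k0 : nat) (g : fam R Zf).
Local Notation k := k0.+1.
Arguments g : clear implicits.
Hypotheses (g1 : fle1 g) (gk : Cl W (BK k.+1) (hat g)) (gN : nnull W (fun n => N2 (g n))).
Let P n : finType := (Z n * k.-tuple (Z n))%type.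
Let cf (j : 'I_m) n (p : P n) : seq (Z n) := [:: p.1 *+ j, p.1 & p.2].
Let P0 n : (0 < #|P n|)%N. Proof. by rewrite card_prod muln_gt0 zmod_gt0 tuple_gt0. Qed.
Variable sh : forall n, 'I_m * k.-tuple bool -> Z n.
Arguments sh : clear implicits.
Let sh' n (i : nat) (w : seq bool) : Z n := sh n (inord (i %% m), insubd (nseq_tuple k false) w).
(** The shift at a vertex depends on [w] and on the index [i] modulo [m]. Thus cubes for different
    [j] that share a layer of points also share its shifts, and the factors still telescope. *)
Definition Psi n (i : nat) (xp : ZP P n) : C :=
  cprod (fun w y => cj w (g n (y + sh' n i w))) xp.2.2 (xp.1 + xp.2.1 *+ i).
Let ts (j : 'I_m) n (s : seq bool) : Z n := if s is [:: b1, b2 & w] then sh' n (b1 * j + b2) w else 0.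
(* The product of the [Qj] over [j] modulo [m] telescopes, see [prodQ]. *)
Definition Qj (j : 'I_m) n (xp : ZP P n) := cprod (fun s y => cj s (g n (y + ts j n s))) (cf j xp.2) xp.1.
Lemma QjE j n (xp : ZP P n) : Qj j xp = (Psi 0 xp * Num.conj (Psi 1 xp)) * (Num.conj (Psi j xp) * Psi j.+1 xp).
Proof.
rewrite /Qj /= /Psi mulr0n addr0 mulr1n mulrSr addrA -!cprod_conj.
congr ((_ * _) * (_ * _)); apply: eq_cprod => s y _; rewrite !cj_cons /= ?conjCK ?mul1n ?mul0n ?addn0 ?addn1 //.
Qed.
Lemma Psi_m n (xp : ZP P n) : Psi m xp = Psi 0 xp.
Proof. by rewrite /Psi tors mulr0n; apply: eq_cprod => s y _; rewrite /sh' modnn mod0n. Qed.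
Lemma Psi1 n i (xp : ZP P n) : ab (Psi i xp) <= 1.
Proof. by apply: cprod_le1 => s y; rewrite ab_cj g1. Qed.
Lemma prodQ n (xp : ZP P n) : \prod_j Qj j xp = (Psi 0 xp * Num.conj (Psi 1 xp)) ^+ m * \prod_(j < m) (ab (Psi j xp) ^+ 2)%:C.
Proof.
under eq_bigr => j _ do rewrite QjE.
rewrite big_split /= prodr_const card_ord; congr (_ * _).
under [RHS]eq_bigr => j _ do rewrite -mulcJ.
rewrite !big_split /= mulrC; congr (_ * _).
by rewrite big_ord_recr [RHS]big_ord_recl /= mulrC Psi_m.
Qed.
Lemma ab_Psi n (j : 'I_m) (xp : ZP P n) :
  ab (Psi j xp) = \prod_(w : k.-tuple bool) ab (g n (xp.1 + xp.2.1 *+ j + dot w xp.2.2 + sh n (j, w))).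
Proof.
rewrite /Psi (cprodEt (N := k)) ?size_tuple // ab_prod; apply: eq_bigr => w _.
by rewrite ab_cj /sh' valKd modn_small // inord_val.
Qed.
(** Without shifts a lower bound for the product of [|g|] over dependent vertices is not at hand;
    with independent random shifts the average factors into moments of [|g|]. *)
Definition shOK e (c : R) := ev (fun n => c <= avg (fun xp : ZP P n => \prod_(i : 'I_m * k.-tuple bool)
   (ab (g n (xp.1 + xp.2.1 *+ i.1 + dot i.2 xp.2.2 + sh n i)) ^+ 2) ^+ (2 ^ e))).
(** By [prodQ] the integrand is the nonnegative number [|Psi 0 * Psi 1|^(2m)] times the product of
    the [|Psi j|^2], and each modulus is at least the product of all of them. *)
Lemma Qcorr e c : (2 * m + 1 <= 2 ^ e)%N -> 0 < c -> shOK e c ->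
  nnull W (fun n => ab (avg (fun xp : ZP P n => (\prod_j Qj j xp) * Num.conj ((Psi 0 xp * Num.conj (Psi 1 xp)) ^+ m)))).
Proof.
move=> he c0 hc; exists c => //; apply: evS hc => n h.
pose Pi (xp : ZP P n) : R := \prod_(j < m) ab (Psi j xp).
have -> : avg (fun xp : ZP P n => (\prod_j Qj j xp) * Num.conj ((Psi 0 xp * Num.conj (Psi 1 xp)) ^+ m)) =
   (avg (fun xp : ZP P n => (ab (Psi 0 xp) * ab (Psi 1 xp)) ^+ m ^+ 2 * Pi xp ^+ 2))%:C.
  rewrite avgC; apply: eq_avg => xp; rewrite prodQ mulrAC mulcJ abX abM ab_conj [RHS]rmorphM /=; congr (_ * _).
  by rewrite /Pi -prodrXl rmorph_prod.
have pi0 xp : 0 <= Pi xp by apply: prodr_ge0 => j _; exact: ab_ge0.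
have pi1 xp : Pi xp <= 1 by apply: prodr_ile1 => j _; rewrite ab_ge0 Psi1.
have pile xp (j : 'I_m) : Pi xp <= ab (Psi j xp).
  rewrite /Pi (bigD1 j) //= ler_piMr ?ab_ge0 //; apply: prodr_ile1 => l _; by rewrite ab_ge0 Psi1.
have pil1 xp : Pi xp <= ab (Psi 1 xp).
  (* For [m = 1] the index 1 is out of range, but then [Psi 1] is [Psi 0]. *)
  have [m1|m1] := ltnP 1 m; first exact: (pile xp (Ordinal m1)).
  have e1 : m' = 0%N by case: (m') m1.
  have -> : Psi 1 xp = Psi 0 xp by have := Psi_m xp; rewrite e1.
  exact: (pile xp ord0).
rewrite abR ger0_norm; last by apply: avg_ge0 => xp; rewrite mulr_ge0 ?sqr_ge0.
apply: le_trans h _; apply: ler_avg => xp.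
have -> : \prod_(i : 'I_m * k.-tuple bool)
   (ab (g n (xp.1 + xp.2.1 *+ i.1 + dot i.2 xp.2.2 + sh n i)) ^+ 2) ^+ (2 ^ e) = (Pi xp ^+ 2) ^+ (2 ^ e).
  rewrite /Pi !prodrXl; congr ((_ ^+ _) ^+ _).
  transitivity (\prod_(i : 'I_m * k.-tuple bool) (fun (j : 'I_m) (w : k.-tuple bool) => ab (g n (xp.1 + xp.2.1 *+ j + dot w xp.2.2 + sh n (j, w)))) i.1 i.2).
    by apply: eq_bigr => -[].
  rewrite -(pair_bigA _ (fun (j : 'I_m) (w : k.-tuple bool) => ab (g n (xp.1 + xp.2.1 *+ j + dot w xp.2.2 + sh n (j, w))))) /=.
  by apply: eq_bigr => j _; rewrite ab_Psi.
apply: le_trans (_ : (Pi xp ^+ 2) ^+ (2 * m + 1) <= _).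
  by apply: ler_wiXn2l => //; rewrite ?exprn_ge0 // exprn_ile1.
rewrite exprD expr1 ler_wpM2r ?exprn_ge0 //; set q := Pi xp.
have -> : (q ^+ 2) ^+ (2 * m) = (q * q) ^+ m ^+ 2 by rewrite -expr2 -!exprM; congr (_ ^+ _); lia.
have qq0 : 0 <= q by exact: pi0.
rewrite ler_pXn2r ?nnegrE ?exprn_ge0 ?mulr_ge0 ?ab_ge0 //.
rewrite ler_pXn2r ?nnegrE ?mulr_ge0 ?ab_ge0 //; apply: ler_pM => //; [exact: (pile xp ord0)|exact: pil1].
Qed.

Definition PB : base R (ZP P) := fun n b => exists c (bv : 'I_m -> seq bool -> Z n -> C),
  [/\ ab c <= 1, forall j s, B k.+1 (bv j s) & b = fun xp => c * \prod_j cprod (bv j) (cf j xp.2) xp.1].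
Lemma good_PB : good_base PB.
Proof.
move=> n b [c [bv [hc hb ->]]]; split.
  move=> t; rewrite abM mulr_ile1 ?ab_ge0 //; apply: prod_le1 => j; apply: cprod_le1 => s; exact: (B_le1 (hb j s)).
move=> a ha; exists (a * c), bv; split => //; first by rewrite abM mulr_ile1 ?ab_ge0.
by apply/funext => xp; rewrite mulrA.
Qed.
Lemma Q_PB : Cl W PB (fun n xp => \prod_j Qj j xp).
Proof.
have hU := U_nnull g1 gk gN.
have hq j : Cl W (QB k.+1 (cf j)) (fun n xp => Qj j xp).
  by apply: (Q_Cl (ts j) P0 _ g1 gk hU) => n p; rewrite /= size_tuple.
apply: (Cl_sub _ (@Cl_prod R W UW (ZP P) 'I_m (index_enum 'I_m) (fun j => QB k.+1 (cf j)) (fun j n xp => Qj j xp) _ _ _ _)).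
- move=> n b [bv hv ->].
  have hx j : exists cb : C * (seq bool -> Z n -> C), [/\ ab cb.1 <= 1, forall s, B k.+1 (cb.2 s) & bv j = fun xp => cb.1 * cprod cb.2 (cf j xp.2) xp.1].
    by have [c [b0 h]] := hv j (mem_index_enum _); exists (c, b0).
  have [cb hcb] := choice hx.
  exists (\prod_j (cb j).1), (fun j => (cb j).2); split.
  + by apply: prod_le1 => j; case: (hcb j).
  + by move=> j s; case: (hcb j).
  + by apply/funext => xp; rewrite -big_split; apply: eq_bigr => j _; case: (hcb j) => _ _ ->.
- exact: index_enum_uniq.
- by move=> j; exact: good_QB.
- by move=> j; apply: (@bdd1 R W _ _ _ 1) => n xp; apply: cprod_le1 => s y; rewrite ab_cj g1.
- by move=> j _; exact: hq.
Qed.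

(** By [Q_PB] the products [Qj] are replaced by products of structured functions, which leaves
    [m]-th powers of [Psi 0] and [Psi 1]. [GCS] in the directions other than [a] isolates the base
    vertices: a derivative of [g^m] along [a], times structured factors at points [y + i a]. This is
    the situation of [core]. *)
Lemma pow_unull e c : (2 * m + 1 <= 2 ^ e)%N -> 0 < c -> shOK e c -> joins k -> regular k ->
  nnull W (fun n => u k.+1 (fun x => g n x ^+ m)).
Proof.
move=> he c0 hc J Rg.
have bS : bdd W (fun n (xp : ZP P n) => Num.conj ((Psi 0 xp * Num.conj (Psi 1 xp)) ^+ m)).
  by apply: (@bdd1 R W _ _ _ 1) => n xp; rewrite ab_conj abX exprn_ile1 ?ab_ge0 // abM ab_conj mulr_ile1 ?ab_ge0 ?Psi1.
have [c1 c10 h1] := Cl_corr good_PB bS Q_PB (Qcorr he c0 hc).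
pose X n (bv : 'I_m -> seq bool -> Z n -> C) := ab (avg (fun xp : ZP P n => (\prod_j cprod (bv j) (cf j xp.2) xp.1) *
   Num.conj ((Psi 0 xp * Num.conj (Psi 1 xp)) ^+ m))).
have hex n : exists bv : 'I_m -> seq bool -> Z n -> C, (forall j s, B k.+1 (bv j s)) /\
  ((exists2 b, PB b & c1 <= ab (avg (fun xp : ZP P n => b xp * Num.conj ((Psi 0 xp * Num.conj (Psi 1 xp)) ^+ m)))) -> c1 <= X n bv).
  have [[b [c2 [bv [hc2 hb ->]]] hle]|hn] := pselect (exists2 b, PB b & c1 <= ab (avg (fun xp : ZP P n => b xp * Num.conj ((Psi 0 xp * Num.conj (Psi 1 xp)) ^+ m)))).
    exists bv; split=> // _; apply: le_trans hle _.
    rewrite (eq_avg (g := fun xp => c2 * ((\prod_j cprod (bv j) (cf j xp.2) xp.1) *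
       Num.conj ((Psi 0 xp * Num.conj (Psi 1 xp)) ^+ m)))); last by move=> xp; rewrite mulrA.
    by rewrite avgZ abM ler_piMl ?ab_ge0.
  by exists (fun _ _ _ => 0); split => [j s|//]; apply: B_const; rewrite ab0.
have [bv hbv] := dep_choice hex.
have hX : ev (fun n => c1 <= X n (bv n)) by apply: evS h1 => n; case: (hbv n).
pose w0 := nseq k false.
pose F n a (w : seq bool) y : C := \prod_(j < m) ((Num.conj (cj w (g n (y + sh' n 0 w))) * cj w (g n (y + a + sh' n 1 w))) *
   (bv n j [:: false, false & w] y * bv n j [:: false, true & w] (y + a) *
   (bv n j [:: true, false & w] (y + a *+ j) * bv n j [:: true, true & w] (y + a *+ j + a)))).
have F1 n a : le1F (F n a).
  move=> w y; apply: prod_le1 => j; have hb s z : ab (bv n j s z) <= 1 := B_le1 ((hbv n).1 j s) z.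
  by rewrite !abM ab_conj !ab_cj !mulr_ile1 ?mulr_ge0 ?ab_ge0 ?g1 ?hb.
have XE n : X n (bv n) = ab (avg (fun a => GP k (F n a))).
  rewrite /X; congr ab; rewrite avg_pair avg_exch avg_pair; apply: eq_avg => a; rewrite avg_exch; apply: eq_avg => x.
  apply: eq_avg => h; rewrite cprod_prod rmorphXn /= -[X in _ ^+ X](card_ord m) -prodr_const -big_split; apply: eq_bigr => j _ /=.
  rewrite !cprodM mulrC rmorphM /= conjCK /Psi /= mulr0n addr0 mulr1n cprod_conj.
  rewrite (cprod_shift (fun w z => cj w (g n (z + sh' n 1 w)))) (cprod_shift (fun w => bv n j [:: false, true & w])).
  rewrite (cprod_shift (fun w => bv n j [:: true, false & w])).
  have -> : cprod (fun w y => bv n j [:: true, true & w] (y + a *+ j + a)) h x = cprod (fun w => bv n j [:: true, true & w]) h (x + a *+ j + a).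
    by rewrite -addrA -(cprod_shift (fun w => bv n j [:: true, true & w])); apply: eq_cprod => w y _; rewrite addrA.
  by [].
have hu : nnull W (fun n => avg (fun a => u k (F n a w0))).
  exists (c1 ^+ (2 ^ k)); first by rewrite exprn_gt0.
  apply: evS hX => n; rewrite XE => hx.
  apply: le_trans (_ : avg (fun a => ab (GP k (F n a))) ^+ (2 ^ k) <= _).
    have c1a : 0 <= avg (fun a => ab (GP k (F n a))) by apply: avg_ge0 => a; exact: ab_ge0.
    rewrite ler_pXn2r ?nnegrE ?(ltW c10) ?expn_gt0 //; exact: le_trans hx (ab_avg _).
  apply: le_trans (avg_exp2 _ _) _; first by move=> a; exact: ab_ge0.
  by apply: ler_avg => a; have := GCS w0 (F1 n a); rewrite size_nseq.
pose A1 n y : C := Num.conj (g n (y + sh' n 0 w0)) ^+ m.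
pose A2 n y : C := g n (y + sh' n 1 w0) ^+ m.
have : nnull W (fun n => u k.+1 (A1 n)).
  apply: (@core R W UW Z m' k0 ('I_m * (bool * bool))%type (fun l => l.2.1 * l.1 + l.2.2)%N
     (fun l n => bv n l.1 [:: l.2.1, l.2.2 & w0]) A1 A2) => //.
  - by move=> n y; rewrite abX ab_conj exprn_ile1 ?ab_ge0 ?g1.
  - by move=> n y; rewrite abX exprn_ile1 ?ab_ge0 ?g1.
  - by move=> l n; exact: (B_le1 ((hbv n).1 _ _)).
  - by move=> l; apply: Cl_base; apply: evT => n; exact: (hbv n).1.
  apply: nnull_le hu; apply: evT => n; rewrite le_eqVlt; apply/orP; left; apply/eqP; apply: eq_avg => a; congr (u k); apply/funext => y.
  rewrite /F /A1 /A2 big_split /= prodr_const card_ord !cj_nseq exprMn; congr (_ * _).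
  rewrite -(pair_bigA _ (fun (j : 'I_m) (b : bool * bool) => bv n j [:: b.1, b.2 & w0] (y + a *+ (b.1 * j + b.2)))) /=.
  apply: eq_bigr => j _; rewrite -(pair_bigA _ (fun (b1 b2 : bool) => bv n j [:: b1, b2 & w0] (y + a *+ (b1 * j + b2)))) /= !big_bool /=.
  rewrite !mul1n !mul0n !add0n !addn0 addn1 mulr1n mulr0n addr0 mulrSr addrA; ring.
apply: nnull_le; apply: evT => n; rewrite /A1.
have -> : u k.+1 (fun y => Num.conj (g n (y + sh' n 0 w0)) ^+ m) = u k.+1 (fun y => Num.conj (g n (y + sh' n 0 w0) ^+ m)).
  by congr u; apply/funext => y; rewrite rmorphXn.
by rewrite (u_conj _ (fun y => g n (y + sh' n 0 w0) ^+ m)) (u_shift _ _ (fun y => g n y ^+ m)).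
Qed.
End Pos.

(** By [struct_or] it suffices that [g^m] is not null. The shifts that [pow_unull] needs exist by
    averaging over all of them. *)
Lemma torsion_Cl k (g : fam R Zf) : joins k -> regular k -> Char W k.+1 g -> nnull W (fun n => N2 (g n)) ->
  Cl W (Bf k.+1) (fun n x => g n x ^+ m).
Proof.
move=> J Rg [g1 gk] hN; case: k J Rg gk => [|k] J Rg gk; first exact: torsion0.
apply: struct_or; [exact: pow_fle1|exact: hat_pow|].
have [c c0 hc] := hN; pose e := (2 * m + 1)%N.
pose c1 : R := (c ^+ (2 ^ e)) ^+ #|{: 'I_m * k.+1.-tuple bool}|.
have c10 : 0 < c1 by rewrite !exprn_gt0.
pose ph n (s : {ffun 'I_m * k.+1.-tuple bool -> Z n}) := avg (fun xp : Z n * (Z n * k.+1.-tuple (Z n)) => \prod_(i : 'I_m * k.+1.-tuple bool)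
   (ab (g n (xp.1 + xp.2.1 *+ i.1 + dot i.2 xp.2.2 + s i)) ^+ 2) ^+ (2 ^ e)).
have hex n : exists s : {ffun 'I_m * k.+1.-tuple bool -> Z n}, c <= N2 (g n) -> c1 <= ph n s.
  have [s hs] := exists_ge_avg (ph n) (zmod_gt0 {ffun 'I_m * k.+1.-tuple bool -> Z n}).
  exists s => hcn; apply: le_trans hs; rewrite /ph avg_exch.
  apply: le_trans (_ : avg (fun xp : Z n * (Z n * k.+1.-tuple (Z n)) => c1) <= _).
    by rewrite avg_const // !card_prod !muln_gt0 !zmod_gt0 tuple_gt0.
  apply: ler_avg => xp; rewrite (avg_ffun (fun (i : 'I_m * k.+1.-tuple bool) (z : Z n) => (ab (g n (xp.1 + xp.2.1 *+ i.1 + dot i.2 xp.2.2 + z)) ^+ 2) ^+ (2 ^ e))).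
  under eq_bigr => i _ do rewrite (avg_addl (fun y => (ab (g n y) ^+ 2) ^+ (2 ^ e))).
  rewrite prodr_const /c1 lerXn2r ?nnegrE ?exprn_ge0 ?(ltW c0) //; first by apply: avg_ge0 => y; rewrite !exprn_ge0 ?ab_ge0.
  apply: le_trans (pow_lower (e := e) (g1 n) (leqnn _)).
  by rewrite ler_pXn2r ?nnegrE ?N2_ge0 ?expn_gt0 // ltW.
have [s hs] := dep_choice hex.
apply: (@pow_unull k g g1 gk hN (fun n => s n) e c1) => //; first by rewrite ltnW // ltn_expl.
by apply: evS hc => n; exact: hs.
Qed.
End Torsion.

(** * Elementary estimates *)

Section Tools.
Variable R : realType.
Local Notation C := R[i].
Lemma ge_half_of_close (eta a b : R) : 0 < eta -> eta <= a -> a - b <= eta / 4 -> eta / 2 <= b.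
Proof. lra. Qed.
Lemma radius_lower (eta d2 r a2 a c b : R) : d2 <= eta / 8 -> eta / 2 <= r -> - (eta / 4) <= a2 - r -> a2 <= a -> c <= d2 ->
  a <= c + b -> eta / 8 <= b.
Proof. lra. Qed.
Lemma two_units_le (a b d : R) : a <= 1 -> b <= 1 -> 0 < d -> a + b <= d + 2.
Proof. lra. Qed.
Lemma quarter_add_lt (a b : R) : a <= b / 4 -> 0 < b -> b / 4 + a < b.
Proof. lra. Qed.
Lemma half_add_le (e a : R) : a <= e / 2 -> e / 2 + a <= e.
Proof. lra. Qed.
Lemma constant_360 (a : R) : a <= 1 -> 360 * (a / 1600) <= 1.
Proof. lra. Qed.
Lemma correlation_budget (a1 a2 a3 a4 : R) : a1 <= a2 / 1600 -> a4 <= a1 -> a3 <= a2 / 4 -> 0 <= a2 ->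
  a2 / 8 <= a2 - a3 - 3 * a4 - 2 * (200 * a1).
Proof. lra. Qed.
Lemma one_le_four_mul (a : R) : 1 <= a -> 1 <= 4 * a.
Proof. lra. Qed.
Lemma quarter_parts_lt (e a b : R) : 0 < e -> a < e / 4 -> b <= e / 4 -> 2 * a + 2 * b < e.
Proof. lra. Qed.
Lemma markov (T : finType) (f : T -> R) (c : R) : 0 < c -> (forall t, 0 <= f t) ->
  avg (fun t => (c < f t)%R%:R : R) <= avg f / c.
Proof.
move=> c0 f0; rewrite ler_pdivlMr // mulrC -avgZ; apply: ler_avg => t.
by case: ltP => [/ltW|_]; rewrite ?mulr1 ?mulr0.
Qed.
Lemma ex_le (I : finType) (P : pred I) : [exists i, P i]%:R <= \sum_i (P i)%:R :> R.
Proof.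
case: existsP => [[i hi]|_]; last by apply: sumr_ge0.
by rewrite (bigD1 i) //= hi lerDl sumr_ge0.
Qed.
Lemma large_part (T : finType) (f : T -> C) (c : R) : (0 < #|T|)%N -> 0 <= c -> le1 f -> c <= N2 f ->
  c / 2 <= avg (fun t => (c / 2 <= ab (f t) ^+ 2)%R%:R : R).
Proof.
move=> T0 c0 f1 h; suff : N2 f <= c / 2 + avg (fun t => (c / 2 <= ab (f t) ^+ 2)%R%:R : R) by lra.
rewrite -[X in X + _](avg_const (c / 2) T0) -avgD; apply: ler_avg => t.
have := exprn_ile1 2 (ab_ge0 (f t)) (f1 t).
by case: (leP (c / 2)) => [h1|/ltW h1] h2; rewrite /= ?mulr0n ?addr0 // (le_trans h2) // lerDr divr_ge0.
Qed.
(** For independent random shifts, each point is missed with probability at most [(1 - c)^J]. *)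
Lemma cover (Zn : finZmodType) (Q : pred Zn) (c : R) J : c <= avg (fun x => (Q x)%:R : R) ->
  exists s : {ffun 'I_J -> Zn}, avg (fun x => [forall j, ~~ Q (x + s j)]%:R) <= (1 - c) ^+ J :> R.
Proof.
move=> h; have [s hs] := exists_le_avg (fun s : {ffun 'I_J -> Zn} => avg (fun x => [forall j, ~~ Q (x + s j)]%:R : R)) (zmod_gt0 {ffun 'I_J -> Zn}).
exists s; apply: le_trans hs _; rewrite avg_exch.
have e x : avg (fun s : {ffun 'I_J -> Zn} => [forall j, ~~ Q (x + s j)]%:R : R) = (1 - avg (fun x => (Q x)%:R)) ^+ J.
  rewrite (eq_avg (g := fun s : {ffun 'I_J -> Zn} => \prod_j (~~ Q (x + s j))%:R : R)); last first.
    move=> s'; case: forallP => [h'|/forallP]; first by rewrite big1 // => j _; rewrite h'.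
    by rewrite negb_forall => /existsP[j /negbTE hj]; rewrite (bigD1 j) //= hj mul0r.
  rewrite (avg_ffun (fun (_ : 'I_J) z => (~~ Q (x + z))%:R : R)) prodr_const card_ord; congr (_ ^+ _).
  rewrite (avg_addl (fun y => (~~ Q y)%:R : R)) -[X in _ = X - _](avg_const (K := R) (T := Zn) 1 (zmod_gt0 Zn)) -avgB.
  by apply: eq_avg => y; case: (Q y); rewrite ?subrr ?subr0.
rewrite (eq_avg e) avg_const ?zmod_gt0 //.
have a1 : avg (fun x => (Q x)%:R : R) <= 1 by apply: avg_le => // x; case: (Q x).
apply: lerXn2r; rewrite ?nnegrE ?subr_ge0 // ?lerD2l ?lerN2 //; exact: le_trans h a1.
Qed.
Lemma avg_vertex (Zn : finZmodType) N (v : N.-tuple bool) (f : Zn -> R) :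
  avg (fun xh : Zn * N.-tuple Zn => f (xh.1 + dot v xh.2)) = avg f.
Proof.
rewrite (avg_pairE (fun x (h : N.-tuple Zn) => f (x + dot v h))) avg_exch.
rewrite (eq_avg (g := fun _ => avg f)) ?avg_const ?tuple_gt0 // => h; exact: avg_addr.
Qed.
Variable m' : nat.
Local Notation m := m'.+1.
Local Notation A := 'I_m.
Local Notation E := (@E R m').
(** [y^m - ga^m] is the product of the [y - ga * E a]; the smallest of the [m] factors is taken. *)
Lemma root_near (y ga : C) : exists a : A, ab (y - ga * E a) ^+ m <= ab (y ^+ m - ga ^+ m).
Proof.
have [->|g0] := eqVneq ga 0; first by exists 0; rewrite mul0r expr0n !subr0 abX.
have e : y ^+ m - ga ^+ m = \prod_(a : A) (y - ga * E a).
  have := congr1 (fun p => p.[y / ga]) (factor_Xn_sub_1 (om_prim R m')).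
  rewrite horner_prod big_mkord hornerD hornerXn hornerN -polyC1 hornerC => h.
  have -> : y ^+ m - ga ^+ m = ga ^+ m * ((y / ga) ^+ m - 1) by rewrite mulrBr mulr1 -exprMn [ga * _]mulrC mulfVK.
  rewrite -h -[X in ga ^+ X](card_ord m) -prodr_const -big_split; apply: eq_bigr => a _ /=.
  by rewrite hornerXsubC mulrBr [ga * (y / ga)]mulrC mulfVK.
pose f (a : A) := ab (y - ga * E a).
have [a ha] : exists a, forall b, f a <= f b.
  by case: (arg_minP (i0 := 0 : A) (P := predT) f isT) => a _ h; exists a => b; exact: h.
exists a; rewrite e ab_prod -[X in _ ^+ X](card_ord m) -prodr_const; apply: ler_prod => b _.
by rewrite ab_ge0; exact: ha.
Qed.
End Tools.

(** * From structured derivatives to exact phases *)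

Section Patch.
Variable R : realType.
Context (W : set_system nat) {UW : UltraFilter W}.
Variable Z : nat -> finZmodType.
Local Notation C := R[i].
Local Notation ev := (ev W).
Local Notation Zf := (Zf Z).
Local Notation Bf := (@Bf R Z).
Local Notation BK := (@BK R Z).
Local Notation ZP := (ZP Z).
Variable m' : nat.
Local Notation m := m'.+1.
Local Notation A := 'I_m.
Local Notation E := (@E R m').
Hypothesis tors : forall n (x : Z n), x *+ m = 0.
Local Notation joins := (@joins R W Z m').
Local Notation regular := (@regular R W Z m').
Local Notation dets := (@dets R W Z m').
Local Notation apx := (@apx R W Z m').
Local Notation eqs X n x x' := (@eqs Z m' X n x x').

(** By [regular], each factor of a cube product is approximately a function of lower phases; hence
    the product is approximately a function of the types of the vertices. *)
Lemma Q_apx k N (f : fam R (ZP (fun n => N.-tuple (Z n) : finType))) e : joins k -> regular k ->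
  Cl W (@QB R Z k.+1 (fun n => N.-tuple (Z n) : finType) (fun n h => h)) f -> 0 < e ->
  exists (T : nat -> Type) (p : forall n, Z n -> T n) (F : forall n, Z n -> seq (Z n) -> C),
  [/\ dets k p,
      forall n x hs x' hs', (forall s, size s = N -> p n (x + dot s hs) = p n (x' + dot s hs')) -> F n x hs = F n x' hs' &
      ev (fun n => avg (fun xh => ab (f n xh - F n xh.1 xh.2)) < e)].
Proof.
pose QBn := @QB R Z k.+1 (fun n => N.-tuple (Z n) : finType) (fun n h => h).
move=> J Rg hf e0; have e20 : 0 < (e / 4) ^+ 2 by rewrite exprn_gt0 // divr_gt0.
have [I hI] := hf _ e20.
pose good n (cb : I -> C * (seq bool -> Z n -> C)) := forall i, ab (cb i).1 <= 1 /\ forall s, B k.+1 ((cb i).2 s).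
pose val n (cb : I -> C * (seq bool -> Z n -> C)) (xh : Z n * N.-tuple (Z n)) := \sum_i (cb i).1 * cprod (cb i).2 xh.2 xh.1.
have hex n : exists cb : I -> C * (seq bool -> Z n -> C), good n cb /\
   ((exists b : I -> ZP (fun n => N.-tuple (Z n) : finType) n -> C, (forall j, QBn n (b j)) /\
     N2 (fun t => f n t - \sum_j b j t) < (e / 4) ^+ 2) -> N2 (fun t => f n t - val n cb t) < (e / 4) ^+ 2).
  have [[b [hb hN]]|hn] := pselect (exists b : I -> ZP (fun n => N.-tuple (Z n) : finType) n -> C, (forall j, QBn n (b j)) /\
     N2 (fun t => f n t - \sum_j b j t) < (e / 4) ^+ 2); last first.
    by exists (fun _ => (0, fun _ _ => 0)); split => // i; rewrite ab0; split => // s; apply: B_const; rewrite ab0.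
  have hc i : exists cb : C * (seq bool -> Z n -> C), (ab cb.1 <= 1 /\ forall s, B k.+1 (cb.2 s)) /\
     b i = fun xh => cb.1 * cprod cb.2 xh.2 xh.1 by have [c [bv [h1 h2 h3]]] := hb i; exists (c, bv).
  have [cb hcb] := choice hc; exists cb; split; first by move=> i; case: (hcb i).
  move=> _; rewrite (eq_N2 (g := fun t => f n t - \sum_j b j t)) // => t; congr (_ - _).
  by apply: eq_bigr => i _; case: (hcb i) => _ ->.
have [cb hcb] := dep_choice hex.
have hev : ev (fun n => N2 (fun t => f n t - val n (cb n) t) < (e / 4) ^+ 2) by apply: evS hI => n; exact: (hcb n).2.
pose IS := (I * N.-tuple bool)%type; pose th := e / 4 / (#|{: IS}|%:R + 1).
have d0 : 0 < #|{: IS}|%:R + 1 :> R by rewrite ltr_wpDl ?ler0n.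
have th0 : 0 < th by rewrite !divr_gt0.
have hF0 (i : IS) : exists F : fam R Zf, [/\ fle1 F, dets k F & ev (fun n => N2 (fun x => (cb n i.1).2 i.2 x - F n x) < th ^+ 2)].
  apply: apx1; last by rewrite exprn_gt0.
    by move=> n; exact: (B_le1 (((hcb n).1 i.1).2 i.2)).
  by apply: Rg => n; exact: (((hcb n).1 i.1).2 i.2).
have [F hF] := choice hF0.
have F1 i : fle1 (F i) by case: (hF i).
exists _, (fun n x => fun i => F i n x), (fun n x hs => \sum_i (cb n i).1 * \prod_(s : N.-tuple bool) F (i, s) n (x + dot s hs)); split.
- by apply: joins_fin => // i; case: (hF i).
- move=> n x hs x' hs' h; apply: eq_bigr => i _; congr (_ * _); apply: eq_bigr => s _.
  by have := congr1 (fun q => q (i, s)) (h s (size_tuple s)).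
have hF2 : ev (fun n => forall i : IS, N2 (fun x => (cb n i.1).2 i.2 x - F i n x) < th ^+ 2).
  by apply: ev_fin => i; case: (hF i).
apply: ev2 hev hF2 => n h1 h2.
have b1 : avg (fun xh => ab (f n xh - val n (cb n) xh)) <= e / 4 by apply: ab_le_N2; [rewrite divr_ge0 // ltW|exact: ltW].
have b2 : avg (fun xh : Z n * N.-tuple (Z n) => ab (val n (cb n) xh - \sum_i (cb n i).1 * \prod_(s : N.-tuple bool) F (i, s) n (xh.1 + dot s xh.2))) <= e / 4.
  apply: le_trans (_ : avg (fun xh : Z n * N.-tuple (Z n) => \sum_(i : IS) ab ((cb n i.1).2 i.2 (xh.1 + dot i.2 xh.2) - F i n (xh.1 + dot i.2 xh.2))) <= _).
    apply: ler_avg => xh; rewrite /val -sumrB; apply: le_trans (ab_sum _ _ _) _.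
    have -> : \sum_(i : IS) ab ((cb n i.1).2 i.2 (xh.1 + dot i.2 xh.2) - F i n (xh.1 + dot i.2 xh.2)) =
      \sum_(i : IS) (fun a s => ab ((cb n a).2 (tval s) (xh.1 + dot s xh.2) - F (a, s) n (xh.1 + dot s xh.2))) i.1 i.2 by apply: eq_bigr => -[].
    rewrite -(pair_bigA _ (fun a (s : N.-tuple bool) => ab ((cb n a).2 s (xh.1 + dot s xh.2) - F (a, s) n (xh.1 + dot s xh.2)))) /=.
    apply: ler_sum => a _; rewrite -mulrBr abM; have [ha hb] := (hcb n).1 a.
    apply: le_trans (_ : ab (cprod (cb n a).2 xh.2 xh.1 - \prod_(s : N.-tuple bool) F (a, s) n (xh.1 + dot s xh.2)) <= _).
      by rewrite ler_piMl ?ab_ge0.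
    rewrite (cprodEt _ _ (size_tuple xh.2)); apply: prod_diff => s; [exact: (B_le1 (hb s))|exact: F1].
  rewrite avg_sum; apply: le_trans (_ : \sum_(i : IS) th <= _).
    apply: ler_sum => i _; rewrite (avg_vertex i.2 (fun y => ab ((cb n i.1).2 i.2 y - F i n y))).
    by apply: ab_le_N2; [exact: ltW|exact/ltW/h2].
  have -> : \sum_(i : IS) th = #|{: IS}|%:R * th by rewrite sumr_const mulr_natl.
  have -> : #|{: IS}|%:R * th = e / 4 * (#|{: IS}|%:R / (#|{: IS}|%:R + 1)) by rewrite /th mulrCA.
  by rewrite ler_piMr ?divr_ge0 ?(ltW e0) // ler_pdivrMr // mul1r lerDl.
apply: le_lt_trans (_ : e / 4 + e / 4 < e); last by lra.
apply: le_trans (lerD b1 b2); rewrite -avgD; apply: ler_avg => xh; exact: ab_tri.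
Qed.

(** Index 0 stands for no shift. *)
Definition tr n Jn (s : {ffun 'I_Jn -> Z n}) (j : 'I_Jn.+1) : Z n := if unlift ord0 j is Some i then s i else 0.
Section Main.
Variables (k : nat) (g : fam R Zf).
Hypotheses (Jk : joins k) (Rk : regular k) (hg : Char W k.+1 g).
Arguments g : clear implicits.
Let N := k.+2.
Local Notation NN := (2 ^+ N : R).
Local Notation V := (N.-tuple bool).
Let g1 : fle1 g := hg.1.
Let gk : Cl W (BK k.+1) (hat g) := hg.2.
Let NN1 : 1 <= NN. Proof. by rewrite exprn_ege1 // ler1n. Qed.

Let cV : #|{: V}| = (2 ^ N)%N. Proof. by rewrite card_tuple card_bool. Qed.
Section Point.
Variables (eta d2 d3 cr : R) (Jn : nat) (rd : C -> A) (n : nat).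
Variables (s : {ffun 'I_Jn -> Z n}) (Nf Gf : 'I_Jn.+1 -> Z n -> C) (QF : {ffun V -> 'I_Jn.+1} -> Z n -> seq (Z n) -> C).
Hypotheses (eta0 : 0 < eta) (d20 : 0 < d2) (d2e : d2 <= eta / 8) (G1 : forall j, le1 (Gf j)).
Hypothesis hrd : forall a z, ab (E a - z) < cr -> rd z = a.
Hypothesis hcr : d3 + NN * d2 < cr * (eta / 8) ^+ (2 ^ N).
Local Notation t := (tr s).
Definition J0 x := eta / 2 <= Re (Nf ord0 x).
(** The unshifted point is preferred: where [J0] holds, [g] itself is compared with the phase, which
    [corr_low] uses. *)
Definition jx x : 'I_Jn.+1 := if J0 x then ord0 else odflt ord0 [pick j | eta / 2 <= Re (Nf j x)].
(** Any choice of [m]-th root would do that depends on the type of [x] only; the remaining ambiguity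
    is the residue [uu x]. *)
Definition gam x : C := m.-root (Gf (jx x) x).
Definition uu x : A := projT1 (cid (root_near m' (g n (x + t (jx x))) (gam x))).
Definition Qs (si : {ffun V -> 'I_Jn.+1}) x hs : C := cprod (fun v y => cj v (g n (y + t (si (insubd (nseq_tuple N false) v))))) hs x.
Definition sig x hs : {ffun V -> 'I_Jn.+1} := [ffun v : V => jx (x + dot v hs)].
Definition r0 x hs : A := rd (QF (sig x hs) x hs / cprod (fun v y => cj v (gam y)) hs x).
Definition badpt x := [exists j, (eta / 4 < ab ((ab (g n (x + t j)) ^+ 2)%:C - Nf j x)) || (d2 ^+ m < ab (g n (x + t j) ^+ m - Gf j x))].
Definition none x := [forall j, ~~ (eta <= ab (g n (x + s j)) ^+ 2)].
Lemma gam1 x : ab (gam x) <= 1.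
Proof. by rewrite -(ler_pXn2r (n := m)) ?nnegrE ?ab_ge0 // expr1n -abX /gam rootCK // G1. Qed.
Lemma near_u x : ~~ badpt x -> ab (g n (x + t (jx x)) - gam x * E (uu x)) <= d2.
Proof.
rewrite /badpt negb_exists => /forallP /(_ (jx x)); rewrite negb_or -!leNgt => /andP[_ h].
rewrite -(ler_pXn2r (n := m)) ?nnegrE ?ab_ge0 ?(ltW d20) //; apply: le_trans (projT2 (cid (root_near _ _ _))) _.
by rewrite [gam x ^+ _]rootCK.
Qed.
Lemma near_N x j : ~~ badpt x -> `|ab (g n (x + t j)) ^+ 2 - Re (Nf j x)| <= eta / 4.
Proof.
rewrite /badpt negb_exists => /forallP /(_ j); rewrite negb_or -!leNgt => /andP[h _]; apply: le_trans h.
by apply: le_trans (Re_le_ab _); rewrite ReB.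
Qed.
Lemma gam_low x : ~~ badpt x -> ~~ none x -> eta / 8 <= ab (gam x).
Proof.
move=> hb hn; have [i hi] : exists i, eta <= ab (g n (x + s i)) ^+ 2.
  apply: contrapT => hno; move/negP: hn; apply; apply/forallP => i; apply/negP => hi; apply: hno; by exists i.
have hj : eta / 2 <= Re (Nf (jx x) x).
  rewrite /jx; case: ifP => // _; case: pickP => // /(_ (lift ord0 i)).
  have := near_N (lift ord0 i) hb; rewrite /tr liftK => h; suff -> : eta / 2 <= Re (Nf (lift ord0 i) x) by [].
  by move: h; rewrite ler_norml => /andP[_]; exact: ge_half_of_close.
have h2 := near_N (jx x) hb; have h3 := near_u hb.
have h4 : ab (g n (x + t (jx x))) ^+ 2 <= ab (g n (x + t (jx x))).
  by rewrite expr2 ler_piMr ?ab_ge0 ?g1.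
have h5 := ab_tri (g n (x + t (jx x))) 0 (gam x * E (uu x)).
rewrite !subr0 abM ab_E mulr1 in h5; move: h2; rewrite ler_norml => /andP[h2 h2'].
exact: radius_lower d2e hj h2 h4 h3 h5.
Qed.
(** At good vertices [g] is close to [gam * E uu], so the cube product of [g] is close to that of
    [gam] times [E (du uu h x)]. It is also close to [QF], and the product of the [gam] is bounded
    below, so rounding the quotient recovers the derivative. *)
Lemma cube_ok x (h : N.-tuple (Z n)) :
  (forall v : V, ~~ badpt (x + dot v h) && ~~ none (x + dot v h)) ->
  ab (Qs (sig x h) x h - QF (sig x h) x h) <= d3 -> du uu h x = r0 x h.
Proof.
move=> hv hq; apply/esym; apply: hrd.
set Ga := cprod _ _ _.
have Gl : (eta / 8) ^+ (2 ^ N) <= ab Ga.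
  rewrite /Ga (cprodEt _ _ (size_tuple h)) ab_prod.
  have -> : (eta / 8) ^+ (2 ^ N) = \prod_(v : V) (eta / 8) by rewrite prodr_const card_tuple card_bool.
  apply: ler_prod => v _; rewrite divr_ge0 ?(ltW eta0) //= ab_cj.
  by have /andP[a b] := hv v; exact: gam_low.
have G0 : 0 < ab Ga by apply: lt_le_trans Gl; rewrite exprn_gt0 // divr_gt0.
have cr0 : 0 < cr.
  have : 0 < cr * (eta / 8) ^+ (2 ^ N).
    have d3p : 0 <= d3 := le_trans (ab_ge0 _) hq.
    have NN0 : 0 <= NN := le_trans ler01 NN1.
    by apply: le_lt_trans hcr; rewrite addr_ge0 // mulr_ge0 // ltW.
  by rewrite pmulr_lgt0 // exprn_gt0 // divr_gt0.
have e1 : ab (Qs (sig x h) x h - Ga * E (du uu h x)) <= NN * d2.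
  rewrite -E_du /Ga -cprodM /Qs !(cprodEt _ _ (size_tuple h)).
  apply: le_trans (prod_diff _ _ _) _.
  - by move=> v; rewrite ab_cj g1.
  - by move=> v; rewrite abM !ab_cj ab_E mulr1 gam1.
  apply: le_trans (_ : \sum_(v : V) d2 <= _); last by rewrite sumr_const cV -natrX mulr_natl.
  apply: ler_sum => v _; rewrite valKd ffunE -cjM; have /andP[a _] := hv v.
  apply: le_trans (near_u a).
  by rewrite /cj; case: (odd _) => //; rewrite -rmorphB ab_conj.
have -> : E (du uu h x) - QF (sig x h) x h / Ga = (Ga * E (du uu h x) - QF (sig x h) x h) / Ga.
  by rewrite mulrBl mulrAC mulfV ?mul1r // -ab_eq0 gt_eqF.
rewrite abM abV ltr_pdivrMr //; apply: le_lt_trans (ab_tri _ _ (Qs (sig x h) x h)) _.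
rewrite ab_sym addrC; apply: le_lt_trans (lerD hq e1) _; apply: lt_le_trans hcr _.
by rewrite ler_wpM2l // ltW.
Qed.
Lemma cube_prob (pb e3 : R) :
  avg (fun x => (badpt x)%:R : R) <= pb -> avg (fun x => (none x)%:R : R) <= pb -> 0 < d3 ->
  (forall si, avg (fun xh : Z n * N.-tuple (Z n) => ab (Qs si xh.1 xh.2 - QF si xh.1 xh.2)) <= e3) ->
  avg (fun x => Eh N (fun h => (du uu h x != r0 x h)%:R : R)) <= NN * (pb + pb) + #|{: {ffun V -> 'I_Jn.+1}}|%:R * (e3 / d3) :> R.
Proof.
move=> hb hn d30 hq.
rewrite -(avg_pairE (fun x (h : N.-tuple (Z n)) => (du uu h x != r0 x h)%:R : R)).
apply: le_trans (_ : avg (fun xh : Z n * N.-tuple (Z n) => \sum_(v : V) ((badpt (xh.1 + dot v xh.2))%:R + (none (xh.1 + dot v xh.2))%:R) +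
   \sum_(si : {ffun V -> 'I_Jn.+1}) (d3 < ab (Qs si xh.1 xh.2 - QF si xh.1 xh.2))%R%:R) <= _).
  apply: ler_avg => -[x h] /=.
  have sv0 (v : V) : 0 <= (badpt (x + dot v h))%:R + (none (x + dot v h))%:R :> R by rewrite addr_ge0 ?ler0n.
  have s1 : 0 <= \sum_(v : V) ((badpt (x + dot v h))%:R + (none (x + dot v h))%:R) :> R by apply: sumr_ge0 => v _.
  have s2 : 0 <= \sum_(si : {ffun V -> 'I_Jn.+1}) (d3 < ab (Qs si x h - QF si x h))%R%:R :> R by apply: sumr_ge0 => v _; exact: ler0n.
  case: eqP => [_|ne] /=; first by rewrite addr_ge0.
  have [/existsP[v hv]|/existsPn hv] := boolP [exists v : V, badpt (x + dot v h) || none (x + dot v h)].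
    rewrite -[X in X <= _]addr0 lerD // (bigD1 v) //= -[X in X <= _]addr0 lerD //; last by apply: sumr_ge0.
    by case/orP: hv => ->; rewrite ?lerDl ?lerDr ler0n.
  rewrite -[X in X <= _]add0r lerD // (bigD1 (sig x h)) //= -[X in X <= _]addr0 lerD //; last by apply: sumr_ge0 => si _; exact: ler0n.
  case: ltP => // hle; case: ne; apply: cube_ok => // v.
  by have := hv v; rewrite negb_or.
rewrite avgD !avg_sum; apply: lerD.
  have -> : NN * (pb + pb) = \sum_(v : V) (pb + pb) by rewrite sumr_const cV -natrX mulr_natl.
  apply: ler_sum => v _; rewrite avgD (avg_vertex v (fun y => (badpt y)%:R : R)) (avg_vertex v (fun y => (none y)%:R : R)).
  exact: lerD.
have -> : #|{: {ffun V -> 'I_Jn.+1}}|%:R * (e3 / d3) = \sum_(si : {ffun V -> 'I_Jn.+1}) (e3 / d3) by rewrite sumr_const mulr_natl.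
apply: ler_sum => si _; apply: le_trans (markov d30 _) _; first by move=> xh; exact: ab_ge0.
by rewrite ler_wpM2r ?invr_ge0 ?(ltW d30).
Qed.
Lemma bad_prob (th : R) : 0 < th -> (forall j, avg (fun x => ab ((ab (g n (x + t j)) ^+ 2)%:C - Nf j x)) <= th) ->
  (forall j, avg (fun x => ab (g n (x + t j) ^+ m - Gf j x)) <= th) ->
  avg (fun x => (badpt x)%:R : R) <= Jn.+1%:R * (th / (eta / 4) + th / d2 ^+ m) :> R.
Proof.
move=> th0 hN hG.
have e4 : 0 < eta / 4 by rewrite divr_gt0.
have d2m : 0 < d2 ^+ m by rewrite exprn_gt0.
apply: le_trans (_ : \sum_(j < Jn.+1) (avg (fun x => (eta / 4 < ab ((ab (g n (x + t j)) ^+ 2)%:C - Nf j x))%R%:R : R) +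
   avg (fun x => (d2 ^+ m < ab (g n (x + t j) ^+ m - Gf j x))%R%:R : R)) <= _).
  under eq_bigr => j _ do rewrite -avgD.
  rewrite -avg_sum; apply: ler_avg => x; apply: le_trans (ex_le _ _) _; apply: ler_sum => j _.
  by case: (_ < _); case: (_ < _); rewrite ?addr0 ?add0r ?lerDl.
apply: le_trans (_ : \sum_(j < Jn.+1) (th / (eta / 4) + th / d2 ^+ m) <= _); last by rewrite sumr_const card_ord mulr_natl.
apply: ler_sum => j _; apply: lerD; (apply: le_trans (markov _ _) _ => //; first by [move=> x; exact: ab_ge0]).
  by rewrite ler_wpM2r ?invr_ge0 ?(ltW e4).
by rewrite ler_wpM2r ?invr_ge0 ?(ltW d2m).
Qed.
(** On [J0] the function [g] is close to [gam * E uu], and [uu = u' + w] outside a small set, so the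
    average is close to the mean of [|g|^2] over [J0]. *)
Lemma corr_low (pb p2 : R) (u' w : Z n -> A) : avg (fun x => (badpt x)%:R : R) <= pb -> eta <= avg (fun x => (eta <= ab (g n x) ^+ 2)%R%:R : R) ->
  eta <= 1 -> avg (fun x => (u' x != uu x - w x)%:R : R) <= p2 ->
  eta ^+ 2 - d2 - 3 * pb - 2 * p2 <= ab (avg (fun x => (g n x * Num.conj (E (u' x))) * (Num.conj (gam x * E (w x)) * (J0 x)%:R))).
Proof.
move=> hb he eta1 hp.
pose T x : C := g n x * Num.conj (gam x * E (uu x)) * (J0 x)%:R.
pose h x : C := (ab (g n x) ^+ 2 * (J0 x)%:R)%:C.
have nJ x : ab ((J0 x)%:R : C) <= 1 by rewrite ab_nat; case: (J0 x).
have a1 : ab (avg T - avg (fun x => (g n x * Num.conj (E (u' x))) * (Num.conj (gam x * E (w x)) * (J0 x)%:R))) <= 2 * p2.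
  rewrite -avgB; apply: le_trans (ab_avg _) _; apply: le_trans (ler_wpM2l (ler0n _ 2) hp); rewrite -avgZ; apply: ler_avg => x.
  case: eqP => [->|_] /=.
    have -> : T x - g n x * Num.conj (E (uu x - w x)) * (Num.conj (gam x * E (w x)) * (J0 x)%:R) = 0; last by rewrite ab0 mulr0.
    rewrite EB /T !rmorphM /= conjCK.
    rewrite [X in _ - X](_ : _ = g n x * (Num.conj (gam x) * Num.conj (E (uu x))) * (J0 x)%:R * (E (w x) * Num.conj (E (w x)))); last by ring.
    by rewrite EJ mulr1 subrr.
  rewrite mulr1; apply: le_trans (abB _ _) _; rewrite -[2]/(1 + 1); apply: lerD.
    by rewrite !abM ab_conj abM ab_E mulr1 !mulr_ile1 ?mulr_ge0 ?ab_ge0 ?g1 ?gam1.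
  by rewrite !abM !ab_conj abM !ab_E !mulr1 !mulr_ile1 ?mulr_ge0 ?ab_ge0 ?g1 ?gam1.
have a2 : ab (avg h - avg T) <= d2 + 2 * pb.
  rewrite -avgB; apply: le_trans (ab_avg _) _.
  apply: le_trans (_ : avg (fun x => d2 + 2 * (badpt x)%:R) <= _).
    apply: ler_avg => x; rewrite /h /T rmorphM /= -mulcJ.
    have -> : ((J0 x)%:R : R)%:C = (J0 x)%:R :> C by case: (J0 x).
    rewrite -mulrBl -mulrBr -rmorphB abM abM ab_conj.
    case hJ : (J0 x); last by rewrite ab0 mulr0 addr_ge0 ?(ltW d20) ?mulr_ge0.
    rewrite ab1 mulr1; apply: le_trans (_ : ab (g n x - gam x * E (uu x)) <= _); first by rewrite ler_piMl ?ab_ge0 ?g1.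
    have [hbx|hbx] := boolP (badpt x).
      rewrite mulr1; apply: le_trans (abB _ _) _; rewrite abM ab_E mulr1.
      exact: (two_units_le (hg.1 n x) (gam1 x) d20).
    rewrite mulr0 addr0; have := near_u hbx; have -> : jx x = ord0 by rewrite /jx hJ.
    by rewrite /tr unlift_none addr0.
  rewrite avgD avg_const ?zmod_gt0 // avgZ lerD2l; lra.
have a3 : eta ^+ 2 - pb <= ab (avg h).
  rewrite -avgC abR; apply: le_trans (ler_norm _); apply: le_trans (_ : avg (fun x => eta * ((eta <= ab (g n x) ^+ 2)%R%:R - (badpt x)%:R : R)) <= _).
    rewrite avgZ avgB expr2; set p := avg _ in he *; set q := avg _ in hb *.
    have q0 : 0 <= q by apply: avg_ge0 => x; exact: ler0n.
    have : eta * q <= q by rewrite ler_piMl.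
    have : eta * eta <= eta * p by rewrite ler_wpM2l // ltW.
    rewrite mulrBr; lra.
  apply: ler_avg => x.
  have h0 : 0 <= ab (g n x) ^+ 2 * (J0 x)%:R by rewrite mulr_ge0 ?exprn_ge0 ?ab_ge0.
  case: (leP eta (ab (g n x) ^+ 2)) => hl; last first.
    by apply: le_trans h0; rewrite sub0r mulrN oppr_le0 mulr_ge0 ?(ltW eta0).
  have [hbx|hbx] := boolP (badpt x); first by rewrite subrr mulr0.
  have := near_N ord0 hbx; rewrite /tr unlift_none addr0 ler_norml => /andP[_ hN].
  have -> : J0 x by exact: ge_half_of_close eta0 hl hN.
  by rewrite subr0 !mulr1.
have t1 := ab_tri (avg h) 0 (avg T); have t2 := ab_tri (avg T) 0 (avg (fun x => (g n x * Num.conj (E (u' x))) * (Num.conj (gam x * E (w x)) * (J0 x)%:R))).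
rewrite !subr0 in t1 t2; lra.
Qed.
Definition rel0 x x' := forall j, Nf j x = Nf j x' /\ Gf j x = Gf j x'.
Lemma jx_typed x x' : rel0 x x' -> [/\ J0 x = J0 x', jx x = jx x' & gam x = gam x'].
Proof.
move=> h; have eN j : Nf j x = Nf j x' := (h j).1.
have eJ : J0 x = J0 x' by rewrite /J0 eN.
have ej : jx x = jx x' by rewrite /jx eJ; case: ifP => // _; congr odflt; apply: eq_pick => j; rewrite eN.
by split => //; rewrite /gam ej (h _).2.
Qed.
Lemma r0_typed x hs x' hs' : size hs = N -> size hs' = N ->
  (forall v, size v = N -> rel0 (x + dot v hs) (x' + dot v hs')) -> (forall si, QF si x hs = QF si x' hs') ->
  r0 x hs = r0 x' hs'.
Proof.
move=> sh sh' h hq; rewrite /r0 !(cprodEt (N := N)) //.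
have -> : sig x hs = sig x' hs' by apply/ffunP => v; rewrite !ffunE; case: (jx_typed (h v (size_tuple v))).
rewrite hq; congr (rd (_ / _)); apply: eq_bigr => v _; by case: (jx_typed (h v (size_tuple v))) => _ _ ->.
Qed.
End Point.

Definition conds (eta d2 d3 th pb e3 : R) Jn n (s : {ffun 'I_Jn -> Z n}) Nf Gf QF :=
  [/\ forall j, avg (fun x => ab ((ab (g n (x + tr s j)) ^+ 2)%:C - Nf j x)) <= th,
      forall j, avg (fun x => ab (g n (x + tr s j) ^+ m - Gf j x)) <= th,
      avg (fun x => (none eta s x)%:R : R) <= pb,
      forall si, avg (fun xh : Z n * N.-tuple (Z n) => ab (Qs s si xh.1 xh.2 - QF si xh.1 xh.2)) <= e3 &
      eta <= avg (fun x => (eta <= ab (g n x) ^+ 2)%R%:R : R)].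
(** The data for one [n], in a form suited to a choice over all [n]: typing holds always, while the
    estimates are asserted under [conds], which holds for almost all [n]. *)
Lemma point_ex (eta d2 d3 cr th pb e3 : R) Jn (rd : C -> A) n (s : {ffun 'I_Jn -> Z n})
    (Nf Gf : 'I_Jn.+1 -> Z n -> C) (QF : {ffun V -> 'I_Jn.+1} -> Z n -> seq (Z n) -> C) :
  0 < eta -> eta <= 1 -> 0 < d2 -> 0 < d3 -> 0 < th -> d2 <= eta / 8 -> (forall j, le1 (Gf j)) ->
  (forall a z, ab (E a - z) < cr -> rd z = a) -> d3 + NN * d2 < cr * (eta / 8) ^+ (2 ^ N) ->
  Jn.+1%:R * (th / (eta / 4) + th / d2 ^+ m) <= pb ->
  exists q : (Z n -> A) * (Z n -> seq (Z n) -> A) * ((Z n -> bool) * (Z n -> C)),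
  [/\ forall x, ab (q.2.2 x) <= 1,
      forall x x', rel0 Nf Gf x x' -> q.2.1 x = q.2.1 x' /\ q.2.2 x = q.2.2 x',
      forall x hs x' hs', size hs = N -> size hs' = N ->
        (forall v, size v = N -> rel0 Nf Gf (x + dot v hs) (x' + dot v hs')) -> (forall si, QF si x hs = QF si x' hs') ->
        q.1.2 x hs = q.1.2 x' hs' &
      conds eta d2 d3 th pb e3 s Nf Gf QF ->
       avg (fun x => Eh N (fun h => (du q.1.1 h x != q.1.2 x h)%:R : R)) <= NN * (pb + pb) + #|{: {ffun V -> 'I_Jn.+1}}|%:R * (e3 / d3) /\
       forall (p2 : R) (u' w : Z n -> A), avg (fun x => (u' x != q.1.1 x - w x)%:R : R) <= p2 ->
        eta ^+ 2 - d2 - 3 * pb - 2 * p2 <=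
          ab (avg (fun x => (g n x * Num.conj (E (u' x))) * (Num.conj (q.2.2 x * E (w x)) * (q.2.1 x)%:R)))].
Proof.
move=> eta0 eta1 d20 d30 th0 d2e G1 hrd hcr hpb.
exists (uu eta s Nf Gf, r0 eta rd Nf Gf QF, (J0 eta Nf, gam eta Nf Gf)); split => /=.
- by move=> x; exact: gam1.
- by move=> x x' /(jx_typed eta) [].
- by move=> x hs x' hs' h1 h2 h3 h4; exact: r0_typed.
move=> [hN hG hn hq he].
have hb : avg (fun x => (badpt eta d2 s Nf Gf x)%:R : R) <= pb by apply: le_trans hpb; exact: bad_prob.
split; first exact: (cube_prob (d2 := d2) (cr := cr)).
by move=> p2 u' w hp; exact: (corr_low eta0 d20 G1 hb he eta1 hp).
Qed.

(** [exactify] turns [uu] into an exact phase [u']. The quotient [psi] of [g] by [E u'] still has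
    structured derivatives and correlates with a function of lower phases; by [corr_struct] it is
    structured of degree [k + 1], hence approximated by induction. [assemble] adds [u'] to the lower
    phases. *)
Lemma patch : nnull W (fun n => N2 (g n)) -> apx k.+1 g.
Proof.
move=> hN.
have gm : Cl W (Bf k.+1)  (fun n x => g n x ^+ m) by exact: (torsion_Cl tors Jk Rk hg hN).
have sq : Cl W (Bf k.+1)  (fun n x => (ab (g n x) ^+ 2)%:C) by exact: (sq_Cl g1 gk hN).
have hU : nnull W  (fun n => u N (g n)) by exact: (U_nnull g1 gk hN).
have [c2 c20 hc2] := hN.
have c21 : c2 <= 1.
  have [n h] := ev_ex hc2; have hh : N2 (g n) <= 1 ^+ 2 by apply: N2_le => t; rewrite g1.
  by rewrite expr1n in hh; exact: le_trans h hh.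
pose eta := c2 / 2; have eta0 : 0 < eta by rewrite divr_gt0.
have eta1 : eta <= 1 by rewrite /eta; lra.
have [cr cr0 [rd hrd]] := round_ex R m'.
have NN0 : 0 < NN by apply: lt_le_trans NN1.
(* [360 / 1600 <= 1] suits [exactify]; its error, at most [200 * NN * eps], counts twice in the
   correlation, hence at most [eta^2 / 4]. *)
pose eps := eta ^+ 2 / (1600 * (NN * NN)).
have eps0 : 0 < eps.
  by apply: divr_gt0; [exact: exprn_gt0|apply: mulr_gt0; [lra|exact: mulr_gt0]].
pose pb := eps / (4 * NN); have pb0 : 0 < pb by rewrite divr_gt0 // mulr_gt0.
pose rho := (eta / 8) ^+ (2 ^ N); have rho0 : 0 < rho by rewrite exprn_gt0 // divr_gt0.
(* The three bounds serve, in this order, the lower bound on [gam], the correlation, and the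
   rounding. *)
pose d2 := Num.min (Num.min (eta / 8) (eta ^+ 2 / 4)) (cr * rho / (4 * NN)).
pose d3 := cr * rho / 4; have d30 : 0 < d3 by rewrite divr_gt0 // mulr_gt0.
have x1 : 0 < eta / 8 by rewrite divr_gt0.
have x2 : 0 < eta ^+ 2 / 4 by rewrite divr_gt0 // exprn_gt0.
have x3 : 0 < cr * rho / (4 * NN) by apply: divr_gt0; apply: mulr_gt0.
have d20 : 0 < d2 by rewrite !lt_min x1 x2 x3.
have d2a : d2 <= eta / 8 by rewrite /d2 !ge_min lexx.
have d2b : d2 <= eta ^+ 2 / 4 by rewrite /d2 !ge_min lexx orbT.
have d2c : d2 <= cr * rho / (4 * NN) by rewrite /d2 !ge_min lexx orbT.
have hcr : d3 + NN * d2 < cr * rho.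
  have h : NN * d2 <= cr * rho / 4.
    have -> : cr * rho / 4 = NN * (cr * rho / (4 * NN)) by field; rewrite gt_eqF.
    by rewrite ler_wpM2l ?(ltW NN0).
  have q0 : 0 < cr * rho by rewrite mulr_gt0.
  exact: quarter_add_lt h q0.
have [Jn hJn] : exists L, (1 - eta) ^+ L < pb.
  by apply: pow_small => //; rewrite subr_ge0 eta1 ltrBlDr ltrDl.
pose iv := (eta / 4)^-1 + (d2 ^+ m)^-1.
have iv0 : 0 < iv by rewrite addr_gt0 // invr_gt0 ?divr_gt0 ?exprn_gt0.
pose th := pb / (Jn.+1%:R * iv); have th0 : 0 < th by rewrite divr_gt0 // mulr_gt0 ?ltr0Sn.
have hth : Jn.+1%:R * (th / (eta / 4) + th / d2 ^+ m) <= pb.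
  rewrite -mulrDr -/iv mulrCA /th mulfVK ?lexx // mulf_neq0 ?pnatr_eq0 // gt_eqF //.
pose Sg := {ffun V -> 'I_Jn.+1}; pose cS : R := #|{: Sg}|%:R.
have cS0 : 0 < cS + 1 by rewrite ltr_wpDl ?ler0n.
pose e3 := eps * d3 / (2 * (cS + 1)); have e30 : 0 < e3 by apply: divr_gt0; apply: mulr_gt0.
have heps : NN * (pb + pb) + cS * (e3 / d3) <= eps.
  have -> : NN * (pb + pb) = eps / 2 by rewrite /pb; field; rewrite gt_eqF.
  have -> : cS * (e3 / d3) = eps / 2 * (cS / (cS + 1)) by rewrite /e3; field; rewrite !gt_eqF.
  have q1 : cS / (cS + 1) <= 1 by rewrite ler_pdivrMr // mul1r lerDl.
  have q2 : 0 <= eps / 2 by rewrite divr_ge0 // ltW.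
  by apply: half_add_le; rewrite ler_piMr.
have exs n : exists s : {ffun 'I_Jn -> Z n}, c2 <= N2 (g n) ->
   avg (fun x => (none eta s x)%:R : R) <= pb /\ eta <= avg (fun x => (eta <= ab (g n x) ^+ 2)%R%:R : R).
  have [h|h] := boolP (c2 <= N2 (g n)); last by exists [ffun => 0].
  have hl := large_part (zmod_gt0 (Z n)) (ltW c20) (hg.1 n) h.
  by have [s hs] := cover Jn hl; exists s => _; split => //; apply: le_trans hs (ltW hJn).
have [s hs] := dep_choice exs.
have e20 : 0 < th ^+ 2 by rewrite exprn_gt0.
have hN0 j : exists F : fam R Zf, [/\ fle1 F, dets k F & ev (fun n => N2 (fun x => (ab (g n (x + tr (s n) j)) ^+ 2)%:C - F n x) < th ^+ 2)].
  apply: apx1 => //; last exact: (Cl_apx Jk Rk (S_shift (fun n => tr (s n) j) sq)).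
  by move=> n x; rewrite abR ger0_norm ?exprn_ge0 ?ab_ge0 // exprn_ile1 ?ab_ge0 ?g1.
have hG0 j : exists F : fam R Zf, [/\ fle1 F, dets k F & ev (fun n => N2 (fun x => g n (x + tr (s n) j) ^+ m - F n x) < th ^+ 2)].
  apply: apx1 => //; last exact: (Cl_apx Jk Rk (S_shift (fun n => tr (s n) j) gm)).
  by move=> n x; rewrite abX exprn_ile1 ?ab_ge0 ?g1.
have [Nf hNf] := choice hN0; have [Gf hGf] := choice hG0.
have hQ0 (si : Sg) : exists q : {T : nat -> Type & forall n, Z n -> T n} * (forall n, Z n -> seq (Z n) -> C),
  [/\ dets k (projT2 q.1),
      forall n x hs x' hs', (forall v, size v = N -> projT2 q.1 n (x + dot v hs) = projT2 q.1 n (x' + dot v hs')) -> q.2 n x hs = q.2 n x' hs' &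
      ev (fun n => avg (fun xh : Z n * N.-tuple (Z n) => ab (Qs (s n) si xh.1 xh.2 - q.2 n xh.1 xh.2)) < e3)].
  have hq := @Q_Cl R W UW Z k.+1 N (fun n => N.-tuple (Z n) : finType) (fun n h => h) g
     (fun n v => tr (s n) (si (insubd (nseq_tuple N false) v))) (fun n => tuple_gt0 _ _) (fun n p => size_tuple p) g1 gk hU.
  have [T [p [F [h1 h2 h3]]]] := Q_apx Jk Rk hq e30.
  by exists (existT _ T p, F).
have [q hq] := choice hQ0.
have [X gX hX] : dets k (fun n x => (((fun j => Nf j n x), (fun j => Gf j n x)), fun si => projT2 (q si).1 n x)).
  apply: (Jk (Jk _ _) _); apply: joins_fin => // i; [by case: (hNf i)|by case: (hGf i)|by case: (hq i)].
have hpt n := @point_ex eta d2 d3 cr th pb e3 Jn rd n (s n) (fun j => Nf j n) (fun j => Gf j n) (fun si => (q si).2 n)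
  eta0 eta1 d20 d30 th0 d2a (fun j => let: And3 h _ _ := hGf j in h n) hrd hcr hth.
have [Q hQ] := dep_choice hpt.
pose u n := (Q n).1.1.
have hXr : ev (fun n => forall x x', eqs X n x x' -> rel0 (fun j => Nf j n) (fun j => Gf j n) x x' /\ forall si, projT2 (q si).1 n x = projT2 (q si).1 n x').
  apply: evS hX => n h x x' /h e; split => [j|si].
    by split; [exact: (congr1 (fun z => z.1.1 j) e)|exact: (congr1 (fun z => z.1.2 j) e)].
  exact: (congr1 (fun z => z.2 si) e).
have tr0 : ev (fun n => typed X xpredT N ((Q n).1.2)).
  apply: evS hXr => n h x hs' x' hs'' s1 s2 hv; have [_ _ hr _] := hQ n; apply: hr => // [v sv|si].
    by case: (h _ _ (hv v sv isT)).
  by have [_ hd _] := hq si; apply: hd => v sv; case: (h _ _ (hv v sv isT)).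
have hcond : ev (fun n => conds eta d2 d3 th pb e3 (s n) (fun j => Nf j n) (fun j => Gf j n) (fun si => (q si).2 n)).
  have a1 : ev (fun n => forall j, N2 (fun x => (ab (g n (x + tr (s n) j)) ^+ 2)%:C - Nf j n x) < th ^+ 2) by apply: ev_fin => j; case: (hNf j).
  have a2 : ev (fun n => forall j, N2 (fun x => g n (x + tr (s n) j) ^+ m - Gf j n x) < th ^+ 2) by apply: ev_fin => j; case: (hGf j).
  have a3 : ev (fun n => forall si, avg (fun xh : Z n * N.-tuple (Z n) => ab (Qs (s n) si xh.1 xh.2 - (q si).2 n xh.1 xh.2)) < e3) by apply: ev_fin => si; case: (hq si).
  apply: ev2 (evI a1 a2) (evI a3 hc2) => n [b1 b2] [b3 b4]; have [b5 b6] := hs n b4; split => //.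
  - by move=> j; apply: ab_le_N2; [exact: ltW|exact/ltW/b1].
  - by move=> j; apply: ab_le_N2; [exact: ltW|exact/ltW/b2].
  - by move=> si; exact/ltW/b3.
have hu : ev (fun n => avg (fun x => Eh N (fun h => (du (u n) h x != (Q n).1.2 x h)%:R)) <= eps).
  by apply: evS hcond => n h; have [_ _ _ hh] := hQ n; apply: le_trans heps; case: (hh h).
have NNe : NN * NN * eps = eta ^+ 2 / 1600 by rewrite /eps; field; rewrite gt_eqF.
have eta2 : eta ^+ 2 <= 1 by rewrite exprn_ile1 // ltW.
have eps1 : 360 * (NN * NN) * eps <= 1.
  by rewrite -mulrA NNe; exact: constant_360.
have [u' hu' [w hw hwp]] := exactify gX eps0 eps1 tr0 hu.
pose J n (x : Z n) := (Q n).2.1 x; pose ga n (x : Z n) := (Q n).2.2 x.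
pose psi n x : C := g n x * Num.conj (E (u' n x)).
pose b n x : C := Num.conj (ga n x * E (w n x)) * (J n x)%:R.
pose pX n (x : Z n) := fun i => sg (s := X) i x.
have dX : dets k pX by exists X => //; apply: evT => n x x' h; apply/funext.
have eX n x y : pX n x = pX n y -> eqs X n x y by move=> h i; exact: (congr1 (fun f => f i) h).
have ex1 : ev (fun n => exact k.+2 (fun x y => pX n x = pX n y) (u' n)) by apply: evS hu' => n; apply: exact_sub => x y; exact: eX.
have psi1 : fle1 psi by move=> n x; rewrite abM ab_conj ab_E mulr1 g1.
have psiK : Cl W (BK k.+1) (hat psi).
  have hE : Cl W (BK k.+1) (hat (fun n x => E (u' n x))) by exact: (phase_hat dX ex1).
  apply: (Cl_eq _ (P_mul _ gk (P_conj hE))); last first.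
    by apply: bddJ; apply: fle1_bdd; apply: hat_le1 => n x; rewrite ab_E.
  by apply: evT => n xt; rewrite /hat /psi !rmorphM /= !conjCK; ring.
have b1 : fle1 b.
  move=> n x; rewrite abM ab_conj abM ab_E mulr1 ab_nat mulr_ile1 ?ab_ge0 //; last by case: (J n x).
  by have [h _ _ _] := hQ n; exact: h.
have bK : Cl W (Bf k.+1) b.
  apply: (low_Cl gX) => //; have [dd _ _] := gX; apply: evS hXr => n h x x' hx.
  have hx' : eqs X n x x' by move=> i; apply: hx; rewrite ltnS.
  have [_ ht _ _] := hQ n; have [t1 t2] := ht _ _ (h _ _ hx').1.
  by rewrite /b /J /ga t1 t2 (hw _ _ _ hx').
have psiS : Cl W (Bf k.+1) psi.
  apply: (corr_struct (b := b)) => //; first exact: fle1_bdd.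
  exists (eta ^+ 2 / 8); first by rewrite divr_gt0 ?exprn_gt0.
  apply: ev2 hcond hwp => n hc hp; have [_ _ _ hh] := hQ n; have [_ hl] := hh hc.
  apply: le_trans (hl _ _ _ hp).
  have k1 : NN * eps <= eta ^+ 2 / 1600 by rewrite -NNe ler_wpM2r ?(ltW eps0) // ler_peMl // ltW.
  have k2 : pb <= NN * eps.
    rewrite /pb ler_pdivrMr; last exact: mulr_gt0.
    apply: le_trans (_ : NN * eps <= _); first by rewrite ler_peMl // ltW.
    have l9 := one_le_four_mul NN1; have l0 : 0 <= NN * eps by rewrite mulr_ge0 // ltW.
    by rewrite ler_peMr.
  rewrite -[200 * _ * _]mulrA; exact: (correlation_budget k1 k2 d2b (sqr_ge0 eta)).
have apsi : apx k psi by exact: (Cl_apx Jk Rk psiS).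
move=> e e0; have [F [dF hF]] := apsi e e0.
have dp := Jk dX dF.
have ex2 : ev (fun n => forall j : unit, exact k.+2 (fun x y => (pX n x, F n x) = (pX n y, F n y)) (u' n)).
  by apply: evS ex1 => n h j; apply: exact_sub h => x y [].
have das := @assemble R W UW Z m' k _ _ unit (fun n _ => u' n) Jk Rk dp ex2.
exists (fun n x => F n x * E (u' n x)); split.
  apply: dets_sub das; apply: evT => n x x' [_ -> h]; congr (_ * E _).
  exact: (congr1 (fun f => f tt) h).
apply: evS hF => n; suff -> : N2 (fun x => g n x - F n x * E (u' n x)) = N2 (fun x => psi n x - F n x) by [].
apply: eq_avg => x; rewrite /psi; congr (_ ^+ _).
rewrite -[RHS]mulr1 -(ab_E R (u' n x)) -abM mulrBl -mulrA [Num.conj _ * _]mulrC EJ mulr1 //.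
Qed.
End Main.

Lemma regularS k : joins k -> regular k -> joins k.+1 -> regular k.+1.
Proof.
move=> Jk Rk JS b hb e e0; have e4 : 0 < e / 4 by rewrite divr_gt0.
have [J [g [c [K [hg hK hN]]]]] := span hb e4.
pose K1 := Num.max K 1; have K10 : 0 < K1 by rewrite lt_max ltr01 orbT.
pose cJ : R := #|J|%:R + 1; have cJ0 : 0 < cJ by rewrite ltr_wpDl ?ler0n.
pose e1 := e / 4 / (cJ * cJ * K1 ^+ 2); have e10 : 0 < e1 by rewrite !divr_gt0 // !mulr_gt0 ?exprn_gt0.
have ag j : apx k.+1 (g j).
  have [nl|nn] := null_or (UW := UW) (fun n => N2 (g j n)); last exact: (patch Jk Rk (hg j) nn).
  move=> e' e'0; exists (fun _ _ => 0); split; first by apply: dets_const; apply: evT.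
  by apply: evS (nl _ e'0) => n; rewrite (eq_N2 (g := g j n)) // => x; rewrite subr0.
have [F hF] := choice (fun j => ag j e1 e10).
have dF : dets k.+1 (fun n x => fun j => F j n x) by apply: joins_fin => // j; case: (hF j).
exists (fun n x => \sum_j c j n * F j n x); split.
  apply: dets_sub dF; apply: evT => n x x' h; apply: eq_bigr => j _; congr (_ * _).
  exact: (congr1 (fun f => f j) h).
have hF2 : ev (fun n => forall j, N2 (fun x => g j n x - F j n x) < e1) by apply: ev_fin => j; case: (hF j).
apply: ev2 hN hF2 => n h1 h2; apply: le_lt_trans (N2_tri _ _ (fun x => \sum_j c j n * g j n x)) _.
have h3 : N2 (fun x => \sum_j c j n * g j n x - \sum_j c j n * F j n x) <= e / 4.
  rewrite (eq_N2 (g := fun x => \sum_j c j n * (g j n x - F j n x))); last first.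
    by move=> x; rewrite -sumrB; apply: eq_bigr => j _; rewrite mulrBr.
  apply: le_trans (N2_sum (fun j x => c j n * (g j n x - F j n x))) _.
  apply: le_trans (_ : cJ * (cJ * (K1 ^+ 2 * e1)) <= _); last first.
    have -> : cJ * (cJ * (K1 ^+ 2 * e1)) = e / 4 by rewrite /e1; field; rewrite !gt_eqF.
    exact: lexx.
  have q0 : 0 <= K1 ^+ 2 * e1 by rewrite mulr_ge0 ?exprn_ge0 // ltW.
  have hs : \sum_j N2 (fun x => c j n * (g j n x - F j n x)) <= cJ * (K1 ^+ 2 * e1).
    apply: le_trans (_ : \sum_(j : J) K1 ^+ 2 * e1 <= _); last by rewrite sumr_const -mulr_natl ler_wpM2r // lerDl.
    apply: ler_sum => j _; rewrite N2Z ler_pM ?exprn_ge0 ?ab_ge0 ?N2_ge0 //; last exact/ltW/h2.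
    by rewrite ler_pXn2r ?nnegrE ?ab_ge0 ?(ltW K10) // le_max hK.
  by apply: ler_pM => //; [apply: sumr_ge0 => j _; exact: N2_ge0|rewrite lerDl].
exact: quarter_parts_lt e0 h1 h3.
Qed.

(** A joint induction: joining in degree [k + 1] uses approximation in degree [k], and approximation
    in degree [k + 1] uses joining in that degree. *)
Theorem all_regular k : joins k /\ regular k.
Proof.
elim: k => [|k [J Rg]]; first by split; [exact: joins0|exact: regular0].
have JS : joins k.+1 by exact: (joinsS J Rg).
by split => //; exact: (regularS J Rg JS).
Qed.
End Patch.

(** * The nilspace *)

Section Combinatorics.
Definition tup N (v : cube N) : N.-tuple bool := [tuple v i | i < N].
Definition cub N (s : N.-tuple bool) : cube N := [ffun i => tnth s i].
Lemma tupK N : cancel (@tup N) (@cub N).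
Proof. by move=> v; apply/ffunP => i; rewrite ffunE tnth_mktuple. Qed.
Lemma cubK N : cancel (@cub N) (@tup N).
Proof. by move=> s; apply: eq_from_tnth => i; rewrite tnth_mktuple ffunE. Qed.
Lemma seq_tup N (s : seq bool) : size s = N -> exists v : cube N, s = tup v.
Proof. by move=> /eqP h; exists (cub (Tuple h)); rewrite cubK. Qed.
Lemma dot_nth (Zn : finZmodType) N (s : seq bool) (hs : seq Zn) : size s = N -> size hs = N ->
  dot s hs = \sum_(i < N) nth 0 hs i *+ nth false s i.
Proof.
elim: N s hs => [|N IH] [|b s] [|h hs] //=; first by rewrite big_ord0.
by move=> [s1] [s2]; rewrite big_ord_recl /= (IH _ _ s1 s2); case: b.
Qed.
Lemma weight_count N (v : cube N) : count id (tup v) = weight v.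
Proof.
have h (s : seq bool) : count id s = (\sum_(b <- s) b)%N by elim: s => [|b s IH]; rewrite ?big_nil //= big_cons IH.
by rewrite h big_tuple; apply: eq_bigr => i _; rewrite tnth_mktuple.
Qed.
Lemma alt_tuple (A : zmodType) N (f : seq bool -> A) :
  alt N f = \sum_(s : N.-tuple bool) f s *~ (-1) ^+ count id s.
Proof.
elim: N f => [|N IH] f.
  by rewrite /= (bigD1 [tuple]) //= big1 ?addr0 // => s /eqP []; apply: val_inj; case: s => -[].
rewrite /= !IH (big_tupleS _ N (fun s : seq bool => f s *~ (-1) ^+ count id s)) -sumrN; congr (_ + _); apply: eq_bigr => s _.
by rewrite /= add1n exprS mulN1r mulrNz.
Qed.
Lemma alt_cube (A : zmodType) N (f : seq bool -> A) :
  \sum_(v : cube N) f (tup v) *~ (-1) ^+ weight v = alt N f.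
Proof.
rewrite alt_tuple (reindex (@tup N)); last by exists (@cub N) => ? _; [exact: tupK|exact: cubK].
by apply: eq_bigr => v _; rewrite weight_count.
Qed.

Definition conc (Zn : finZmodType) N (x : Zn) (h : N.-tuple Zn) (v : cube N) : Zn := x + \sum_i tnth h i *+ v i.
Lemma concE (Zn : finZmodType) N (x : Zn) (h : N.-tuple Zn) v : conc x h v = x + dot (tup v) h.
Proof.
rewrite (dot_nth (N := N)) ?size_tuple // /conc; congr (_ + _); apply: eq_bigr => i _.
by rewrite (tnth_nth 0 h) -[in LHS](tnth_mktuple v i) (tnth_nth false).
Qed.
Lemma conc_morph (Zn : finZmodType) M N (th : cube M -> cube N) (x : Zn) (h : N.-tuple Zn) : cube_morphism th ->
  exists x' (h' : M.-tuple Zn), forall v, conc x h (th v) = conc x' h' v.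
Proof.
move=> [Mx [b hm]]; exists (x + \sum_j tnth h j *~ b 0 j), [tuple \sum_j tnth h j *~ Mx i j | i < M] => v.
rewrite /conc -addrA; congr (_ + _).
have e j : ((th v j : nat)%:Z = \sum_i (v i : nat)%:Z * Mx i j + b 0 j)%R.
  have := congr1 (fun q : 'rV_N => q 0 j) (hm v); rewrite !mxE => ->; congr (_ + _).
  by apply: eq_bigr => i _; rewrite mxE.
under eq_bigr => j _ do rewrite pmulrn e mulrzDr.
rewrite big_split /= addrC; congr (_ + _).
under [RHS]eq_bigr => i _ do rewrite tnth_mktuple -sumrMnl.
rewrite exchange_big; apply: eq_bigr => j _ /=.
rewrite mulrz_sumr; apply: eq_bigr => i _; by rewrite mulrC mulrzA -pmulrn.
Qed.
(** [ka j] tells which input coordinate is copied to coordinate [j] and whether it is negated; with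
    [None] the coordinate is constant. *)
Lemma coord_morph M N (th : cube M -> cube N) (ka : 'I_N -> option 'I_M * bool) :
  (forall v j, th v j = (ka j).2 (+) (if (ka j).1 is Some l then v l else false)) -> cube_morphism th.
Proof.
move=> h; exists (\matrix_(i, j) if (ka j).1 == Some i then (if (ka j).2 then -1 else 1) else 0), (\row_j ((ka j).2 : nat)%:Z) => v.
apply/rowP => j; rewrite !mxE h; case E : (ka j) => [[l|] b] /=; last first.
  by rewrite big1 ?add0r ?addbF // => i _; rewrite !mxE E mulr0.
rewrite (bigD1 l) //= !mxE E /= eqxx big1 ?addr0 => [|i il]; last first.
  by rewrite !mxE E /=; case: eqP => [[e]|]; rewrite ?mulr0 // e eqxx in il *.
by clear E; case: b; case: (v l).
Qed.
Lemma face_morph N i : cube_morphism (@face N i).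
Proof.
apply: (coord_morph (ka := fun j => (unlift i j, false))) => v j; rewrite /face ffunE /=.
by case: (unlift i j).
Qed.
Definition flip N (v : cube N) : cube N := [ffun i => ~~ v i].
Lemma flip_morph N : cube_morphism (@flip N).
Proof. by apply: (coord_morph (ka := fun j => (Some j, true))) => v j; rewrite ffunE. Qed.
Lemma flipK N : involutive (@flip N).
Proof. by move=> v; apply/ffunP => i; rewrite !ffunE negbK. Qed.
Lemma flip0 N : flip (cube0 N) = cube1 N.
Proof. by apply/ffunP => i; rewrite !ffunE. Qed.
Lemma weight_face N i (v : cube N) : weight (face i v) = weight v.
Proof.
rewrite /weight (bigD1_ord i) //= ffunE unlift_none add0n; apply: eq_bigr => j _.
by rewrite ffunE liftK.
Qed.
Lemma face_ne1 N i (v : cube N) : face i v != cube1 N.+1.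
Proof. by apply/eqP => /(congr1 (fun q : cube N.+1 => q i)); rewrite !ffunE unlift_none. Qed.
Lemma ne1_face N (v : cube N.+1) : v != cube1 N.+1 -> exists i v', v = face i v'.
Proof.
move=> h; have [i hi] : exists i, v i = false.
  apply: contrapT => hno; case/eqP: h; apply/ffunP => i; rewrite ffunE.
  by apply/negbNE/negP => hi; apply: hno; exists i; exact/negbTE.
exists i, [ffun j => v (lift i j)]; apply/ffunP => j; rewrite ffunE.
by case: unliftP => [j' ->|->]; rewrite ?ffunE.
Qed.
Lemma weight_lt N (u v : cube N) : (forall j, u j -> v j) -> u != v -> (weight u < weight v)%N.
Proof.
move=> h ne; have [i hi] : exists i, v i && ~~ u i.
  apply: contrapT => hno; case/eqP: ne; apply/ffunP => i.
  have := h i; case hu : (u i); case hv : (v i) => // hh; first by have := hh isT.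
  by case: hno; exists i; rewrite hv hu.
case/andP: hi => v1 u0; rewrite /weight (bigD1 i) //= [X in (_ < X)%N](bigD1 i) //= v1 (negbTE u0) add0n add1n ltnS.
by apply: leq_sum => j _; move: (h j); case: (u j) => // ->.
Qed.
Lemma weight1 N : weight (cube1 N) = N.
Proof. by rewrite /weight (eq_bigr (fun _ => 1%N)) ?sum1_card ?card_ord // => i _; rewrite ffunE. Qed.
(** [M] of the ones of [v] become variable, and the other coordinates keep their values. *)
Lemma top_cube M N (v : cube N) : (M <= weight v)%N -> exists th : cube M -> cube N,
  [/\ cube_morphism th, th (cube1 M) = v & forall t, t != cube1 M -> (weight (th t) < weight v)%N].
Proof.
move=> hw; have cw : #|[pred j | v j]| = weight v.
  by rewrite -sum1_card big_mkcond; apply: eq_bigr => i _; rewrite inE; case: (v i).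
have hM : (M <= #|[pred j | v j]|)%N by rewrite cw.
pose p (l : 'I_M) : 'I_N := enum_val (widen_ord hM l).
have pv l : v (p l) by have := enum_valP (widen_ord hM l); rewrite inE.
have pI : injective p by move=> a b /enum_val_inj /(congr1 val) /= /val_inj.
pose th (t : cube M) : cube N := [ffun j => if [pick l | p l == j] is Some l then t l else v j].
exists th; split.
- apply: (coord_morph (ka := fun j => if [pick l | p l == j] is Some l then (Some l, false) else (None, v j))) => t j.
  by rewrite ffunE; case: pickP => [l _|_] //=; rewrite addbF.
- by apply/ffunP => j; rewrite ffunE; case: pickP => [l /eqP <-|//]; rewrite ffunE pv.
move=> t ht; apply: weight_lt => [j|].
  by rewrite ffunE; case: pickP => [l /eqP <- _|//]; exact: pv.
apply/eqP => e; case/eqP: ht; apply/ffunP => l; rewrite ffunE.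
have := congr1 (fun q : cube N => q (p l)) e; rewrite ffunE pv.
by case: pickP => [l' /eqP /pI -> //|/(_ l)]; rewrite eqxx.
Qed.
(** The cube condition along [top_cube], in dimension [i + 1], expresses [e v] by values at vertices
    of smaller weight. *)
Lemma deg_zero i (A : zmodType) N (e : cube N -> A) : @degree_cubes i A N e ->
  (forall v, (weight v <= i)%N -> e v = 0) -> forall v, e v = 0.
Proof.
move=> hd h0 v; have [n hn] := ubnP (weight v); elim: n v hn => // n IH v; rewrite ltnS => hv.
have [le|gt] := leqP (weight v) i; first exact: h0.
have [th [hm h1 hlt]] := top_cube gt; have := hd th hm.
rewrite (bigD1 (cube1 i.+1)) //= h1 big1 ?addr0 => [|t ht]; last by rewrite IH ?mul0rz // (leq_trans (hlt t ht)).
by rewrite weight1 -signr_odd; case: (odd _); rewrite ?expr1 ?expr0 ?mulrN1z ?mulr1z // => /eqP; rewrite oppr_eq0 => /eqP.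
Qed.
Lemma degB i (A : zmodType) N (c c' : cube N -> A) : @degree_cubes i A N c -> @degree_cubes i A N c' ->
  @degree_cubes i A N (fun v => c v - c' v).
Proof.
move=> h h' th hm; under eq_bigr => v _ do rewrite mulrzBl.
by rewrite sumrB (h th hm) (h' th hm) subrr.
Qed.
Lemma conc_deg (Zn : finZmodType) N (x : Zn) (h : N.-tuple Zn) : @degree_cubes 1 Zn N (conc x h).
Proof.
move=> th hm; have [x' [h' e]] := conc_morph x h hm.
under eq_bigr => v _ do rewrite e concE.
rewrite (alt_cube 2 (fun s => x' + dot s h')).
case: h' {e} => -[|a [|b [|c l]]] //= _; rewrite !addr0 !add0r.
have q (y z : Zn) : y - (y + z) = - z by rewrite opprD addrA subrr add0r.
by rewrite q addrA q subrr.
Qed.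
Lemma weight_small N (v : cube N) : (weight v <= 1)%N -> v = cube0 N \/ exists i, v = [ffun j => j == i].
Proof.
move=> hw; have [[i hi]|hno] := pselect (exists i, v i); last first.
  by left; apply/ffunP => i; rewrite ffunE; apply/negbTE/negP => hi; apply: hno; exists i.
right; exists i; apply/ffunP => j; rewrite ffunE; have [->|ne] := eqVneq j i; first exact: hi.
apply/negbTE/negP => hj; move: hw; rewrite /weight (bigD1 i) //= (bigD1 j) //= hi hj; lia.
Qed.
Lemma deg1_conc (Zn : finZmodType) N (c : cube N -> Zn) : @degree_cubes 1 Zn N c ->
  c = conc (c (cube0 N)) [tuple c [ffun j => j == i] - c (cube0 N) | i < N].
Proof.
move=> hc; apply/funext => v; apply/eqP; rewrite -subr_eq0; apply/eqP; move: v.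
apply: (deg_zero (degB hc (@conc_deg _ _ _ _))) => v /weight_small [->|[i ->]].
  by rewrite /conc big1 ?addr0 ?subrr // => i _; rewrite ffunE mulr0n.
rewrite /conc (bigD1 i) //= tnth_mktuple ffunE eqxx mulr1n big1 ?addr0 => [|j /negbTE ji]; last by rewrite ffunE ji mulr0n.
by rewrite [X in _ - X]addrC subrK subrr.
Qed.
Lemma conc_inj (Zn : finZmodType) N (x x' : Zn) (h h' : N.-tuple Zn) : conc x h =1 conc x' h' -> (x, h) = (x', h').
Proof.
move=> e; have e0 (y : Zn) (l : N.-tuple Zn) : conc y l (cube0 N) = y.
  by rewrite /conc big1 ?addr0 // => i _; rewrite ffunE mulr0n.
have e1 (y : Zn) (l : N.-tuple Zn) i : conc y l [ffun j => j == i] = y + tnth l i.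
  rewrite /conc (bigD1 i) //= ffunE eqxx mulr1n big1 ?addr0 // => j /negbTE ji; by rewrite ffunE ji mulr0n.
have ex : x = x' by have := e (cube0 N); rewrite !e0.
congr (_, _) => //; apply: eq_from_tnth => i; have := e [ffun j => j == i]; rewrite !e1 ex; exact: addrI.
Qed.
End Combinatorics.

(** * Points, cubes and structure groups *)

Section Nilspace.
Variable R : realType.
Context (W : set_system nat) {UW : UltraFilter W}.
Variable Z : nat -> finZmodType.
Local Notation C := R[i].
Local Notation ev := (ev W).
Variable m' : nat.
Local Notation m := m'.+1.
Local Notation A := 'I_m.
Local Notation E := (@E R m').
Local Notation sys := (sys Z m').
Variables (k : nat) (S : sys).
Hypothesis gS : @good R W Z m' k S.
Local Notation I := (sI S).
Local Notation sd := (@sd Z m' S).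
Local Notation sg n := (@sg Z m' S n).
Local Notation G0 := {ffun I -> A}.
Let sdk i : (sd i <= k)%N. Proof. by have [h _ _] := gS. Qed.
Let exS : ev (fun n => @exacts Z m' S n). Proof. by have [_ h _] := gS. Qed.

Definition typ n (x : Z n) : G0 := [ffun i => sg n i x].
(* The values satisfying all linear relations between the phases. *)
Definition rz (z : G0) : bool := `[< forall e : G0, ev (fun n => forall x, ep (n := n) e x = 0) -> pair e z = 0 >].
Lemma rzP z : reflect (forall e : G0, ev (fun n => forall x, ep (n := n) e x = 0) -> pair e z = 0) (rz z).
Proof. exact: asboolP. Qed.
Lemma ep_typ (e : G0) n (x : Z n) : ep e x = pair e (typ x).
Proof. by apply: eq_bigr => i _; rewrite ffunE. Qed.
Lemma rz_typ : ev (fun n => forall x : Z n, rz (typ x)).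
Proof.
have h : ev (fun n => forall e : G0, ev (fun n => forall x, ep (n := n) e x = 0) -> forall x : Z n, ep e x = 0).
  apply: ev_fin => e; have [h|h] := pselect (ev (fun n => forall x, ep (n := n) e x = 0)); last exact: evT.
  by apply: evS h.
by apply: evS h => n h x; apply/rzP => e he; rewrite -ep_typ h.
Qed.
Lemma absC (a b : R) : `|a - b| = ab (a%:C - b%:C).
Proof. by rewrite -rmorphB abR. Qed.
Lemma u_one d n : 1 <= u d (fun _ : Z n => 1 : C).
Proof.
elim: d => [|d IH]; first by rewrite u0E avg_const ?zmod_gt0 // ab1.
by apply: le_trans (u_mono _ _); rewrite exprn_ege1.
Qed.
Definition at_lev D (e : G0) : G0 := [ffun i => if sd i == D then e i else 0].
Definition below D (e : G0) : G0 := [ffun i => if (sd i < D)%N then e i else 0].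
Lemma below_split D e n (x : Z n) : ep (below D.+1 e) x = ep (at_lev D e) x + ep (below D e) x.
Proof.
rewrite /ep -big_split; apply: eq_bigr => i _; rewrite !ffunE ltnS leq_eqVlt.
by case: eqP => [->|_] /=; rewrite ?ltnn ?mulr0n ?addr0 ?add0r.
Qed.
(** Degrees are removed from the top. If the part of highest degree [D] did not vanish, its [U^D]
    norm would be null; but times the lower parts, a structured factor, it is the constant 1. *)
Lemma lev_zero (e : G0) D : ev (fun n => forall x, ep (n := n) e x = 0) -> ev (fun n => forall x, ep (n := n) (at_lev D e) x = 0).
Proof.
move=> he.
have st D' : ev (fun n => forall x, ep (n := n) (below D'.+1 e) x = 0) ->
   ev (fun n => forall x, ep (n := n) (at_lev D' e) x = 0) /\ ev (fun n => forall x, ep (n := n) (below D' e) x = 0).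
  move=> h0; have [_ _ g3] := gS.
  have sup i : sd i != D' -> at_lev D' e i = 0 by rewrite ffunE => /negbTE ->.
  have [z|nl] := g3 D' (at_lev D' e) sup.
    by split => //; apply: ev2 h0 z => n h z x; have := h x; rewrite below_split z add0r.
  exfalso; have cl : Cl W (@Bf R Z D') (fun n x => E (ep (below D' e) x)).
    apply: (low_Cl gS); first by move=> n x; rewrite ab_E.
    apply: evT => n x x' h; congr E; apply: eq_bigr => i _; rewrite ffunE; case: ifP => [/h -> //|_].
    by rewrite !mulr0n.
  have nl2 : null W (fun n => u D' (fun x : Z n => E (ep (at_lev D' e) x) * E (ep (below D' e) x))).
    exact: (unull_mul (f := fun n x => E (ep (at_lev D' e) x)) (fun n x => eq_ind_r (fun r => r <= 1) (lexx 1) (ab_E R _)) (fun n x => eq_ind_r (fun r => r <= 1) (lexx 1) (ab_E R _)) cl nl).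
  have h1 : ev (fun n => 1 <= u D' (fun x : Z n => E (ep (at_lev D' e) x) * E (ep (below D' e) x))).
    apply: evS h0 => n h; have -> : (fun x : Z n => E (ep (at_lev D' e) x) * E (ep (below D' e) x)) = fun _ => 1.
      by apply/funext => x; rewrite -ED -below_split h E0.
    exact: u_one.
  by have [n [a b]] := ev_ex (evI h1 (nl2 _ ltr01)); have := le_lt_trans a b; rewrite ltxx.
have top : ev (fun n => forall x, ep (n := n) (below k.+1 e) x = 0).
  apply: evS he => n h x; rewrite -[RHS](h x); apply: eq_bigr => i _; by rewrite ffunE ltnS sdk.
have bl j : ev (fun n => forall x, ep (n := n) (below (k.+1 - j) e) x = 0).
  elim: j => [|j IH]; first by rewrite subn0.
  have [lt|ge] := ltnP j k.+1; last by move: IH; rewrite (eqP ge) (eqP (leqW ge)).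
  by have [_ h] := st (k.+1 - j.+1)%N (eq_ind _ (fun q => ev (fun n => forall x, ep (n := n) (below q e) x = 0)) IH _ (esym (subnSK lt))).
have [le|gt] := leqP D k.
  have := bl (k - D)%N; rewrite subSn ?leq_subr // subKn // => h; by case: (st D h).
apply: evT => n x; rewrite /ep big1 // => i _; rewrite ffunE; case: eqP => [e0|_]; last by rewrite mulr0n.
by have := sdk i; rewrite e0 leqNgt gt.
Qed.

Lemma pairDr (e z z' : G0) : pair e (z + z') = pair e z + pair e z'.
Proof. by rewrite /pair -big_split; apply: eq_bigr => i _; rewrite ffunE mulrnDl. Qed.
Lemma rz0 : rz 0.
Proof. by apply/rzP => e _; rewrite /pair big1 // => i _; rewrite ffunE mul0rn. Qed.
Lemma rzB z z' : rz z -> rz z' -> rz (z - z').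
Proof. by move=> /rzP h /rzP h'; apply/rzP => e he; rewrite pairB h // h' // subrr. Qed.
Lemma rzD z z' : rz z -> rz z' -> rz (z + z').
Proof. by move=> /rzP h /rzP h'; apply/rzP => e he; rewrite pairDr h // h' // addr0. Qed.
Lemma rz_lev D z : rz z -> rz (at_lev D z).
Proof.
move=> /rzP h; apply/rzP => e he; rewrite -(h _ (lev_zero D he)); apply: eq_bigr => i _.
by rewrite !ffunE; case: ifP => _; rewrite ?mul0rn ?mulr0n.
Qed.

Section Law.
Variable N : nat.
Local Notation V := (N.-tuple bool).
Local Notation FD := {ffun V * I -> A}.
Let SS : pred (seq bool) := xpredT.
Definition fdat n (x : Z n) (h : seq (Z n)) : FD := @fd Z m' S SS N n x h.
Definition Phi (tau : cube N -> G0) : FD := [ffun vi : V * I => if (count id vi.1 <= sd vi.2)%N then tau (cub vi.1) vi.2 else 0].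
(** Only free positions are prescribed; the other values on a cube are determined by them. *)
Definition hit (tau : cube N -> G0) n (x : Z n) (h : N.-tuple (Z n)) : Prop :=
  forall v i, (weight v <= sd i)%N -> sg n i (conc x h v) = tau v i.
Lemma hitP tau n (x : Z n) h : reflect (hit tau x h) (fdat x h == Phi tau).
Proof.
apply: (iffP eqP) => [e v i hw|hh].
  have := congr1 (fun f : FD => f (tup v, i)) e; rewrite !ffunE /= /fr /SS /= weight_count hw tupK concE //.
apply/ffunP => -[v i]; rewrite !ffunE /= /fr /SS /=; case: ifP => // hw.
by rewrite -hh ?concE ?cubK // -weight_count cubK.
Qed.
(** By [max_bad] and [GP_law], a character of the free data has null average unless its part at
    every vertex is a relation; in that case it is 1, as [tau] satisfies all relations. So [lam] is
    the proportion of such characters, whatever [tau] is. *)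
Lemma dist : exists2 lam : R, 0 < lam & forall tau : cube N -> G0, (forall v, rz (tau v)) ->
  null W (fun n => `|avg (fun xh : Z n * N.-tuple (Z n) => (`[< hit tau xh.1 xh.2 >])%:R) - lam|).
Proof.
pose Lam (e : FD) : bool := `[< forall v : V, ev (fun n => forall y, @ef Z m' S SS N e v n y = 0) >].
have G0p : (0 < #|{: FD}|)%N := zmod_gt0 FD.
exists (avg (fun e => (Lam e)%:R)) => [|tau ht].
  rewrite /avg divr_gt0 ?ltr0n // (bigD1 (0 : FD)) //= ltr_pwDl ?sumr_ge0 //.
  suff -> : Lam 0 by rewrite ltr01.
  apply/asboolP => v; apply: evT => n y; rewrite /ef big1 // => i _; by rewrite ffunE mulr0n.
pose tm (e : FD) n : R := ab (avg (fun xh : Z n * N.-tuple (Z n) => E (pair e (fdat xh.1 xh.2 - Phi tau))) - (Lam e)%:R).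
have htm e : null W (tm e).
  have [/asboolP hL|/asboolPn hL] := boolP (Lam e).
    have pP : pair e (Phi tau) = 0.
      rewrite /pair; have -> : \sum_(v : V * I) Phi tau v *+ e v = \sum_(v : V * I) (fun (a : V) (i : I) => Phi tau (a, i) *+ e (a, i)) v.1 v.2 by apply: eq_bigr => -[].
      rewrite -(pair_bigA _ (fun (a : V) (i : I) => Phi tau (a, i) *+ e (a, i))) /= big1 // => v _.
      have /rzP := ht (cub v); move=> /(_ [ffun i => if (count id v <= sd i)%N then e (v, i) else 0]) hv.
      rewrite -[RHS]hv.
        by apply: eq_bigr => i _; rewrite !ffunE /=; case: ifP => _; rewrite ?mul0rn ?mulr0n.
      apply: evS (hL v) => n h y; rewrite -[RHS](h y); apply: eq_bigr => i _; rewrite ffunE /fr /SS /=.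
      by case: ifP => _; rewrite ?mul0rn ?mulr0n.
    move=> e0 e00; have hall : ev (fun n => forall (v : V) y, @ef Z m' S SS N e v n y = 0) by apply: ev_fin.
    have LE : Lam e by apply/asboolP.
    apply: evS hall => n h; rewrite /tm LE (eq_avg (g := fun _ => 1)) => [|xh].
      have cd : (0 < #|{: Z n * N.-tuple (Z n)}|)%N by rewrite card_prod muln_gt0 zmod_gt0 tuple_gt0.
      by rewrite (avg_const _ cd) subrr ab0.
    by rewrite pairB pP subr0 /fdat pair_fd big1 ?E0.
  have hb : exists2 v : V, predT v & ~ ev (fun n => forall y, @ef Z m' S SS N e v n y = 0).
    by move/existsNP: hL => [v hv]; exists v.
  have [vs [_ hnu hab]] := max_bad gS hb.
  have nl : null W (fun n => ab (GP N (fun s y => E (@ef Z m' S SS N e (insubd vs s) n y)))).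
    apply: (@null_pow W UW R _ (2 ^ count id vs)); first by apply: evT => n; exact: ab_ge0.
    apply: null_le hnu.
    have hall : ev (fun n => forall v : V, leb vs v -> v != vs -> forall y, @ef Z m' S SS N e v n y = 0).
      apply: ev_fin => v; have [a|a] := boolP (leb vs v && (v != vs)).
        by case/andP: a => a b; apply: evS (hab v isT a b).
      by apply: evT => n a' b'; rewrite a' b' in a.
    apply: evS hall => n h.
    have := @GP_law R (Z n) vs (fun s y => E (@ef Z m' S SS N e (insubd vs s) n y)).
    rewrite size_tuple valKd; apply => [s y|s y h1 h2]; first by rewrite ab_E.
    have ss : size s == N by rewrite -(leb_size h1) size_tuple.
    have es : s = val (insubd vs s : V) by rewrite val_insubd ss.
    by rewrite h ?E0 // -?es //; apply: contraNneq h2 => e2; rewrite es e2.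
  move=> e0 e00; apply: evS (nl _ e00) => n; suff -> : tm e n = ab (GP N (fun s y => E (@ef Z m' S SS N e (insubd vs s) n y))) by [].
  rewrite /tm (_ : Lam e = false); last exact/negbTE/asboolPn.
  rewrite mulr0n subr0 (eq_avg (g := fun xh : Z n * N.-tuple (Z n) => E (- pair e (Phi tau)) * cprod (fun s y => E (@ef Z m' S SS N e (insubd vs s) n y)) xh.2 xh.1)).
    rewrite avgZ abM ab_E mul1r; congr ab.
    exact: (avg_pairE (fun x (h : N.-tuple (Z n)) => cprod (fun s y => E (@ef Z m' S SS N e (insubd vs s) n y)) h x)).
  move=> xh; rewrite pairB ED mulrC; congr (_ * _).
  rewrite /fdat pair_fd E_sum (cprodEt _ _ (size_tuple xh.2)); apply: eq_bigr => v _; by rewrite valKd.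
apply: null_le (null_sum htm); apply: evT => n.
have -> : `|avg (fun xh : Z n * N.-tuple (Z n) => (`[< hit tau xh.1 xh.2 >])%:R) - avg (fun e => (Lam e)%:R)| =
  ab (avg (fun e : FD => avg (fun xh : Z n * N.-tuple (Z n) => E (pair e (fdat xh.1 xh.2 - Phi tau))) - (Lam e)%:R)).
  rewrite absC !avgC avgB; congr (ab (_ - _)); last by apply: eq_avg => e; case: (Lam e).
  rewrite avg_exch; apply: eq_avg => xh; rewrite pair_orth subr_eq0.
  by case: hitP => h; [rewrite (asboolT h)|rewrite (asboolF h)].
apply: le_trans (ab_avg _) _; rewrite /avg ler_pdivrMr ?ltr0n // ler_peMr ?ler1n //.
by apply: sumr_ge0 => e _; exact: ab_ge0.
Qed.
End Law.

Definition X := {z : G0 | rz z}.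
HB.instance Definition _ := Finite.on X.
(* A cube of the nilspace is a configuration realised by a cube of [Z n] for almost all [n]. *)
Definition Cb : cubes_on X := fun N T => ev (fun n => exists x (h : N.-tuple (Z n)), forall v, typ (conc x h v) = val (T v)).
(** By [dist] the prescribed free values occur on some cube for almost all [n], and [ev_pick]
    selects one full configuration for almost all of them. *)
Lemma C_real N (T : cube N -> X) : exists2 c1, Cb c1 & forall v i, (weight v <= sd i)%N -> val (c1 v) i = val (T v) i.
Proof.
have [lam l0 hl] := dist N; have h := hl (fun v => val (T v)) (fun v => valP (T v)) (lam / 2).
have l2 : 0 < lam / 2 by rewrite divr_gt0.
have hex : ev (fun n => exists c1 : {ffun cube N -> X}, (exists x (h : N.-tuple (Z n)), forall v, typ (conc x h v) = val (c1 v)) /\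
    forall v i, (weight v <= sd i)%N -> val (c1 v) i = val (T v) i).
  apply: ev2 (h l2) rz_typ => n hn hr.
  have [[xh hxh]|hno] := pselect (exists xh : Z n * N.-tuple (Z n), hit (fun v => val (T v)) xh.1 xh.2).
    exists [ffun v => exist _ (typ (conc xh.1 xh.2 v)) (hr _)]; split.
      by exists xh.1, xh.2 => v; rewrite ffunE.
    by move=> v i hw; rewrite ffunE /= ffunE hxh.
  exfalso; move: hn; rewrite (eq_avg (g := fun _ => 0)) ?avg0 => [|xh].
    by rewrite sub0r normrN gtr0_norm // ltNge ler_pdivrMr // ler_peMr ?ler1n // ltW.
  by rewrite asboolF // => hh; apply: hno; exists xh.
have [c1 hc] := ev_pick hex; exists c1; first by apply: evS hc => n [].
by have [n [_ hh]] := ev_ex hc.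
Qed.
(** [det] at one [n] where both configurations are realised, for the system in which phases of
    degree above [i] are replaced by 0. *)
Lemma C_det i N (c0 c1 : cube N -> X) : Cb c0 -> Cb c1 ->
  (forall v j, (sd j <= i)%N -> (weight v <= sd j)%N -> val (c0 v) j = val (c1 v) j) ->
  forall v j, (sd j <= i)%N -> val (c0 v) j = val (c1 v) j.
Proof.
move=> h0 h1 hag v j hj; have [n [ex [[x [h e0]] [x' [h' e1]]]]] := ev_ex (evI exS (evI h0 h1)).
have t0 w l : val (c0 w) l = sg n l (conc x h w) by rewrite -e0 ffunE.
have t1 w l : val (c1 w) l = sg n l (conc x' h' w) by rewrite -e1 ffunE.
pose dg l := if (sd l <= i)%N then sd l else 0%N.
pose g l y := if (sd l <= i)%N then sg n l y else 0.
have exg l : exact (dg l).+1 (low dg g (dg l)) (g l).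
  have [hl|hl] := boolP (sd l <= i)%N; last first.
    have e : g l = fun=> 0 by apply/funext => y; rewrite /g (negbTE hl).
    by move=> *; rewrite e /du !alt_zero.
  have -> : g l = sg n l by apply/funext => y; rewrite /g hl.
  rewrite /dg hl; apply: exact_sub (ex l) => y y' hy q hq.
  have hq' : (sd q <= i)%N by rewrite (leq_trans (ltnW hq)).
  by have := hy q; rewrite /dg /g hq'; apply.
have := det exg (S := xpredT) (N := N) (x := x) (hs := h) (x' := x') (hs' := h') (fun _ _ _ _ => isT) (size_tuple h) (size_tuple h').
move=> /(_ _ (tup v) j (size_tuple _) isT); rewrite /g hj -!concE -t0 -t1; apply.
move=> s l /seq_tup [w ->] _; rewrite /dg; case: ifP => // hl; rewrite weight_count -!concE -t0 -t1; exact: hag.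
Qed.
Lemma C_exact j (c0 c1 : cube (sd j).+1 -> X) : Cb c0 -> Cb c1 ->
  (forall v l, (sd l < sd j)%N -> val (c0 v) l = val (c1 v) l) ->
  \sum_v val (c0 v) j *~ (-1) ^+ weight v = \sum_v val (c1 v) j *~ (-1) ^+ weight v.
Proof.
move=> h0 h1 hag; have [n [ex [[x [h e0]] [x' [h' e1]]]]] := ev_ex (evI exS (evI h0 h1)).
have t0 w l : val (c0 w) l = sg n l (conc x h w) by rewrite -e0 ffunE.
have t1 w l : val (c1 w) l = sg n l (conc x' h' w) by rewrite -e1 ffunE.
under eq_bigr => v _ do rewrite t0 concE; under [RHS]eq_bigr => v _ do rewrite t1 concE.
rewrite (alt_cube _ (fun s => sg n j (x + dot s h))) (alt_cube _ (fun s => sg n j (x' + dot s h'))).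
have := ex j x h x' h' (size_tuple _) (size_tuple _); rewrite /du !size_tuple; apply.
by move=> s /seq_tup [w ->] l hl; rewrite -!concE -t0 -t1 hag.
Qed.
Lemma C_comp M N (th : cube M -> cube N) (c : cube N -> X) : cube_morphism th -> Cb c -> Cb (c \o th).
Proof.
move=> hm; apply: evS => n [x [h e]]; have [x' [h' e']] := conc_morph x h hm.
by exists x', h' => v /=; rewrite -e e'.
Qed.
Lemma realised1 (z : X) : ev (fun n => exists x : Z n, typ x = val z).
Proof.
have [c1 h1 h2] := C_real (N := 0) (fun _ => z).
apply: evS h1 => n [x [h e]]; exists (conc x h (cube0 0)); rewrite e; apply/ffunP => i; apply: h2.
by rewrite /weight big_ord0.
Qed.
Lemma C_const N (z : X) : Cb (fun _ : cube N => z).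
Proof.
apply: evS (realised1 z) => n [x e]; exists x, [tuple 0 | i < N] => v; rewrite -e; congr typ.
by rewrite /conc big1 ?addr0 // => i _; rewrite tnth_mktuple mul0rn.
Qed.
Lemma X_eq (x y : X) : (forall j, val x j = val y j) -> x = y.
Proof. by move=> h; apply: val_inj; apply/ffunP. Qed.
(** On the lower faces the free values determine the cube. At the top vertex exactly the phases of
    degree above [N] are free and can be prescribed; for [N = k] none is left. *)
Lemma fill_corner N (c' : cube N.+1 -> X) (y : X) : corner Cb c' ->
  exists c, [/\ Cb c, forall v, v != cube1 N.+1 -> c v = c' v & forall j, (N < sd j)%N -> val (c (cube1 _)) j = val y j].
Proof.
move=> hc; have [c h1 h2] := C_real (fun v => if v == cube1 N.+1 then y else c' v).
exists c; split => // [v /ne1_face [i [v' ->]]|j hj]; last by rewrite h2 ?eqxx ?weight1.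
apply: X_eq => j; apply: (C_det (i := k) (c0 := c \o face i) (c1 := c' \o face i)) (sdk j) => //.
  exact: C_comp (face_morph i) h1.
by move=> w l _ hw /=; rewrite h2 ?weight_face // (negbTE (face_ne1 _ _)).
Qed.
Lemma nil_X : nilspace Cb.
Proof.
split.
- by exists; exists 0; exact: rz0.
- by move=> M N th c; exact: C_comp.
- apply/seteqP; split => // c _; apply: evS (realised1 (c (cube0 0))) => n [x e]; exists x, [tuple] => v.
  have -> : v = cube0 0 by apply/ffunP => -[].
  by rewrite /conc big_ord0 addr0.
- apply/seteqP; split => // c _; apply: ev2 (realised1 (c (cube0 1))) (realised1 (c (cube1 1))) => n [x e] [y e'].
  exists x, [tuple y - x] => v; rewrite /conc big_ord1 (tnth_nth 0) /=.
  have [h|h] := boolP (v ord0).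
    have -> : v = cube1 1 by apply/ffunP => i; rewrite ffunE (ord1 i).
    by rewrite mulr1n addrC subrK.
  have -> : v = cube0 1 by apply/ffunP => i; rewrite ffunE (ord1 i); exact/negbTE.
  by rewrite mulr0n addr0.
move=> n c' hc; have [c [h1 h2 _]] := fill_corner (c' (cube0 _)) hc; by exists c; split.
Qed.
Lemma C_top N (c1 c2 : cube N -> X) : (k < N)%N -> Cb c1 -> Cb c2 -> (forall v, v != cube1 N -> c1 v = c2 v) -> c1 = c2.
Proof.
move=> hN h1 h2 h; apply/funext => v; apply: X_eq => j; apply: (C_det h1 h2 _ _ (sdk j)) => w l _ hw.
by rewrite h //; apply: contraTneq hw => ->; rewrite weight1 -ltnNge (leq_ltn_trans (sdk l)).
Qed.
Lemma step_X : step Cb k.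
Proof.
move=> c' _ c1 c2 [h1 e1] [h2 e2]; apply: (C_top _ h1 h2) => // v hv; by rewrite e1 ?e2.
Qed.
(** This reduces all dimensions to [k + 1], hence to finitely many configurations, so that a
    statement for almost all [n] can cover all dimensions at once. *)
Lemma C_local N (T : cube N -> X) : (forall th : cube k.+1 -> cube N, cube_morphism th -> Cb (T \o th)) -> Cb T.
Proof.
elim: N T => [|N IH] T hT.
  have h := nilspace_ergodic0 nil_X; by rewrite h.
have [le|gt] := leqP N.+1 k.+1.
  pose p (v : cube k.+1) : cube N.+1 := [ffun i => v (widen_ord le i)].
  pose q (v : cube N.+1) : cube k.+1 := [ffun i => if insub (val i) is Some j then v j else false].
  have hp : cube_morphism p by apply: (coord_morph (ka := fun i => (Some (widen_ord le i), false))) => v j; rewrite ffunE.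
  have hq : cube_morphism q.
    by apply: (coord_morph (ka := fun i => (insub (val i), false))) => v j; rewrite ffunE /=; case: insub.
  have -> : T = (T \o p) \o q.
    apply/funext => v /=; congr T; apply/ffunP => i; rewrite !ffunE /=.
    by case: insubP => [j _ hj|]; [congr (v _); apply: val_inj|rewrite ltn_ord].
  exact: C_comp hq (hT p hp).
have hc : corner Cb T.
  move=> i; apply: IH => th hth; apply: (hT (face i \o th)).
  have [A1 [b1 e1]] := hth; have [A2 [b2 e2]] := face_morph i.
  by exists (A1 *m A2), (b1 *m A2 + b2) => v; rewrite /= e2 e1 mulmxDl -mulmxA addrA.
have [c [h1 h2 _]] := fill_corner (T (cube0 _)) hc.
suff -> : T = c by [].
apply/funext => v; have [->|ne] := eqVneq v (cube1 N.+1); last by rewrite h2.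
have [th [hm ht hlt]] := @top_cube k.+1 _ (cube1 N.+1) (eq_ind_r (fun q => (k < q)%N) (ltnW gt) (weight1 _)).
have := C_top (ltnSn k) (hT th hm) (C_comp hm h1) _; move=> /(_ _)/(congr1 (fun f => f (cube1 _))) /=; rewrite ht; apply.
move=> t htt /=; rewrite h2 //; apply/eqP => e; by have := hlt t htt; rewrite e ltnn.
Qed.

Definition eqv i (x y : X) := forall j, (sd j <= i)%N -> val x j = val y j.
(** At a vertex of full weight [i + 1] the phases of degree at most [i] are determined by the rest
    of the cube, and the others are free; [flip] moves that vertex to [cube0]. *)
Lemma simE i x y : sim Cb i x y <-> eqv i x y.
Proof.
split.
  move=> [c [c' [h h' e e' hv]]] j hj; rewrite -e -e'.
  have f0 : flip (cube1 i.+1) = cube0 i.+1 by rewrite -flip0 flipK.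
  have hag v l : (sd l <= i)%N -> (weight v <= sd l)%N -> val ((c \o @flip _) v) l = val ((c' \o @flip _) v) l.
    move=> hl hw; rewrite /= hv //; apply: contraTneq hw => e0.
    have -> : v = cube1 i.+1 by rewrite -[v]flipK e0 flip0.
    by rewrite weight1 -ltnNge ltnS.
  have := C_det (C_comp (@flip_morph _) h) (C_comp (@flip_morph _) h') hag (cube1 i.+1) hj; by rewrite /= f0.
move=> h; have hc : corner Cb (fun _ : cube i.+1 => x) by move=> j; exact: C_const.
have [c [h1 h2 h3]] := fill_corner y hc.
exists (fun _ => x), (c \o @flip _); split => //; [exact: C_const|exact: C_comp (@flip_morph _) h1| |].
  rewrite /= flip0; apply: X_eq => j; have [le|gt] := leqP (sd j) i; last exact: h3.
  rewrite -h //; apply: (C_det (i := i) (c1 := fun _ : cube i.+1 => x) h1 (C_const _ _)) => // v l hl hw.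
  by rewrite h2 //; apply: contraTneq hw => ->; rewrite weight1 -ltnNge ltnS.
move=> v hv /=; rewrite h2 //; apply: contraNneq hv => e; by rewrite -[v]flipK e -flip0 flipK.
Qed.
Local Notation pi := (factor_pi Cb).
Lemma piE i x y : pi i x = pi i y <-> eqv i x y.
Proof.
split=> [e|e].
  have := congr1 (fun a => proj1_sig a y) e => /= h; apply/simE; rewrite h; by apply/simE.
apply: eq_exist; apply/seteqP; split => z /=; rewrite !simE => h j hj; by rewrite -?h // e // h.
Qed.
Definition crep i (a : Defs.factor Cb i) : X := projT1 (cid (proj2_sig a)).
Lemma pi_crep i (a : Defs.factor Cb i) : pi i (crep a) = a.
Proof. by case: a => a p; rewrite /crep /=; case: cid => x /= e; apply: eq_exist; rewrite e. Qed.

(** The [i]-th structure group: admissible values supported on the phases of degree [i], acting by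
    addition. *)
Definition zip i : {pred G0} := fun a => `[< (forall j, sd j != i -> a j = 0) >] && rz a.
Lemma zip_closed i : zmod_closed (zip i).
Proof.
split; first by apply/andP; split; [apply/asboolP => j _; rewrite ffunE|exact: rz0].
move=> a b /andP[/asboolP a1 a2] /andP[/asboolP b1 b2]; apply/andP; split; last exact: rzB.
by apply/asboolP => j hj; rewrite !ffunE a1 // b1 // subrr.
Qed.
HB.instance Definition _ i := GRing.isZmodClosed.Build G0 (zip i) (zip_closed i).
Record zi i := Zi { zval : G0; zvalP : zval \in zip i }.
HB.instance Definition _ i := [isSub for @zval i].
HB.instance Definition _ i := [Choice of zi i by <:].
HB.instance Definition _ i := [SubChoice_isSubZmodule of zi i by <:].
Lemma zi_supp i (z : zi i) j : sd j != i -> val z j = 0.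
Proof. by have /andP[/asboolP h _] := zvalP z; exact: h. Qed.
Lemma zi_rz i (z : zi i) : rz (val z).
Proof. by have /andP[_ h] := zvalP z. Qed.
Definition evz i j (z : zi i) : A := val z j.
Lemma evz_additive i j : zmod_morphism (@evz i j).
Proof. by move=> x y; rewrite /evz raddfB !ffunE. Qed.
HB.instance Definition _ i j := GRing.isZmodMorphism.Build (zi i) A (@evz i j) (@evz_additive i j).
Lemma evz_supp i j (z : zi i) : sd j != i -> evz j z = 0.
Proof. exact: zi_supp. Qed.
Lemma evzMz i j (z : zi i) (q : int) : evz j (z *~ q) = evz j z *~ q.
Proof. exact: raddfMz. Qed.
Definition addX i (z : zi i) (x : X) : X := exist _ (val x + val z) (rzD (valP x) (zi_rz z)).
Definition act i (z : zi i) (a : Defs.factor Cb i) : Defs.factor Cb i := pi i (addX z (crep a)).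
Lemma crep_pi i x : eqv i (crep (pi i x)) x.
Proof. by apply/piE; rewrite pi_crep. Qed.
Lemma act_pi i (z : zi i) x : act z (pi i x) = pi i (addX z x).
Proof. by apply/piE => j hj; rewrite !ffunE crep_pi. Qed.
Lemma down_pi i x : (0 < i)%N -> factor_down (pi i x) = pi i.-1 x.
Proof. by move=> i0; apply/piE => j hj; apply: (crep_pi (i := i)); rewrite (leq_trans hj) // leq_pred. Qed.
Lemma structure_X i : (1 <= i <= k)%N -> structure_group (@act i).
Proof.
move=> /andP[i0 ik].
have lt_le j : (sd j < i)%N = (sd j <= i.-1)%N by case: (i) i0.
split.
- by move=> a; rewrite -(pi_crep a) act_pi; apply/piE => j hj; rewrite !ffunE addr0.
- by move=> z z' a; rewrite -(pi_crep a) !act_pi; apply/piE => j hj; rewrite !ffunE addrA addrAC.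
- move=> z a; rewrite -(pi_crep a) act_pi !down_pi //; apply/piE => j hj.
  by rewrite ffunE zi_supp ?addr0 // neq_ltn lt_le hj.
- move=> a b; rewrite -(pi_crep a) -(pi_crep b) !down_pi // => /piE hab.
  (* Relations are homogeneous, so the part of degree [i] of the difference is admissible by
     itself. *)
  have zP : at_lev i (val (crep b) - val (crep a)) \in zip i.
    apply/andP; split; last by apply: rz_lev; apply: rzB; exact: valP.
    by apply/asboolP => j /negbTE hj; rewrite ffunE hj.
  exists (Zi zP); split.
    rewrite act_pi; apply/piE => j; rewrite leq_eqVlt => /orP[/eqP hj|hj].
      by rewrite !ffunE hj eqxx ?ffunE addrC subrK.
    by rewrite !ffunE (negbTE (_ : sd j != i)) ?neq_ltn ?hj // addr0 hab // -lt_le.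
  move=> z'; rewrite act_pi => /piE hz; apply: val_inj; apply/ffunP => j /=; rewrite !ffunE.
  case: eqP => [hj|/eqP hj]; last by rewrite zi_supp.
  have := hz j; rewrite hj leqnn => /(_ isT); rewrite /= !ffunE => <-; by rewrite addrAC subrr add0r.
move=> N c c' d [c0 hc0 ec] hdn hact.
have hT v : c' v = pi i (addX (d v) (c0 v)) by rewrite hact ec /= act_pi.
split.
  move=> [c1 hc1 ec1] th hm; apply: val_inj; apply/ffunP => j.
  have e1 v : eqv i (c1 v) (addX (d v) (c0 v)) by apply/piE; rewrite -hT ec1.
  rewrite -[LHS]/(evz j _) raddf_sum ffunE.
  have [hj|hj] := eqVneq (sd j) i; last by rewrite big1 // => v _; rewrite /= evzMz evz_supp // mul0rz.
  subst i.
  have hh := @C_exact j (c1 \o th) (c0 \o th) (C_comp hm hc1) (C_comp hm hc0).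
  rewrite (eq_bigr (fun v => val ((c1 \o th) v) j *~ (-1) ^+ weight v - val ((c0 \o th) v) j *~ (-1) ^+ weight v)).
    rewrite sumrB hh ?subrr // => v l hl /=; rewrite e1 ?(ltnW hl) // ffunE zi_supp ?addr0 //.
    by rewrite neq_ltn hl.
  by move=> v _; rewrite raddfMz -mulrzBl /= e1 // ffunE addrAC subrr add0r.
(* [c1] has the prescribed free values and agrees with the wanted configuration below degree [i]. In
   degree [i] the difference is a degree [i] cube by exactness, and it vanishes at the free
   vertices, so [deg_zero] applies. *)
move=> hd; have [c1 hc1 hf] := C_real (fun v => addX (d v) (c0 v)).
have lowc w l : (sd l < i)%N -> val (c0 w) l = val (c1 w) l.
  rewrite lt_le => hl; apply: (C_det hc0 hc1 _ _ hl) => w' l' hl' hw'.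
  by rewrite hf // ffunE zi_supp ?addr0 // neq_ltn lt_le hl'.
exists c1 => //; apply/funext => v; rewrite hT /=; apply/piE => j; rewrite leq_eqVlt => /orP[/eqP hj|hj]; last first.
  by rewrite ffunE zi_supp ?addr0 ?lowc // neq_ltn hj.
subst i; apply/eqP; rewrite eq_sym -subr_eq0; apply/eqP; move: v.
apply: (@deg_zero (sd j) _ _ (fun v => val (c1 v) j - val (addX (d v) (c0 v)) j)) => [th hm|v hv]; last by rewrite hf // subrr.
have hh := @C_exact j (c1 \o th) (c0 \o th) (C_comp hm hc1) (C_comp hm hc0).
rewrite (eq_bigr (fun v => (val ((c1 \o th) v) j *~ (-1) ^+ weight v - val ((c0 \o th) v) j *~ (-1) ^+ weight v) - evz j (d (th v) *~ (-1) ^+ weight v))).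
  rewrite !sumrB hh ?subrr; last by move=> v l hl; rewrite /= lowc.
  by rewrite -raddf_sum (hd th hm) raddf0 subr0.
by move=> v _; rewrite evzMz -!mulrzBl /= ffunE opprD addrA.
Qed.
Lemma torsion_X : torsion_nilspace Cb k m.
Proof.
move=> i hi; exists (zi i), (@act i); split; first exact: structure_X.
move=> z; apply: val_inj; rewrite raddfMn; apply/ffunP => j; rewrite ffunMnE (A_torsion R).
have e0 : evz j (0 : zi i) = 0 by exact: raddf0.
exact: esym e0.
Qed.

Definition phi n (x : Z n) : X := insubd (exist _ 0 rz0 : X) (typ x).
Lemma phiE : ev (fun n => forall x : Z n, val (phi x) = typ x).
Proof. by apply: evS rz_typ => n h x; rewrite /phi insubdK //; exact: h. Qed.
(** Each configuration in dimension [k + 1] outside [Cb] is unrealised for almost all [n]; there are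
    finitely many, and [C_local] gives the other dimensions. *)
Lemma phi_morph : ev (fun n => nil_morphism (@degree_cubes 1 (Z n)) Cb (@phi n)).
Proof.
have h : ev (fun n => forall T : {ffun cube k.+1 -> X}, ~ Cb T -> ~ exists x (h : k.+1.-tuple (Z n)), forall v, typ (conc x h v) = val (T v)).
  apply: ev_fin => T; have [hT|hT] := pselect (Cb T); first exact: evT.
  by apply: evS (evNE hT).
apply: ev2 h phiE => n h hp N c hc; apply: C_local => th hm.
have e : (@phi n \o c) \o th = ([ffun v => phi (c (th v))] : {ffun cube k.+1 -> X}).
  by apply/funext => v /=; rewrite ffunE.
rewrite e; apply: contrapT => hno; apply: (h _ hno).
rewrite (deg1_conc hc); have [x' [h' e']] := conc_morph (c (cube0 N)) [tuple c [ffun j => j == i] - c (cube0 N) | i < N] hm.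
by exists x', h' => v; rewrite ffunE hp e'.
Qed.
Definition freq N (T : cube N -> X) n : R :=
  avg (fun xh : Z n * N.-tuple (Z n) => (`[< forall v, phi (conc xh.1 xh.2 v) = T v >])%:R).
Lemma freq_lam N : exists2 lam : R, 0 < lam & forall T : cube N -> X, Cb T -> null W (fun n => `|freq T n - lam|).
Proof.
have [lam l0 hl] := dist N; exists lam => // T hT e e0.
apply: ev3 phi_morph phiE (hl (fun v => val (T v)) (fun v => valP (T v)) e e0) => n hm hp.
congr (is_true (`|_ - _| < _)); apply: eq_avg => xh; congr ((nat_of_bool _)%:R); apply/asboolP/asboolP => hh.
  have hc := hm N _ (conc_deg xh.1 xh.2).
  move=> v; apply: X_eq => j; apply: (C_det hc hT _ _ (sdk j)) => w l _ hw.
  by rewrite /= hp ffunE hh.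
by move=> v i _; rewrite -hh hp ffunE.
Qed.
(** All cubes have the same limiting frequency [lam], and the frequencies add up to 1. *)
Lemma freq_uniform N (T : cube N -> X) : Cb T ->
  null W (fun n => `|freq T n - (#|cube_set Cb N|%:R)^-1|).
Proof.
move=> hT; have [lam l0 hl] := freq_lam N; set c : R := #|_|%:R.
have hs : null W (fun n => \sum_(t : cube_set Cb N) `|freq (cube_fun t) n - lam|).
  by apply: null_sum => t; apply: hl; have /asboolP := valP t.
have c1 : c * lam = 1.
  apply/eqP; rewrite eq_sym -subr_eq0; apply: contrapT => /negP hne.
  have a0 : 0 < `|1 - c * lam| by rewrite normr_gt0.
  have [n [hm hn]] := ev_ex (evI phi_morph (hs _ a0)).
  move: hn; apply/negP; rewrite -leNgt; apply: le_trans (ler_norm_sum _ _ _).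
  rewrite sumrB sumr_const -mulr_natl -/c (_ : \sum_t freq (cube_fun t) n = 1) //.
  rewrite -avg_sum -[RHS](avg_const (K := R) (T := (Z n * N.-tuple (Z n))%type) 1); last by rewrite card_prod muln_gt0 zmod_gt0 tuple_gt0.
  apply: eq_avg => xh; have hc : Cb ([ffun v => phi (conc xh.1 xh.2 v)] : {ffun cube N -> X}).
    have := hm N _ (conc_deg xh.1 xh.2); congr Cb; apply/funext => v; by rewrite ffunE.
  pose t0 : cube_set Cb N := exist _ [ffun v => phi (conc xh.1 xh.2 v)] (asboolT hc).
  rewrite (bigD1 t0) //= asboolT ?big1 ?addr0 // => [t ht|v]; last by rewrite /cube_fun /= ffunE.
  rewrite asboolF // => hv; case/eqP: ht; apply: val_inj; apply/ffunP => v; by rewrite ffunE hv.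
have c0 : c != 0 by apply: contraTneq (ltr01 : 0 < 1 :> R) => cz; rewrite -c1 cz mul0r ltxx.
have -> : c^-1 = lam by rewrite -[LHS]mulr1 -c1 mulKf.
exact: hl.
Qed.

(** [G] is the conjugate of [F] read on the values of the phases, multiplied by a unimodular
    constant that makes the inner product a positive real. *)
Lemma dual_corr (f F : fam R (Zf Z)) (d : R) : fle1 f -> fle1 F ->
  ev (fun n => forall x x', @eqs Z m' S n x x' -> F n x = F n x') -> 0 < d ->
  ev (fun n => d <= ab (avg (fun x => f n x * F n x))) ->
  exists2 G : nat -> X -> C, forall n, bounded1 (G n) & ev (fun n => d%:C <= inner (f n) (G n \o @phi n)).
Proof.
move=> f1 F1 hF d0 hd.
pose a n := avg (fun x => f n x * F n x); pose th n : C := Num.conj (a n) / (ab (a n))%:C.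
have th1 n : ab (th n) <= 1.
  rewrite /th abM abV abR ab_conj ger0_norm ?ab_ge0 //.
  by have [->|h] := eqVneq (ab (a n)) 0; [rewrite mul0r|rewrite divff].
pose G n (z : X) : C := if pselect (exists x : Z n, typ x = val z) is left h then Num.conj (th n * F n (projT1 (cid h))) else 0.
exists G.
  move=> n z; rewrite -abE -[1]/((1 : R)%:C) lecR /G; case: pselect => h; last by rewrite ab0.
  by rewrite ab_conj abM mulr_ile1 ?ab_ge0 ?F1.
apply: ev3 hd hF phiE => n hn hF' hp.
have -> : inner (f n) (G n \o @phi n) = (ab (a n))%:C; last by rewrite lecR.
have a0 : (ab (a n))%:C != 0 :> C by rewrite -ab_eq0 abR gt_eqF // normr_gt0 gt_eqF // (lt_le_trans d0).
have -> : (ab (a n))%:C = th n * a n.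
  by rewrite /th mulrAC [_ * a n]mulrC mulcJ expr2 rmorphM /= mulfK.
rewrite /a -avgZ; apply: eq_avg => x /=.
rewrite /G; case: pselect => [h|[]]; last by exists x; rewrite hp.
rewrite conjCK mulrCA; congr (_ * (_ * _)); apply: hF' => i.
case: (cid h) => y /= hy; have := congr1 (fun z : G0 => z i) hy; by rewrite hp !ffunE.
Qed.
End Nilspace.

(** * Norms, image measures and the conclusion *)

Section Gowers.
Variables (R : realType) (Z : finZmodType).
Local Notation C := R[i].
Lemma iter_conj n (z : C) : iter n Num.conj z = if odd n then Num.conj z else z.
Proof. by elim: n => //= n ->; case: (odd n); rewrite /= ?conjCK. Qed.
Lemma gowers_U N (f : Z -> C) : gowers_pow N f = U N f.
Proof.
pose p (xh : Z * N.-tuple Z) : Z * {ffun 'I_N -> Z} := (xh.1, [ffun i => tnth xh.2 i]).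
have bp : bijective p.
  exists (fun xh : Z * {ffun 'I_N -> Z} => (xh.1, [tuple xh.2 i | i < N])) => -[x h]; rewrite /p /=; congr (_, _).
    by apply: eq_from_tnth => i; rewrite tnth_mktuple ffunE.
  by apply/ffunP => i; rewrite ffunE tnth_mktuple.
rewrite /gowers_pow -[LHS](mp_avg _ (bij_mp bp)).
rewrite -[RHS](avg_pairE (fun x (h : N.-tuple Z) => cprod (fun s x => cj s (f x)) h x)); apply: eq_avg => -[x h] /=.
rewrite (cprodEt _ _ (size_tuple h)) [RHS](reindex (@tup N)); last by exists (@cub N) => ? _; [exact: tupK|exact: cubK].
apply: eq_bigr => v _; rewrite iter_conj /cj weight_count -concE /conc.
by under eq_bigr => i _ do rewrite ffunE.
Qed.
Lemma norm_u N (f : Z -> C) (delta : R) : 0 < delta -> delta%:C <= gowers_norm N.+1 f -> delta ^+ (2 ^ N.+1) <= u N.+1 f.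
Proof.
move=> d0; rewrite /gowers_norm gowers_U U_u => h.
have dC : 0 <= delta%:C :> C by rewrite ler0c ltW.
rewrite -lecR rmorphXn /= -[leRHS](rootCK (n := (2 ^ N.+1)%N)) ?expn_gt0 //.
by apply: lerXn2r; rewrite ?nnegrE // (le_trans dC).
Qed.
(** A base point and edges parametrise the cubes of [D_1(Z)] bijectively. *)
Lemma image_freq (X : finType) (Cx : cubes_on X) N (phi : Z -> X) (c' : cube_set Cx N) :
  cube_image Cx phi (uniform R (cube_set (@degree_cubes 1 Z) N)) c' =
  avg (fun xh : Z * N.-tuple Z => (`[< forall v, phi (conc xh.1 xh.2 v) = cube_fun c' v >])%:R).
Proof.
have dg (xh : Z * N.-tuple Z) : @degree_cubes 1 Z N ([ffun v => conc xh.1 xh.2 v] : {ffun cube N -> Z}).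
  have := @conc_deg Z N xh.1 xh.2; congr (@degree_cubes 1 Z N); apply/funext => v; by rewrite ffunE.
pose p xh : cube_set (@degree_cubes 1 Z) N := exist _ [ffun v => conc xh.1 xh.2 v] (asboolT (dg xh)).
have bp : bijective p.
  apply: inj_card_bij.
    move=> [x h] [x' h'] /(congr1 sval) /= e; apply: conc_inj => v.
    by have := congr1 (fun q : {ffun cube N -> Z} => q v) e; rewrite !ffunE.
  rewrite -(card_codom (f := fun c : cube_set (@degree_cubes 1 Z) N => (cube_fun c (cube0 N), [tuple cube_fun c [ffun j => j == i] - cube_fun c (cube0 N) | i < N]))).
    exact: max_card.
  move=> c1 c2 eE; have e0 := congr1 fst eE; have e := congr1 snd eE; apply: val_inj; apply/ffunP => v.
  have /asboolP d1 := valP c1; have /asboolP d2 := valP c2.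
  have := deg1_conc d1; have := deg1_conc d2; rewrite /cube_fun in e0 e; move=> /(congr1 (fun q => q v)) -> /(congr1 (fun q => q v)) ->.
  by congr (conc _ _ v); [exact: e0|exact: e].
pose G (c : cube_set (@degree_cubes 1 Z) N) : R := ([forall v, phi (cube_fun c v) == cube_fun c' v])%:R.
rewrite ffunE (eq_avg (g := fun xh => G (p xh))).
  rewrite (mp_avg G (bij_mp bp)) /avg /G mulr_suml [RHS](bigID (fun c : cube_set (@degree_cubes 1 Z) N => [forall v, phi (cube_fun c v) == cube_fun c' v])) /=.
  rewrite [X in _ = _ + X]big1 ?addr0 => [|c /negbTE ->]; last by rewrite mul0r.
  by apply: eq_bigr => c ->; rewrite ffunE mul1r.
move=> xh; congr ((nat_of_bool _)%:R); apply/asboolP/forallP => h v; have := h v; rewrite /cube_fun /= ffunE.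
  by move=> ->.
by move/eqP.
Qed.
Lemma image_prob (Y X : finType) (Cy : cubes_on Y) (Cx : cubes_on X) N (phi : Y -> X) (p : {ffun cube_set Cy N -> R}) :
  nil_morphism Cy Cx phi -> is_prob p -> is_prob (cube_image Cx phi p).
Proof.
move=> hm [p0 p1]; split; first by move=> t; rewrite ffunE sumr_ge0.
rewrite -p1; under eq_bigr => t _ do rewrite ffunE big_mkcond.
rewrite exchange_big; apply: eq_bigr => c _ /=.
have hc : Cx N ([ffun v => phi (cube_fun c v)] : {ffun cube N -> X}).
  have /asboolP h := valP c; have := hm N _ h; congr (Cx N); apply/funext => v; by rewrite ffunE.
pose t0 : cube_set Cx N := exist _ [ffun v => phi (cube_fun c v)] (asboolT hc).
have ht0 : [forall v, phi (cube_fun c v) == cube_fun t0 v] by apply/forallP => v; rewrite /cube_fun /= ffunE.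
rewrite (bigD1 t0) //= ht0 big1 ?addr0 // => t ht; case: forallP => // h; case/eqP: ht; apply: val_inj; apply/ffunP => v.
by rewrite ffunE; have /eqP := h v.
Qed.
Lemma uniform_prob (T : finType) : (0 < #|T|)%N -> is_prob (uniform R T).
Proof.
move=> h; split => [t|]; first by rewrite ffunE invr_ge0.
rewrite (eq_bigr (fun _ => (#|T|%:R)^-1)) => [|t _]; last by rewrite ffunE.
have -> : \sum_(t : T) (#|T|%:R)^-1 = #|T|%:R * (#|T|%:R)^-1 :> R by rewrite sumr_const mulr_natl.
by rewrite mulfV // pnatr_eq0 -lt0n.
Qed.
End Gowers.

Lemma free_ultra : exists2 W : set_system nat, UltraFilter W & forall N0 : nat, W (fun n => (N0 <= n)%N).
Proof.
have [W [UW hW]] := @ultraFilterLemma nat \oo%classic _.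
by exists W => // N0; apply: hW; exact: nbhs_infty_ge.
Qed.

(** The nilspace is the same for all [n], so the bound [n + 1] on its size holds for almost all [n].
    Balance concerns finitely many dimensions [N <= 1 / e], each covered by [freq_uniform]. *)
Lemma key (R : realType) (W : set_system nat) (UW : UltraFilter W) (k m' : nat) (delta : R) (Z : nat -> finZmodType)
    (f : forall n, Z n -> R[i]) : (forall N0 : nat, W (fun n => (N0 <= n)%N)) -> 0 < delta ->
  (forall n, torsion m'.+1 (Z n)) -> (forall n, bounded1 (f n)) -> (forall n, delta%:C <= gowers_norm k.+1 (f n)) ->
  exists (X : finType) (Cx : cubes_on X) (phi : forall n, Z n -> X) (F : nat -> X -> R[i]),
  [/\ nilspace Cx, ev W (fun n => correlates k m'.+1 delta n.+1%:R (f n) Cx (phi n) (F n)) &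
    forall (d : cube_metrics R) e, (forall N, prob_metric (d X Cx N)) -> 0 < e -> ev W (fun n => balanced d Cx (phi n) e)].
Proof.
move=> hW d0 tZ f1 fd; pose dl := delta ^+ (2 ^ k.+1); have dl0 : 0 < dl by rewrite exprn_gt0.
have f1' : fle1 (f : fam R (Zf Z)) by move=> n x; have := f1 n x; rewrite -abE -[1]/((1 : R)%:C) lecR.
have hu n : dl <= u k.+1 (f n) by exact: norm_u (fd n).
have [b hb] := dep_choice (fun n => let: ex_intro2 b h1 h2 := dual_exists k.+1 (f1' n) in ex_intro (fun b => B k.+1 b /\ U k.+1 (f n) = avg (fun x => f n x * b x)) b (conj h1 h2)).
have [_ Rk] := @all_regular R W UW Z m' tZ k.
have e0 : 0 < (dl / 2) ^+ 2 by rewrite exprn_gt0 // divr_gt0.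
have hB : forall n, B k.+1 (b n) by move=> n; case: (hb n).
have b1 : fle1 (b : fam R (Zf Z)) by move=> n; exact: (B_le1 (hB n)).
have [F [F1 [S gS hS] hF]] := apx1 b1 (Rk _ hB) e0.
have hc : ev W (fun n => dl / 2 <= ab (avg (fun x => f n x * F n x))).
  apply: evS hF => n h.
  have h1 : dl <= ab (avg (fun x => f n x * b n x)) by rewrite -(hb n).2; exact: hu.
  have h2 : ab (avg (fun x => f n x * b n x) - avg (fun x => f n x * F n x)) <= dl / 2.
    rewrite -avgB; apply: le_trans (ab_avg _) _; apply: le_trans (_ : avg (fun x => ab (b n x - F n x)) <= _).
      by apply: ler_avg => x; rewrite -mulrBr abM ler_piMl ?ab_ge0 ?f1'.
    by apply: ab_le_N2; [rewrite divr_ge0 // ltW|exact: ltW].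
  have := ab_tri (avg (fun x => f n x * b n x)) 0 (avg (fun x => f n x * F n x)); rewrite !subr0; lra.
have [G G1 hG] := dual_corr f1' F1 hS (divr_gt0 dl0 (ltr0Sn R 1)) hc.
have nX : nilspace (@Cb W Z m' S) by exact: (nil_X gS).
exists _, (@Cb W Z m' S), (fun n => @phi W Z m' S n), G; split => //.
  apply: ev3 (hW #|{: X W S}|) (phi_morph gS) hG => n h1 h2 h3; split => //.
    split => //; [exact: step_X gS|exact: torsion_X gS|by rewrite ler_nat ltnW // ltnS].
  by rewrite mulrC.
move=> d e hd e00.
have hN (N : 'I_(Num.bound e^-1)) : ev W (fun n => d _ _ N (cube_image (@Cb W Z m' S) (@phi _ _ _ S n) (uniform R (cube_set (@degree_cubes 1 (Z n)) N)))
     (uniform R (cube_set (@Cb W Z m' S) N)) <= e).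
  have cp : (0 < #|cube_set (@Cb W Z m' S) N|)%N.
    apply/card_gt0P; have [x0] := nilspace_nonempty nX.
    have h : @Cb W Z m' S N ([ffun => x0] : {ffun cube N -> X W S}).
      have -> : ([ffun => x0] : {ffun cube N -> X W S}) = (fun=> x0) :> (cube N -> X W S) by apply/funext => v; rewrite ffunE.
      exact: (C_const gS).
    by exists (exist _ [ffun => x0] (asboolT h)).
  have up := uniform_prob R cp.
  have [eta eta0 he] := pm_coarser (hd N) up e00.
  have hfr : ev W (fun n => forall t : cube_set (@Cb W Z m' S) N, `|freq R (cube_fun t) n - (#|cube_set (@Cb W Z m' S) N|%:R)^-1| < eta).
    by apply: ev_fin => t; apply: (freq_uniform gS) => //; have /asboolP := valP t.
  apply: ev2 hfr (phi_morph gS) => n hn hm.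
  have cz : (0 < #|cube_set (@degree_cubes 1 (Z n)) N|)%N.
    apply/card_gt0P; have h : @degree_cubes 1 (Z n) N ([ffun v => conc 0 [tuple 0 | i < N] v] : {ffun cube N -> Z n}).
      have := @conc_deg (Z n) N 0 [tuple 0 | i < N]; congr (@degree_cubes 1 (Z n) N); apply/funext => v; by rewrite ffunE.
    by exists (exist _ [ffun v => conc 0 [tuple 0 | i < N] v] (asboolT h)).
  have ip := image_prob hm (uniform_prob R cz).
  rewrite (pm_sym (hd N)) //; apply/ltW/he => // t.
  by rewrite image_freq ffunE distrC; exact: hn.
apply: evS (ev_fin hN) => n h N hle.
have hlt : (N < Num.bound e^-1)%N.
  rewrite -(ltr_nat R); apply: le_lt_trans hle _; apply: archi_boundP; by rewrite invr_ge0 ltW.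
exact: (h (Ordinal hlt)).
Qed.
Theorem theorem2p3 (R : realType) (k m : nat) (delta : R) :
  (0 < k)%N -> (0 < m)%N -> 0 < delta ->
  (exists2 B : R, 0 < B &
     forall (Z : finZmodType) (f : Z -> R[i]),
       torsion m Z -> bounded1 f -> delta%:C <= gowers_norm k.+1 f ->
       exists (X : finType) (C : cubes_on X) (phi : Z -> X) (F : X -> R[i]),
         correlates k m delta B f C phi F)
  /\
  (forall (cplx : forall X : topologicalType, cubes_on X -> nat)
          (d : cube_metrics R) (D : R -> R),
     complexity_notion R k cplx ->
     (forall (X : finType) (C : cubes_on X) (n : nat),
        nilspace C -> prob_metric (d X C n)) ->
     (forall r, 0 < r -> 0 < D r) ->
     exists B M : R, [/\ 0 < B, 0 < M &
       forall (Z : finZmodType) (f : Z -> R[i]),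
         torsion m Z -> bounded1 f -> delta%:C <= gowers_norm k.+1 f ->
         exists (X : finType) (C : cubes_on X) (phi : Z -> X) (F : X -> R[i])
                (r : R),
           [/\ correlates k m delta B f C phi F,
               0 < r <= M,
               (cplx (discrete_topology X) C)%:R <= r &
               balanced d C phi (D r)]]).
Proof.
move=> k0 m0 d0; case: m m0 => // m' _.
have [W UW hW] := free_ultra; split.
  apply: contrapT => hno.
  have hex n : exists q : {Z : finZmodType & Z -> R[i]}, [/\ torsion m'.+1 (projT1 q), bounded1 (projT2 q), delta%:C <= gowers_norm k.+1 (projT2 q) &
    ~ exists (X : finType) (C : cubes_on X) (phi : projT1 q -> X) (F : X -> R[i]), correlates k m'.+1 delta n.+1%:R (projT2 q) C phi F].
    apply: contrapT => hh; apply: hno; exists n.+1%:R => // Z f t b g; apply: contrapT => hne.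
    by apply: hh; exists (existT _ Z f).
  have [q hq] := choice hex.
  have [X [C [phi [F [_ h2 _]]]]] := @key R W UW k m' delta (fun n => projT1 (q n)) (fun n => projT2 (q n)) hW d0
    (fun n => let: And4 h _ _ _ := hq n in h) (fun n => let: And4 _ h _ _ := hq n in h) (fun n => let: And4 _ _ h _ := hq n in h).
  have [n hn] := ev_ex h2; have [_ _ _ hne] := hq n; apply: hne; by exists X, C, (phi n), (F n).
move=> cplx d D _ hd hD; apply: contrapT => hno.
have hex n : exists q : {Z : finZmodType & Z -> R[i]}, [/\ torsion m'.+1 (projT1 q), bounded1 (projT2 q), delta%:C <= gowers_norm k.+1 (projT2 q) &
    ~ exists (X : finType) (C : cubes_on X) (phi : projT1 q -> X) (F : X -> R[i]) (r : R),
       [/\ correlates k m'.+1 delta n.+1%:R (projT2 q) C phi F, 0 < r <= n.+1%:R,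
           (cplx (discrete_topology X) C)%:R <= r & balanced d C phi (D r)]].
  apply: contrapT => hh; apply: hno; exists n.+1%:R, n.+1%:R; split => // Z f t b g; apply: contrapT => hne.
  by apply: hh; exists (existT _ Z f).
have [q hq] := choice hex.
have [X [C [phi [F [nX h2 h3]]]]] := @key R W UW k m' delta (fun n => projT1 (q n)) (fun n => projT2 (q n)) hW d0
    (fun n => let: And4 h _ _ _ := hq n in h) (fun n => let: And4 _ h _ _ := hq n in h) (fun n => let: And4 _ _ h _ := hq n in h).
(* The complexity is that of the single nilspace [X], so [r = c + 1] and the balance [D r] are fixed
   before [n] is chosen; adding 1 makes [r] positive. *)
pose c := cplx (discrete_topology X) C.
have r0 : 0 < c.+1%:R :> R by rewrite ltr0Sn.
have hb := h3 d (D c.+1%:R) (fun N => hd X C N nX) (hD _ r0).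
have [n [[hc hn] hbal]] := ev_ex (evI (evI h2 (hW c)) hb).
have [_ _ _ hne] := hq n; apply: hne; exists X, C, (phi n), (F n), c.+1%:R; split => //.
  by rewrite r0 ler_nat.
by rewrite ler_nat.
Qed.
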